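(* Let $J=\mathrm{diag}(J_1,\dots,J_d)$ with $J_1\ge J_2\ge\dots\ge J_d>0$, and let $M(x)$, $P(x)$ be a solution (in general, quasi-periodic) of the system $$M'=[M,\Omega]-[P,J],\qquad P'=[P,\Omega],$$ where $M=J\Omega+\Omega J$, and $\Omega^\top=-\Omega$, $P^\top=P$ are real $d\times d$ matrix functions of $x\in\mathbb R$. Then the matrix Schrödinger operator $$L=-D_x^2+U(x),\qquad U=\Omega^2-\Omega'+P,$$ is a self-adjoint maximally finite-gap operator with the spectral curve $\Gamma$ given by $$\det(\mu^2J^2-\mu M-P+\lambda I)=0$$ with $\bar\mu=-\mu$, $\bar\lambda=\lambda$, which is a real version of the classical spectral curve $\det(P+\mu M-\mu^2J^2-\lambda I)=0$ of the system.
   Context: Here $D_x=d/dx$, $'=d/dx$, $[X,Y]=XY-YX$. The system (with time $t$ replaced by $x$) describes the rotation of a $d$-dimensional rigid body about its centre of mass in a Newtonian field with quadratic potential. It has the Lax form $\mathcal L'=[\mathcal L,\mathcal A]$ with $\mathcal L=P+\mu M-\mu^2J^2$, $\mathcal A=\Omega-\mu J$, where $\mu$ is the spectral parameter; its classical spectral curve is the characteristic curve $\det(\mathcal L-\lambda I)=0$. A Schrödinger operator $L$ with $d\times d$ matrix potential (periodic or quasi-periodic) is called maximally finite-gap if for all sufficiently large positive $\lambda$ all solutions of $L\psi=\lambda\psi$ are bounded. A matrix differential operator is called finite-gap if its vector-eigenfunction is meromorphic on a Riemann surface of finite genus, its spectral curve.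
   Formalization: ''Self-adjoint'' is proved for the J-weighted inner product ∑ J_i ū_i v_i (i.e. for J^{1/2} L J^{-1/2} in the standard one), because U = Ω² − Ω' + P is not symmetric when Ω' ≠ 0, so the unweighted claim fails. *)

(* Defs.v *)
(* MathComp / MathComp-Analysis *)
From HB Require Import structures.
From mathcomp Require Import all_boot all_order all_algebra.
From mathcomp Require Import all_classical all_reals all_analysis.
From mathcomp Require Import complex.
Import Order.TTheory GRing.Theory Num.Theory.
Import numFieldNormedType.Exports.

Set Implicit Arguments.
Unset Strict Implicit.
Unset Printing Implicit Defensive.

Local Open Scope ring_scope.
Local Open Scope classical_set_scope.

Definition commx (A : pzRingType) n (X Y : 'M[A]_n) : 'M[A]_n :=
  X *m Y - Y *m X.

Section Germs.
Variable K : numClosedFieldType.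

(* The topology of K is the one of its norm, so that derivable means complex
   derivable when K is the field of complex numbers. *)
Definition near0' (Q : K -> Prop) : Prop := \forall z \near (0 : K)^', Q z.

(* Germs at 0 of z^-n times a holomorphic function *)
Definition laurent0 (n : nat) (f : K -> K) : Prop :=
  exists2 g : K -> K,
    (\forall z \near (0 : K), derivable g z 1) &
    near0' (fun z => f z = g z / z ^+ n).

Definition holomorphic0 (f : K -> K) : Prop := laurent0 0 f.
Definition meromorphic0 (f : K -> K) : Prop := exists n, laurent0 n f.

End Germs.

Section Schrodinger.
Variables (R : realType) (d : nat).
Local Notation C := R[i].
Local Notation mu := (@lebesgue_measure R).

Definition cmx m n (A : 'M[R]_(m, n)) : 'M[C]_(m, n) :=
  map_mx (fun a => a%:C%C) A.

Definition Remx (f : R -> 'cV[C]_d) (x : R) : 'cV[R]_d :=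
  map_mx (@complex.Re R) (f x).

Definition Immx (f : R -> 'cV[C]_d) (x : R) : 'cV[R]_d :=
  map_mx (@complex.Im R) (f x).

Definition cderivable (f : R -> 'cV[C]_d) : Prop :=
  forall x, derivable (Remx f) x 1 /\ derivable (Immx f) x 1.

Definition cderive (f : R -> 'cV[C]_d) (x : R) : 'cV[C]_d :=
  cmx (derive1 (Remx f) x) + 'i%C *: cmx (derive1 (Immx f) x).

Definition cintegral (A : set R) (h : R -> C) : C :=
  ((\int[mu]_(x in A) complex.Re (h x)) +i* (\int[mu]_(x in A) complex.Im (h x)))%C.

Definition schrodinger (U : R -> 'M[R]_d) (f : R -> 'cV[C]_d) (x : R)
    : 'cV[C]_d :=
  - cderive (cderive f) x + cmx (U x) *m f x.

Definition eigensolution (U : R -> 'M[R]_d) (la : C) (f : R -> 'cV[C]_d)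
    : Prop :=
  [/\ cderivable f, cderivable (cderive f)
    & forall x, schrodinger U f x = la *: f x].

Definition maximally_finite_gap (U : R -> 'M[R]_d) : Prop :=
  exists La : R, forall la : R, La < la ->
  forall f, eigensolution U la%:C%C f ->
  exists B : R, forall x i, `|f x i 0| <= B%:C%C.

Definition L2 (f : R -> 'cV[C]_d) : Prop :=
  forall i, [/\ measurable_fun setT (fun x => complex.Re (f x i 0)),
                measurable_fun setT (fun x => complex.Im (f x i 0))
              & mu.-integrable setT
                  (fun x => (complex.Re (f x i 0) ^+ 2
                             + complex.Im (f x i 0) ^+ 2)%:E)].

(* The Euclidean structure on C^d is the one defined by J = diag(J_1,...,J_d):
   U = Om^2 - Om' + P is not a symmetric matrix unless Om' = 0, but the
   equations of motion make J U symmetric. *)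
Definition dotJ (J : 'rV[R]_d) (f g : R -> 'cV[C]_d) : C :=
  cintegral setT
    (fun x => \sum_i (f x i 0)^* * (J 0 i)%:C%C * g x i 0).

(* Graph of L on its maximal domain {f in L^2 | f, f' locally absolutely
   continuous, L f in L^2}; the equation L f = h almost everywhere is written in
   its integrated form f'(b) - f'(a) = \int_a^b (U f - h), which for U
   continuous and f, h in L^2 contains the absolute continuity of f'. *)
Definition schrodinger_graph (U : R -> 'M[R]_d) (f h : R -> 'cV[C]_d) : Prop :=
  [/\ L2 f, L2 h, cderivable f
    & forall (a b : R) (i : 'I_d), a <= b ->
      cderive f b i 0 - cderive f a i 0 =
      cintegral `[a, b] (fun x => (cmx (U x) *m f x - h x) i 0)].

(* (u, w) is in the graph of the adjoint of L if and only if it is in the graph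
   of L, functions being identified when they agree almost everywhere.  The
   adjoint being then single-valued, the domain of L is dense. *)
Definition self_adjoint (J : 'rV[R]_d) (U : R -> 'M[R]_d) : Prop :=
  forall u w : R -> 'cV[C]_d, L2 u -> L2 w ->
  (forall f h, schrodinger_graph U f h -> dotJ J h u = dotJ J f w) <->
  (exists2 v, schrodinger_graph U v w & {ae mu, forall x, u x = v x}).

(** Plane algebraic curves F(la, mu) = 0 and their Baker-Akhiezer functions.
    The outer variable of F : {poly {poly C}} is mu and the inner one is la;
    F.[mu, la] is the value of F.  The Riemann surface of F is the normalization
    of this curve; since F is a polynomial it has finite genus. *)

Definition poly_at (F : {poly {poly C}}) (la : C) : {poly C} :=
  map_poly (fun c : {poly C} => c.[la]) F.

Definition cexp (z : C) : C :=
  (expR (complex.Re z))%:C%C * (cos (complex.Im z) +i* sin (complex.Im z))%C.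

(* psi la mu is a nonzero solution of L f = la f at the point (la, mu) of the
   curve, outside a finite set of points D independent of x, where it may vanish
   or have a pole.  Holomorphic discs (l, m) in the curve, with poles of l, m at 0
   allowed, include the local parametrizations of the compactified normalization:
   psi is meromorphic in each of them, up to a factor exp(x q(1/z)), which is
   present only at the points at infinity.  Without a condition at infinity the
   notion would be void, since for any U the solutions of L f = la f with fixed
   Cauchy data are entire in la. *)
Definition baker_akhiezer (U : R -> 'M[R]_d) (F : {poly {poly C}})
    (psi : C -> C -> R -> 'cV[C]_d) : Prop :=
  (exists D : seq (C * C), forall la mu : C,
     F.[mu, la] = 0 -> (la, mu) \notin D ->
     eigensolution U la (psi la mu) /\ exists x, psi la mu x != 0) /\
  (forall l m : C -> C, meromorphic0 l -> meromorphic0 m ->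
     near0' (fun z => F.[m z, l z] = 0) ->
     exists2 q : {poly C},
       (holomorphic0 l -> holomorphic0 m -> q = 0) &
       forall (x : R) (i : 'I_d),
         meromorphic0
           (fun z => cexp (- (x%:C%C * q.[z^-1])) * psi (l z) (m z) x i 0)).

(* The vector-eigenfunction of L is meromorphic on the curve F = 0, and its values
   over la give, for all but finitely many la, all the solutions of
   L f = la f.  The number n of functions needed is bounded by the multiplicity
   of the components of the curve: it is 1 when F is square-free, but not for
   instance when Om = P = 0 and J = 1, where F = (mu^2 + la)^d. *)
Definition finite_gap (U : R -> 'M[R]_d) (F : {poly {poly C}}) : Prop :=
  F != 0 /\
  exists (n : nat) (psi : 'I_n -> C -> C -> R -> 'cV[C]_d),
    (forall j, baker_akhiezer U F (psi j)) /\
    exists S : seq C, forall la : C, la \notin S ->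
      (exists mu : C, (n <= mup mu (poly_at F la))%N) /\
      forall f, eigensolution U la f ->
      exists (r : seq C) (c : 'I_n -> C -> C),
        {in r, forall mu, F.[mu, la] = 0} /\
        forall x, f x = \sum_(mu <- r) \sum_(j < n) c j mu *: psi j la mu x.

(* A real structure tau on the curve F = 0 (tau is antiholomorphic in the two uses
   below); its real points are those with tau (la, mu) = (la, mu). *)
Definition real_structure (F : {poly {poly C}}) (tau : C * C -> C * C) : Prop :=
  involutive tau /\
  forall p : C * C, F.[(tau p).2, (tau p).1] = (F.[p.2, p.1])^*.

Definition conj_std (p : C * C) : C * C := (p.1^*, p.2^*).

(* The real points are given by la^* = la and mu^* = - mu. *)
Definition conj_skew (p : C * C) : C * C := (p.1^*, - p.2^*).

(* F = 0 and G = 0 are the same complex curve, but the real structure of the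
   first is tau while that of the second is the usual one. *)
Definition real_version (F G : {poly {poly C}}) (tau : C * C -> C * C) : Prop :=
  [/\ real_structure F tau, real_structure G conj_std
    & exists2 c : C, c != 0 & F = (c%:P)%:P * G].

End Schrodinger.

(* Main.v *)
(** Let Lax(x, mu) = P + mu M - mu^2 J^2.  The linear system X' = (mu J - Om) X
    has a fundamental matrix X(x, mu), entire in mu, and the Lax equation gives
    Lax(x, mu) X(x, mu) = X(x, mu) Lax(0, mu).  Since (mu J - Om)^2 - Om' =
    U - Lax(x, mu), the function X(x, mu) v solves L psi = la psi as soon as
    Lax(0, mu) v = la v.  Hence det(Lax - la) does not depend on x, and the
    Baker-Akhiezer functions are X(x, mu) w(la, mu), where w is an eigenvector of
    Lax(0, mu) polynomial in (la, mu).  The eigenvectors of the companion matrix of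
    the quadratic pencil in mu are the Cauchy data of these solutions, and they span
    because this matrix is skew for a definite Hermitian form when la is large.

    At a pole of mu on the curve, -la / mu^2 tends to some J_i^2, so that it has a
    holomorphic square root s, and Gronwall's inequality shows that
    exp(- x mu s) X(x, mu) w has a pole of bounded order.

    The solutions are bounded for large real la because |v' + Om v|^2 + <(la - P) v, v>
    is conserved; L is self-adjoint because J U is symmetric and U is bounded. *)

Require Import Defs.
From HB Require Import structures.
From mathcomp Require Import all_boot all_order all_algebra.
From mathcomp Require Import all_classical all_reals all_analysis.
From mathcomp Require Import measurable_realfun complex ring lra.
Import Order.TTheory GRing.Theory Num.Theory.
Import numFieldNormedType.Exports.

Set Implicit Arguments.
Unset Strict Implicit.
Unset Printing Implicit Defensive.

Local Open Scope ring_scope.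
Local Open Scope classical_set_scope.
Local Open Scope complex_scope.

(** * Calculus and linear differential equations on the line *)

(** The curve may have multiple components, so one eigenvector per point need not produce all
    solutions. Everything is therefore done over polynomials in la: if p is the minimal polynomial
    of the companion matrix with denominators cleared, the vectors (p(T) - p(mu)) / (T - mu) c,
    taken at T = the matrix, are eigenvectors polynomial in (la, mu), and as many constant vectors c
    are taken as the generic multiplicity of the eigenvalues. The Hermitian form is definite only
    for large real la, but these la are infinitely many, and what is deduced from them is the
    non-vanishing of polynomials in la, which then holds for all la but finitely many. Meromorphy at
    infinity comes from growth bounds alone: a bound by a power of 1/z is turned into a Laurent germ
    by removing a singularity. Extracting principal parts requires Taylor division, hence Cauchy's
    formula; of the integral of 1/z only the non-vanishing is used. In the domain of L the
    derivative f' is merely an indefinite integral, so Green's formula is proved by subdivision, and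
    the adjoint is identified by a du Bois-Reymond argument. *)

Section RealCalculus.
Variable R : realType.
Implicit Types (f g h u : R -> R) (a b c x y M : R).

(* A plain definition: the class [is_derive] would be resolved automatically. *)
Definition hasd f x (l : R) := is_derive x (1 : R) f l.

Definition der f f' := forall x, hasd f x (f' x).

Lemma hasd_eq f x l m : hasd f x l -> l = m -> hasd f x m.
Proof. by move=> h <-. Qed.

Lemma hasd_ext f g x l : f =1 g -> hasd f x l -> hasd g x l.
Proof. by move=> /funext->. Qed.

Lemma hasdD f g x l m :
  hasd f x l -> hasd g x m ->
  hasd (fun y => f y + g y) x (l + m).
Proof. exact: is_deriveD. Qed.

Lemma hasdN f x l :
  hasd f x l -> hasd (fun y => - f y) x (- l).
Proof. exact: is_deriveN. Qed.

Lemma hasdB f g x l m :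
  hasd f x l -> hasd g x m ->
  hasd (fun y => f y - g y) x (l - m).
Proof. exact: is_deriveB. Qed.

Lemma hasdM f g x l m :
  hasd f x l -> hasd g x m ->
  hasd (fun y => f y * g y) x (l * g x + f x * m).
Proof.
move=> hf hg; apply: (hasd_eq (is_deriveM hf hg)).
by rewrite /GRing.scale /= addrC; congr (_ + _); rewrite mulrC.
Qed.

Lemma hasd_cst c x : hasd (fun=> c) x 0.
Proof. exact: is_derive_cst. Qed.

Lemma hasd_id x : hasd id x 1.
Proof. exact: is_derive_id. Qed.

Lemma hasd_comp f g x l m : hasd f (g x) l -> hasd g x m -> hasd (fun y => f (g y)) x (l * m).
Proof. exact: is_derive1_comp. Qed.

Lemma hasdZ c f x l :
  hasd f x l -> hasd (fun y => c * f y) x (c * l).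
Proof.
move=> hf; apply: (hasd_eq (hasdM (hasd_cst c x) hf)).
by rewrite mul0r add0r.
Qed.

Lemma hasd_sum (I : Type) (r : seq I) (P : pred I) (F : I -> R -> R) (D : I -> R) x :
  (forall i, P i -> hasd (F i) x (D i)) ->
  hasd (fun y => \sum_(i <- r | P i) F i y) x (\sum_(i <- r | P i) D i).
Proof.
move=> h; elim: r => [|i r ih].
  rewrite big_nil; apply: (@hasd_ext (fun=> 0)); last exact: hasd_cst.
  by move=> y; rewrite big_nil.
rewrite big_cons; case: ifPn => Pi.
  apply: (@hasd_ext (fun y => F i y + \sum_(j <- r | P j) F j y)).
    by move=> y; rewrite big_cons Pi.
  exact: hasdD (h _ Pi) ih.
by apply: hasd_ext ih => y; rewrite big_cons (negbTE Pi).
Qed.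

Lemma hasd_lin (a b x : R) : hasd (fun y => a * y + b) x a.
Proof.
apply: (hasd_eq (hasdD (hasdZ a (hasd_id x)) (hasd_cst b x))).
by rewrite mulr1 addr0.
Qed.

Lemma hasd_exp a x : hasd (fun y => expR (a * y)) x (a * expR (a * x)).
Proof.
have h : hasd (fun y => a * y) x a.
  by apply: hasd_ext (hasd_lin a 0 x) => y; rewrite addr0.
apply: (hasd_eq (@hasd_comp expR (fun y => a * y) x _ _ (is_derive_expR (a * x)) h)).
by rewrite mulrC.
Qed.

Lemma hasd_continuous f x l : hasd f x l -> {for x, continuous f}.
Proof. by move=> [d _]; apply: differentiable_continuous; apply/derivable1_diffP. Qed.

Lemma continuous_sumf (I : Type) (r : seq I) (P : pred I) (F : I -> R -> R) :
  (forall i, P i -> continuous (F i)) -> continuous (fun y => \sum_(i <- r | P i) F i y).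
Proof.
move=> h; elim: r => [|i r ih] x.
  under eq_fun do rewrite big_nil; exact: cvg_cst.
under eq_fun do rewrite big_cons; case: ifPn => Pi; last exact: ih.
by apply: cvgD; [exact: h|exact: ih].
Qed.

Lemma der_continuous f f' : der f f' -> continuous f.
Proof. by move=> h x; exact: hasd_continuous (h x). Qed.

Lemma der_unique f g f' : der f f' -> der g f' -> f 0 = g 0 -> f =1 g.
Proof.
move=> hf hg h0 x; apply/eqP; rewrite -subr_eq0; apply/eqP.
have -> : 0 = f 0 - g 0 by rewrite h0 subrr.
apply: (@is_derive_0_is_cst _ (fun y => f y - g y)) => y.
by rewrite -[0](subrr (f' y)); apply: hasdB.
Qed.

Lemma le_of_derive_ge0 f f' a b : (forall x, a <= x <= b -> hasd f x (f' x)) ->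
  a <= b -> (forall x, a <= x <= b -> 0 <= f' x) -> f a <= f b.
Proof.
move=> hf ab h0; rewrite -subr_ge0.
have [x|x xab|x] := @MVT_segment R f f' a b ab.
- by rewrite in_itv/= => /andP[/ltW ? /ltW ?]; apply: hf; apply/andP.
- move: x xab; apply: continuous_in_subspaceT => x; rewrite inE/= in_itv/= => xab.
  exact: hasd_continuous (hf _ xab).
- by rewrite in_itv/= => xab ->; rewrite mulr_ge0 ?h0 ?subr_ge0.
Qed.

Lemma norm_le_of_derive f f' a b M : (forall x, a <= x <= b -> hasd f x (f' x)) ->
  a <= b -> (forall x, a <= x <= b -> `|f' x| <= M) -> `|f b - f a| <= M * (b - a).
Proof.
move=> hf ab hM; rewrite ler_norml.
have h1 x : a <= x <= b -> hasd (fun y => (M * y + 0) - f y) x (M - f' x).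
  by move=> xab; apply: hasdB; [exact: hasd_lin|exact: hf].
have h2 x : a <= x <= b -> hasd (fun y => (M * y + 0) + f y) x (M + f' x).
  by move=> xab; apply: hasdD; [exact: hasd_lin|exact: hf].
have := le_of_derive_ge0 h1 ab; have := le_of_derive_ge0 h2 ab.
move=> H2 H1.
have {H1} : M * a + 0 - f a <= M * b + 0 - f b.
  by apply: H1 => x /hM; rewrite ler_norml => /andP[_]; rewrite subr_ge0.
have {H2} : M * a + 0 + f a <= M * b + 0 + f b.
  by apply: H2 => x /hM; rewrite ler_norml => /andP[]; lra.
by lra.
Qed.

(** Gronwall on both half-lines: [f x * exp (- c x)] decreases for x >= 0 and [f x * exp (c x)]
    increases for x <= 0. *)
Lemma le_expR_of_derive f f' c : der f f' -> (forall x, 0 <= f x) ->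
  (forall x, `|f' x| <= c * f x) -> forall x, f x <= f 0 * expR (c * `|x|).
Proof.
move=> hf f0 hc x.
have key (s : R) (y : R) : hasd (fun y => f y * expR (s * y)) y
    ((f' y + s * f y) * expR (s * y)).
  apply: (hasd_eq (hasdM (hf y) (hasd_exp s y))).
  by rewrite mulrDl; congr (_ + _); ring.
have [x0|x0] := leP 0 x.
  have := @le_of_derive_ge0 (fun y => - (f y * expR (- c * y)))
     (fun y => - ((f' y + (- c) * f y) * expR (- c * y))) 0 x _ x0.
  rewrite mulr0 expR0 mulr1 lerN2 ger0_norm// => h.
  have : f x * expR (- c * x) <= f 0.
    apply: h => y _; first exact: hasdN (key _ _).
    rewrite oppr_ge0 mulr_le0_ge0 ?expR_ge0// mulNr subr_le0.
    exact: le_trans (ler_norm _) (hc y).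
  by rewrite mulNr expRN ler_pdivrMr ?expR_gt0.
have := @le_of_derive_ge0 (fun y => f y * expR (c * y))
     (fun y => (f' y + c * f y) * expR (c * y)) x 0 _ (ltW x0).
rewrite mulr0 expR0 mulr1 ltr0_norm// mulrN expRN => h.
rewrite ler_pdivlMr ?expR_gt0//.
apply: h => y _; first exact: key.
rewrite mulr_ge0 ?expR_ge0//.
by have := hc y; rewrite ler_norml => /andP[]; lra.
Qed.

Lemma ex_primitive h : continuous h -> exists H, H 0 = 0 /\ der H h.
Proof.
move=> ch.
have ih a b : (@lebesgue_measure R).-integrable `[a, b] (EFin \o h).
  apply: continuous_compact_integrable; first exact: segment_compact.
  exact: continuous_subspaceT.
pose F a x := \int[@lebesgue_measure R]_(t in `[a, x]) h t.
have dF a x : a < x -> hasd (F a) x (h x).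
  move=> ax; have [d1 d2] := continuous_FTC1_closed (ltr_pwDr ltr01 (lexx x)) (ih a (x + 1)) ax (ch x).
  by split; [exact: d1|rewrite -derive1E; exact: d2].
have FB a c x : a <= c -> c <= x -> F a x - F a c = F c x.
  move=> ac cx; rewrite /F (@Rintegral_itvB _ h (BLeft a) (BRight x) c)//.
    rewrite Rintegral_itv_obnd_cbnd//.
    apply: integrableS (ih c x) => //.
    by apply: subset_itv; rewrite bnd_simp.
(* The fundamental theorem is applied with a lower end strictly to the left of x, so the base point
   moves with x and also stays left of 0. By [FH] every base point further left gives the same
   value, and near x a single one serves. *)
pose H x := F (- `|x| - 1) x - F (- `|x| - 1) 0.
have FH a x : a <= - `|x| - 1 -> H x = F a x - F a 0.
  move=> ax.
  have h1 : - `|x| - 1 <= x by have := ler_norm (- x); rewrite normrN; lra.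
  have h0 : - `|x| - 1 <= 0 by have := normr_ge0 x; lra.
  rewrite /H -(FB _ _ _ ax h1) -(FB _ _ _ ax h0); lra.
exists H; split; first by rewrite /H subrr.
move=> x.
have := dF (- `|x| - 2) x; set a := - `|x| - 2 => /(_ _) dFa.
have {}dFa : hasd (F a) x (h x).
  by apply: dFa; rewrite /a; have := ler_norm (- x); rewrite normrN; lra.
have d2 := hasdB dFa (hasd_cst (F a 0) x).
rewrite subr0 in d2.
apply: (@near_eq_is_derive _ _ _ (fun y => F a y - F a 0)); last exact: d2.
near=> y; rewrite (FH a)//.
have : `|x - y| < 1 by near: y; exact: (nbhsx_ballx x 1 ltr01).
by rewrite /a; have := lerB_dist y x; rewrite distrC; lra.
Unshelve. all: by end_near. Qed.

(* Junk value [h] when [h] is not continuous. *)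
Definition primitive h :=
  if pselect (continuous h) is left ch then projT1 (cid (ex_primitive ch)) else h.

Lemma primitive0 h : continuous h -> primitive h 0 = 0.
Proof. by rewrite /primitive; case: pselect => // ch _; case: cid => H []. Qed.

Lemma der_primitive h : continuous h -> der (primitive h) h.
Proof. by rewrite /primitive; case: pselect => // ch _; case: cid => H []. Qed.

(** In the norm weighted by [exp (- a |x|)], integration from 0 gains a factor 1/a. With a large
    this makes Picard iteration contract on the whole line. *)
Lemma primitive_le_expR f f' (C a : R) : der f f' -> f 0 = 0 -> 0 < a ->
  (forall x, `|f' x| <= C * expR (a * `|x|)) -> forall x, `|f x| <= C / a * expR (a * `|x|).
Proof.
move=> hf f0 a0 hC.
have C0 : 0 <= C.
  have := hC 0; rewrite normr0 mulr0 expR0 mulr1; exact: le_trans.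
have pos (g g' : R -> R) : der g g' -> g 0 = 0 -> (forall x, `|g' x| <= C * expR (a * `|x|)) ->
    forall x, 0 <= x -> g x <= C / a * expR (a * x).
  move=> hg g0 hgC x x0.
  have := @le_of_derive_ge0 (fun y => C / a * expR (a * y) - g y)
     (fun y => C / a * (a * expR (a * y)) - g' y) 0 x _ x0.
  rewrite mulr0 expR0 mulr1 g0 subr0 => h.
  have : C / a <= C / a * expR (a * x) - g x.
    apply: h => y /andP[y0 _].
      by apply: hasdB => //; apply: hasdZ; exact: hasd_exp.
    rewrite mulrA mulfVK ?gt_eqF// subr_ge0.
    by have := hgC y; rewrite (ger0_norm y0); apply: le_trans; exact: ler_norm.
  by have : 0 <= C / a by [rewrite divr_ge0// ltW]; lra.
have hN : der (fun y => - f y) (fun y => - f' y) by move=> y; exact: hasdN.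
have hM (g g' : R -> R) : der g g' -> der (fun y => g (- y)) (fun y => - g' (- y)).
  move=> hg y.
  apply: (hasd_eq (@hasd_comp g (fun y => - y) y _ _ (hg (- y)) (hasdN (hasd_id y)))).
  by rewrite mulrN1.
have nN (z : R) : `|- z| = `|z| by rewrite normrN.
move=> x; rewrite ler_norml.
have [x0|x0] := leP 0 x.
  rewrite ger0_norm// lerNl; apply/andP; split.
    by apply: (pos _ _ hN) => // [|y]; rewrite ?f0 ?oppr0// nN.
  exact: (pos _ _ hf).
have x0' : 0 <= - x by lra.
rewrite ltr0_norm// -[in f x](opprK x) lerNl; apply/andP; split.
  apply: (pos _ _ (hM _ _ hN) _ _ _ x0'); first by rewrite oppr0 f0 oppr0.
  by move=> y; rewrite opprK (le_trans (hC _))// nN.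
apply: (pos _ _ (hM _ _ hf) _ _ _ x0'); first by rewrite oppr0 f0.
by move=> y; rewrite nN (le_trans (hC _))// nN.
Qed.

(** The intervals of centre [S n] and radius [2 C / 2^n], a bound of the tail of the series, are
    nested; the limit is the supremum of their left ends. *)
Lemma geometric_limit (S : nat -> R) C :
  (forall n, `|S n.+1 - S n| <= C / 2 ^+ n) ->
  exists l, forall n, `|l - S n| <= 2 * C / 2 ^+ n.
Proof.
move=> hS.
have e2 n : 2 * C / 2 ^+ n.+1 = C / 2 ^+ n.
  by rewrite exprS invfM mulrACA divff// mul1r.
pose lo n := S n - 2 * C / 2 ^+ n; pose hi n := S n + 2 * C / 2 ^+ n.
have dbl n : 2 * C / 2 ^+ n = C / 2 ^+ n + C / 2 ^+ n by ring.
have los n : lo n <= lo n.+1.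
  by rewrite /lo e2 dbl; have := hS n; rewrite ler_norml => /andP[]; lra.
have his n : hi n.+1 <= hi n.
  by rewrite /hi e2 dbl; have := hS n; rewrite ler_norml => /andP[]; lra.
have lohi n : lo n <= hi n.
  have C0 : 0 <= C.
    by have := hS 0; rewrite expr0 divr1; apply: le_trans.
  have : 0 <= 2 * C / 2 ^+ n by rewrite divr_ge0 ?mulr_ge0 ?exprn_ge0.
  by rewrite /lo /hi; lra.
have lom m n : (m <= n)%N -> lo m <= lo n by exact: homo_leq le_refl le_trans _ m n.
have him m n : (m <= n)%N -> hi n <= hi m.
  by move=> mn; apply: (@homo_leq _ hi (fun a b => b <= a)) mn => // b a c /[swap]; exact: le_trans.
have lh m n : lo m <= hi n.
  have [mn|nm] := leqP m n; first exact: le_trans (lom _ _ mn) (lohi n).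
  exact: le_trans (lohi m) (him _ _ (ltnW nm)).
exists (sup (range lo)) => n.
have h1 : lo n <= sup (range lo).
  by apply: ub_le_sup; [exists (hi 0%N) => _ [k _ <-]|exists n].
have h2 : sup (range lo) <= hi n.
  by apply: ge_sup; [exists (lo 0%N); exists 0%N|move=> _ [k _ <-]].
by rewrite ler_norml; move: h1 h2; rewrite /lo /hi; lra.
Qed.

(** Picard iteration carried out on the whole line at once: the coefficients are bounded globally,
    so no local solutions have to be glued. *)
Lemma ex_linear_ode (I : finType) (B : I -> I -> R -> R) (K : R) (y0 : I -> R) :
  (forall i j, continuous (B i j)) -> (forall i j x, `|B i j x| <= K) ->
  exists2 y : I -> R -> R, (forall i, y i 0 = y0 i) &
    forall i, der (y i) (fun x => \sum_j B i j x * y j x).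
Proof.
move=> cB hK.
pose k := `|K| * #|I|%:R + 1.
have k0 : 0 < k by rewrite ltr_wpDl// mulr_ge0.
pose V (z : I -> R -> R) i x := \sum_j B i j x * z j x.
have cV z : (forall i, continuous (z i)) -> forall i, continuous (V z i).
  move=> cz i; apply: continuous_sumf => j _ x.
  by apply: cvgM; [exact: cB|exact: cz].
pose C := \sum_i `|y0 i|.
(* One iteration multiplies the weighted norm by [k / a], which is 1/2 for this a. *)
pose a := 2 * k; have a0 : 0 < a by rewrite mulr_gt0.
have VM z D : (forall i x, `|z i x| <= D * expR (a * `|x|)) ->
   forall i x, `|V z i x| <= k * D * expR (a * `|x|).
  move=> hz i x.
  have D0 : 0 <= D * expR (a * `|x|) by exact: le_trans (hz i x).
  rewrite (le_trans (ler_norm_sum _ _ _))//.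
  apply: (@le_trans _ _ (\sum_(j : I) `|K| * (D * expR (a * `|x|)))).
    apply: ler_sum => j _; rewrite normrM ler_pM//.
    exact: le_trans (hK _ _ _) (ler_norm _).
  rewrite sumr_const -mulr_natr mulrAC -(mulrA k) ler_wpM2r// /k.
  by rewrite lerDl.
(* The terms of the Picard series, that is the differences of successive iterates; [S n] below is
   the sum of the first n of them. *)
pose Y := fix Y n : I -> R -> R :=
  if n is m.+1 then fun i => primitive (V (Y m) i) else fun i _ => y0 i.
have cY n i : continuous (Y n i).
  elim: n i => [|n ih] i; first by move=> x; exact: cvg_cst.
  exact: der_continuous (der_primitive (cV _ ih i)).
have YM n i x : `|Y n i x| <= C / 2 ^+ n * expR (a * `|x|).
  elim: n i x => [|n ih] i x.
    rewrite expr0 divr1 /= /C (bigD1 i)//=.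
    apply: (@le_trans _ _ (`|y0 i| + \sum_(j | j != i) `|y0 j|)).
      by rewrite lerDl sumr_ge0.
    by rewrite ler_peMr ?addr_ge0 ?sumr_ge0// -expR0 ler_expR mulr_ge0// ltW.
  have -> : C / 2 ^+ n.+1 = k * (C / 2 ^+ n) / a.
    by rewrite /a exprS; field; rewrite expf_neq0//= gt_eqF.
  apply: primitive_le_expR; [by apply: der_primitive; exact: cV|by apply: primitive0; exact: cV|exact: a0|].
  exact: VM.
pose S n i x := \sum_(m < n) Y m i x.
have cS n i : continuous (S n i).
  by apply: continuous_sumf => m _; exact: cY.
have [y yP] : exists y : I -> R -> R, forall i x n,
    `|y i x - S n i x| <= 2 * C * expR (a * `|x|) / 2 ^+ n.
  have /choice[y yP] : forall ix : I * R, exists l, forall n,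
      `|l - S n ix.1 ix.2| <= 2 * C * expR (a * `|ix.2|) / 2 ^+ n.
    move=> [i x] /=; have [|l hl] := @geometric_limit (fun n => S n i x) (C * expR (a * `|x|)).
      by move=> n; rewrite /S big_ord_recr/= addrAC subrr add0r mulrAC YM.
    by exists l => n; rewrite -(mulrA 2 C) hl.
  by exists (fun i x => y (i, x)) => i x; exact: (yP (i, x)).
have e0 (M e : R) : 0 < e -> exists n, M / 2 ^+ n < e.
  move=> he; exists (Num.truncn (`|M| / e)).+1.
  rewrite ltr_pdivrMr ?exprn_gt0// (le_lt_trans (ler_norm M))// mulrC -ltr_pdivrMr//.
  apply: (lt_trans (truncnS_gt _)).
  by rewrite -natrX ltr_nat ltn_expl.
have small (z : R) M : (forall n, `|z| <= M / 2 ^+ n) -> z = 0.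
  move=> hz; apply/eqP; rewrite -normr_eq0 eq_le normr_ge0 andbT leNgt.
  by apply/negP => /(e0 M)[n]; rewrite ltNge hz.
have cy i : continuous (y i).
  move=> x; apply/cvgrPdist_lt => e he.
  pose M := 2 * C * expR (a * (`|x| + 1)).
  have [n hn] := e0 M (e / 3) ltac:(by rewrite divr_gt0).
  have := cS n i x; move/cvgrPdist_lt => /(_ (e / 3)); rewrite divr_gt0// => /(_ isT) hS.
  have close z : `|z| <= `|x| + 1 -> `|y i z - S n i z| < e / 3.
    move=> hz; apply: le_lt_trans hn; apply: (le_trans (yP i z n)).
    rewrite ler_pM2r ?invr_gt0 ?exprn_gt0// /M ler_wpM2l ?mulr_ge0// ?sumr_ge0//.
    by rewrite ler_expR ler_pM2l.
  near=> z.
  have h1 := close x ltac:(by rewrite lerDl).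
  have h2 : `|y i z - S n i z| < e / 3.
    apply: close; have : `|x - z| < 1 by near: z; exact: (nbhsx_ballx x 1 ltr01).
    by have := lerB_dist z x; rewrite distrC; lra.
  have h3 : `|S n i x - S n i z| < e / 3 by near: z.
  by move: h1 h2 h3; rewrite !ltr_norml; lra.
have cVy i := cV y cy i.
(* The error in the integral equation is bounded by a constant times [2^-n] for every n: both
   [y - S (n+1)] and the primitive of [V y - V (S n)] are that small. *)
have yE i x : y i x = y0 i + primitive (V y i) x.
  apply/eqP; rewrite -subr_eq0; apply/eqP; apply: (small _ (2 * C * expR (a * `|x|))) => n.
  have hS : der (fun x => primitive (V y i) x - (S n.+1 i x - y0 i)) (fun x => V y i x - V (S n) i x).
    have dS : der (S n.+1 i) (V (S n) i).
      move=> z; apply: (@hasd_ext (fun z => y0 i + \sum_(m < n) primitive (V (Y m) i) z)).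
        by move=> w; rewrite /S big_ord_recl.
      have hs : hasd (fun w => \sum_(m < n) primitive (V (Y m) i) w) z (\sum_(m < n) V (Y m) i z).
        by apply: hasd_sum => m _; by apply: der_primitive; exact: cV.
      apply: (hasd_eq (hasdD (hasd_cst _ _) hs)).
      rewrite add0r /V exchange_big/=; apply: eq_bigr => j _.
      by rewrite /S mulr_sumr.
    move=> z; apply: (hasd_eq (hasdB (der_primitive (cVy i) z) (hasdB (dS z) (hasd_cst _ _)))).
    by rewrite subr0.
  have := primitive_le_expR hS _ a0 (C := k * (2 * C / 2 ^+ n)) _ x.
  rewrite primitive0// /S big_ord_recl/= big1 ?addr0 ?subrr; last by move=> m _; by apply: primitive0; exact: cV.
  rewrite -/(S n.+1 i x) => /(_ erefl) hP.
  have {}hP := hP ltac:(move=> z; rewrite /V -sumrB;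
    under eq_bigr do rewrite -mulrBr; apply: (VM (fun j z => y j z - S n j z)) => j w;
    rewrite mulrAC; exact: yP).
  have -> : y i x - (y0 i + primitive (V y i) x) =
    (y i x - S n.+1 i x) - (primitive (V y i) x - (S n.+1 i x - y0 i)) by ring.
  rewrite (le_trans (ler_normB _ _))// (le_trans (lerD (yP i x n.+1) hP))//.
  rewrite le_eqVlt; apply/orP; left; apply/eqP; rewrite /a exprS; field.
  by rewrite expf_neq0//= gt_eqF.
exists y => i; first by rewrite yE primitive0// addr0.
move=> x; have := hasdD (hasd_cst (y0 i) x) (der_primitive (cVy i) x); rewrite add0r.
by apply: hasd_ext => z; rewrite yE.
Unshelve. all: by end_near. Qed.

End RealCalculus.

(** * Complex derivatives and Cauchy's theorem *)

Section ComplexNorm.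
Variable R : realType.
Local Notation C := R[i].
Implicit Types z w : C.

(** The norm of [R[i]] takes its values in [R[i]]; this real-valued version makes the order and the
    arithmetic of [R] available for all estimates. *)
Definition cn z : R := Num.sqrt (complex.Re z ^+ 2 + complex.Im z ^+ 2).

Lemma normcn z : `|z| = (cn z)%:C.
Proof. by rewrite normc_def. Qed.

Lemma cn_ge0 z : 0 <= cn z.
Proof. exact: sqrtr_ge0. Qed.

Lemma cn0 : cn 0 = 0.
Proof. by apply: complexI; rewrite -normcn normr0. Qed.

Lemma cn_eq0 z : (cn z == 0) = (z == 0).
Proof. by rewrite -(inj_eq (@complexI R)) -normcn normr_eq0. Qed.

Lemma cn_gt0 z : (0 < cn z) = (z != 0).
Proof. by rewrite lt0r cn_eq0 cn_ge0 andbT. Qed.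

Lemma cnM z w : cn (z * w) = cn z * cn w.
Proof. by apply: complexI; rewrite rmorphM/= -!normcn normrM. Qed.

Lemma cnX z n : cn (z ^+ n) = cn z ^+ n.
Proof. by apply: complexI; rewrite rmorphXn/= -!normcn normrX. Qed.

Lemma cnN z : cn (- z) = cn z.
Proof. by apply: complexI; rewrite -!normcn normrN. Qed.

Lemma cnD z w : cn (z + w) <= cn z + cn w.
Proof. by rewrite -lecR rmorphD/= -!normcn ler_normD. Qed.

Lemma cnB z w : cn (z - w) <= cn z + cn w.
Proof. by rewrite -(cnN w) cnD. Qed.

Lemma cnBC z w : cn (z - w) = cn (w - z).
Proof. by rewrite -cnN opprB. Qed.

Lemma cnBl z w : cn z - cn w <= cn (z - w).
Proof. by rewrite lerBlDr -{1}(subrK w z) cnD. Qed.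

Lemma cn_sum (I : Type) (r : seq I) (P : pred I) (F : I -> C) :
  cn (\sum_(i <- r | P i) F i) <= \sum_(i <- r | P i) cn (F i).
Proof.
elim/big_rec2 : _ => [|i y1 y2 _ h]; first by rewrite cn0.
by rewrite (le_trans (cnD _ _))// lerD2l.
Qed.

Lemma cnR (x : R) : cn x%:C = `|x|.
Proof. by rewrite /cn /= expr0n addr0 sqrtr_sqr. Qed.

Lemma cnV z : cn z^-1 = (cn z)^-1.
Proof.
have [->|z0] := eqVneq z 0; first by rewrite invr0 cn0 invr0.
have cz : cn z != 0 by rewrite cn_eq0.
by apply: (mulfI cz); rewrite -cnM !divff// cnR normr1.
Qed.

Lemma cni : cn 'i%C = 1.
Proof. by rewrite /cn /= expr0n add0r expr1n sqrtr1. Qed.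

Lemma Re_le_cn z : `|complex.Re z| <= cn z.
Proof. by rewrite -sqrtr_sqr ler_wsqrtr// lerDl sqr_ge0. Qed.

Lemma Im_le_cn z : `|complex.Im z| <= cn z.
Proof. by rewrite -sqrtr_sqr ler_wsqrtr// lerDr sqr_ge0. Qed.

Lemma cn_le_ReIm z : cn z <= `|complex.Re z| + `|complex.Im z|.
Proof.
rewrite -[leRHS]ger0_norm ?addr_ge0// -sqrtr_sqr ler_wsqrtr// sqrrD !real_normK ?num_real//.
by rewrite lerD2r lerDl mulrn_wge0 ?mulr_ge0.
Qed.

Lemma sqr_cn z : cn z ^+ 2 = complex.Re z ^+ 2 + complex.Im z ^+ 2.
Proof. by rewrite sqr_sqrtr// addr_ge0 ?sqr_ge0. Qed.

Lemma eq_complexP z w : complex.Re z = complex.Re w -> complex.Im z = complex.Im w -> z = w.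
Proof. by case: z w => [a b] [c d] /= -> ->. Qed.

Lemma cnJ z : cn z^* = cn z.
Proof. by case: z => a b; rewrite /cn /= sqrrN. Qed.

End ComplexNorm.

Lemma derivable1_dist (K : numFieldType) (f : K -> K) z : derivable f z 1 <->
  exists l, forall e, 0 < e -> \forall h \near (0 : K)^', `|l - h^-1 * (f (h + z) - f z)| <= e.
Proof.
have E : (fun h : K => h^-1 *: (f (h *: 1 + z) - f z)) = (fun h => h^-1 * (f (h + z) - f z)).
  by apply/funext => h; rewrite /GRing.scale /= mulr1.
rewrite /derivable /= E; split=> [/cvg_ex[/= l /cvgrPdist_le hl]|[l hl]]; first by exists l.
by apply/cvg_ex; exists l; apply/cvgrPdist_le.
Qed.

(** * Complex differentiability in epsilon-delta form *)

Section Holomorphic.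
Variable R : realType.
Local Notation C := R[i].
Let K : numClosedFieldType := R[i].
Implicit Types (f g : C -> C) (z w l : C).

(** Free of division, hence meaningful at h = 0 as well, and with real epsilons; [holo_derivable]
    relates it to derivability over the field [R[i]]. *)
Definition cdiff f z l := forall e : R, 0 < e -> exists2 d : R, 0 < d &
  forall h, cn h < d -> cn (f (z + h) - f z - l * h) <= e * cn h.

Definition holo f z := exists l, cdiff f z l.

Definition near0c (Q : C -> Prop) := exists2 d : R, 0 < d & forall z, cn z < d -> Q z.

Lemma cn_ball (x y : C) (e : R) : @ball K K x e%:C y <-> cn (x - y) < e.
Proof. by rewrite -ball_normE /ball_/= normcn ltcR. Qed.

Lemma nbhscP (x : C) (Q : C -> Prop) : @nbhs K K x Q <->
  exists2 d : R, 0 < d & forall z, cn (z - x) < d -> Q z.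
Proof.
split=> [/nbhs_ballP[e /= e0 he]|[d d0 hd]].
  exists (complex.Re e); first by move: e0; rewrite ltcE => /andP[].
  move=> z hz; apply: he; have -> : e = (complex.Re e)%:C.
    by move: e0; rewrite ltcE => /andP[/eqP]; case: (e) => a b /= ->.
  by apply/cn_ball; rewrite cnBC.
apply/nbhs_ballP; exists d%:C; first by rewrite /= ltcR.
by move=> z /cn_ball hz; apply: hd; rewrite cnBC.
Qed.

Lemma near0cP (Q : C -> Prop) : (\forall z \near (0 : K), Q z) <-> near0c Q.
Proof.
by split=> [/nbhscP[d d0 hd]|[d d0 hd]]; [|apply/nbhscP]; exists d => // z;
  have := hd z; rewrite subr0.
Qed.

Lemma near0'P (Q : C -> Prop) : near0' (K := K) Q <-> near0c (fun z => z != 0 -> Q z).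
Proof. by rewrite /near0' -near0cP. Qed.

Lemma near0c_and (P Q : C -> Prop) : near0c P -> near0c Q -> near0c (fun z => P z /\ Q z).
Proof.
move=> [d d0 hd] [e e0 he]; exists (Num.min d e); first by rewrite lt_min d0.
by move=> z; rewrite lt_min => /andP[zd ze]; split; [exact: hd|exact: he].
Qed.

Lemma near0c_sub (P Q : C -> Prop) : (forall z, P z -> Q z) -> near0c P -> near0c Q.
Proof. by move=> PQ [d d0 hd]; exists d => // z /hd /PQ. Qed.

Lemma holo_derivable f z : holo f z <-> @derivable K K K f z 1.
Proof.
rewrite derivable1_dist; split=> -[l hl]; exists l => e e0; last first.
  have := hl e%:C; rewrite ltcR => /(_ e0).
  move=> /near0'P[d d0 hd]; exists d => // h hd'.
  have [->|h0] := eqVneq h 0; first by rewrite addr0 subrr mulr0 subrr cn0 mulr0.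
  have := hd h hd' h0; rewrite normcn lecR => hle.
  have -> : f (z + h) - f z - l * h = - ((l - h^-1 * (f (h + z) - f z)) * h).
    rewrite [h + z]addrC mulrBl mulrAC mulVf// mul1r opprB.
    by rewrite addrC.
  by rewrite cnN cnM ler_wpM2r ?cn_ge0.
have er : e = (complex.Re e)%:C.
  by move: e0; rewrite ltcE => /andP[/eqP]; case: (e) => a b /= ->.
have [|d d0 hd] := hl (complex.Re e); first by move: e0; rewrite ltcE => /andP[].
apply/near0'P; exists d => // h hd' h0.
rewrite er normcn lecR -(ler_pM2r (x := cn h)) ?cn_gt0// -cnM.
apply: le_trans (hd h hd'); rewrite -cnN [h + z]addrC mulrBl mulrAC mulVf// mul1r opprB.
by rewrite addrAC addrC addrA.
Qed.

Lemma holoP f z : holo f z <-> exists l, cdiff f z l.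
Proof. by []. Qed.

Lemma holo_cst (c : C) z : holo (fun=> c) z.
Proof. by apply/holo_derivable; exact: derivable_cst. Qed.

Lemma holo_id z : holo id z.
Proof. by apply/holo_derivable; exact: derivable_id. Qed.

Lemma holoD f g z : holo f z -> holo g z -> holo (fun w => f w + g w) z.
Proof. by move=> /holo_derivable hf /holo_derivable hg; apply/holo_derivable; exact: derivableD. Qed.

Lemma holoN f z : holo f z -> holo (fun w => - f w) z.
Proof. by move=> /holo_derivable hf; apply/holo_derivable; exact: derivableN. Qed.

Lemma holoB f g z : holo f z -> holo g z -> holo (fun w => f w - g w) z.
Proof. by move=> /holo_derivable hf /holo_derivable hg; apply/holo_derivable; exact: derivableB. Qed.

Lemma holoM f g z : holo f z -> holo g z -> holo (fun w => f w * g w) z.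
Proof. by move=> /holo_derivable hf /holo_derivable hg; apply/holo_derivable; exact: (@derivableM K K f g z 1 hf hg). Qed.

Lemma holoV f z : f z != 0 -> holo f z -> holo (fun w => (f w)^-1) z.
Proof. by move=> f0 /holo_derivable hf; apply/holo_derivable; exact: derivableV. Qed.

Lemma holoX f n z : holo f z -> holo (fun w => f w ^+ n) z.
Proof.
move=> hf; elim: n => [|n ih]; first exact: holo_cst.
by under eq_fun do rewrite exprS; apply: holoM.
Qed.

Lemma holo_sum (I : Type) (r : seq I) (P : pred I) (F : I -> C -> C) z :
  (forall i, P i -> holo (F i) z) -> holo (fun w => \sum_(i <- r | P i) F i w) z.
Proof.
move=> h; elim: r => [|i r ih].
  by under eq_fun do rewrite big_nil; exact: holo_cst.
have E : (fun w => \sum_(j <- i :: r | P j) F j w) =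
    (fun w => if P i then F i w + \sum_(j <- r | P j) F j w else \sum_(j <- r | P j) F j w).
  by apply/funext => w; rewrite big_cons.
rewrite E; case Pi : (P i); last exact: ih.
by apply: holoD; [exact: h|exact: ih].
Qed.

Lemma holo_poly (p : {poly C}) f z : holo f z -> holo (fun w => p.[f w]) z.
Proof.
move=> hf; under eq_fun do rewrite horner_coef.
by apply: holo_sum => i _; apply: holoM; [exact: holo_cst|exact: holoX].
Qed.

Lemma holo_near f g z : (exists2 d : R, 0 < d & forall h, cn h < d -> f (z + h) = g (z + h)) ->
  holo f z -> holo g z.
Proof.
move=> [d d0 fg] /holoP[l hl]; apply/holoP; exists l => e e0.
have [d' d'0 hd'] := hl e e0; exists (Num.min d d'); first by rewrite lt_min d0.
move=> h; rewrite lt_min => /andP[h1 h2]; rewrite -fg// -(addr0 z) -fg ?cn0// addr0.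
exact: hd'.
Qed.

Lemma cdiff_lip f z l : cdiff f z l ->
  exists2 d : R, 0 < d & forall h, cn h < d -> cn (f (z + h) - f z) <= (cn l + 1) * cn h.
Proof.
move=> hl; have [d d0 hd] := hl 1 ltr01; exists d => // h /hd.
rewrite mul1r => H; rewrite -[f _ - _](subrK (l * h)) (le_trans (cnD _ _))//.
by rewrite cnM mulrDl addrC mul1r lerD2l.
Qed.

Lemma holo_comp f g z : holo f (g z) -> holo g z -> holo (fun w => f (g w)) z.
Proof.
move=> /holoP[l hl] /holoP[m hm]; apply/holoP; exists (l * m) => e e0.
have [d3 d30 lip] := cdiff_lip hm.
(* [e1] compensates the Lipschitz constant of g near z and [e2] the derivative of f; each of the two
   errors is then at most [e / 2 * cn h]. *)
pose e1 := e / (2 * (cn m + 1)); pose e2 := e / (2 * (cn l + 1)).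
have cp w : 0 < cn w + 1 by rewrite ltr_wpDl ?cn_ge0.
have e10 : 0 < e1 by rewrite divr_gt0 ?mulr_gt0.
have e20 : 0 < e2 by rewrite divr_gt0 ?mulr_gt0.
have [d1 d10 h1] := hl e1 e10; have [d2 d20 h2] := hm e2 e20.
exists (Num.min (Num.min d2 d3) (d1 / (cn m + 1))).
  by rewrite !lt_min d20 d30 divr_gt0.
move=> h; rewrite !lt_min => /andP[/andP[hd2 hd3] hd1].
set k := g (z + h) - g z.
have kd : cn k <= (cn m + 1) * cn h by exact: lip.
have kd1 : (cn m + 1) * cn h < d1 by rewrite mulrC -ltr_pdivlMr.
have {}h1 := h1 k (le_lt_trans kd kd1).
have {}h2 := h2 h hd2.
have -> : f (g (z + h)) - f (g z) - l * m * h =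
  (f (g z + k) - f (g z) - l * k) + l * (k - m * h).
  by rewrite (_ : g z + k = g (z + h)); [ring|rewrite /k addrC subrK].
rewrite (le_trans (cnD _ _))// cnM (le_trans (lerD h1 (ler_wpM2l (cn_ge0 l) h2)))//.
have a1 : e1 * cn k <= e / 2 * cn h.
  apply: (le_trans (ler_wpM2l (ltW e10) kd)); rewrite mulrA ler_wpM2r ?cn_ge0// /e1.
  by rewrite invfM mulrA mulfVK// gt_eqF.
have a2 : cn l * (e2 * cn h) <= e / 2 * cn h.
  rewrite mulrA ler_wpM2r ?cn_ge0// (_ : _ * e2 = e / 2 * (cn l / (cn l + 1))); last first.
    by rewrite /e2; field; rewrite gt_eqF.
  by rewrite ler_piMr ?divr_ge0 ?(ltW e0)// ler_pdivrMr// mul1r lerDl.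
by rewrite (le_trans (lerD a1 a2))// -mulrDl -splitr.
Qed.

Definition ccont f := forall z (e : R), 0 < e -> exists2 d : R, 0 < d &
  forall h, cn h < d -> cn (f (z + h) - f z) < e.

Lemma holo_cont f z : holo f z -> forall e : R, 0 < e -> exists2 d : R, 0 < d &
  forall h, cn h < d -> cn (f (z + h) - f z) < e.
Proof.
move=> /holoP[l /cdiff_lip[d d0 hd]] e e0.
have l0 : 0 < cn l + 1 by rewrite ltr_wpDl ?cn_ge0.
exists (Num.min d (e / (cn l + 1))); first by rewrite lt_min d0 divr_gt0.
move=> h; rewrite lt_min => /andP[h1 h2]; apply: (le_lt_trans (hd h h1)).
by rewrite mulrC -ltr_pdivlMr.
Qed.

Lemma ccont_holo f : (forall z, holo f z) -> ccont f.
Proof. by move=> h z; exact: holo_cont. Qed.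

End Holomorphic.

(** * Integrals along segments and boundaries of rectangles *)

Section PathIntegral.
Variable R : realType.
Local Notation C := R[i].
Implicit Types (F G : R -> C) (a b c d t : R) (z w : C).

Lemma ReD z w : complex.Re (z + w) = complex.Re z + complex.Re w.
Proof. by case: z w => [? ?] [? ?]. Qed.

Lemma ImD z w : complex.Im (z + w) = complex.Im z + complex.Im w.
Proof. by case: z w => [? ?] [? ?]. Qed.

Lemma Re_scale (x : R) z : complex.Re (x%:C * z) = x * complex.Re z.
Proof. by case: z => u v /=; rewrite mul0r subr0. Qed.

Lemma Im_scale (x : R) z : complex.Im (x%:C * z) = x * complex.Im z.
Proof. by case: z => u v /=; rewrite mul0r addr0. Qed.

Definition pcont F := continuous (fun t => complex.Re (F t)) /\
  continuous (fun t => complex.Im (F t)).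

Lemma pcontP F : pcont F <-> forall t (e : R), 0 < e ->
  exists2 r : R, 0 < r & forall s, `|s| < r -> cn (F (t + s) - F t) < e.
Proof.
split=> [[hr hi] t e e0|h].
  have e20 : 0 < e / 2 by rewrite divr_gt0.
  have /cvgrPdist_lt/(_ _ e20)/nbhs_ballP[r1 r10 h1] := hr t.
  have /cvgrPdist_lt/(_ _ e20)/nbhs_ballP[r2 r20 h2] := hi t.
  exists (Num.min r1 r2); first by rewrite lt_min r10.
  move=> s; rewrite lt_min => /andP[s1 s2].
  have b1 : ball t r1 (t + s) by rewrite -ball_normE /ball_/= opprD addNKr normrN.
  have b2 : ball t r2 (t + s) by rewrite -ball_normE /ball_/= opprD addNKr normrN.
  have {}h1 := h1 _ b1; have {}h2 := h2 _ b2.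
  apply: (le_lt_trans (cn_le_ReIm _)); rewrite !raddfB/=.
  by rewrite (splitr e) ltrD// distrC.
have key (p : C -> R) : (forall z w, p (z - w) = p z - p w) -> (forall z, `|p z| <= cn z) ->
    continuous (fun t => p (F t)).
  move=> pB pn t; apply/cvgrPdist_lt => e e0.
  have [r r0 hr] := h t e e0; apply/nbhs_ballP; exists r => // s.
  rewrite /ball_/= => ts; rewrite distrC -pB (le_lt_trans (pn _))//.
  by have := hr (s - t); rewrite (addrC t) subrK distrC; apply.
by split; apply: key => *; rewrite ?raddfB// ?Re_le_cn ?Im_le_cn.
Qed.

Lemma pcontD F G : pcont F -> pcont G -> pcont (fun t => F t + G t).
Proof.
move=> [h1 h2] [h3 h4]; split => t; under eq_fun do rewrite raddfD/=.
  by apply: cvgD; [exact: h1|exact: h3].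
by apply: cvgD; [exact: h2|exact: h4].
Qed.

Lemma pcontM F G : pcont F -> pcont G -> pcont (fun t => F t * G t).
Proof.
have E1 z w : complex.Re (z * w) = complex.Re z * complex.Re w - complex.Im z * complex.Im w.
  by case: z w => [x y] [x' y'].
have E2 z w : complex.Im (z * w) = complex.Re z * complex.Im w + complex.Im z * complex.Re w.
  by case: z w => [x y] [x' y'].
move=> [h1 h2] [h3 h4]; split => t.
  by under eq_fun do rewrite E1; apply: cvgB; apply: cvgM; [exact: h1|exact: h3|exact: h2|exact: h4].
by under eq_fun do rewrite E2; apply: cvgD; apply: cvgM; [exact: h1|exact: h4|exact: h2|exact: h3].
Qed.

Lemma pcont_cst z : pcont (fun=> z).
Proof. by split=> t; exact: cvg_cst. Qed.

Lemma pcont_real (f : R -> R) : continuous f -> pcont (fun t => (f t)%:C).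
Proof. by move=> h; split => // t; exact: cvg_cst. Qed.

Lemma pcontV F : (forall t, F t != 0) -> pcont F -> pcont (fun t => (F t)^-1).
Proof.
move=> F0 hF.
pose N t := complex.Re (F t) ^+ 2 + complex.Im (F t) ^+ 2.
have N0 t : N t != 0 by rewrite /N -sqr_cn expf_neq0// cn_eq0.
have cN : continuous N.
  by case: hF => h1 h2 t; apply: cvgD; rewrite expr2; apply: cvgM; [exact: h1..|exact: h2|exact: h2].
have cV : continuous (fun t => (N t)^-1) by move=> t; apply: cvgV => //; exact: cN.
have -> : (fun t => (F t)^-1) = (fun t => (complex.Re (F t) +i* - complex.Im (F t)) * ((N t)^-1)%:C).
  apply/funext => t; apply: (mulfI (F0 t)); rewrite divff// mulrA.
  have -> : F t * (complex.Re (F t) +i* - complex.Im (F t)) = (N t)%:C.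
    by rewrite /N; case: (F t) => x y; apply: eq_complexP => /=; ring.
  by rewrite -rmorphM/= divff.
apply: pcontM; last exact: pcont_real.
by case: hF => h1 h2; split => //= t; apply: cvgN; exact: h2.
Qed.

Lemma pcont_lin z w : pcont (fun t => z + t%:C * w).
Proof.
apply: pcontD; first exact: pcont_cst.
by apply: pcontM; [apply: pcont_real => t; exact: cvg_id|exact: pcont_cst].
Qed.

Lemma pcont_ccont (f : C -> C) z w : ccont f -> pcont (fun t => f (z + t%:C * w)).
Proof.
move=> cf; apply/pcontP => t e e0.
have [d d0 hd] := cf (z + t%:C * w) e e0.
exists (d / (cn w + 1)); first by rewrite divr_gt0// ltr_wpDl ?cn_ge0.
move=> s hs; have -> : z + (t + s)%:C * w = z + t%:C * w + s%:C * w.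
  by rewrite rmorphD/= mulrDl addrA.
apply: hd; rewrite cnM cnR.
move: hs; rewrite ltr_pdivlMr; last by rewrite ltr_wpDl ?cn_ge0.
by apply: le_lt_trans; rewrite ler_wpM2l// lerDl.
Qed.

(* The integral is defined through primitives of the real and imaginary parts;
   it is meaningful when [F] satisfies [pcont]. *)
Definition pint F a b : C :=
  (primitive (fun t => complex.Re (F t)) b - primitive (fun t => complex.Re (F t)) a) +i*
  (primitive (fun t => complex.Im (F t)) b - primitive (fun t => complex.Im (F t)) a).

Lemma pint_eq F G a b :
  (forall t, hasd (fun t => complex.Re (G t)) t (complex.Re (F t))) ->
  (forall t, hasd (fun t => complex.Im (G t)) t (complex.Im (F t))) ->
  pcont F -> pint F a b = G b - G a.
Proof.
move=> hr hi [cr ci].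
have key (g f : R -> R) : der g f -> continuous f -> primitive f b - primitive f a = g b - g a.
  move=> hg cf.
  have := @is_derive_0_is_cst _ (fun t => primitive f t - g t) b a.
  have h0 (t : R) : is_derive t (1 : R) (fun t => primitive f t - g t) 0.
    by have := hasdB (der_primitive cf t) (hg t); rewrite subrr.
  by move=> /(_ h0); lra.
rewrite /pint (key _ _ hr cr) (key _ _ hi ci).
by case: (G b) (G a) => [? ?] [? ?].
Qed.

Lemma pintD F G a b : pcont F -> pcont G -> pint (fun t => F t + G t) a b = pint F a b + pint G a b.
Proof.
move=> hF hG.
have [P hP] : exists P : R -> C, (forall t, hasd (fun t => complex.Re (P t)) t (complex.Re (F t))) /\
    (forall t, hasd (fun t => complex.Im (P t)) t (complex.Im (F t))).
  case: hF => h1 h2; exists (fun t => primitive (fun t => complex.Re (F t)) t +i* primitive (fun t => complex.Im (F t)) t).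
  by split => t; exact: der_primitive.
have [Q hQ] : exists P : R -> C, (forall t, hasd (fun t => complex.Re (P t)) t (complex.Re (G t))) /\
    (forall t, hasd (fun t => complex.Im (P t)) t (complex.Im (G t))).
  case: hG => h1 h2; exists (fun t => primitive (fun t => complex.Re (G t)) t +i* primitive (fun t => complex.Im (G t)) t).
  by split => t; exact: der_primitive.
rewrite (@pint_eq F P) ?(@pint_eq G Q); try by [case: hP|case: hQ].
rewrite (@pint_eq _ (fun t => P t + Q t)); first by ring.
- move=> t; apply: (@hasd_ext _ (fun t => complex.Re (P t) + complex.Re (Q t))).
    by move=> s; rewrite raddfD.
  by rewrite raddfD; apply: hasdD; [case: hP|case: hQ].
- move=> t; apply: (@hasd_ext _ (fun t => complex.Im (P t) + complex.Im (Q t))).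
    by move=> s; rewrite raddfD.
  by rewrite raddfD; apply: hasdD; [case: hP|case: hQ].
- exact: pcontD.
Qed.

Lemma pintZ z F a b : pcont F -> pint (fun t => z * F t) a b = z * pint F a b.
Proof.
move=> [h1 h2].
pose P t := primitive (fun t => complex.Re (F t)) t +i* primitive (fun t => complex.Im (F t)) t.
have d1 := der_primitive h1; have d2 := der_primitive h2.
rewrite (@pint_eq F P)// (@pint_eq _ (fun t => z * P t)) ?mulrBr//.
- move=> t; case: z => x y /=; case E : (F t) => [u v] /=.
  have := d1 t; have := d2 t; rewrite E/= => hv hu.
  exact: hasdB (hasdZ _ hu) (hasdZ _ hv).
- move=> t; case: z => x y /=; case E : (F t) => [u v] /=.
  have := d1 t; have := d2 t; rewrite E/= => hv hu.
  exact: hasdD (hasdZ _ hv) (hasdZ _ hu).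
- by apply: pcontM => //; exact: pcont_cst.
Qed.

Lemma pintB F G a b : pcont F -> pcont G -> pint (fun t => F t - G t) a b = pint F a b - pint G a b.
Proof.
move=> hF hG; have := @pintD F (fun t => -1 * G t) a b hF (pcontM (pcont_cst _) hG).
by rewrite pintZ// mulN1r => <-; congr pint; apply/funext => t; rewrite mulN1r.
Qed.

Lemma pint_chasles F a b c : pint F a b + pint F b c = pint F a c.
Proof. by rewrite /pint; apply: eq_complexP => /=; ring. Qed.

(** The factor 2 comes from bounding the real and imaginary parts separately. It is harmless, as
    only the order of magnitude matters in what follows. *)
Lemma pint_bound F a b M : pcont F -> a <= b -> (forall t, a <= t <= b -> cn (F t) <= M) ->
  cn (pint F a b) <= 2 * M * (b - a).
Proof.
move=> [h1 h2] ab hM; apply: (le_trans (cn_le_ReIm _)) => /=.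
have -> : 2 * M * (b - a) = M * (b - a) + M * (b - a) by ring.
apply: lerD; apply: norm_le_of_derive ab _ => [t _|t /hM]; first exact: der_primitive.
- by apply: le_trans; exact: Re_le_cn.
- exact: der_primitive.
- by apply: le_trans; exact: Im_le_cn.
Qed.

Lemma eq_pint F G a b : pcont F -> pcont G -> a <= b -> (forall t, a <= t <= b -> F t = G t) ->
  pint F a b = pint G a b.
Proof.
move=> hF hG ab FG; apply/eqP; rewrite -subr_eq0 -cn_eq0 eq_le cn_ge0 andbT -pintB//.
have hFG : pcont (fun t => F t - G t).
  have -> : (fun t => F t - G t) = (fun t => F t + -1 * G t) by apply/funext => t; rewrite mulN1r.
  exact: pcontD hF (pcontM (pcont_cst _) hG).
have := @pint_bound _ a b 0 hFG ab; rewrite mulr0 mul0r; apply => t /FG ->.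
by rewrite subrr cn0.
Qed.

(* Integral along the boundary of [a, b] x [c, d], counterclockwise. *)
Definition rint (f : C -> C) a b c d : C :=
  pint (fun t => f (0 +i* c + t%:C * 1)) a b + 'i%C * pint (fun t => f (b%:C + t%:C * 'i%C)) c d
  - pint (fun t => f (0 +i* d + t%:C * 1)) a b - 'i%C * pint (fun t => f (a%:C + t%:C * 'i%C)) c d.

Definition rcont (f : C -> C) a b c d :=
  [/\ pcont (fun t => f (0 +i* c + t%:C * 1)), pcont (fun t => f (b%:C + t%:C * 'i%C)),
  pcont (fun t => f (0 +i* d + t%:C * 1)) & pcont (fun t => f (a%:C + t%:C * 'i%C))].

Lemma ccont_rcont f a b c d : ccont f -> rcont f a b c d.
Proof. by move=> cf; split; exact: pcont_ccont. Qed.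

Lemma rintD (f g : C -> C) a b c d : rcont f a b c d -> rcont g a b c d ->
  rint (fun z => f z + g z) a b c d = rint f a b c d + rint g a b c d.
Proof. by move=> [? ? ? ?] [? ? ? ?]; rewrite /rint !pintD//; ring. Qed.

Lemma rintB (f g : C -> C) a b c d : rcont f a b c d -> rcont g a b c d ->
  rint (fun z => f z - g z) a b c d = rint f a b c d - rint g a b c d.
Proof. by move=> [? ? ? ?] [? ? ? ?]; rewrite /rint !pintB//; ring. Qed.

Lemma rintZ (f : C -> C) w a b c d : rcont f a b c d ->
  rint (fun z => w * f z) a b c d = w * rint f a b c d.
Proof. by move=> [? ? ? ?]; rewrite /rint !pintZ//; ring. Qed.

Lemma rcontM (f g : C -> C) a b c d : rcont f a b c d -> rcont g a b c d ->
  rcont (fun z => f z * g z) a b c d.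
Proof. by move=> [? ? ? ?] [? ? ? ?]; split; apply: pcontM. Qed.

Lemma rcontD (f g : C -> C) a b c d : rcont f a b c d -> rcont g a b c d ->
  rcont (fun z => f z + g z) a b c d.
Proof. by move=> [? ? ? ?] [? ? ? ?]; split; apply: pcontD. Qed.

Lemma rcont_cst w a b c d : rcont (fun=> w) a b c d.
Proof. by split; exact: pcont_cst. Qed.

Lemma rcontN (f : C -> C) a b c d : rcont f a b c d -> rcont (fun z => - f z) a b c d.
Proof.
move=> hf; have -> : (fun z => - f z) = (fun z => -1 * f z) by apply/funext => z; rewrite mulN1r.
exact: rcontM (rcont_cst _ _ _ _ _) hf.
Qed.

Definition onrect (P : C -> Prop) a b c d := forall z,
  a <= complex.Re z <= b -> c <= complex.Im z <= d ->
  (complex.Re z = a \/ complex.Re z = b \/ complex.Im z = c \/ complex.Im z = d) -> P z.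

Lemma onrect_sides (P : C -> Prop) a b c d : a <= b -> c <= d -> onrect P a b c d ->
  [/\ forall t, a <= t <= b -> P (0 +i* c + t%:C * 1), forall t, c <= t <= d -> P (b%:C + t%:C * 'i%C),
  forall t, a <= t <= b -> P (0 +i* d + t%:C * 1) & forall t, c <= t <= d -> P (a%:C + t%:C * 'i%C)].
Proof.
move=> ab cd hP; split=> t ht; apply: hP => /=;
  rewrite ?(mulr0, mul0r, mulr1, add0r, addr0, subr0) ?lexx ?ab ?cd ?ht//;
  by [left|right; left|right; right; left|right; right; right].
Qed.

Lemma rint_bound (f : C -> C) a b c d M : rcont f a b c d -> a <= b -> c <= d ->
  onrect (fun z => cn (f z) <= M) a b c d ->
  cn (rint f a b c d) <= 4 * M * ((b - a) + (d - c)).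
Proof.
move=> [h1 h2 h3 h4] ab cd /(onrect_sides ab cd)[b1 b2 b3 b4].
have := pint_bound h1 ab b1; have := pint_bound h2 cd b2.
have := pint_bound h3 ab b3; have := pint_bound h4 cd b4.
rewrite /rint; move: (pint _ _ _) (pint _ _ _) (pint _ _ _) (pint _ _ _) => p1 p2 p3 p4.
move=> i4 i3 i2 i1; rewrite (le_trans (cnB _ _))// cnM cni mul1r.
have := cnB (p1 + 'i%C * p2) p3; have := cnD p1 ('i%C * p2); rewrite cnM cni mul1r.
by move=> j1 j2; lra.
Qed.

Lemma eq_rint (f g : C -> C) a b c d : rcont f a b c d -> rcont g a b c d -> a <= b -> c <= d ->
  onrect (fun z => f z = g z) a b c d -> rint f a b c d = rint g a b c d.
Proof.
move=> [h1 h2 h3 h4] [k1 k2 k3 k4] ab cd /(onrect_sides ab cd)[b1 b2 b3 b4].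
by rewrite /rint (eq_pint h1 k1)// (eq_pint h2 k2)// (eq_pint h3 k3)// (eq_pint h4 k4).
Qed.

Lemma rint_hcut (f : C -> C) a m b c d : rint f a b c d = rint f a m c d + rint f m b c d.
Proof. by rewrite /rint -!(pint_chasles _ a m b); ring. Qed.

Lemma rint_vcut (f : C -> C) a b c m d : rint f a b c d = rint f a b c m + rint f a b m d.
Proof. by rewrite /rint -!(pint_chasles _ c m d); ring. Qed.

(** This is what allows Goursat's argument to subtract the first-order Taylor polynomial. Each side
    is integrated with an explicit quadratic primitive. *)
Lemma rint_affine z w a b c d : rint (fun u => z + u * w) a b c d = 0.
Proof.
have P (p q : C) s t : pint (fun t => z + (p + t%:C * q) * w) s t =
    (z + p * w) * (t - s)%:C + q * w * ((t ^+ 2 - s ^+ 2) / 2)%:C.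
  rewrite (@pint_eq _ (fun t => (z + p * w) * t%:C + q * w * (t ^+ 2 / 2)%:C)).
  - by rewrite mulrBl !raddfB /=; ring.
  - move=> x; apply: (@hasd_ext _ (fun t => complex.Re (z + p * w) * t + (complex.Re (q * w) / 2) * (t * t))).
      by move=> s'; case: (z + p * w) (q * w) => [? ?] [? ?] /=; field.
    apply: (hasd_eq (hasdD (hasdZ _ (hasd_id _)) (hasdZ _ (hasdM (hasd_id x) (hasd_id x))))).
    have -> : z + (p + x%:C * q) * w = (z + p * w) + x%:C * (q * w) by ring.
    by rewrite [RHS]ReD Re_scale; field.
  - move=> x; apply: (@hasd_ext _ (fun t => complex.Im (z + p * w) * t + (complex.Im (q * w) / 2) * (t * t))).
      by move=> s'; case: (z + p * w) (q * w) => [? ?] [? ?] /=; field.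
    apply: (hasd_eq (hasdD (hasdZ _ (hasd_id _)) (hasdZ _ (hasdM (hasd_id x) (hasd_id x))))).
    have -> : z + (p + x%:C * q) * w = (z + p * w) + x%:C * (q * w) by ring.
    by rewrite [RHS]ImD Im_scale; field.
  - have -> : (fun t => z + (p + t%:C * q) * w) = (fun t => (z + p * w) + t%:C * (q * w)).
      by apply/funext => x; ring.
    exact: pcont_lin.
rewrite /rint !P {P}; case: z w => [zr zi] [wr wi].
by apply: eq_complexP => /=; field.
Qed.

End PathIntegral.

(** * Goursat's theorem on rectangles *)

Section Goursat.
Variable R : realType.
Local Notation C := R[i].
Implicit Types (f g : C -> C) (a b c d : R) (z w : C).

Lemma pow2_small (M e : R) : 0 < e -> exists n, M / 2 ^+ n < e.
Proof.
move=> he; exists (Num.truncn (`|M| / e)).+1.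
rewrite ltr_pdivrMr ?exprn_gt0// (le_lt_trans (ler_norm M))// mulrC -ltr_pdivrMr//.
apply: (lt_trans (truncnS_gt _)).
by rewrite -natrX ltr_nat ltn_expl.
Qed.

Lemma nested_interval (u : nat -> R) (L : R) : 0 <= L ->
  (forall n, u n <= u n.+1 /\ u n.+1 + L / 2 ^+ n.+1 <= u n + L / 2 ^+ n) ->
  exists l, forall n, u n <= l <= u n + L / 2 ^+ n.
Proof.
move=> L0 hu.
have L0n n : 0 <= L / 2 ^+ n by rewrite divr_ge0// exprn_ge0.
have lom m n : (m <= n)%N -> u m <= u n.
  by apply: (homo_leq le_refl le_trans) => k; case: (hu k).
have him m n : (m <= n)%N -> u n + L / 2 ^+ n <= u m + L / 2 ^+ m.
  move=> mn; apply: (@homo_leq _ (fun n => u n + L / 2 ^+ n) (fun a b => b <= a)) mn => //.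
    by move=> b a c /[swap]; exact: le_trans.
  by move=> k; case: (hu k).
have lh m n : u m <= u n + L / 2 ^+ n.
  have [mn|/ltnW nm] := leqP m n; first by rewrite (le_trans (lom _ _ mn))// lerDl.
  by apply: le_trans (him _ _ nm); rewrite lerDl.
exists (sup (range u)) => n; apply/andP; split.
  by apply: ub_le_sup; [exists (u 0%N + L / 2 ^+ 0) => _ [k _ <-]|exists n].
by apply: ge_sup; [exists (u 0%N); exists 0%N|move=> _ [k _ <-]].
Qed.

Definition inrect a b c d z := a <= complex.Re z <= b /\ c <= complex.Im z <= d.

(** Quadrisection: the rectangles shrink to a point where f differs from its affine approximation by
    o(|h|). Continuity is asked on the whole plane because [pint] is built from primitives of
    functions on the whole line, while differentiability is asked on the rectangle only. *)
Lemma goursat f a b c d : ccont f -> a <= b -> c <= d ->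
  (forall z, inrect a b c d z -> holo f z) -> rint f a b c d = 0.
Proof.
move=> cf ab cd hf.
pose w := b - a; pose h := d - c.
have w0 : 0 <= w by rewrite subr_ge0.
have h0 : 0 <= h by rewrite subr_ge0.
pose I (p : R * R) n := rint f p.1 (p.1 + w / 2 ^+ n) p.2 (p.2 + h / 2 ^+ n).
have half (x : R) n : x / 2 ^+ n = x / 2 ^+ n.+1 + x / 2 ^+ n.+1.
  by rewrite exprS; field; rewrite expf_neq0.
(* p and q are lower left corners. One of the four quarters carries at least a quarter of the
   modulus of the integral, otherwise the four together would be too small. *)
have step p n : exists q, [/\ q.1 = p.1 \/ q.1 = p.1 + w / 2 ^+ n.+1,
    q.2 = p.2 \/ q.2 = p.2 + h / 2 ^+ n.+1 & cn (I p n) <= 4 * cn (I q n.+1)].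
  pose x' := p.1 + w / 2 ^+ n.+1; pose y' := p.2 + h / 2 ^+ n.+1.
  have E : I p n = I p n.+1 + I (p.1, y') n.+1 + (I (x', p.2) n.+1 + I (x', y') n.+1).
    rewrite /I /= (rint_hcut f p.1 x') (rint_vcut f p.1 x' p.2 y') (rint_vcut f x' _ p.2 y').
    by rewrite /x' /y' !(half w n) !(half h n) !addrA.
  apply: contrapT => hN.
  have key q : (q.1 = p.1 \/ q.1 = x') -> (q.2 = p.2 \/ q.2 = y') -> 4 * cn (I q n.+1) < cn (I p n).
    by move=> h1 h2; rewrite ltNge; apply/negP => h3; apply: hN; exists q.
  have k1 := key p (or_introl erefl) (or_introl erefl).
  have k2 := key (p.1, y') (or_introl erefl) (or_intror erefl).
  have k3 := key (x', p.2) (or_intror erefl) (or_introl erefl).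
  have k4 := key (x', y') (or_intror erefl) (or_intror erefl).
  have := cnD (I p n.+1 + I (p.1, y') n.+1) (I (x', p.2) n.+1 + I (x', y') n.+1).
  have := cnD (I p n.+1) (I (p.1, y') n.+1); have := cnD (I (x', p.2) n.+1) (I (x', y') n.+1).
  by rewrite -E => h1 h2 h3; clear - k1 k2 k3 k4 h1 h2 h3; lra.
have [next nextP] : exists next : (R * R) * nat -> R * R, forall pn,
    [/\ (next pn).1 = pn.1.1 \/ (next pn).1 = pn.1.1 + w / 2 ^+ pn.2.+1,
    (next pn).2 = pn.1.2 \/ (next pn).2 = pn.1.2 + h / 2 ^+ pn.2.+1
    & cn (I pn.1 pn.2) <= 4 * cn (I (next pn) pn.2.+1)].
  exists (fun pn => projT1 (cid (step pn.1 pn.2))) => -[p n]; exact: projT2 (cid (step p n)).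
pose s := fix s n := if n is m.+1 then next (s m, m) else (a, c).
have sP n : [/\ (s n.+1).1 = (s n).1 \/ (s n.+1).1 = (s n).1 + w / 2 ^+ n.+1,
    (s n.+1).2 = (s n).2 \/ (s n.+1).2 = (s n).2 + h / 2 ^+ n.+1
    & cn (I (s n) n) <= 4 * cn (I (s n.+1) n.+1)] by exact: nextP (s n, n).
have pw (x : R) n : 0 <= x -> 0 <= x / 2 ^+ n by move=> x0; rewrite divr_ge0// exprn_ge0.
have [x xP] : exists l, forall n, (s n).1 <= l <= (s n).1 + w / 2 ^+ n.
  apply: nested_interval => // n; have [h1 _ _] := sP n.
  have := pw w n.+1 w0; rewrite (half w n); case: h1 => ->; lra.
have [y yP] : exists l, forall n, (s n).2 <= l <= (s n).2 + h / 2 ^+ n.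
  apply: nested_interval => // n; have [_ h1 _] := sP n.
  have := pw h n.+1 h0; rewrite (half h n); case: h1 => ->; lra.
have Is n : cn (rint f a b c d) <= 4 ^+ n * cn (I (s n) n).
  elim: n => [|n ih].
    by rewrite expr0 mul1r /I /= expr0 !divr1 /w /h !subrKC.
  apply: (le_trans ih); have [_ _ h3] := sP n.
  by rewrite exprSr -mulrA ler_wpM2l// exprn_ge0.
have /holoP[l hl] : holo f (x +i* y).
  by apply: hf; have := xP 0%N; have := yP 0%N; rewrite /= expr0 !divr1 /w /h !subrKC.
apply/eqP; rewrite -cn_eq0 eq_le cn_ge0 andbT leNgt; apply/negP => Ipos.
pose L := w + h; have L0 : 0 <= L by rewrite addr_ge0.
pose M := 4 * L * L + 1; have M0 : 0 < M by rewrite ltr_wpDl ?mulr_ge0.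
(* Chosen so that the final bound [4^n * (4 * (e L / 2^n) * (L / 2^n)) = 4 e L^2] stays below half
   of the integral that it should dominate. *)
pose e := cn (rint f a b c d) / 2 / M.
have e0 : 0 < e by rewrite !divr_gt0.
have [del del0 hdel] := hl e e0.
have [n hn] := pow2_small L del0.
have Ln : L / 2 ^+ n = w / 2 ^+ n + h / 2 ^+ n by rewrite mulrDl.
have wn := pw w n w0; have hhn := pw h n h0.
set a1 := (s n).1; set c1 := (s n).2.
pose aff := fun u : C => (f (x +i* y) - l * (x +i* y)) + u * l.
have caff : rcont aff a1 (a1 + w / 2 ^+ n) c1 (c1 + h / 2 ^+ n).
  apply: rcontD; first exact: rcont_cst.
  apply: (rcontM (f := id)); last exact: rcont_cst.
  by apply/ccont_rcont/ccont_holo => z; exact: holo_id.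
have cff := @ccont_rcont _ f a1 (a1 + w / 2 ^+ n) c1 (c1 + h / 2 ^+ n) cf.
have IE : I (s n) n = rint (fun z => f z - aff z) a1 (a1 + w / 2 ^+ n) c1 (c1 + h / 2 ^+ n).
  by rewrite rintB// rint_affine subr0.
have Ib : cn (I (s n) n) <= 4 * (e * (L / 2 ^+ n)) * (L / 2 ^+ n).
  rewrite IE; apply: (le_trans (rint_bound (M := e * (L / 2 ^+ n)) _ _ _ _)).
  - exact: rcontD cff (rcontN caff).
  - by rewrite lerDl.
  - by rewrite lerDl.
  - move=> z zx zy _.
    have -> : f z - aff z = f (x +i* y + (z - x +i* y)) - f (x +i* y) - l * (z - x +i* y).
      by rewrite subrKC /aff; ring.
    have zd : cn (z - x +i* y) <= L / 2 ^+ n.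
      rewrite (le_trans (cn_le_ReIm _))// Ln !raddfB/= lerD//.
        by rewrite ler_norml; move: zx (xP n); rewrite -/a1; lra.
      by rewrite ler_norml; move: zy (yP n); rewrite -/c1; lra.
    rewrite (le_trans (hdel _ (le_lt_trans zd hn)))// ler_wpM2l// ltW//.
  - by rewrite !(addrC _ (_ / _)) !addrK -Ln.
have := le_trans (Is n) (ler_wpM2l (exprn_ge0 n (ler0n R 4)) Ib).
have -> : 4 ^+ n * (4 * (e * (L / 2 ^+ n)) * (L / 2 ^+ n)) = e * (4 * L * L).
  have -> : (4 : R) ^+ n = 2 ^+ n * 2 ^+ n by rewrite -exprMn -natrM.
  by field; rewrite expf_neq0.
have : e * M = cn (rint f a b c d) / 2 by rewrite /e mulfVK// gt_eqF.
by rewrite /M mulrDr mulr1; lra.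
Qed.

(** Four cuts isolate a square of half side e around w. There f is bounded by [cn (f w) + 1], so the
    integral over its boundary is O(e), and the four other rectangles contribute 0. *)
Lemma goursat_except f a b c d w : ccont f -> a < complex.Re w < b -> c < complex.Im w < d ->
  (forall z, z != w -> inrect a b c d z -> holo f z) -> rint f a b c d = 0.
Proof.
move=> cf /andP[a1 b1] /andP[c1 d1] hf.
apply/eqP; rewrite -cn_eq0 eq_le cn_ge0 andbT leNgt; apply/negP => Ipos.
have [r r0 hr] := cf w 1 ltr01.
pose M := 4 * (cn (f w) + 1) * 4.
have M0 : 0 < M by rewrite !mulr_gt0// ltr_wpDl ?cn_ge0.
pose x := complex.Re w; pose y := complex.Im w.
pose e := Num.min (Num.min (Num.min (x - a) (b - x)) (Num.min (y - c) (d - y)))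
  (Num.min (r / 4) (cn (rint f a b c d) / (2 * M))).
have e0 : 0 < e by rewrite !lt_min !subr_gt0 a1 b1 c1 d1 !divr_gt0// mulr_gt0.
have : e <= e by []; rewrite {2}/e !le_min => /andP[/andP[/andP[e1 e2] /andP[e3 e4]] /andP[e5 e6]].
have z1 : rint f a (x - e) c d = 0.
  apply: goursat => //; [lra|lra|] => z [zx zy]; apply: hf; last by split => //; lra.
  by apply/eqP => zw; move: zx; rewrite zw -/x; lra.
have z2 : rint f (x + e) b c d = 0.
  apply: goursat => //; [lra|lra|] => z [zx zy]; apply: hf; last by split => //; lra.
  by apply/eqP => zw; move: zx; rewrite zw -/x; lra.
have z3 : rint f (x - e) (x + e) c (y - e) = 0.
  apply: goursat => //; [lra|lra|] => z [zx zy]; apply: hf; last by split; lra.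
  by apply/eqP => zw; move: zy; rewrite zw -/y; lra.
have z4 : rint f (x - e) (x + e) (y + e) d = 0.
  apply: goursat => //; [lra|lra|] => z [zx zy]; apply: hf; last by split; lra.
  by apply/eqP => zw; move: zy; rewrite zw -/y; lra.
have E : rint f a b c d = rint f (x - e) (x + e) (y - e) (y + e).
  rewrite (rint_hcut f a (x - e)) z1 add0r (rint_hcut f _ (x + e) b) z2 addr0.
  by rewrite (rint_vcut f _ _ c (y - e)) z3 add0r (rint_vcut f _ _ _ (y + e) d) z4 addr0.
have := rint_bound (M := cn (f w) + 1) (ccont_rcont (x - e) (x + e) (y - e) (y + e) cf).
rewrite -E => /(_ _ _ _)/wrap[|||]; [lra|lra| |].
  move=> z zx zy _.
  have zd : cn (z - w) < r.
    rewrite (le_lt_trans (cn_le_ReIm _))// !raddfB/= -/x -/y.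
    have : `|complex.Re z - x| <= e by rewrite ler_norml; lra.
    have : `|complex.Im z - y| <= e by rewrite ler_norml; lra.
    lra.
  have := hr _ zd; rewrite subrKC; have := cnBl (f z) (f w); lra.
have -> : 4 * (cn (f w) + 1) * (x + e - (x - e) + (y + e - (y - e))) = M * e by rewrite /M; ring.
have : M * e <= cn (rint f a b c d) / 2.
  rewrite mulrC -ler_pdivlMr//; apply: (le_trans e6).
  by rewrite invfM mulrA.
by lra.
Qed.

End Goursat.

Lemma continuous_at_dist (K : numFieldType) (f : K -> K) z : {for z, continuous f} <->
  forall e, 0 < e -> \forall w \near z, `|f z - f w| < e.
Proof.
by split=> h; [exact: (cvgrPdist_lt _ _).1 h|exact: (cvgrPdist_lt _ _).2 h].
Qed.

(** * Cauchy transforms and Cauchy's formula on a square *)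

Section Cauchy.
Variable R : realType.
Local Notation C := R[i].
Let K : numClosedFieldType := R[i].
Implicit Types (f g u : C -> C) (z w l h : C).

Definition ccont_at f z := forall e : R, 0 < e -> exists2 d : R, 0 < d &
  forall h, cn h < d -> cn (f (z + h) - f z) < e.

Lemma ccont_atP f z : ccont_at f z <-> {for z, continuous (f : K -> K)}.
Proof.
rewrite continuous_at_dist; split=> H e e0.
  have er : e = (complex.Re e)%:C.
    by move: e0; rewrite ltcE => /andP[/eqP]; case: (e) => a b /= ->.
  have [|d d0 hd] := H (complex.Re e); first by move: e0; rewrite ltcE => /andP[].
  apply/nbhscP; exists d => // w hw; rewrite er normcn ltcR cnBC.
  by have := hd _ hw; rewrite subrKC.
have := H e%:C; rewrite ltcR => /(_ e0)/nbhscP[d d0 hd]; exists d => // h hh.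
have := hd (z + h); rewrite addrAC subrr add0r => /(_ hh).
by rewrite normcn ltcR cnBC.
Qed.

Lemma ccont_at_near f g z : (exists2 d : R, 0 < d & forall h, cn h < d -> f (z + h) = g (z + h)) ->
  ccont_at f z -> ccont_at g z.
Proof.
move=> [d d0 fg] hf e e0; have [d' d'0 hd'] := hf e e0.
exists (Num.min d d'); first by rewrite lt_min d0.
move=> h; rewrite lt_min => /andP[h1 h2]; rewrite -fg// -(addr0 z) -fg ?cn0// addr0.
exact: hd'.
Qed.

Lemma Re_inv z : complex.Re z^-1 = complex.Re z / (complex.Re z ^+ 2 + complex.Im z ^+ 2).
Proof. by case: z. Qed.

Lemma Im_inv z : complex.Im z^-1 = - (complex.Im z / (complex.Re z ^+ 2 + complex.Im z ^+ 2)).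
Proof. by case: z. Qed.

Lemma pcont_bounded (F : R -> C) a b : a <= b -> pcont F ->
  exists M : R, forall t, a <= t <= b -> cn (F t) <= M.
Proof.
move=> ab [h1 h2].
pose N t := complex.Re (F t) * complex.Re (F t) + complex.Im (F t) * complex.Im (F t).
have cN : continuous N.
  by move=> t; apply: cvgD; apply: cvgM; [exact: h1..|exact: h2|exact: h2].
have [c _ hc] := EVT_max ab (continuous_subspaceT cN).
exists (N c + 1) => t tab.
have : cn (F t) ^+ 2 <= N c by rewrite sqr_cn !expr2; apply: hc; rewrite in_itv.
by have := sqr_ge0 (cn (F t) - 1); rewrite sqrrB1; nra.
Qed.

(** Used for a lower bound of the integral of 1/z along the boundary. *)
Lemma derive_ge (P p : R -> R) a b m : der P p -> a <= b ->
  (forall t, a <= t <= b -> m <= p t) -> m * (b - a) <= P b - P a.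
Proof.
move=> hP ab hm.
have hd t : a <= t <= b -> hasd (fun t => P t - (m * t + 0)) t (p t - m).
  by move=> _; apply: hasdB => //; exact: hasd_lin.
have := le_of_derive_ge0 hd ab; rewrite !addr0 => H.
suff : P a - m * a <= P b - m * b by lra.
by apply: H => t /hm; rewrite subr_ge0.
Qed.

Variable a : R.
Hypothesis a0 : 0 < a.

Let aa : - a <= a. Proof. by rewrite ge0_cp// ltW. Qed.

Local Notation S f := (rint f (- a) a (- a) a).
Local Notation RC f := (rcont f (- a) a (- a) a).

Lemma rcont_bounded f : RC f -> exists M : R, onrect (fun z => cn (f z) <= M) (- a) a (- a) a.
Proof.
move=> [h1 h2 h3 h4].
have [M1 b1] := pcont_bounded aa h1; have [M2 b2] := pcont_bounded aa h2.
have [M3 b3] := pcont_bounded aa h3; have [M4 b4] := pcont_bounded aa h4.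
exists (Num.max (Num.max M1 M2) (Num.max M3 M4)) => z zx zy; rewrite !le_max.
have Eh (x : R) : complex.Im z = x -> z = 0 +i* x + (complex.Re z)%:C * 1.
  by move=> <-; case: z {zx zy} => u v; apply: eq_complexP => /=; ring.
have Ev (x : R) : complex.Re z = x -> z = x%:C + (complex.Im z)%:C * 'i%C.
  by move=> <-; case: z {zx zy Eh} => u v; apply: eq_complexP => /=; ring.
case=> [/Ev->|[/Ev->|[/Eh->|/Eh->]]]; rewrite ?(b1 _ zx) ?(b3 _ zx) ?(b2 _ zy) ?(b4 _ zy) ?orbT//.
Qed.

Definition interior_pt w := `|complex.Re w| < a /\ `|complex.Im w| < a.

Lemma rcont_inv w : interior_pt w -> RC (fun z => (z - w)^-1).
Proof.
move=> [hr hi].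
have E (p q : C) : (fun t : R => p + t%:C * q - w) = (fun t => (p - w) + t%:C * q).
  by apply/funext => t; ring.
have nz (z : C) : (complex.Re z = - a \/ complex.Re z = a \/ complex.Im z = - a \/ complex.Im z = a) ->
    z - w != 0.
  move=> hz; rewrite subr_eq0; apply/eqP => zw; move: hz; rewrite zw.
  by move: hr hi; rewrite !ltr_norml; lra.
split; apply: pcontV; rewrite ?E; try exact: pcont_lin.
- move=> t; apply: nz; right; right; left => /=; ring.
- by move=> t; apply: nz; right; left => /=; ring.
- by move=> t; apply: nz; right; right; right => /=; ring.
- by move=> t; apply: nz; left => /=; ring.
Qed.

Lemma bdry_far z w : (complex.Re z = - a \/ complex.Re z = a \/ complex.Im z = - a \/ complex.Im z = a) ->
  a - cn w <= cn (z - w).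
Proof.
move=> hz; have : a <= cn z.
  have := Re_le_cn z; have := Im_le_cn z; rewrite !ler_norml.
  by case: hz => [->|[->|[->|->]]]; lra.
by have := cnBl z w; lra.
Qed.

(** The Cauchy transform of u on the boundary of the square of half side [a] centred at 0, without
    the factor 1 / (2 pi i): the transform of the constant 1 takes the place of 2 pi i. *)
Definition ctrans u w := S (fun z => u z * (z - w)^-1).

Lemma interior_small w : cn w < a -> interior_pt w.
Proof. by move=> h; split; [exact: le_lt_trans (Re_le_cn w) h|exact: le_lt_trans (Im_le_cn w) h]. Qed.

(** Differentiation under the integral sign. The remainder is [h^2] times the integral of
    [u / ((z - w)^2 (z - w - h))], and both w and w + h keep a distance of at least a/2 from the
    boundary. *)
Lemma ctrans_holo u w : RC u -> cn w < a / 4 -> holo (ctrans u) w.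
Proof.
move=> cu wa; have [M hM] := rcont_bounded cu.
have ha : a / 4 < a by have := a0; lra.
have iw : interior_pt w by apply: interior_small; have := a0; lra.
have ciw := rcont_inv iw.
apply/holoP; exists (S (fun z => u z * ((z - w)^-1 * (z - w)^-1))) => e e0.
pose M' := `|M| + 1; have M'0 : 0 < M' by rewrite ltr_wpDl.
(* [16 a] is the factor 4 of [rint_bound] times the sum [4 a] of the width and the height; the cube
   bounds the three factors of the denominator. *)
pose D := 16 * a * M' / (a / 2) ^+ 3.
have D0 : 0 < D by rewrite !divr_gt0 ?exprn_gt0 ?mulr_gt0 ?divr_gt0.
exists (Num.min (a / 4) (e / D)).
  by rewrite lt_min; apply/andP; split; apply: divr_gt0; rewrite // a0.
move=> h; rewrite lt_min => /andP[h1 h2].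
have wh : cn (w + h) < a / 2 by have := a0; have := cnD w h; lra.
have iwh : interior_pt (w + h) by apply: interior_small; have := a0; lra.
have ciwh := rcont_inv iwh.
have c1 := rcontM cu ciwh; have c2 := rcontM cu ciw.
have c3 := rcontM cu (rcontM ciw ciw).
have c4 := rcontM (rcont_cst h (- a) a (- a) a) c3.
rewrite /ctrans mulrC -rintZ// -rintB// -rintB//; last first.
  by apply: rcontD; [exact: c1|exact: rcontN].
have c5 : RC (fun z => (h * h) * (u z * ((z - w)^-1 * (z - w)^-1 * (z - (w + h))^-1))).
  by apply: rcontM; [exact: rcont_cst|apply: rcontM => //; apply: rcontM => //; apply: rcontM].
have far z (v : C) : cn v < a / 2 -> (complex.Re z = - a \/ complex.Re z = a \/ complex.Im z = - a \/ complex.Im z = a) ->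
    a / 2 <= cn (z - v) by move=> hv /(@bdry_far z v); lra.
have a20 : 0 < a / 2 by have := a0; lra.
have w2 : cn w < a / 2 by have := a0; lra.
rewrite (eq_rint (g := fun z => (h * h) * (u z * ((z - w)^-1 * (z - w)^-1 * (z - (w + h))^-1))))//.
- apply: (le_trans (rint_bound (M := cn h * (cn h * (M' / (a / 2) ^+ 3))) c5 aa aa _)).
    move=> z zx zy hz; rewrite !cnM -[cn h * cn h * _]mulrA !ler_wpM2l ?cn_ge0//.
    have := far _ _ w2 hz; have := far _ _ wh hz => f1 f2.
    have inv (x : R) : a / 2 <= x -> x^-1 <= (a / 2)^-1.
      by move=> hx; rewrite lef_pV2 ?posrE// (lt_le_trans a20).
    rewrite !cnV; apply: ler_pM; rewrite ?cn_ge0 ?mulr_ge0 ?invr_ge0 ?cn_ge0//.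
      by rewrite (le_trans (hM _ zx zy hz))// (le_trans (ler_norm _))// lerDl.
    have -> : ((a / 2) ^+ 3)^-1 = (a / 2)^-1 * (a / 2)^-1 * (a / 2)^-1.
      by rewrite -exprVn; ring.
    have := inv _ f1; have := inv _ f2; move: (a / 2)^-1 => b i1 i2.
    by apply: ler_pM; rewrite ?mulr_ge0 ?invr_ge0 ?cn_ge0//; apply: ler_pM; rewrite ?invr_ge0 ?cn_ge0.
  rewrite (_ : 4 * _ * _ = (D * cn h) * cn h); last first.
    by rewrite /D; move: ((a / 2) ^+ 3)^-1 => q; ring.
  by rewrite ler_wpM2r ?cn_ge0// mulrC -ler_pdivlMr// ltW.
- by apply: rcontD; [apply: rcontD; [exact: c1|exact: rcontN]|exact: rcontN].
- move=> z zx zy hz; field.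
  have := far _ _ w2 hz; have := far _ _ wh hz => f1 f2.
  by rewrite -!cn_gt0 !(lt_le_trans a20).
Qed.

(** Each side contributes to the imaginary part the integral of [a / (t^2 + a^2)] over [-a, a]. The
    integrand is at least [1 / (2 a)], so each contribution is at least 1; no arctangent is
    evaluated. *)
Lemma ctrans_inv_neq0 : ctrans (fun=> 1) 0 != 0.
Proof.
have i0 : interior_pt 0 by apply: interior_small; rewrite cn0.
have [h1 h2 h3 h4] := rcont_inv i0.
suff : 0 < complex.Im (ctrans (fun=> 1) 0) by apply: contraTneq => ->; rewrite ltxx.
have E : (fun z : C => 1 * (z - 0)^-1) = (fun z => (z - 0)^-1) by apply/funext => z; rewrite mul1r.
rewrite /ctrans E /rint.
have k0 : 0 < (2 * a)^-1 by rewrite invr_gt0 mulr_gt0.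
have k1 (t : R) : - a <= t <= a -> (2 * a)^-1 <= a / (t ^+ 2 + a ^+ 2).
  move=> ta; have t2 : t ^+ 2 <= a ^+ 2 by rewrite -ler_sqrt ?sqr_ge0// !sqrtr_sqr (gtr0_norm a0) ler_norml.
  have p0 : 0 < t ^+ 2 + a ^+ 2 by rewrite ltr_wpDl ?sqr_ge0 ?exprn_gt0.
  rewrite ler_pdivlMr// mulrC ler_pdivrMr ?mulr_gt0//; nra.
have lb (P p : R -> R) (s : R) : der P p -> (forall t, - a <= t <= a -> (2 * a)^-1 <= s * p t) ->
    1 <= s * (P a - P (- a)).
  move=> hP hp; have := @derive_ge (fun t => s * P t) (fun t => s * p t) (- a) a (2 * a)^-1 _ aa hp.
  rewrite (_ : (2 * a)^-1 * (a - - a) = 1); last by field; rewrite gt_eqF.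
  by rewrite mulrBr; apply => t; exact: hasdZ.
set p1 := pint _ _ _; set p2 := pint _ _ _; set p3 := pint _ _ _; set p4 := pint _ _ _.
have b1 : 1 <= 1 * complex.Im p1.
  apply: (lb _ _ _ (der_primitive (proj2 h1))) => t ta; rewrite Im_inv/=.
  by rewrite !(mulr0, mulr1, mul0r, add0r, addr0, subr0, oppr0) mul1r sqrrN -mulNr opprK k1.
have b2 : 1 <= 1 * complex.Re p2.
  apply: (lb _ _ _ (der_primitive (proj1 h2))) => t ta; rewrite Re_inv/=.
  by rewrite !(mulr0, mulr1, mul0r, add0r, addr0, subr0, oppr0) mul1r addrC k1.
have b3 : 1 <= -1 * complex.Im p3.
  apply: (lb _ _ _ (der_primitive (proj2 h3))) => t ta; rewrite Im_inv/=.
  by rewrite !(mulr0, mulr1, mul0r, add0r, addr0, subr0, oppr0) mulN1r opprK k1.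
have b4 : 1 <= -1 * complex.Re p4.
  apply: (lb _ _ _ (der_primitive (proj1 h4))) => t ta; rewrite Re_inv/=.
  by rewrite !(mulr0, mulr1, mul0r, add0r, addr0, subr0, oppr0) mulN1r sqrrN -mulNr opprK addrC k1.
have -> : complex.Im (p1 + 'i%C * p2 - p3 - 'i%C * p4) =
   1 * complex.Im p1 + 1 * complex.Re p2 + -1 * complex.Im p3 + -1 * complex.Re p4.
  by move: p1 p2 p3 p4 {b1 b2 b3 b4} => [? ?] [? ?] [? ?] [? ?] /=; ring.
by lra.
Qed.

(** The difference quotient of f at w, completed by the derivative at w, is continuous and
    holomorphic off w, so its boundary integral vanishes by [goursat_except]. Splitting that
    integral gives the formula. *)
Lemma cauchy f w : ccont f -> interior_pt w -> (forall z, inrect (- a) a (- a) a z -> holo f z) ->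
  f w * ctrans (fun=> 1) w = ctrans f w.
Proof.
move=> cf iw hf.
have winr : inrect (- a) a (- a) a w.
  by case: iw; rewrite !ltr_norml => /andP[/ltW ? /ltW ?] /andP[/ltW ? /ltW ?]; split; apply/andP.
have /holoP[l hl] := hf _ winr.
pose g z := if z == w then l else (f z - f w) * (z - w)^-1.
have cfr := @ccont_rcont _ f (- a) a (- a) a cf.
have ciw := rcont_inv iw.
have nearg z : z != w -> exists2 d : R, 0 < d &
    forall h, cn h < d -> (f (z + h) - f w) * (z + h - w)^-1 = g (z + h).
  move=> zw; exists (cn (z - w)); first by rewrite cn_gt0 subr_eq0.
  move=> h hh; rewrite /g ifF//; apply/eqP => zhw.
  by move: hh; rewrite -zhw (_ : z - (z + h) = - h) ?cnN ?ltxx//; ring.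
have cg : ccont g.
  move=> z; have [->|zw] := eqVneq z w.
    move=> e e0; have e20 : 0 < e / 2 by lra.
    have [d d0 hd] := hl (e / 2) e20.
    exists d => // h hh; rewrite {2}/g eqxx /g.
    have [->|h0] := eqVneq h 0; first by rewrite addr0 eqxx subrr cn0.
    rewrite ifF; last by apply/negbTE; rewrite -subr_eq0 addrAC subrr add0r.
    have := hd h hh; rewrite (addrAC w) subrr add0r.
    have -> : (f (w + h) - f w) / h - l = (f (w + h) - f w - l * h) / h by field.
    rewrite cnM cnV => H; rewrite (@le_lt_trans _ _ (e / 2))//; last by lra.
    by rewrite ler_pdivrMr// cn_gt0.
  apply: (@ccont_at_near (fun z => (f z - f w) * (z - w)^-1) g z (nearg z zw)); apply/ccont_atP.
  have h1 : {for z, continuous ((fun z => f z - f w) : K -> K)}.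
    have hfz : {for z, continuous (f : K -> K)} := (ccont_atP f z).1 (cf z).
    exact: cvgB hfz (cvg_cst _).
  have h2 : {for z, continuous ((fun z => (z - w)^-1) : K -> K)}.
    have hV : holo (fun z => (z - w)^-1) z.
      by apply: holoV; [rewrite subr_eq0|apply: holoB; [exact: holo_id|exact: holo_cst]].
    exact: (ccont_atP _ _).1 (holo_cont hV).
  exact: cvgM h1 h2.
have Sg : S g = 0.
  apply: (@goursat_except _ _ _ _ _ _ w) => //.
  - by case: iw; rewrite ltr_norml.
  - by case: iw => _; rewrite ltr_norml.
  - move=> z zw zr; apply: (@holo_near _ (fun z => (f z - f w) * (z - w)^-1) g z (nearg z zw)).
    apply: holoM; first by apply: holoB; [exact: hf|exact: holo_cst].
    apply: holoV; first by rewrite subr_eq0.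
    by apply: holoB; [exact: holo_id|exact: holo_cst].
apply/eqP; rewrite -subr_eq0 -[_ - _]opprK oppr_eq0 opprB -Sg /ctrans -rintZ; last first.
  exact: rcontM (rcont_cst _ _ _ _ _) ciw.
have c1 := rcontM cfr ciw.
have c2 := rcontM (rcont_cst (f w) (- a) a (- a) a) (rcontM (rcont_cst 1 (- a) a (- a) a) ciw).
rewrite -rintB//; apply/eqP; apply: eq_rint => //.
- by apply: rcontD => //; exact: rcontN.
- exact: ccont_rcont.
- move=> z zx zy hz; rewrite /g ifF; first by ring.
  apply/eqP => zw; move: hz; rewrite zw; case: iw; rewrite !ltr_norml; lra.
Qed.

End Cauchy.

(** * Taylor division and Laurent germs *)

Section Germs.
Variable R : realType.
Local Notation C := R[i].
Let K : numClosedFieldType := R[i].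
Implicit Types (f g l m : C -> C) (z w : C).

Definition holo0 f := near0c (fun z => holo f z).

Definition clampR (b x : R) := Num.max (- b) (Num.min b x).

Lemma clampR_bound (b x : R) : 0 < b -> - b <= clampR b x <= b.
Proof.
move=> b0; rewrite le_max lexx /= ge_max ge_min lexx /= andbT.
by rewrite ge0_cp// ltW.
Qed.

Lemma clampR_id (b x : R) : - b <= x <= b -> clampR b x = x.
Proof.
move=> /andP[h1 h2]; rewrite /clampR (min_idPr _)//; exact/max_idPr.
Qed.

Lemma clampR_lip (b x y : R) : `|clampR b x - clampR b y| <= `|x - y|.
Proof.
have tot (u v w : R) : u - v <= w -> v - u <= w -> `|u - v| <= w by rewrite ler_norml; lra.
have lip (u v : R) : u - v <= `|u - v| /\ v - u <= `|u - v|.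
  by split; [exact: ler_norm|rewrite distrC; exact: ler_norm].
rewrite /clampR; apply: (@le_trans _ _ `|Num.min b x - Num.min b y|); apply: tot.
- case: (leP (- b) (Num.min b x)); case: (leP (- b) (Num.min b y)) => h1 h2;
    have [] := lip (Num.min b x) (Num.min b y); have := normr_ge0 (Num.min b x - Num.min b y); lra.
- case: (leP (- b) (Num.min b x)); case: (leP (- b) (Num.min b y)) => h1 h2;
    have [] := lip (Num.min b x) (Num.min b y); have := normr_ge0 (Num.min b x - Num.min b y); lra.
- by case: (leP b x); case: (leP b y) => h1 h2; have [] := lip x y; have := normr_ge0 (x - y); lra.
- by case: (leP b x); case: (leP b y) => h1 h2; have [] := lip x y; have := normr_ge0 (x - y); lra.
Qed.

(** A germ lives on a disc only, whereas the boundary integrals ask for continuity on the whole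
    plane. Composing f with the retraction of the plane onto a small square provides it without
    changing f near 0. *)
Lemma holo_ext_cont f (d : R) : 0 < d -> (forall z, cn z < d -> holo f z) ->
  exists g, ccont g /\ exists2 a : R, 0 < a &
  forall z, inrect (- a) a (- a) a z -> holo g z /\ g z = f z.
Proof.
move=> d0 hf; pose b := d / 4; have b0 : 0 < b by rewrite divr_gt0.
pose r z : C := clampR b (complex.Re z) +i* clampR b (complex.Im z).
have rsmall z : cn (r z) < d.
  have := clampR_bound (complex.Re z) b0; have := clampR_bound (complex.Im z) b0.
  rewrite -!ler_norml /b => h1 h2.
  have := cn_le_ReIm (r z); rewrite /r /= => h3.
  by apply: (le_lt_trans h3); lra.
exists (fun z => f (r z)); split.
  move=> z e e0; have [d1 d10 h1] := holo_cont (hf _ (rsmall z)) e0.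
  exists (d1 / 2); first by rewrite divr_gt0.
  move=> h hh; have -> : r (z + h) = r z + (r (z + h) - r z) by rewrite subrKC.
  apply: h1; apply: (le_lt_trans (cn_le_ReIm _)); rewrite /r /=.
  have := clampR_lip b (complex.Re (z + h)) (complex.Re z).
  have := clampR_lip b (complex.Im (z + h)) (complex.Im z).
  have -> : complex.Re (z + h) - complex.Re z = complex.Re h.
    by case: z h {hh} => [? ?] [? ?] /=; ring.
  have -> : complex.Im (z + h) - complex.Im z = complex.Im h.
    by case: z h {hh} => [? ?] [? ?] /=; ring.
  by have := Re_le_cn h; have := Im_le_cn h; lra.
exists (b / 2); first by rewrite divr_gt0.
have rid z : - b <= complex.Re z <= b -> - b <= complex.Im z <= b -> r z = z.
  by move=> h1 h2; rewrite /r !clampR_id//; case: z {h1 h2}.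
move=> z [h1 h2]; rewrite rid; [|lra|lra]; split => //.
apply: (@holo_near _ f).
  exists (b / 2) => [|h hh]; first by rewrite divr_gt0.
  have := Re_le_cn h; have := Im_le_cn h; rewrite !ler_norml => i1 i2.
  by rewrite rid//; case: z h h1 h2 hh i1 i2 => [? ?] [? ?] /=; lra.
by apply: hf; rewrite -(rid z) ?rsmall//; lra.
Qed.

Lemma holo_quotient (F G H : C -> C) (a b w : C) : G w != 0 -> a != 0 ->
  holo G w -> holo F w -> holo H w ->
  holo (fun w => (F w * a - b * H w) * (G w * a)^-1) w.
Proof.
move=> G0 a0 hG hF hH; apply: holoM.
  by apply: holoB; apply: holoM => //; exact: holo_cst.
apply: (@holoV _ (fun w => G w * a)); first exact: mulf_neq0.
by apply: holoM => //; exact: holo_cst.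
Qed.

(* The Cauchy transforms satisfy [T u w = T u 0 + w T (u/z) w], so dividing
   [T f = f * T 1] by [T 1] gives the quotient explicitly. *)
Lemma holo0_factor f : holo0 f ->
  exists2 g, holo0 g & near0c (fun z => f z = f 0 + z * g z).
Proof.
move=> [d d0 hf]; have [f' [cf' [a a0 ha]]] := holo_ext_cont d0 hf.
pose T u w := ctrans a u w.
pose u1 z : C := 1 * (z - 0)^-1; pose uf z := f' z * (z - 0)^-1.
have i0 : interior_pt a 0 by apply: interior_small => //; rewrite cn0.
have cinv := rcont_inv i0.
have c1 := rcont_cst 1 (- a) a (- a) a.
have cf := ccont_rcont (- a) a (- a) a cf'.
have cu1 : rcont u1 (- a) a (- a) a by exact: rcontM.
have cuf : rcont uf (- a) a (- a) a by exact: rcontM.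
have T10 : T (fun=> 1) 0 != 0 by exact: ctrans_inv_neq0.
have aa : - a <= a by rewrite ge0_cp// ltW.
have expand u w : rcont u (- a) a (- a) a -> interior_pt a w ->
    T u w = T u 0 + w * T (fun z => u z * (z - 0)^-1) w.
  move=> cu iw; have ciw := rcont_inv iw.
  rewrite /T /ctrans -rintZ; last by apply: rcontM => //; exact: rcontM.
  have cA : rcont (fun z => u z * (z - 0)^-1) (- a) a (- a) a by exact: rcontM.
  have cB : rcont (fun z => w * (u z * (z - 0)^-1 * (z - w)^-1)) (- a) a (- a) a.
    by apply: rcontM; [exact: rcont_cst|exact: rcontM].
  rewrite -rintD//; apply: eq_rint => //; [exact: rcontM|exact: rcontD|].
  move=> z zx zy hz.
  have z0 : z - 0 != 0.
    rewrite subr0; apply/eqP => z0; move: hz; rewrite z0 /=; lra.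
  have zw : z - w != 0.
    rewrite subr_eq0; apply/eqP => zw; move: hz iw; rewrite zw /interior_pt !ltr_norml; lra.
  by rewrite subr0 in z0; rewrite !subr0; field; rewrite ?z0 ?zw.
have Th u : rcont u (- a) a (- a) a -> near0c (fun w => holo (T u) w).
  by move=> cu; exists (a / 4); [rewrite divr_gt0|move=> w; exact: ctrans_holo].
have small : near0c (fun w => interior_pt a w /\ inrect (- a) a (- a) a w).
  exists a => // w wa; have iw := interior_small wa; split => //.
  by case: iw; rewrite !ltr_norml /inrect; lra.
have nz : near0c (fun w => T (fun=> 1) w != 0).
  have [e e0 he] := Th _ c1.
  have := he 0; rewrite cn0 => /(_ e0)/holo_cont/(_ (cn (T (fun=> 1) 0))).
  rewrite cn_gt0 => /(_ T10)[r r0 hr]; exists r => // w /hr; rewrite add0r.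
  by apply: contraTneq => ->; rewrite sub0r cnN ltxx.
exists (fun w => (T uf w * T (fun=> 1) 0 - T f' 0 * T u1 w) * (T (fun=> 1) w * T (fun=> 1) 0)^-1).
  have := near0c_and nz (near0c_and (Th _ c1) (near0c_and (Th _ cuf) (Th _ cu1))).
  apply: near0c_sub => w [n1 [h1 [h2 h3]]].
  exact: (@holo_quotient (T uf) (T (fun=> 1)) (T u1)).
have := near0c_and nz small; apply: near0c_sub => w [n1 [iw ir]].
have in0 : inrect (- a) a (- a) a 0 by rewrite /inrect /= oppr_le0 ltW.
have hin z : inrect (- a) a (- a) a z -> holo f' z by move=> /ha[].
have e1 := cauchy a0 cf' iw hin; have e2 := cauchy a0 cf' i0 hin.
have [_ fw] := ha _ ir; have [_ f0] := ha _ in0.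
rewrite -fw -f0.
have := expand _ _ cf iw; have := expand _ _ c1 iw.
rewrite -[ctrans a f' w]/(T f' w) -[ctrans a f' 0]/(T f' 0) in e1 e2.
rewrite -/u1 -/uf -/(T u1 w) -/(T uf w) => E1 Ef.
apply: (mulIf n1); apply: (mulIf T10).
rewrite -[ctrans a _ w]/(T _ w) in e1; rewrite -[ctrans a _ 0]/(T _ 0) in e2.
have -> : (f' 0 + w * ((T uf w * T (fun=> 1) 0 - T f' 0 * T u1 w) / (T (fun=> 1) w * T (fun=> 1) 0))) *
    T (fun=> 1) w * T (fun=> 1) 0 =
    (f' 0 * T (fun=> 1) 0) * T (fun=> 1) w + (w * T uf w) * T (fun=> 1) 0 - T f' 0 * (w * T u1 w).
  move: (f' 0) (T uf w) (T f' 0) (T u1 w) (T (fun=> 1) w) (T (fun=> 1) 0) n1 T10 => p A q B t1 t0 h1 h0.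
  by field; rewrite ?h0 ?h1.
rewrite e1 e2 Ef; have -> : T (fun=> 1) w = T (fun=> 1) 0 + w * T u1 w by exact: E1.
ring.
Qed.

Lemma holo0_taylor n f : holo0 f ->
  exists (p : {poly C}) (g : C -> C), [/\ (size p <= n)%N, holo0 g &
    near0c (fun z => f z = p.[z] + z ^+ n * g z)].
Proof.
elim: n f => [|n ih] f hf.
  exists 0, f; split => //; first by rewrite size_poly0.
  by exists 1 => // z _; rewrite horner0 add0r expr0 mul1r.
have [g /ih[p [h [sp hh gE]]] fE] := holo0_factor hf.
exists (p * 'X + (f 0)%:P), h; split => //.
  rewrite (leq_trans (size_polyD _ _))// geq_max.
  rewrite (leq_trans (size_polyMleq _ _)) ?size_polyX ?addn2//=.
  by rewrite (leq_trans (size_polyC_leq1 _)).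
apply: near0c_sub (near0c_and fE gE) => z [-> ->].
by rewrite !hornerE exprS; ring.
Qed.

Lemma laurent0P n f : laurent0 (K := K) n f <->
  exists2 g, holo0 g & near0c (fun z => z != 0 -> f z = g z / z ^+ n).
Proof.
split=> -[g hg fE]; exists g; [|exact/near0'P| |exact/near0'P].
  by move/near0cP: hg; apply: near0c_sub => z /holo_derivable.
by apply/near0cP; apply: near0c_sub hg => z /holo_derivable.
Qed.

Lemma holo0_cst (c : C) : holo0 (fun=> c).
Proof. by exists 1 => // z _; exact: holo_cst. Qed.

(** Zeros of the numerator at 0 are divided out one at a time against the powers of z. What remains
    is either holomorphic or has a pole of exact order k. *)
Lemma laurent0_normal n f : laurent0 (K := K) n f -> holomorphic0 (K := K) f \/
  exists k g, [/\ (0 < k <= n)%N, holo0 g, g 0 != 0 & near0c (fun z => z != 0 -> f z = g z / z ^+ k)].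
Proof.
elim: n f => [|n ih] f; first by left.
move=> /laurent0P[g hg fE].
have [g0|g0] := eqVneq (g 0) 0; last by right; exists n.+1, g; split => //; rewrite leqnn.
have [h hh gE] := holo0_factor hg.
have /ih[] : laurent0 (K := K) n f.
- apply/laurent0P; exists h => //; apply: near0c_sub (near0c_and fE gE) => z [+ +] z0.
  move=> /(_ z0)-> ->; rewrite g0 add0r exprS; field.
  by rewrite z0 expf_neq0.
- by left.
- by case=> k [h' [/andP[k0 kn] ? ? ?]]; right; exists k, h'; split => //; rewrite k0 ltnW.
Qed.

(** Riemann's removable singularity theorem. The exponent N + 2 makes [f z * z^(N+2)] of order
    [z^2], so that at 0 it is differentiable with derivative 0. *)
Lemma meromorphic0_bound N (M : R) f : near0c (fun z => z != 0 -> holo f z) ->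
  near0c (fun z => z != 0 -> cn (f z) * cn z ^+ N <= M) -> meromorphic0 (K := K) f.
Proof.
move=> hf hM; exists N.+2; apply/laurent0P; exists (fun z => f z * z ^+ N.+2); last first.
  by exists 1 => // z _ z0; rewrite mulfK// expf_neq0.
have [d d0 hd] := near0c_and hf hM.
exists d => // z zd; have [->|z0] := eqVneq z 0; last first.
  by apply: holoM; [exact: (hd z zd).1|apply: holoX; exact: holo_id].
apply/holoP; exists 0 => e e0.
have M0 : 0 < `|M| + 1 by rewrite ltr_wpDl.
exists (Num.min d (e / (`|M| + 1))); first by rewrite lt_min d0 divr_gt0.
move=> h; rewrite lt_min => /andP[h1 h2].
have [->|h0] := eqVneq h 0; first by rewrite addr0 subrr mul0r subr0 cn0 mulr0.
rewrite add0r mul0r subr0 (expr0n _ N.+2)/= mulr0 subr0 cnM cnX !exprSr.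
rewrite mulrA ler_wpM2r ?cn_ge0// mulrA.
apply: (@le_trans _ _ ((`|M| + 1) * cn h)).
  rewrite ler_wpM2r ?cn_ge0// (le_trans ((hd h h1).2 h0))// (le_trans (ler_norm _))// lerDl//.
by rewrite mulrC -ler_pdivlMr// ltW.
Qed.

End Germs.

(** * Eigenvectors of a matrix of polynomials *)

Section DifferenceQuotient.
Variable K : fieldType.
Implicit Types (g : {poly K}) (mu x : K).

(** The quotient (g(mu) - g(X)) / (mu - X) for g of size at most n. Written out in powers it is
    linear in the coefficients of g and polynomial in mu, so it still makes sense when these
    coefficients are polynomials in a parameter. *)
Definition dquot n g mu : {poly K} :=
  \sum_(k < n) g`_k *: \sum_(i < k) (mu ^+ (k.-1 - i) *: 'X^i).

Lemma dquotE n g mu : (size g <= n)%N -> (mu%:P - 'X) * dquot n g mu = (g.[mu])%:P - g.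
Proof.
move=> sg; have gE : g = \sum_(i < n) g`_i *: 'X^i.
  rewrite -poly_def; apply/polyP => i; rewrite coef_poly; case: ltnP => // ni.
  by rewrite nth_default// (leq_trans sg).
have -> : (g.[mu])%:P - g = \sum_(k < n) (g`_k)%:P * (mu%:P ^+ k - 'X ^+ k).
  rewrite (eq_bigr (fun k : 'I_n => (g`_k * mu ^+ k)%:P - g`_k *: 'X^k)).
    by rewrite sumrB -gE (horner_coef_wide mu sg) rmorph_sum.
  by move=> k _; rewrite -mul_polyC rmorphM rmorphXn/= mulrBr.
rewrite /dquot mulr_sumr; apply: eq_bigr => k _.
rewrite -scalerAr -mul_polyC; congr (_ * _).
rewrite (subrXX mu%:P 'X k); congr (_ * _).
by apply: eq_bigr => i _; rewrite -mul_polyC rmorphXn.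
Qed.

Lemma dquot_diag n g mu : (size g <= n)%N -> (dquot n g mu).[mu] = g^`().[mu].
Proof.
move=> sg; have := congr1 (fun p => (p^`()).[mu]) (dquotE mu sg).
rewrite /= derivM derivB derivC derivX sub0r derivB derivC sub0r !hornerE.
by rewrite subrr mul0r addr0 => /eqP; rewrite mulN1r eqr_opp => /eqP.
Qed.

Lemma dquot_neq n g mu x : (size g <= n)%N -> mu != x -> g.[mu] = 0 -> g.[x] = 0 ->
  (dquot n g mu).[x] = 0.
Proof.
move=> sg mux g0 gx; have := congr1 (fun p => p.[x]) (dquotE mu sg).
rewrite /= !hornerE g0 gx subrr => /eqP; rewrite mulf_eq0 subr_eq0 (negbTE mux)/=.
by move/eqP.
Qed.

(** This coefficient does not depend on mu; it is the reason why the eigenvectors built from the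
    quotient do not vanish at any point over a generic parameter. *)
Lemma dquot_coef r g mu : (dquot r.+2 g mu)`_r = g`_r.+1.
Proof.
rewrite /dquot big_ord_recr/= coefD coefZ coef_sum.
rewrite [X in _ + _ * X](_ : _ = 1); last first.
  rewrite big_ord_recr/= coefD coefZ coefXn eqxx subnn expr0 mulr1 coef_sum big1 ?add0r// => i _.
  by rewrite coefZ coefXn gtn_eqF ?ltn_ord// mulr0.
rewrite mulr1 big1 ?add0r// => k _; rewrite coefZ coef_sum big1 ?mulr0// => i _.
rewrite coefZ coefXn gtn_eqF ?mulr0//.
by rewrite (leq_trans (ltn_ord i)) -1?ltnS.
Qed.

Lemma size_dquot n g mu : (size (dquot n.+1 g mu) <= n)%N.
Proof.
rewrite /dquot (leq_trans (size_sum _ _ _))//; apply/bigmax_leqP => k _.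
rewrite (leq_trans (size_scale_leq _ _))// (leq_trans (size_sum _ _ _))//.
apply/bigmax_leqP => i _; rewrite (leq_trans (size_scale_leq _ _))// size_polyXn.
by rewrite (leq_trans (ltn_ord i))// -ltnS.
Qed.

End DifferenceQuotient.

(** * Diagonalizable matrices with a chosen eigenbasis *)

Section Diagonalized.
Variables (K : fieldType) (n : nat).
Implicit Types (M V : 'M[K]_n.+1) (a : 'rV[K]_n.+1) (g : {poly K}).

Definition diagonalized M V a := V \in unitmx /\ M = invmx V *m diag_mx a *m V.

Lemma diagonalized_horner M V a g : diagonalized M V a ->
  diagonalized (horner_mx M g) V (map_mx (horner g) a).
Proof. by move=> [uV ->]; split => //; rewrite horner_mx_uconjC// horner_mx_diag. Qed.

Lemma diagonalized_det M V a : diagonalized M V a -> \det M = \prod_i a 0 i.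
Proof.
move=> [uV ->]; rewrite !det_mulmx mulrAC -det_mulmx mulVmx// det1 mul1r.
exact: det_diag.
Qed.

Lemma diagonalized_trace M V a : diagonalized M V a -> \tr M = \sum_i a 0 i.
Proof. by move=> [uV ->]; rewrite mxtrace_mulC mulmxA mulmxV// mul1mx mxtrace_diag. Qed.

Lemma diagonalized_eq0 M V a : diagonalized M V a -> (forall i, a 0 i = 0) -> M = 0.
Proof.
move=> [uV ->] a0; have -> : a = 0 by apply/rowP => i; rewrite a0 mxE.
by rewrite linear0 mulmx0 mul0mx.
Qed.

Lemma diagonalized_inj M V a : diagonalized M V a -> M = 0 -> forall i, a 0 i = 0.
Proof.
move=> [uV ME] M0 i; have : diag_mx a = V *m M *m invmx V.
  by rewrite ME !mulmxA mulmxV// mul1mx -mulmxA mulmxV// mulmx1.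
by rewrite M0 mulmx0 mul0mx => /matrixP/(_ i i); rewrite !mxE eqxx.
Qed.

Lemma diagonalized_char M V a : diagonalized M V a ->
  char_poly M = \prod_i ('X - (a 0 i)%:P).
Proof.
move=> [uV ME].
have -> : char_poly M = char_poly (diag_mx a).
  rewrite /char_poly; have -> : char_poly_mx M =
    map_mx polyC (invmx V) *m char_poly_mx (diag_mx a) *m map_mx polyC V.
    have E : map_mx polyC (invmx V) *m 'X%:M *m map_mx polyC V = 'X%:M.
      by rewrite -mulmxA -scalar_mxC mulmxA -map_mxM mulVmx// map_mx1 mul1mx.
    by rewrite /char_poly_mx mulmxBr mulmxBl E ME !map_mxM.
  by rewrite !det_mulmx mulrAC -det_mulmx -map_mxM mulVmx// map_mx1 det1 mul1r.
rewrite char_poly_trig ?diag_mx_is_trig//.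
by apply: eq_bigr => i _; rewrite mxE eqxx mulr1n.
Qed.

Lemma diagonalized_mup M V a mu : diagonalized M V a ->
  mup mu (char_poly M) = #|[pred i | a 0 i == mu]|.
Proof.
move=> /diagonalized_char->.
rewrite (_ : \prod_i _ = \prod_(y <- [seq a 0 i | i <- enum 'I_n.+1]) ('X - y%:P)); last first.
  by rewrite big_map big_enum.
by rewrite mu_prod_XsubC count_map -sum1_count -sum1_card big_enum_cond.
Qed.

Lemma diagonalized_root M V a mu : diagonalized M V a ->
  root (char_poly M) mu = [exists i, a 0 i == mu].
Proof.
move=> /diagonalized_char->; rewrite (_ : \prod_i _ = \prod_(y <- [seq a 0 i | i <- enum 'I_n.+1]) ('X - y%:P)).
  rewrite root_prod_XsubC; apply/mapP/existsP => [[i _ ->]|[i /eqP<-]]; exists i => //.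
  by rewrite mem_enum.
by rewrite big_map big_enum.
Qed.

Lemma row_free_powersP M r : row_free (powers_mx M r) <->
  forall g, (size g <= r)%N -> horner_mx M g = 0 -> g = 0.
Proof.
split=> [free g sg|H].
  rewrite -(poly_rV_K sg) horner_rVpoly => /(congr1 mxvec); rewrite vec_mxK linear0 => E.
  have : poly_rV g = 0 :> 'rV_r by apply: (row_free_inj free); rewrite E mul0mx.
  by move=> ->; rewrite linear0.
apply: inj_row_free => v hv; have : rVpoly v = 0.
  apply: H; first exact: size_poly.
  by rewrite horner_rVpoly hv linear0.
by move=> E; rewrite -[v]rVpolyK E linear0.
Qed.

End Diagonalized.

(** * Properties valid for all but finitely many parameters *)

Section GenericPoint.
Variable K : numClosedFieldType.
Implicit Types (P : K -> Prop) (l : K).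

(** Cofinite truth. A nonzero polynomial gives a generic property, and a polynomial vanishing on an
    [infinitely] property is zero; together they transport facts from an infinite set of parameters
    to all but finitely many. *)
Definition generic P := exists S : seq K, forall l, l \notin S -> P l.
Definition infinitely P := forall S : seq K, exists2 l, l \notin S & P l.

Lemma genericI P Q : generic P -> generic Q -> generic (fun l => P l /\ Q l).
Proof.
move=> [S hS] [T hT]; exists (S ++ T) => l; rewrite mem_cat negb_or => /andP[lS lT].
by split; [exact: hS|exact: hT].
Qed.

Lemma genericS P Q : (forall l, P l -> Q l) -> generic P -> generic Q.
Proof. by move=> PQ [S hS]; exists S => l /hS/PQ. Qed.

Lemma genericT P : (forall l, P l) -> generic P.
Proof. by move=> h; exists [::]. Qed.

Lemma generic_all (I : finType) (P : I -> K -> Prop) : (forall i, generic (P i)) ->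
  generic (fun l => forall i, P i l).
Proof.
move=> h; have [S hS] := choice h; exists (flatten [seq S i | i <- enum I]) => l lS i.
apply: hS; apply: contra lS => lS; apply/flattenP; exists (S i) => //.
by apply/mapP; exists i; rewrite ?mem_enum.
Qed.

Lemma infinitelyI P Q : infinitely P -> generic Q -> infinitely (fun l => P l /\ Q l).
Proof.
move=> hP [S hS] T; have [l] := hP (S ++ T); rewrite mem_cat negb_or => /andP[lS lT] Pl.
by exists l => //; split => //; exact: hS.
Qed.

Lemma infinitely_ex P : infinitely P -> exists l, P l.
Proof. by move=> /(_ [::])[l _ Pl]; exists l. Qed.

Lemma generic_neq0 (g : {poly K}) : g != 0 -> generic (fun l => g.[l] != 0).
Proof.
move=> g0; have [r gE] := closed_field_poly_normal g.
exists r => l; apply: contra => gl; rewrite -root_prod_XsubC.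
by move: gl; rewrite gE hornerZ mulf_eq0 lead_coef_eq0 (negbTE g0).
Qed.

Lemma infinitely_poly0 P (g : {poly K}) : infinitely P -> (forall l, P l -> g.[l] = 0) -> g = 0.
Proof.
move=> iP gP; apply/eqP; apply: contraT => /generic_neq0/(infinitelyI iP)/infinitely_ex[l [Pl]].
by rewrite gP ?eqxx.
Qed.

Definition evm a b l (B : 'M[{poly K}]_(a, b)) := map_mx (horner_eval l) B.

Lemma evmC a b l (B : 'M[K]_(a, b)) : evm l (map_mx polyC B) = B.
Proof. by apply/matrixP => i j; rewrite !mxE /horner_eval hornerC. Qed.

Lemma evm_det a l (B : 'M[{poly K}]_a) : (\det B).[l] = \det (evm l B).
Proof. by rewrite -[LHS]/(horner_eval l _) -det_map_mx. Qed.

Lemma evmM a b c l (B : 'M[{poly K}]_(a, b)) (B' : 'M[{poly K}]_(b, c)) :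
  evm l (B *m B') = evm l B *m evm l B'.
Proof. exact: map_mxM. Qed.

(** If V is a right inverse at [l0], then det (B V) is a polynomial in l equal to 1 at [l0]. *)
Lemma generic_row_free a b (B : 'M[{poly K}]_(a, b)) l0 : row_free (evm l0 B) ->
  generic (fun l => row_free (evm l B)).
Proof.
move=> /row_freeP[V BV]; pose g := \det (B *m map_mx polyC V).
have : g != 0.
  have : g.[l0] != 0 by rewrite evm_det evmM evmC BV det1 oner_neq0.
  by apply: contraNneq => ->; rewrite horner0.
move/generic_neq0; apply: genericS => l; rewrite evm_det evmM evmC => d0.
have u : evm l B *m V \in unitmx by rewrite unitmxE unitfE.
by apply/row_freeP; exists (V *m invmx (evm l B *m V)); rewrite mulmxA mulmxV.
Qed.

End GenericPoint.

(** * Polynomial eigenvectors of a polynomial family of matrices *)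

Section SpectralDecomposition.
Variables (K : numClosedFieldType) (n : nat).
Variable A : 'M[{poly K}]_n.+1.
Local Notation N := n.+1.
Local Notation A_ l := (evm l A).

Definition evp l (p : {poly {poly K}}) : {poly K} := map_poly (horner_eval l) p.

Lemma evp_horner l mu (p : {poly {poly K}}) : (evp l p).[mu] = p.[mu%:P].[l].
Proof. by rewrite /evp -[mu in LHS](hornerC mu l) -[_.[l] in LHS]/(horner_eval l _) horner_map. Qed.

Lemma evm_horner_mx l (p : {poly {poly K}}) : evm l (horner_mx A p) = horner_mx (A_ l) (evp l p).
Proof. exact: map_horner_mx. Qed.

Lemma evm_powers l r : evm l (powers_mx A r) = powers_mx (A_ l) r.
Proof. exact: map_powers_mx. Qed.

(** p plays the part of the minimal polynomial of A over the fractions in l, with denominators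
    cleared. Its degree r + 1 is the largest number of powers 1, A, A^2, ... that are independent at
    some point of D. *)
Lemma ex_annihilator (D : K -> Prop) : infinitely D ->
  exists r (p : {poly {poly K}}), [/\ size p = r.+2, horner_mx A p = 0 &
    generic (fun l => row_free (powers_mx (A_ l) r.+1))].
Proof.
move=> iD.
pose P r := `[< exists2 l, D l & row_free (powers_mx (A_ l) r) >].
have P1 : exists r, P r.
  have [l Dl] := infinitely_ex iD; exists 1%N; apply/asboolP; exists l => //.
  apply/row_free_powersP => g sg; rewrite (size1_polyC sg) horner_mx_C => /matrixP/(_ ord0 ord0).
  by rewrite !mxE eqxx mulr1n => ->; rewrite polyC0.
have Pb r : P r -> (r <= N * N)%N.
  by move=> /asboolP[l _ /eqP<-]; exact: rank_leq_col.
have [r Pr rmax] := ex_maxnP P1 Pb.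
have : (0 < r)%N.
  apply: rmax; case: P1 => k _; have [l Dl] := infinitely_ex iD; apply/asboolP; exists l => //.
  apply/row_free_powersP => g sg; rewrite (size1_polyC sg) horner_mx_C => /matrixP/(_ ord0 ord0).
  by rewrite !mxE eqxx mulr1n => ->; rewrite polyC0.
case: r Pr rmax => // r Pr rmax _.
have [l1 _ free1] := asboolP _ Pr.
have NP l : D l -> ~ row_free (powers_mx (A_ l) r.+2).
  by move=> Dl h; have /rmax : P r.+2 by [apply/asboolP; exists l]; rewrite ltnn.
have [V BV] := row_freeP free1.
(* W is a square matrix, invertible at [l1]. Multiplying by its adjugate is Cramer's rule: it
   expresses det W times the next power of A by the lower ones with polynomial coefficients. *)
pose B := powers_mx A r.+1; pose W := B *m map_mx polyC V.
pose d := \det W; pose b := mxvec (A ^+ r.+1).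
pose u := b *m map_mx polyC V *m \adj W.
have d1 : d.[l1] != 0 by rewrite evm_det evmM evmC evm_powers BV det1 oner_neq0.
have d0 : d != 0 by apply: contraNneq d1 => ->; rewrite horner0.
have E : d *: b = u *m B.
  apply/rowP => k; apply/eqP; rewrite -subr_eq0; apply/eqP.
  apply: (infinitely_poly0 (infinitelyI iD (generic_neq0 d0))) => l [Dl dl].
  have Wl : evm l W = powers_mx (A_ l) r.+1 *m V by rewrite evmM evmC evm_powers.
  have Wu : evm l W \in unitmx by rewrite unitmxE unitfE -evm_det.
  have freel : row_free (powers_mx (A_ l) r.+1).
    by apply/row_freeP; exists (V *m invmx (evm l W)); rewrite mulmxA -Wl mulmxV.
  have [x xE] : exists x : 'rV_r.+1, evm l b = x *m powers_mx (A_ l) r.+1.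
    have : ~~ row_free (powers_mx (A_ l) r.+2) by apply/negP; exact: NP.
    move=> nf; have : exists2 g : {poly K}, (size g <= r.+2)%N & horner_mx (A_ l) g = 0 /\ g != 0.
      apply: contrapT => H; case/negP: nf; apply/row_free_powersP => g sg gA.
      by apply: contrapT => /eqP g0; apply: H; exists g.
    move=> [g sg [gA g0]].
    (* Without this coefficient g would be a relation among the first r + 1 powers, which are
       independent at l. *)
    have gr : g`_r.+1 != 0.
      apply: contra g0 => /eqP gr; apply/eqP; move/row_free_powersP : freel; apply => //.
      apply/leq_sizeP => j; rewrite leq_eqVlt => /predU1P[<-//|rj].
      by rewrite nth_default// (leq_trans sg).
    have bl : evm l b = mxvec (A_ l ^+ r.+1).
      by rewrite /evm map_mxvec; congr mxvec; rewrite rmorphXn.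
    exists (- (g`_r.+1)^-1 *: \row_(k < r.+1) g`_k).
    apply: (can_inj vec_mxK); rewrite bl mxvecK -scalemxAl linearZ/= -horner_rVpoly.
    have -> : rVpoly (\row_(k < r.+1) g`_k) = g - g`_r.+1 *: 'X^(r.+1).
      apply/polyP => i; rewrite coef_rVpoly coefB coefZ coefXn.
      case: insubP => [j|] /=; rewrite ?ltnS.
        by move=> ir ij; rewrite mxE ij ltn_eqF ?ltnS// mulr0 subr0.
      rewrite -ltnNge leq_eqVlt => /predU1P[<-|ri]; first by rewrite eqxx mulr1 subrr.
      by rewrite gtn_eqF// mulr0 subr0 nth_default// (leq_trans sg).
    rewrite rmorphB/= gA sub0r linearZ/= rmorphXn/= horner_mx_X scalerN scaleNr opprK.
    by rewrite scalerA mulVf// scale1r.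
  have : evm l (d *: b) = evm l (u *m B).
    rewrite /evm map_mxZ -/(evm l b) -/(evm l (u *m B)) evmM evmM evmM evmC xE evm_powers.
    rewrite -(mulmxA x) -Wl -(mulmxA x) /evm map_mx_adj -/(evm l W) mul_mx_adj -evm_det.
    by rewrite -scalemx1 -scalemxAr mulmx1 scalemxAl.
  move/rowP/(_ k); rewrite [LHS]mxE [RHS]mxE /horner_eval => h.
  by rewrite hornerD hornerN h subrr.
exists r, (d *: 'X^(r.+1) - rVpoly u); split.
- rewrite size_polyDl ?size_polyN; first by rewrite size_scale// size_polyXn.
  by rewrite size_scale// size_polyXn ltnS size_poly.
- rewrite rmorphB/= linearZ/= rmorphXn/= horner_mx_X horner_rVpoly -/B -E linearZ/= mxvecK.
  by rewrite subrr.
- have := @generic_row_free _ _ _ (powers_mx A r.+1) l1; rewrite evm_powers => /(_ free1).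
  by apply: genericS => l; rewrite evm_powers.
Qed.

(** The polynomial det p'(A(l)) in l is nonzero at [l0], hence generically. Where it is nonzero, p'
    does not vanish at the eigenvalues, so the minimal polynomial, which divides p, has simple
    roots. *)
Lemma generic_diagonalized (p : {poly {poly K}}) l0 V0 a0 : horner_mx A p = 0 ->
  diagonalized (A_ l0) V0 a0 -> (forall i, (evp l0 p)^`().[a0 0 i] != 0) ->
  generic (fun l => exists V a, diagonalized (A_ l) V a /\ forall i, (evp l p)^`().[a 0 i] != 0).
Proof.
move=> pA dg0 p'0.
pose g := \det (horner_mx A p^`()).
have gE l : g.[l] = \det (horner_mx (A_ l) (evp l p)^`()).
  by rewrite evm_det evm_horner_mx /evp deriv_map.
have : g != 0.
  have : g.[l0] != 0.
    rewrite gE (diagonalized_det (diagonalized_horner _ dg0)).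
    by apply/prodf_neq0 => i _; rewrite mxE.
  by apply: contraNneq => ->; rewrite horner0.
move/generic_neq0; apply: genericS => l; rewrite gE => gl.
set q := evp l p in gl *.
have qA : horner_mx (A_ l) q = 0 by rewrite -evm_horner_mx pA /evm map_mx0.
have root_ok x : root (mxminpoly (A_ l)) x -> q^`().[x] != 0.
  rewrite -eigenvalue_root_min => /eigenvalueP[v vA v0]; apply: contra gl => /eqP qx.
  apply/det0P; exists v => //.
  suff -> : v *m horner_mx (A_ l) q^`() = q^`().[x] *: v by rewrite qx scale0r.
  elim/poly_ind: (deriv q) => [|h c IH]; first by rewrite rmorph0 mulmx0 horner0 scale0r.
  rewrite rmorphD rmorphM/= horner_mx_X horner_mx_C mulmxDr mulmxA IH -scalemxAl vA.
  by rewrite scalerA mul_mx_scalar -scalerDl !hornerE.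
have [rs rsE] := closed_field_poly_normal (mxminpoly (A_ l)).
rewrite (monicP (mxminpoly_monic _)) scale1r in rsE.
(* A double root of the minimal polynomial would be a double root of q, so q' would vanish at an
   eigenvalue, against [root_ok]. *)
have urs : uniq rs.
  apply: contraT => /uniqPn-/(_ 0)[i [j [ij jr ijE]]].
  have xrs : rs`_i \in rs by rewrite mem_nth// (ltn_trans ij).
  have : root (mxminpoly (A_ l)) rs`_i by rewrite rsE root_prod_XsubC.
  move/root_ok; set x := rs`_i in ijE xrs *.
  have cnt : (2 <= mup x (mxminpoly (A_ l)))%N.
    rewrite rsE mu_prod_XsubC.
    rewrite -(cat_take_drop j rs) count_cat.
    rewrite -addn1 leq_add// -has_count; apply/hasP; exists x => //=.
      by rewrite /x -(nth_take 0 ij) mem_nth// size_take jr.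
    by rewrite ijE -[j in rs`_j]addn0 -nth_drop mem_nth// size_drop subn_gt0.
  rewrite mup_geq in cnt; last by rewrite monic_neq0// mxminpoly_monic.
  have : ('X - x%:P) ^+ 2 %| q by apply: dvdp_trans cnt _; exact: mxminpoly_min.
  move=> /dvdpP[h ->]; rewrite expr2 !derivM derivXsubC !hornerE/= subrr.
  by rewrite !(mulr0, mul0r, addr0, add0r) subrr mulr0 eqxx.
have [_] := diagonalizableP (A_ l); case; first by exists rs => //; rewrite rsE.
move=> W uW /(similar_diagLR uW)[a aE]; exists W, a.
have dg : diagonalized (A_ l) W a by split => //; rewrite aE conjVmx.
split => // i; have := diagonalized_det (diagonalized_horner q^`() dg).
by move: gl => /[swap] -> /prodf_neq0/(_ i isT); rewrite mxE.
Qed.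

Definition ev2 l mu (f : {poly {poly K}}) : K := f.[mu%:P].[l].

Definition ev2m a b l mu (B : 'M[{poly {poly K}}]_(a, b)) : 'M[K]_(a, b) := map_mx (ev2 l mu) B.

(* The quotient (p(T) - p(mu)) / (T - mu) evaluated at T = A: its columns are
   eigenvectors of A for mu whenever p(A) = 0 and p(mu) = 0. *)
Definition spectral_mx r (p : {poly {poly K}}) : 'M[{poly {poly K}}]_N :=
  \sum_(k < r) \sum_(i < k) ((p`_k)%:P * 'X^(k.-1 - i)) *: map_mx polyC (A ^+ i).

Lemma ev2_sum l mu (I : Type) (s : seq I) (P : pred I) (F : I -> {poly {poly K}}) :
  ev2 l mu (\sum_(i <- s | P i) F i) = \sum_(i <- s | P i) ev2 l mu (F i).
Proof. by rewrite /ev2 horner_sum horner_sum. Qed.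

Lemma ev2m_spectral l mu r p : ev2m l mu (spectral_mx r p) = horner_mx (A_ l) (dquot r (evp l p) mu).
Proof.
have -> : horner_mx (A_ l) (dquot r (evp l p) mu) =
    \sum_(k < r) \sum_(i < k) ((evp l p)`_k * mu ^+ (k.-1 - i)) *: A_ l ^+ i.
  rewrite /dquot rmorph_sum/=; apply: eq_bigr => k _; rewrite linearZ/= rmorph_sum/= scaler_sumr.
  by apply: eq_bigr => i _; rewrite linearZ/= rmorphXn/= horner_mx_X scalerA.
rewrite /spectral_mx; apply/matrixP => x y; rewrite mxE !summxE ev2_sum.
apply: eq_bigr => k _; rewrite !summxE ev2_sum; apply: eq_bigr => i _.
have -> : A_ l ^+ i = evm l (A ^+ i) by rewrite /evm rmorphXn.
by rewrite !mxE /ev2 !hornerE /evp coef_map.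
Qed.

Lemma annihilator_root l mu (p : {poly {poly K}}) : horner_mx A p = 0 ->
  root (char_poly (A_ l)) mu -> (evp l p).[mu] = 0.
Proof.
move=> pA; rewrite -eigenvalue_root_char => /eigenvalueP[v vA v0].
have := congr1 (fun M => v *m evm l M) pA; rewrite /= evm_horner_mx /evm map_mx0 mulmx0.
have -> : v *m horner_mx (A_ l) (evp l p) = (evp l p).[mu] *: v.
  elim/poly_ind: (evp l p) => [|h c IH]; first by rewrite rmorph0 mulmx0 horner0 scale0r.
  rewrite rmorphD rmorphM/= horner_mx_X horner_mx_C mulmxDr mulmxA IH -scalemxAl vA.
  by rewrite scalerA mul_mx_scalar -scalerDl !hornerE.
by move/eqP; rewrite scaler_eq0 (negbTE v0) orbF => /eqP.
Qed.

Lemma spectral_mx_eigen l mu r (p : {poly {poly K}}) : horner_mx A p = 0 -> (size p <= r)%N ->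
  root (char_poly (A_ l)) mu ->
  A_ l *m ev2m l mu (spectral_mx r p) = mu *: ev2m l mu (spectral_mx r p).
Proof.
move=> pA sp rmu; rewrite ev2m_spectral.
have sp' : (size (evp l p) <= r)%N by rewrite (leq_trans (size_poly _ _)).
have := congr1 (horner_mx (A_ l)) (dquotE mu sp').
rewrite (annihilator_root pA rmu) polyC0 sub0r rmorphN/= -evm_horner_mx pA /evm map_mx0 oppr0.
rewrite rmorphM rmorphB/= horner_mx_X horner_mx_C -[_ * _]/(_ *m _) mulmxBl mul_scalar_mx.
by move/eqP; rewrite subr_eq0 => /eqP.
Qed.

(** If an eigenvalue x were a double root of q, then q / (X - x) would still vanish at all
    eigenvalues and so kill the diagonalizable matrix A(l), with a degree too small for the
    independence of its powers. *)
Lemma simple_annihilator l r V a (p : {poly {poly K}}) : horner_mx A p = 0 -> size p = r.+2 ->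
  (lead_coef p).[l] != 0 -> row_free (powers_mx (A_ l) r.+1) -> diagonalized (A_ l) V a ->
  forall i, (evp l p)^`().[a 0 i] != 0.
Proof.
move=> pA sp ld /row_free_powersP free dg i; set q := evp l p; set x := a 0 i.
have sq : size q = r.+2.
  apply/eqP; rewrite eqn_leq -{1}sp size_poly ltnNge; apply/negP => /leq_sizeP/(_ r.+1 (leqnn _)).
  by rewrite coef_map/= => h; move: ld; rewrite /lead_coef sp/= -[_.[l]]/(horner_eval l _) h eqxx.
have qa j : q.[a 0 j] = 0.
  have := diagonalized_inj (diagonalized_horner q dg) _ j; rewrite mxE; apply.
  by rewrite -evm_horner_mx pA /evm map_mx0.
have /factor_theorem[k kE] : root q x by apply/eqP; exact: qa.
apply/eqP; rewrite kE derivM derivXsubC !hornerE subrr mulr0 add0r => kx.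
have : k = 0.
  apply: free.
    by have := size_polyMleq k ('X - x%:P); move: sq; rewrite kE; have [->|k0] := eqVneq k 0;
      [rewrite size_poly0|rewrite size_Mmonic ?monicXsubC// size_XsubC addn2 => -[->]].
  apply: diagonalized_eq0 (diagonalized_horner k dg) _ => j; rewrite mxE.
  have [->//|ajx] := eqVneq (a 0 j) x.
  have := qa j; rewrite kE !hornerE => /eqP; rewrite mulf_eq0 subr_eq0 (negbTE ajx) orbF.
  by move/eqP.
by move=> k0; move: sq; rewrite kE k0 mul0r size_poly0.
Qed.

Lemma horner_mx_mulc (M : 'M[K]_N) (h : {poly K}) r (c : 'cV[K]_N) : (size h <= r)%N ->
  horner_mx M h *m c = \sum_(k < r) h`_k *: (M ^+ k *m c).
Proof.
move=> sh; have hE : h = \sum_(i < r) h`_i *: 'X^i.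
  rewrite -poly_def; apply/polyP => i; rewrite coef_poly; case: ltnP => // ni.
  by rewrite nth_default// (leq_trans sh).
rewrite {1}hE rmorph_sum/= mulmx_suml; apply: eq_bigr => k _.
by rewrite linearZ/= rmorphXn/= horner_mx_X scalemxAl.
Qed.

Definition multiplicity (a : 'rV[K]_N) i := #|[pred j | a 0 j == a 0 i]|.

(** At an eigenvalue the spectral matrix is p'(mu) times the projection on the eigenspace. Its trace
    therefore encodes the multiplicity in a polynomial of (l, mu), which is how multiplicities can
    be compared at different l. *)
Lemma trace_spectral_mx l r V a (p : {poly {poly K}}) : horner_mx A p = 0 -> (size p <= r)%N ->
  diagonalized (A_ l) V a -> forall i, (evp l (\tr (spectral_mx r p))).[a 0 i] =
    (evp l p)^`().[a 0 i] * (multiplicity a i)%:R.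
Proof.
move=> pA sp dg i; set mu := a 0 i.
have sp' : (size (evp l p) <= r)%N by rewrite (leq_trans (size_poly _ _)).
have qa j : (evp l p).[a 0 j] = 0.
  have := diagonalized_inj (diagonalized_horner (evp l p) dg) _ j; rewrite mxE; apply.
  by rewrite -evm_horner_mx pA /evm map_mx0.
rewrite evp_horner -[_.[_].[_]]/(ev2 l mu _) /mxtrace ev2_sum.
rewrite (_ : \sum_i _ = \tr (ev2m l mu (spectral_mx r p))); last first.
  by apply: eq_bigr => j _; rewrite mxE.
rewrite ev2m_spectral (diagonalized_trace (diagonalized_horner _ dg)).
rewrite (bigID [pred j | a 0 j == mu])/= [X in _ + X]big1 ?addr0; last first.
  by move=> j jmu; rewrite mxE (dquot_neq sp' _ (qa i) (qa j))// eq_sym.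
rewrite (eq_bigr (fun=> (evp l p)^`().[mu])); last first.
  by move=> j /eqP jmu; rewrite mxE jmu dquot_diag.
by rewrite sumr_const mulr_natr.
Qed.


(** Lagrange interpolation of h at the distinct eigenvalues, evaluated at a diagonalizable
    matrix. *)
Lemma spectral_resolution (M V : 'M[K]_N) a k (g h : {poly K}) : diagonalized M V a ->
  (size g <= k)%N -> (forall i, g.[a 0 i] = 0) -> (forall i, g^`().[a 0 i] != 0) ->
  horner_mx M h = \sum_(mu <- undup [seq a 0 i | i <- enum 'I_N])
    (h.[mu] / g^`().[mu]) *: horner_mx M (dquot k g mu).
Proof.
move=> dg sg ga g'a; apply/eqP; rewrite -subr_eq0; apply/eqP.
set rs := undup _.
pose f := h - \sum_(mu <- rs) (h.[mu] / g^`().[mu]) *: dquot k g mu.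
have -> : horner_mx M h - \sum_(mu <- rs) (h.[mu] / g^`().[mu]) *: horner_mx M (dquot k g mu)
    = horner_mx M f.
  rewrite rmorphB rmorph_sum/=; congr (_ - _).
  by apply: eq_bigr => mu _; rewrite linearZ.
apply: diagonalized_eq0 (diagonalized_horner f dg) _ => i; rewrite mxE.
have irs : a 0 i \in rs by rewrite mem_undup map_f// mem_enum.
rewrite /f hornerD hornerN horner_sum (bigD1_seq (a 0 i))//= ?undup_uniq// big1_seq.
  by rewrite hornerZ dquot_diag// divfK// addr0 subrr.
move=> mu /andP[mui]; rewrite mem_undup => /mapP[j _ muj].
by rewrite hornerZ (dquot_neq sg mui) ?mulr0// muj.
Qed.

(** The block Krylov matrix of the starting vectors c 0, ..., c (m-1): quotient and remainder by N
    of the column index give the vector and the power of A. *)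
Definition krylov m (c : nat -> 'cV[K]_N) : 'M[{poly K}]_(N, m * N) :=
  \matrix_(x, e) (A ^+ (e %% N) *m map_mx polyC (c (e %/ N)%N)) x 0.

Lemma evm_krylov_col l k (c : 'cV[K]_N) x :
  ((A ^+ k *m map_mx polyC c) x 0).[l] = ((A_ l) ^+ k *m c) x 0.
Proof.
have -> : A_ l ^+ k = evm l (A ^+ k) by rewrite /evm rmorphXn.
by rewrite -[in RHS](evmC l c) -evmM [RHS]mxE.
Qed.

Lemma krylov_span l m c y : row_free (evm l (krylov m c)) ->
  exists h : 'I_m -> {poly K}, y = \sum_j horner_mx (A_ l) (h j) *m c j.
Proof.
move=> /row_freeP[W BW]; pose z := W *m y.
have qm (e : 'I_(m * N)) : (e %/ N < m)%N by rewrite ltn_divLR.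
exists (fun j => \sum_(e < m * N | Ordinal (qm e) == j) z e 0 *: 'X^(e %% N)).
rewrite -[LHS]mul1mx -BW -mulmxA -/z.
transitivity (\sum_e z e 0 *: (A_ l ^+ (e %% N) *m c (e %/ N)%N)).
  apply/colP => x; rewrite mxE summxE; apply: eq_bigr => e _.
  by rewrite [evm _ _ _ _]mxE mxE [_ l _]evm_krylov_col [RHS]mxE mulrC.
rewrite (partition_big (fun e => Ordinal (qm e)) xpredT)//=; apply: eq_bigr => j _.
rewrite rmorph_sum/= mulmx_suml; apply: eq_bigr => e /eqP <-.
by rewrite linearZ/= rmorphXn/= horner_mx_X scalemxAl.
Qed.

(** In the eigenbasis the coordinates are j-th powers of the distinct nonzero numbers 1, ..., N.
    Distinctness makes the first m vectors span, by projection, every eigenspace of dimension at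
    most m; since the coordinates are nonzero, each single vector has a component in every
    eigenspace. *)
Definition vandermonde_col (V : 'M[K]_N) (j : nat) : 'cV[K]_N :=
  invmx V *m \col_i (i.+1)%:R ^+ j.

Lemma vandermonde_horner l V a (g : {poly K}) j : diagonalized (A_ l) V a ->
  V *m (horner_mx (A_ l) g *m vandermonde_col V j) = \col_i (g.[a 0 i] * (i.+1)%:R ^+ j).
Proof.
move=> dg; have [uV ->] := diagonalized_horner g dg.
rewrite /vandermonde_col !mulmxA mulmxV// mul1mx -(mulmxA _ V) mulmxV// mulmx1.
by apply/colP => i; rewrite mul_diag_mx !mxE.
Qed.

(** For a row w in the left kernel, with w' its coordinates in the eigenbasis, the sum of w'_i
    h(a_i) g(i+1) vanishes for all polynomials h of size at most N and g of size at most m. Suitable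
    h and g isolate one coordinate. *)
Lemma krylov_free l m V (a : 'rV[K]_N) : diagonalized (A_ l) V a ->
  (forall i, (multiplicity a i) <= m)%N ->
  row_free (evm l (krylov m (vandermonde_col V))).
Proof.
move=> dg am; apply: inj_row_free => w wB.
have [uV _] := dg; pose w' := w *m invmx V.
have E e j : (e < N)%N -> (j < m)%N -> \sum_i w' 0 i * (a 0 i ^+ e * (i.+1)%:R ^+ j) = 0.
  move=> eN jm; have eP : (j * N + e < m * N)%N.
    by rewrite (@leq_trans (j.+1 * N)%N)// ?leq_mul2r ?jm ?orbT// mulSn addnC ltn_add2r.
  have := congr1 (fun M : 'rV_(m * N) => M 0 (Ordinal eP)) wB; rewrite /= [LHS]mxE [RHS]mxE => ZE; rewrite -[RHS]ZE.
  have := vandermonde_horner 'X^e j dg; rewrite rmorphXn/= horner_mx_X => H.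
  transitivity ((w' *m \col_i (a 0 i ^+ e * (i.+1)%:R ^+ j)) 0 0).
    by rewrite [RHS]mxE; apply: eq_bigr => i _; congr (_ * _); rewrite mxE.
  have -> : \col_i (a 0 i ^+ e * (i.+1)%:R ^+ j) = \col_i (('X^e).[a 0 i] * (i.+1)%:R ^+ j).
    by apply/colP => i; rewrite !mxE hornerXn.
  rewrite -H /w' !mulmxA -(mulmxA w) mulVmx// mulmx1 -!mulmxA mxE; apply: eq_bigr => x _.
  rewrite [evm _ _ _ _]mxE [krylov _ _ _ _]mxE [horner_eval _ _]evm_krylov_col.
  by rewrite /= divnMDl// divn_small// addn0 modnMDl modn_small.
suff w'0 : w' = 0 by rewrite -[w]mulmx1 -(mulVmx uV) mulmxA -/w' w'0 mul0mx.
apply/rowP => i0; rewrite [RHS]mxE.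
(* h kills the indices of the other eigenvalues and g the other indices of the same eigenvalue. The
   size of g is the multiplicity, which is where the bound by m enters. *)
pose h := \prod_(i | a 0 i != a 0 i0) ('X - (a 0 i)%:P).
pose g : {poly K} := \prod_(i | (a 0 i == a 0 i0) && (i != i0)) ('X - (i.+1)%:R%:P).
have sh : (size h <= N)%N.
  rewrite /h -big_filter size_prod_XsubC size_filter -sum1_count sum1_card -[X in (_ < X)%N]card_ord.
  rewrite -(cardC [pred i | a 0 i != a 0 i0]) -[X in (X < _)%N]addn0 ltn_add2l.
  by apply/card_gt0P; exists i0; rewrite !inE eqxx.
have sg : (size g <= m)%N.
  rewrite /g -big_filter size_prod_XsubC size_filter -sum1_count sum1_card (leq_trans _ (am i0))// /multiplicity.
  rewrite -[X in (X < _)%N]/#|[pred j | (a 0 j == a 0 i0) && (j != i0)]|.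
  apply/proper_card/properP; split; last by exists i0; rewrite !inE !eqxx.
  by apply/fintype.subsetP => i; rewrite !inE => /andP[].
have : \sum_(e < N) \sum_(j < m) h`_e * g`_j * \sum_i w' 0 i * (a 0 i ^+ e * (i.+1)%:R ^+ j) = 0.
  by rewrite big1// => e _; rewrite big1// => j _; rewrite E ?mulr0.
have -> : \sum_(e < N) \sum_(j < m) h`_e * g`_j * \sum_i w' 0 i * (a 0 i ^+ e * (i.+1)%:R ^+ j)
    = \sum_i w' 0 i * (h.[a 0 i] * g.[(i.+1)%:R]).
  transitivity (\sum_(e < N) \sum_i \sum_(j < m)
     h`_e * g`_j * (w' 0 i * (a 0 i ^+ e * (i.+1)%:R ^+ j))).
    apply: eq_bigr => e _; rewrite exchange_big/=; apply: eq_bigr => j _.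
    by rewrite mulr_sumr.
  rewrite exchange_big/=; apply: eq_bigr => i _.
  rewrite (horner_coef_wide _ sh) (horner_coef_wide _ sg) big_distrlr/= mulr_sumr.
  apply: eq_bigr => e _; rewrite mulr_sumr; apply: eq_bigr => j _.
  by rewrite [in RHS]mulrACA [RHS]mulrCA.
rewrite (bigD1 i0)//= big1 ?addr0; last first.
  move=> i ii0; have [aE|aN] := eqVneq (a 0 i) (a 0 i0).
    rewrite [g.[_]]horner_prod (bigD1 i) ?aE ?eqxx ?ii0//= hornerXsubC subrr.
    by rewrite !(mul0r, mulr0).
  rewrite [h.[_]]horner_prod (bigD1 i)//= hornerXsubC subrr.
  by rewrite !(mul0r, mulr0).
move/eqP; rewrite !mulf_eq0 => /orP[/eqP//|/orP[]].
  rewrite horner_prod => /prodf_eq0[i ai]; rewrite hornerXsubC subr_eq0 => /eqP E0.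
  by rewrite E0 eqxx in ai.
rewrite horner_prod => /prodf_eq0[i /andP[_ ii0]]; rewrite hornerXsubC subr_eq0 eqr_nat eqSS.
by move/eqP => E0; case/eqP: ii0; apply: val_inj.
Qed.

Lemma ev2m_mulC l mu a b e (B : 'M[{poly {poly K}}]_(a, b)) (c : 'M[K]_(b, e)) :
  ev2m l mu (B *m map_mx (fun x => x%:P%:P) c) = ev2m l mu B *m c.
Proof.
apply/matrixP => i j; rewrite !mxE ev2_sum; apply: eq_bigr => k _.
by rewrite !mxE /ev2 !hornerE.
Qed.

(** m is the largest multiplicity of an eigenvalue at a generic l, and q j is the spectral matrix
    applied to a constant vector c j. Eigenvectors of the m-dimensional eigenspaces cannot be
    spanned by fewer functions. *)
Theorem spectral_basis (D : K -> Prop) : infinitely D ->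
  (forall l, D l -> exists V a, diagonalized (A_ l) V a) ->
  exists m (q : 'I_m -> 'cV[{poly {poly K}}]_N),
  (forall j l mu, root (char_poly (A_ l)) mu ->
     A_ l *m ev2m l mu (q j) = mu *: ev2m l mu (q j)) /\
  generic (fun l => [/\ exists mu, (m <= mup mu (char_poly (A_ l)))%N,
    forall j mu, root (char_poly (A_ l)) mu -> ev2m l mu (q j) != 0 &
    forall y, exists rs (c : 'I_m -> K -> K),
      {in rs, forall mu, root (char_poly (A_ l)) mu} /\
      y = \sum_(mu <- rs) \sum_(j < m) c j mu *: ev2m l mu (q j)]).
Proof.
move=> iD dgD; have [r [p [sp pA gfree]]] := ex_annihilator iD.
have sp' l : (size (evp l p) <= r.+2)%N by rewrite -sp size_poly.
have lp0 : lead_coef p != 0 by rewrite lead_coef_eq0 -size_poly_eq0 sp.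
have gdg : generic (fun l => exists V a, diagonalized (A_ l) V a /\
    forall i, (evp l p)^`().[a 0 i] != 0).
  have [l [[Dl free] ldl]] := infinitely_ex (infinitelyI (infinitelyI iD gfree) (generic_neq0 lp0)).
  have [V [a dg]] := dgD l Dl.
  by apply: (generic_diagonalized pA dg); exact: (simple_annihilator pA sp ldl free dg).
(* At a generic l its value is the product over i of p'(a_i) (mult_i - k), so the polynomial T k is
   zero exactly when some eigenvalue has multiplicity k for generic l. *)
pose T k := \det (horner_mx A (\tr (spectral_mx r.+2 p) - k%:R *: p^`())).
have TE l V a k : diagonalized (A_ l) V a ->
    (T k).[l] = \prod_i ((evp l p)^`().[a 0 i] * ((multiplicity a i)%:R - k%:R)).
  move=> dg; rewrite evm_det evm_horner_mx (diagonalized_det (diagonalized_horner _ dg)).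
  apply: eq_bigr => i _; rewrite mxE /evp rmorphB/= -/(evp l _) hornerD hornerN.
  rewrite -/(evp l (\tr _)) (trace_spectral_mx pA _ dg) ?sp// mulrBr; congr (_ - _).
  rewrite map_polyZ/= /horner_eval -[k%:R]polyC_natr hornerC hornerZ deriv_map mulrC.
  by [].
have iT : infinitely (fun _ : K => True).
  by move=> S; have [l lS _] := iD S; exists l.
(* Every multiplicity is at most N, so the product of all T k vanishes at generic l, hence
   identically; in an integral domain one factor is zero. *)
have Tex : exists k, (k <= N)%N && (T k == 0).
  have : \prod_(k < N.+1) T k = 0.
    apply: (infinitely_poly0 (infinitelyI iT gdg)) => l [_ [V [a [dg _]]]].
    have kP : ((multiplicity a ord0) < N.+1)%N.
      by rewrite ltnS -[X in (_ <= X)%N]card_ord max_card.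
    rewrite horner_prod (bigD1 (Ordinal kP))//= (TE _ _ _ _ dg) (bigD1 ord0)//= subrr.
    by rewrite !(mulr0, mul0r).
  move/eqP; rewrite prodf_seq_eq0 => /hasP[k _ /= Tk].
  by exists k; rewrite -ltnS ltn_ord.
have Tb k : (k <= N)%N && (T k == 0) -> (k <= N)%N by case/andP.
have [m /andP[mN /eqP Tm] mmax] := ex_maxnP Tex Tb.
have gT : generic (fun l => forall k : 'I_N.+1, T k != 0 -> (T k).[l] != 0).
  apply: generic_all => k; have [->|T0] := eqVneq (T k) 0.
    by apply: genericT => l.
  by apply: genericS (generic_neq0 T0) => l.
have gm : generic (fun l => exists V a, [/\ diagonalized (A_ l) V a,
    forall i, (evp l p)^`().[a 0 i] != 0,
    forall i, ((multiplicity a i) <= m)%N &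
    exists i, (multiplicity a i) = m]).
  apply: genericS (genericI gdg gT) => l [[V [a [dg p'0]]] Tl].
  exists V, a; split => //.
    move=> i; apply: mmax.
    have iN : ((multiplicity a i) <= N)%N.
      by rewrite -[X in (_ <= X)%N]card_ord max_card.
    rewrite iN/=; apply: contraT => /(Tl (Ordinal (iN : _ < N.+1)%N))/=.
    by rewrite (TE _ _ _ _ dg) (bigD1 i)//= subrr !(mulr0, mul0r) eqxx.
  have := TE l V a m dg; rewrite Tm horner0 => /esym/eqP; rewrite prodf_seq_eq0.
  move=> /hasP[i _ /=]; rewrite mulf_eq0 (negbTE (p'0 i))/= subr_eq0 eqr_nat => /eqP.
  by exists i.
have [ls [[_ [V [a [dg p'0 am _]]]] free]] := infinitely_ex (infinitelyI (infinitelyI iT gm) gfree).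
have [uV _] := dg.
(* The vectors c j come from the eigenbasis at the single generic point [ls] and are constant in l;
   independence at [ls] spreads to generic l by [generic_row_free]. *)
pose c := vandermonde_col V.
have gk := generic_row_free (krylov_free dg am).
(* Where the rows A^k c_j are independent, h(A) c_j = 0 forces h = 0 for h of size at most r + 1.
   For the difference quotient this fails, its coefficient of degree r being the leading coefficient
   of p. *)
pose B (j : 'I_m) : 'M[{poly K}]_(r.+1, N) :=
  \matrix_(k, x) (A ^+ k *m map_mx polyC (c j)) x 0.
have BlE l (j : 'I_m) k x : evm l (B j) k x = (A_ l ^+ k *m c j) x 0.
  by rewrite [LHS]mxE [B j _ _]mxE; exact: evm_krylov_col.
have BE l (j : 'I_m) (g : {poly K}) : (size g <= r.+1)%N ->
    horner_mx (A_ l) g *m c j = (poly_rV g *m evm l (B j))^T.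
  move=> sg; rewrite (horner_mx_mulc _ _ sg); apply/colP => x; rewrite summxE !mxE.
  by apply: eq_bigr => k _; rewrite BlE [LHS]mxE [poly_rV _ _ _]mxE.
have Bfree j : row_free (evm ls (B j)).
  apply: inj_row_free => w wB; have sw : (size (rVpoly w) <= r.+1)%N by exact: size_poly.
  have E := BE ls j _ sw; rewrite rVpolyK wB trmx0 in E.
  suff : rVpoly w = 0 by move=> w0; rewrite -[w]rVpolyK w0 linear0.
  move/row_free_powersP : free; apply => //.
  apply: diagonalized_eq0 (diagonalized_horner _ dg) _ => i; rewrite mxE.
  have := congr1 (fun v : 'cV_N => (V *m v) i 0) E; rewrite /= (vandermonde_horner _ _ dg) mulmx0 !mxE.
  by move/eqP; rewrite mulf_eq0 expf_eq0 pnatr_eq0 andbF orbF => /eqP.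
have gB := generic_all (fun j => generic_row_free (Bfree j)).
exists m, (fun j => spectral_mx r.+2 p *m map_mx (fun x => x%:P%:P) (c j)); split.
  move=> j l mu rmu; rewrite ev2m_mulC mulmxA (spectral_mx_eigen pA _ rmu) ?sp//.
  by rewrite scalemxAl.
apply: genericS (genericI (genericI gm gk) (genericI gB (generic_neq0 lp0))).
move=> l [[[V' [a' [dg' p'0' am' [i im]]]] kl] [Bl ldl]]; split.
- by exists (a' 0 i); rewrite (diagonalized_mup _ dg') -im.
- move=> j mu rmu; rewrite ev2m_mulC ev2m_spectral.
  rewrite BE ?size_dquot//; apply/eqP => /(congr1 trmx); rewrite trmxK trmx0.
  move=> /eqP; rewrite -[X in _ == X](mul0mx _ (evm l (B j))) (inj_eq (row_free_inj (Bl j))).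
  move/eqP/rowP/(_ ord_max); rewrite !mxE/= dquot_coef coef_map/= => h.
  by move: ldl; rewrite /lead_coef sp/= -[_.[l]]/(horner_eval l _) h eqxx.
- move=> y; have [h ->] := krylov_span y kl.
  have qa k : (evp l p).[a' 0 k] = 0.
    by apply: (annihilator_root pA); rewrite (diagonalized_root _ dg'); apply/existsP; exists k.
  exists (undup [seq a' 0 k | k <- enum 'I_N]).
  exists (fun j mu => (h j).[mu] / (evp l p)^`().[mu]); split.
    move=> mu; rewrite mem_undup => /mapP[k _ ->].
    by rewrite (diagonalized_root _ dg'); apply/existsP; exists k.
  rewrite exchange_big/=; apply: eq_bigr => j _.
  rewrite (spectral_resolution _ dg' (sp' l) qa p'0') mulmx_suml.
  by apply: eq_bigr => mu _; rewrite ev2m_mulC ev2m_spectral scalemxAl.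
Qed.

End SpectralDecomposition.

(** * Self-adjointness of Schrodinger operators *)

Section Integration.
Variable R : realType.
Local Notation mu := (@lebesgue_measure R).
Implicit Types (f g : R -> R) (a b c : R) (A B : set R).

Definition ig A f := mu.-integrable A (EFin \o f).

Lemma ig_measurable A f : ig A f -> measurable_fun A f.
Proof. by move=> /measurable_int h; apply/measurable_EFinP. Qed.

Lemma ig_le A f g : measurable A -> measurable_fun A f -> ig A g ->
  (forall x, A x -> `|f x| <= g x) -> ig A f.
Proof.
move=> mA mf gi fg; apply: (@le_integrable _ _ _ mu A mA (EFin \o f) (EFin \o g) _ _ gi); first exact/measurable_EFinP.
by move=> x Ax; rewrite /= lee_fin (le_trans (fg x Ax))// ler_norm.
Qed.

Lemma igD A f g : measurable A -> ig A f -> ig A g -> ig A (fun x => f x + g x).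
Proof. by move=> mA fi gi; exact: (@integrableD _ _ _ mu A mA (EFin \o f) (EFin \o g)). Qed.

Lemma igB A f g : measurable A -> ig A f -> ig A g -> ig A (fun x => f x - g x).
Proof. by move=> mA fi gi; exact: (@integrableB _ _ _ mu A mA (EFin \o f) (EFin \o g)). Qed.

Lemma igZ A c f : measurable A -> ig A f -> ig A (fun x => c * f x).
Proof. by move=> mA fi; exact: (@integrableZl _ _ _ mu A mA c (EFin \o f)). Qed.

Lemma ig_norm A f : measurable A -> ig A f -> ig A (fun x => `|f x|).
Proof. by move=> mA fi; exact: (@integrable_abse _ _ _ mu A (EFin \o f)). Qed.

Lemma ig_sum A (I : Type) (r : seq I) (h : I -> R -> R) : measurable A ->
  (forall i, ig A (h i)) -> ig A (fun x => \sum_(i <- r) h i x).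
Proof.
move=> mA hi; have := @integrable_sum _ _ _ mu A mA I r xpredT (fun i => EFin \o h i) (fun i _ => hi i).
rewrite /ig; congr (mu.-integrable _ _); apply/funext => x /=.
by rewrite sumEFin.
Qed.

Lemma igS A B f : measurable A -> measurable B -> B `<=` A -> ig A f -> ig B f.
Proof. by move=> mA mB BA; exact: integrableS. Qed.

Lemma subset_itv a b c d : a <= c -> d <= b -> (`[c, d] : set R) `<=` `[a, b].
Proof.
move=> ac db x; rewrite /= !in_itv/= => /andP[cx xd].
by rewrite (le_trans ac)// (le_trans xd).
Qed.

Lemma ig_itv f a b c d : a <= c -> d <= b -> ig `[a, b] f -> ig `[c, d] f.
Proof. by move=> ac db; apply: igS => //; exact: subset_itv. Qed.

Lemma ig_setT_itv f a b : ig setT f -> ig `[a, b] f.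
Proof. exact: igS. Qed.

Lemma ig_cst a b c : ig `[a, b] (fun=> c).
Proof.
apply: continuous_compact_integrable; first exact: segment_compact.
by apply: continuous_subspaceT => x; exact: cvg_cst.
Qed.

Lemma ig_continuous f a b : continuous f -> ig `[a, b] f.
Proof.
move=> cf; apply: continuous_compact_integrable; first exact: segment_compact.
exact: continuous_subspaceT.
Qed.

Lemma int_cat f a b c : a <= b -> b <= c -> ig `[a, c] f ->
  \int[mu]_(x in `[a, c]) f x = \int[mu]_(x in `[a, b]) f x + \int[mu]_(x in `[b, c]) f x.
Proof.
move=> ab bc fi; apply/eqP; rewrite addrC -subr_eq; apply/eqP.
rewrite Rintegral_itvB//= ?bnd_simp// Rintegral_itv_obnd_cbnd//.
apply: igS fi => // x /=; rewrite !in_itv/= => /andP[bx ->].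
by rewrite (le_trans ab) ?ltW.
Qed.

Lemma int_cst a b c : a <= b -> \int[mu]_(x in `[a, b]) c = c * (b - a).
Proof.
move=> ab; rewrite Rintegral_cst//= lebesgue_measure_itv/= lte_fin.
move: ab; rewrite le_eqVlt => /predU1P[->|ab]; last by rewrite ab.
by rewrite ltxx subrr !mulr0.
Qed.

Lemma int_norm_le f a b : ig `[a, b] f ->
  `|\int[mu]_(x in `[a, b]) f x| <= \int[mu]_(x in `[a, b]) `|f x|.
Proof. by move=> fi; exact: le_normr_Rintegral. Qed.

Lemma int_le_sub f A B : measurable A -> measurable B -> A `<=` B -> ig B f ->
  (forall x, 0 <= f x) -> \int[mu]_(x in A) f x <= \int[mu]_(x in B) f x.
Proof.
move=> mA mB AB fi f0; rewrite /Rintegral fine_le//.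
- by apply: integrable_fin_num => //; exact: igS AB fi.
- exact: integrable_fin_num.
apply: ge0_subset_integral => //.
- exact: (measurable_int mu).
- by move=> x _; rewrite lee_fin.
Qed.

Lemma int_sum A (I : Type) (r : seq I) (h : I -> R -> R) : measurable A ->
  (forall i, ig A (h i)) ->
  \int[mu]_(x in A) (\sum_(i <- r) h i x) = \sum_(i <- r) \int[mu]_(x in A) h i x.
Proof.
move=> mA hi; elim: r => [|i r IH].
  rewrite big_nil (@eq_Rintegral _ _ _ mu A (fun=> 0)); last by move=> x _; rewrite big_nil.
  by rewrite Rintegral_cst// mul0r.
rewrite big_cons -IH -RintegralD//; [|exact: hi|exact: ig_sum].
by apply: eq_Rintegral => x _; rewrite big_cons.
Qed.

Lemma int_cvg f : ig setT f ->
  (fun n : nat => \int[mu]_(x in `[- n%:R, n%:R]) f x) @ \oo --> \int[mu]_x f x.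
Proof.
move=> fi; have fmn := ig_measurable fi.
pose F n : R -> \bar R := (EFin \o f) \_ `[- n%:R, n%:R].
have := @dominated_cvg _ _ _ mu setT measurableT F (EFin \o f) (EFin \o (fun x => `|f x|)).
move=> /(_ _ _ _ (ig_norm measurableT fi)) H.
have {H} : (\int[mu]_x F n x)%E @[n --> \oo] --> (\int[mu]_x (EFin \o f) x)%E.
  apply: H => //.
  - move=> n; apply: (measurable_restrictT _ _).1 => //.
    by apply: measurable_funTS; exact/measurable_EFinP.
  - move=> x _; apply: cvg_near_cst; near=> n.
    rewrite /F patchE mem_set//= in_itv/= -ler_norml.
    by near: n; exact: nbhs_infty_ger.
  - move=> n x _; rewrite /F patchE; case: ifP => _ //=.
    by rewrite normr0 lee_fin.
rewrite -(fineK (integrable_fin_num _ fi))// => /fine_cvgP[_].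
move=> h; rewrite (_ : (fun n : nat => _) = fine \o (fun n => \int[mu]_x F n x)%E)//.
by apply/funext => n; rewrite /Rintegral/= integral_mkcond.
Unshelve. all: by end_near. Qed.

(** A pointwise value at most twice the bound on the mean; the slack avoids any discussion of almost
    everywhere equality. *)
Lemma ex_low_point f a b e : a < b -> ig `[a, b] f -> 0 < e ->
  \int[mu]_(x in `[a, b]) f x <= e * (b - a) -> exists2 x, a <= x <= b & f x <= e + e.
Proof.
move=> ab fi e0 fe; apply: contrapT => H.
have : \int[mu]_(x in `[a, b]) (e + e) <= \int[mu]_(x in `[a, b]) f x.
  apply: le_Rintegral => //; first exact: ig_cst.
  move=> x; rewrite /= in_itv/= => xab; rewrite leNgt; apply/negP => /ltW fx.
  by apply: H; exists x.
rewrite int_cst; last exact: ltW.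
move=> h; have := le_trans h fe; rewrite mulrDl.
have : 0 < e * (b - a) by rewrite mulr_gt0// subr_gt0.
by move=> ? ?; lra.
Qed.

Lemma mvt f p a b : der f p -> a <= b -> exists2 c, a <= c <= b & f b - f a = p c * (b - a).
Proof.
move=> fp ab; have [c cab ->] := MVT_segment ab (fun x _ => fp x)
  (continuous_subspaceT (der_continuous fp)).
by exists c => //; move: cab; rewrite in_itv.
Qed.

(** Cutting [a, b] into n + 1 equal pieces gains a factor 1 / (n + 1), because N is additive and
    each piece has length (b - a) / (n + 1). *)
Lemma additive_eq0 (de N : R -> R -> R) a b C : 0 <= C -> a <= b ->
  (forall s t u, a <= s -> s <= t -> t <= u -> u <= b -> de s u = de s t + de t u) ->
  (forall s t u, a <= s -> s <= t -> t <= u -> u <= b -> N s u = N s t + N t u) ->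
  (forall s t, a <= s -> s <= t -> t <= b -> `|de s t| <= C * (t - s) * N s t) ->
  de a b = 0.
Proof.
move=> C0 ab dD ND dN.
have d0 : de a a = 0 by have := dD a a a; rewrite !lexx ab => /(_ isT isT isT isT); lra.
have N0 : N a a = 0 by have := ND a a a; rewrite !lexx ab => /(_ isT isT isT isT); lra.
have H n : `|de a b| <= C * (b - a) * N a b / n.+1%:R.
  pose h := (b - a) / n.+1%:R.
  have h0 : 0 <= h by rewrite divr_ge0// subr_ge0.
  have hn : a + n.+1%:R * h = b by rewrite mulrCA divff ?mulr1 ?pnatr_eq0// addrC subrK.
  suff K k : (k <= n.+1)%N -> `|de a (a + k%:R * h)| <= C * h * N a (a + k%:R * h).
    by have := K n.+1 (leqnn _); rewrite hn /h; congr (_ <= _); rewrite mulrA mulrAC.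
  elim: k => [_|k IH kn]; first by rewrite mul0r addr0 d0 N0 normr0 mulr0.
  have k1 : a <= a + k%:R * h by rewrite lerDl mulr_ge0.
  have k2 : a + k%:R * h <= a + k.+1%:R * h by rewrite lerD2l ler_wpM2r// ler_nat.
  have k3 : a + k.+1%:R * h <= b by rewrite -[leRHS]hn lerD2l ler_wpM2r// ler_nat.
  rewrite (dD _ _ _ (lexx a) k1 k2 k3) (ND _ _ _ (lexx a) k1 k2 k3) mulrDr.
  rewrite (le_trans (ler_normD _ _))// lerD ?IH 1?ltnW//.
  rewrite (le_trans (dN _ _ k1 k2 k3))//.
  by rewrite [_ - _](_ : _ = h)// -natr1; ring.
apply/eqP; rewrite -normr_le0 leNgt; apply/negP => dpos.
pose Q := C * (b - a) * N a b.
have [m mQ] : exists m : nat, Q / `|de a b| < m.+1%:R.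
  by exists (Num.truncn (Q / `|de a b|)); exact: truncnS_gt.
have := H m; rewrite -/Q ler_pdivlMr ?ltr0Sn// leNgt => /negP; apply.
by rewrite mulrC -ltr_pdivrMr.
Qed.

(** p and q are only indefinite integrals, so the boundary expression cannot be differentiated
    pointwise. Instead the defect of the formula on [s, t] is additive in the interval and bounded
    by a constant times (t - s) times the integral of |g| + |k|; [additive_eq0] concludes. *)
Lemma green f p g v q k a b : a <= b -> der f p -> der v q -> ig `[a, b] g -> ig `[a, b] k ->
  (forall s t, a <= s -> s <= t -> t <= b -> p t - p s = \int[mu]_(x in `[s, t]) g x) ->
  (forall s t, a <= s -> s <= t -> t <= b -> q t - q s = \int[mu]_(x in `[s, t]) k x) ->
  (p b * v b - f b * q b) - (p a * v a - f a * q a) =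
  \int[mu]_(x in `[a, b]) (g x * v x - f x * k x).
Proof.
move=> ab fp vq gi ki pg qk.
pose n x := `|g x| + `|k x|; pose N s t := \int[mu]_(x in `[s, t]) n x.
have ni : ig `[a, b] n by apply: igD => //; exact: ig_norm.
have N_ge0 s t : 0 <= N s t by apply: Rintegral_ge0 => x _; rewrite addr_ge0.
have ND s t u : a <= s -> s <= t -> t <= u -> u <= b -> N s u = N s t + N t u.
  by move=> as' st tu ub; apply: int_cat => //; exact: ig_itv ni.
have Nle s t s' t' : a <= s -> s <= s' -> s' <= t' -> t' <= t -> t <= b -> N s' t' <= N s t.
  move=> as' ss st tt tb; rewrite (ND s s' t)// ?(le_trans st)//.
  rewrite (ND s' t' t)// ?(le_trans as')//.
  have := N_ge0 s s'; have := N_ge0 t' t; lra.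
have small h s t : ig `[a, b] h -> (forall x, `|h x| <= n x) -> a <= s -> s <= t -> t <= b ->
    `|\int[mu]_(x in `[s, t]) h x| <= N s t.
  move=> hi hn as' st tb; have hi' : ig `[s, t] h by exact: ig_itv hi.
  rewrite (le_trans (int_norm_le hi'))//; apply: le_Rintegral => //.
    exact: ig_norm.
  exact: ig_itv ni.
have gn x : `|g x| <= n x by rewrite lerDl.
have kn x : `|k x| <= n x by rewrite lerDr.
pose B := `|p a| + `|q a| + N a b.
have B0 : 0 <= B by rewrite !addr_ge0.
have pB x : a <= x -> x <= b -> `|p x| <= B.
  move=> ax xb; have := pg _ _ (lexx a) ax xb; have := small g a x gi gn (lexx a) ax xb.
  have := Nle a b a x (lexx _) (lexx _) ax xb (lexx _).
  move=> h1 h2 h3; have -> : p x = p a + \int[mu]_(x in `[a, x]) g x by rewrite -h3; ring.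
  by rewrite /B; have := ler_normD (p a) (\int[mu]_(x in `[a, x]) g x); have := normr_ge0 (q a); lra.
have qB x : a <= x -> x <= b -> `|q x| <= B.
  move=> ax xb; have := qk _ _ (lexx a) ax xb; have := small k a x ki kn (lexx a) ax xb.
  have := Nle a b a x (lexx _) (lexx _) ax xb (lexx _).
  move=> h1 h2 h3; have -> : q x = q a + \int[mu]_(x in `[a, x]) k x by rewrite -h3; ring.
  by rewrite /B; have := ler_normD (q a) (\int[mu]_(x in `[a, x]) k x); have := normr_ge0 (p a); lra.
have lip F F' s t : der F F' -> (forall x, a <= x -> x <= b -> `|F' x| <= B) ->
    a <= s -> s <= t -> t <= b -> `|F t - F s| <= B * (t - s).
  move=> FF' F'B as' st tb; have [c /andP[sc ct] ->] := mvt FF' st.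
  rewrite normrM [`|t - s|]ger0_norm ?subr_ge0// ler_wpM2r ?subr_ge0// F'B//.
    exact: le_trans sc.
  exact: le_trans tb.
have bnd F F' : der F F' -> (forall x, a <= x -> x <= b -> `|F' x| <= B) ->
    forall x, a <= x <= b -> `|F x| <= `|F a| + B * (b - a).
  move=> FF' F'B x /andP[ax xb]; have := lip _ _ _ _ FF' F'B (lexx a) ax xb.
  have : B * (x - a) <= B * (b - a) by rewrite ler_wpM2l// lerD2r.
  move=> h1 h2; rewrite -[F x](subrK (F a)) addrC (le_trans (ler_normD _ _))// lerD2l.
  exact: le_trans h1.
have mul_ig F F' h : der F F' -> (forall x, a <= x -> x <= b -> `|F' x| <= B) -> ig `[a, b] h ->
    ig `[a, b] (fun x => h x * F x).
  move=> FF' F'B hi.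
  have mh := ig_measurable hi.
  apply: (@ig_le _ _ (fun x => (`|F a| + B * (b - a)) * `|h x|)) => //.
  - apply: measurable_funM => //; apply: measurable_funTS.
    exact: continuous_measurable_fun (der_continuous FF').
  - by apply: igZ => //; exact: ig_norm.
  - move=> x; rewrite /= in_itv/= => xab; rewrite normrM mulrC ler_wpM2r//.
    exact: bnd xab.
have gvi := mul_ig _ _ _ vq qB gi; have kfi := mul_ig _ _ _ fp pB ki.
have Di : ig `[a, b] (fun x => g x * v x - f x * k x).
  rewrite (_ : (fun x => _) = (fun x => g x * v x - k x * f x)); first exact: igB.
  by apply/funext => x; rewrite (mulrC (f x)).
pose de s t := (p t * v t - f t * q t) - (p s * v s - f s * q s) -
  \int[mu]_(x in `[s, t]) (g x * v x - f x * k x).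
suff : de a b = 0 by move=> h; apply/eqP; rewrite -subr_eq0; apply/eqP.
apply: (@additive_eq0 de N a b (3 * B)) => //; first by rewrite mulr_ge0.
  by move=> s t u as' st tu ub; rewrite /de (@int_cat _ s t u)//; [ring|exact: ig_itv Di].
move=> s t as' st tb.
have [xi /andP[sxi xit] vE] := mvt vq st.
have [eta /andP[seta etat] fE] := mvt fp st.
have gst := ig_itv as' tb gi; have kst := ig_itv as' tb ki.
have gvst := ig_itv as' tb gvi; have kfst := ig_itv as' tb kfi.
pose h x := (v t * g x - g x * v x) - (f t * k x - k x * f x).
have hi : ig `[s, t] h by apply: igB => //; apply: igB => //; apply: igZ.
(* The mean value theorem replaces v s and f s by values at t. The defect that remains is made of g
   and k integrated against increments of v and f, and of (t - s) times increments of p and q. *)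
have deE : de s t = \int[mu]_(x in `[s, t]) h x +
    (t - s) * (p s * (q xi - q s) - q s * (p eta - p s)).
  rewrite /h RintegralB//; last 2 first.
    by apply: igB => //; apply: igZ.
    by apply: igB => //; apply: igZ.
  rewrite !RintegralB//; try by apply: igZ.
  rewrite !RintegralZl// -pg// -qk//.
  rewrite /de.
  have -> : \int[mu]_(x in `[s, t]) (g x * v x - f x * k x) =
    \int[mu]_(x in `[s, t]) (g x * v x) - \int[mu]_(x in `[s, t]) (k x * f x).
    by rewrite -RintegralB//; apply: eq_Rintegral => x _; rewrite (mulrC (k x)).
  have -> : v s = v t - q xi * (t - s) by rewrite -vE; ring.
  have -> : f s = f t - p eta * (t - s) by rewrite -fE; ring.
  ring.
rewrite deE (le_trans (ler_normD _ _))//.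
have -> : 3 * B * (t - s) * N s t = B * (t - s) * N s t + (t - s) * (B * N s t + B * N s t) by ring.
apply: lerD.
  rewrite (le_trans (int_norm_le hi))// /N -RintegralZl//; last exact: ig_itv ni.
  apply: le_Rintegral => //; first exact: ig_norm.
    by apply: igZ => //; exact: ig_itv ni.
  move=> x; rewrite /= in_itv/= => /andP[sx xt].
  have ax := le_trans as' sx.
  have l1 := lip _ _ _ _ vq qB ax xt tb; have l2 := lip _ _ _ _ fp pB ax xt tb.
  have mono : B * (t - x) <= B * (t - s) by rewrite ler_wpM2l// lerD2l lerN2.
  have -> : h x = (v t - v x) * g x - (f t - f x) * k x by rewrite /h; ring.
  rewrite (le_trans (ler_normB _ _))// !normrM /n mulrDr.
  by rewrite lerD// ler_wpM2r// (le_trans _ mono).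
rewrite normrM ger0_norm ?subr_ge0// ler_wpM2l ?subr_ge0// (le_trans (ler_normB _ _))//.
have sb := le_trans st tb.
rewrite !normrM lerD// ler_pM//; [exact: pB| |exact: qB|].
- rewrite qk//; last exact: le_trans tb.
  by rewrite (le_trans (small _ _ _ ki kn as' sxi (le_trans xit tb)))// Nle.
- rewrite pg//; last exact: le_trans tb.
  by rewrite (le_trans (small _ _ _ gi gn as' seta (le_trans etat tb)))// Nle.
Qed.

Definition sqint f := measurable_fun setT f /\ ig setT (fun x => f x ^+ 2).

Lemma sqint_mul f g : sqint f -> sqint g -> ig setT (fun x => f x * g x).
Proof.
move=> [mf fi] [mg gi]; apply: (@ig_le _ _ (fun x => f x ^+ 2 + g x ^+ 2)) => //.
- exact: measurable_funM.
- exact: igD.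
- by move=> x _; rewrite ler_norml; apply/andP; split; nra.
Qed.

Lemma sqint_itv f a b : sqint f -> ig `[a, b] f.
Proof.
move=> [mf fi]; apply: (@ig_le _ _ (fun x => 1 + f x ^+ 2)) => //.
- exact: measurable_funTS.
- by apply: igD => //; [exact: ig_cst|exact: ig_setT_itv].
- by move=> x _; rewrite ler_norml; apply/andP; split; nra.
Qed.

Lemma sqint_le f g h : measurable_fun setT f -> sqint g -> sqint h ->
  (forall x, f x ^+ 2 <= g x ^+ 2 + h x ^+ 2) -> sqint f.
Proof.
move=> mf [mg gi] [mh hi] fgh; split => //.
apply: (@ig_le _ _ (fun x => g x ^+ 2 + h x ^+ 2)) => //; [exact: measurable_funX|exact: igD|].
by move=> x _; rewrite ger0_norm ?sqr_ge0.
Qed.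

Lemma sqintM f (u : R -> R) K : sqint f -> measurable_fun setT u -> (forall x, `|u x| <= K) ->
  sqint (fun x => u x * f x).
Proof.
move=> [mf fi] mu_ uK; split; first exact: measurable_funM.
apply: (@ig_le _ _ (fun x => K ^+ 2 * f x ^+ 2)) => //.
- by apply: measurable_funX; exact: measurable_funM.
- exact: igZ.
- move=> x _; rewrite ger0_norm ?sqr_ge0// exprMn ler_wpM2r ?sqr_ge0//.
  by rewrite -real_normK ?num_real// lerXn2r// nnegrE// (le_trans _ (uK x)).
Qed.

Lemma sqintZ c f : sqint f -> sqint (fun x => c * f x).
Proof. by move=> fi; exact: (@sqintM f (fun=> c) `|c| fi (measurable_cst _)). Qed.

Lemma sqintD f g : sqint f -> sqint g -> sqint (fun x => f x + g x).
Proof.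
move=> fi gi; have [mf _] := fi; have [mg _] := gi.
apply: (sqint_le _ (sqintZ 2 fi) (sqintZ 2 gi)); first exact: measurable_funD.
by move=> x; nra.
Qed.

Lemma sqintB f g : sqint f -> sqint g -> sqint (fun x => f x - g x).
Proof.
move=> fi gi; rewrite (_ : (fun x => _) = (fun x => f x + (-1) * g x)).
  by apply: sqintD => //; exact: sqintZ.
by apply/funext => x; rewrite mulN1r.
Qed.

Lemma sqint0 : sqint (fun=> 0).
Proof.
split; first exact: measurable_cst.
rewrite (_ : (fun=> _) = (fun=> 0)); last by apply/funext => x; rewrite expr0n.
exact: integrable0.
Qed.

Lemma sqint_sum (I : Type) (r : seq I) (h : I -> R -> R) : (forall i, sqint (h i)) ->
  sqint (fun x => \sum_(i <- r) h i x).
Proof.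
move=> hi; elim: r => [|i r IH].
  by rewrite (_ : (fun x => _) = (fun=> 0)); [exact: sqint0|apply/funext => x; rewrite big_nil].
rewrite (_ : (fun x => _) = (fun x => h i x + \sum_(j <- r) h j x)); first exact: sqintD.
by apply/funext => x; rewrite big_cons.
Qed.

Lemma int_supp f a b : (forall x, ~ (a <= x <= b) -> f x = 0) ->
  \int[mu]_x f x = \int[mu]_(x in `[a, b]) f x.
Proof.
move=> f0; rewrite [RHS]Rintegral_mkcond; apply: eq_Rintegral => x _; rewrite patchE.
case: ifPn => //; rewrite notin_setE/= in_itv/= => xab; exact: f0.
Qed.

Lemma ig_supp f a b : (forall x, ~ (a <= x <= b) -> f x = 0) -> ig `[a, b] f -> ig setT f.
Proof.
move=> f0 fi; have mi : measurable (`[a, b] : set R) by [].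
have := (@integrable_mkcond _ _ _ mu _ (EFin \o f) mi).1 fi.
rewrite /ig; congr (mu.-integrable _ _); apply/funext => x; rewrite patchE.
by case: ifPn => //=; rewrite notin_setE/= in_itv/= => /f0 ->.
Qed.

Lemma int_interior f g a b : a <= b -> ig `[a, b] f -> ig `[a, b] g ->
  (forall x, a < x < b -> f x = g x) ->
  \int[mu]_(x in `[a, b]) f x = \int[mu]_(x in `[a, b]) g x.
Proof.
move=> ab fi gi fg; rewrite /Rintegral; congr fine.
have mfi := measurable_int mu fi; have mgi := measurable_int mu gi.
have oc (A : set R) (h : R -> R) : measurable A -> measurable_fun `[a, b] (EFin \o h) -> A `<=` `[a, b] ->
    measurable_fun A (EFin \o h).
  by move=> mA mh Aab; apply: measurable_funS mh.
have s1 : (`]a, b] : set R) `<=` `[a, b].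
  by move=> x /=; rewrite !in_itv/= => /andP[/ltW-> ->].
have s2 : (`]a, b[ : set R) `<=` `[a, b].
  by move=> x /=; rewrite !in_itv/= => /andP[/ltW-> /ltW->].
have red (h : R -> R) : measurable_fun `[a, b] (EFin \o h) ->
    (\int[mu]_(x in `[a, b]) (h x)%:E = \int[mu]_(x in `]a, b[) (h x)%:E)%E.
  move=> mh; rewrite -integral_itv_obnd_cbnd; last first.
    by exact: oc (`]a, b] : set R) h (measurable_itv _) mh s1.
  by rewrite -integral_itv_bndo_bndc//; exact: oc (`]a, b[ : set R) h (measurable_itv _) mh s2.
rewrite !red//; apply: eq_integral => x; rewrite inE/= in_itv/= => xab.
by rewrite fg.
Qed.

Lemma aeS (P Q : R -> Prop) : (forall x, P x -> Q x) -> {ae mu, forall x, P x} ->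
  {ae mu, forall x, Q x}.
Proof. by move=> PQ; apply: negligibleS => x /= nQ /PQ. Qed.

Lemma aeI (P Q : R -> Prop) : {ae mu, forall x, P x} -> {ae mu, forall x, Q x} ->
  {ae mu, forall x, P x /\ Q x}.
Proof.
move=> aP aQ; apply: negligibleS (negligibleU aP aQ) => x /= nPQ.
by have [Px|nPx] := pselect (P x); [right => Qx; apply: nPQ|left].
Qed.

Lemma int_ae f g A : measurable A -> measurable_fun A f -> measurable_fun A g ->
  {ae mu, forall x, f x = g x} -> \int[mu]_(x in A) f x = \int[mu]_(x in A) g x.
Proof.
move=> mA mf mg fg; rewrite /Rintegral; congr fine; apply: ae_eq_integral => //.
- exact/measurable_EFinP.
- exact/measurable_EFinP.
- by apply: aeS fg => x -> _.
Qed.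

Lemma sqint_ae f g : measurable_fun setT g -> sqint f -> {ae mu, forall x, f x = g x} -> sqint g.
Proof.
move=> mg [mf fi] fg; split => //; apply/integrableP; split.
  by apply/measurable_EFinP; exact: measurable_funX.
have /integrableP[_ ] := fi; congr (_ < _)%E; apply: ae_eq_integral => //.
- by apply: measurableT_comp => //; apply/measurable_EFinP; exact: measurable_funX.
- by apply: measurableT_comp => //; apply/measurable_EFinP; exact: measurable_funX.
- by apply: aeS fg => x /= -> _.
Qed.

Lemma int_eq0_ae f a b : ig `[a, b] f -> (forall x, 0 <= f x) ->
  \int[mu]_(x in `[a, b]) f x = 0 -> {ae mu, forall x, a <= x <= b -> f x = 0}.
Proof.
move=> fi f0 fE; have H : (\int[mu]_(x in `[a, b]) `|(EFin \o f) x| = 0)%E.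
  rewrite -[RHS]/(0%:E) -[in RHS]fE /Rintegral fineK; last exact: integrable_fin_num.
  by apply: eq_integral => x _ /=; rewrite ger0_norm.
have mf : measurable_fun `[a, b] (EFin \o f) by exact: (measurable_int mu).
have := (ae_eq_integral_abs mu (measurable_itv _) mf).1 H.
apply: aeS => x /= h xab; apply: EFin_inj; apply: h.
by rewrite in_itv.
Qed.

Lemma ae_meets (Q : R -> Prop) a b : a < b -> {ae mu, forall x, Q x} ->
  exists2 x, a <= x <= b & Q x.
Proof.
move=> ab aQ; apply: contrapT => H.
have : mu.-negligible (`[a, b] : set R).
  apply: negligibleS aQ => x /=; rewrite in_itv/= => xab Qx.
  by apply: H; exists x.
move/(negligibleP mu (measurable_itv _)) => E.
have : lebesgue_measure (`[a, b] : set R) = 0%E by [].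
rewrite lebesgue_measure_itv/= lte_fin ab; move/eqP; by rewrite -EFinB eqe subr_eq0 gt_eqF.
Qed.

Lemma int_der F f a b : der F f -> continuous f -> a <= b ->
  \int[mu]_(x in `[a, b]) f x = F b - F a.
Proof.
move=> Ff cf; rewrite le_eqVlt => /predU1P[->|ab].
  by rewrite set_itv1 Rintegral_set1 subrr.
have cF := der_continuous Ff.
rewrite /Rintegral (@continuous_FTC2 _ f F a b ab)//.
- exact: continuous_subspaceT.
- split => [x _||]; first by have [] := Ff x.
    by apply: cvg_at_right_filter; exact: cF.
  by apply: cvg_at_left_filter; exact: cF.
- by move=> x _; rewrite derive1E; have [_] := Ff x.
Qed.

(** A square integrable function is locally integrable, and its indefinite integral is even
    uniformly continuous. *)
Lemma ex_integral_fun k : sqint k -> exists2 K, continuous K &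
  forall a b, a <= b -> K b - K a = \int[mu]_(x in `[a, b]) k x.
Proof.
move=> ki; have [mk k2i] := ki.
pose I a b := \int[mu]_(x in `[a, b]) k x.
have I0 a b : b < a -> I a b = 0.
  by move=> ba; rewrite /I set_itv_ge ?Rintegral_set0// bnd_simp -ltNge.
have I1 a : I a a = 0 by rewrite /I set_itv1 Rintegral_set1.
have Ic a b c : a <= b -> b <= c -> I a c = I a b + I b c.
  by move=> ab bc; apply: int_cat => //; exact: sqint_itv.
(* An inverted interval is empty and contributes 0, so this difference is the signed integral from 0
   to x. *)
pose K x := I 0 x - I x 0.
have KE a b : a <= b -> K b - K a = I a b.
  move=> ab; rewrite /K; have [a0|a0] := leP 0 a.
    have b0 := le_trans a0 ab; rewrite (Ic 0 a b)//.
    have -> : I b 0 = 0 by move: b0; rewrite le_eqVlt => /predU1P[<-|/I0].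
    have -> : I a 0 = 0 by move: a0; rewrite le_eqVlt => /predU1P[<-|/I0].
    ring.
  rewrite (I0 0 a)//; have [b0|b0] := leP 0 b.
    rewrite (Ic a 0 b (ltW a0) b0).
    have -> : I b 0 = 0 by move: b0; rewrite le_eqVlt => /predU1P[<-|/I0].
    ring.
  by rewrite (I0 0 b)// (Ic a b 0 ab (ltW b0)); ring.
exists K => //.
pose S := \int[mu]_x (k x ^+ 2).
have S0 : 0 <= S by apply: Rintegral_ge0 => x _; rewrite sqr_ge0.
(* From |k| <= e k^2 + 1/e. Taking e small and then b - a small gives continuity. *)
have est a b e : 0 < e -> a <= b -> `|I a b| <= e * S + e^-1 * (b - a).
  move=> e0 ab; have kab : ig `[a, b] k by exact: sqint_itv.
  have k2ab : ig `[a, b] (fun x => k x ^+ 2) by exact: ig_setT_itv.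
  rewrite (le_trans (int_norm_le kab))//.
  apply: (@le_trans _ _ (\int[mu]_(x in `[a, b]) (e * k x ^+ 2 + e^-1))).
    apply: le_Rintegral => //; first exact: ig_norm.
      by apply: igD => //; [exact: igZ|exact: ig_cst].
    move=> x _; have e1 : e * e^-1 = 1 by rewrite divff// gt_eqF.
    have e2 : 0 < e^-1 by rewrite invr_gt0.
    rewrite ler_norml; apply/andP; split.
      have : 0 <= e * (k x + e^-1) ^+ 2 by rewrite mulr_ge0 ?sqr_ge0// ltW.
      have : 0 <= e * k x ^+ 2 by rewrite mulr_ge0 ?sqr_ge0// ltW.
      have -> : e * (k x + e^-1) ^+ 2 = e * k x ^+ 2 + 2 * (e * e^-1) * k x + (e * e^-1) * e^-1 by ring.
      by rewrite e1; lra.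
    have : 0 <= e * (k x - e^-1) ^+ 2 by rewrite mulr_ge0 ?sqr_ge0// ltW.
    have : 0 <= e * k x ^+ 2 by rewrite mulr_ge0 ?sqr_ge0// ltW.
    have -> : e * (k x - e^-1) ^+ 2 = e * k x ^+ 2 - 2 * (e * e^-1) * k x + (e * e^-1) * e^-1 by ring.
    by rewrite e1; lra.
  rewrite RintegralD//; [|exact: igZ|exact: ig_cst].
  rewrite RintegralZl// int_cst// lerD2r ler_pM2l//.
  by apply: int_le_sub => // x; exact: sqr_ge0.
have est' x y e : 0 < e -> `|K x - K y| <= e * S + e^-1 * `|x - y|.
  move=> e0; have [xy|/ltW yx] := leP x y.
    by rewrite distrC KE// [`|x - y|]distrC [`|y - x|]ger0_norm ?subr_ge0//; exact: est.
  by rewrite KE// [`|x - y|]ger0_norm ?subr_ge0//; exact: est.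
move=> x; apply/cvgrPdist_le => eps eps0.
pose e := eps / 2 / (S + 1); have e0 : 0 < e by rewrite !divr_gt0//; lra.
have eS : e * S <= eps / 2.
  rewrite /e -[leRHS]mulr1 -mulrA ler_pM2l ?divr_gt0// mulrC ler_pdivrMr; lra.
near=> y.
apply: le_trans (est' x y e e0) _.
have : `|x - y| <= eps / 2 * e.
  by near: y; apply: cvgr_dist_le => //; rewrite mulr_gt0// divr_gt0.
rewrite -(ler_pM2l (_ : 0 < e^-1)) ?invr_gt0// => h.
have : e^-1 * (eps / 2 * e) = eps / 2 by rewrite mulrC mulfK// gt_eqF.
by lra.
Unshelve. all: by end_near. Qed.

(** There are y in [x, x+1] and z in [x+2, x+3] where f is bounded independently of x. The mean
    value theorem bounds p at some c between them, and |p c - p x| is at most the integral of 1 +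
    g^2 over an interval of length at most 3. *)
Lemma derivative_bounded f p g : sqint f -> sqint g -> der f p ->
  (forall a b, a <= b -> p b - p a = \int[mu]_(x in `[a, b]) g x) ->
  exists2 C, 0 <= C & forall x, `|p x| <= C.
Proof.
move=> [mf fi] gi fp pg; have [mg g2i] := gi.
pose S := \int[mu]_x (f x ^+ 2); pose G := \int[mu]_x (g x ^+ 2).
have S0 : 0 <= S by apply: Rintegral_ge0 => x _; rewrite sqr_ge0.
have G0 : 0 <= G by apply: Rintegral_ge0 => x _; rewrite sqr_ge0.
have low y : exists2 x, y <= x <= y + 1 & `|f x| <= 1 + 2 * (S + 1).
  have [|||x xy fx] := @ex_low_point (fun x => f x ^+ 2) y (y + 1) (S + 1) _ (ig_setT_itv _ _ fi).
  - by rewrite ltrDl.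
  - by lra.
  - rewrite (_ : y + 1 - y = 1) ?mulr1; last by ring.
    apply: (@le_trans _ _ S); last by rewrite lerDl.
    by apply: int_le_sub => // z; exact: sqr_ge0.
  by exists x => //; rewrite ler_norml; apply/andP; split; nra.
exists (2 * (1 + 2 * (S + 1)) + (3 + G)); first by lra.
move=> x; have [y /andP[xy yx] fy] := low x; have [z /andP[xz zx] fz] := low (x + 2).
have yz : y <= z by lra.
have [c /andP[yc cz] E] := mvt fp yz.
have pc : `|p c| <= 2 * (1 + 2 * (S + 1)).
  apply: (@le_trans _ _ (`|p c| * (z - y))); first by rewrite ler_peMr//; lra.
  rewrite -[X in _ * X]ger0_norm; last by lra.
  by rewrite -normrM -E (le_trans (ler_normB _ _))//; lra.
have xc : x <= c by lra.
have : `|p c - p x| <= 3 + G.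
  rewrite pg//; have gxc : ig `[x, c] g by exact: sqint_itv.
  rewrite (le_trans (int_norm_le gxc))//.
  apply: (@le_trans _ _ (\int[mu]_(t in `[x, c]) (1 + g t ^+ 2))).
    apply: le_Rintegral => //; first exact: ig_norm.
      by apply: igD => //; [exact: ig_cst|exact: ig_setT_itv].
    by move=> t _; rewrite ler_norml; apply/andP; split; nra.
  rewrite RintegralD//; [|exact: ig_cst|exact: ig_setT_itv].
  rewrite int_cst// lerD//; first by lra.
  by apply: int_le_sub => // z'; exact: sqr_ge0.
move=> h; have := ler_normB (p c) (p c - p x); rewrite opprB addrC subrK => h2.
by lra.
Qed.

Lemma le0_of_small x c : 0 <= c -> (forall eta, 0 < eta -> eta <= 1 -> x <= eta * c) -> x <= 0.
Proof.
move=> c0 H; rewrite leNgt; apply/negP => x0.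
have e0 : 0 < x / (x + 2 * c) by rewrite divr_gt0//; lra.
have e1 : x / (x + 2 * c) <= 1 by rewrite ler_pdivrMr ?mul1r; lra.
by have := H _ e0 e1; rewrite mulrAC ler_pdivlMr; nra.
Qed.

End Integration.

(** * The Schrodinger operator on real functions: symmetry and adjoint *)

Section RealGraph.
Variables (R : realType) (d : nat).
Local Notation mu := (@lebesgue_measure R).
Variables (Jd : 'rV[R]_d) (U : R -> 'M[R]_d) (K : R).
Hypothesis Jpos : forall i, 0 < Jd 0 i.
Hypothesis cU : forall i j, continuous (fun x => U x i j).
Hypothesis UK : forall x i j, `|U x i j| <= K.
Hypothesis symU : forall x i j, Jd 0 i * U x i j = Jd 0 j * U x j i.
Implicit Types f p h v q w u : 'I_d -> R -> R.

(** The derivative p is carried as data, since Green's formula and its boundary terms refer to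
    it. *)
Definition rgraph v p w :=
  [/\ forall i, sqint (v i), forall i, sqint (w i), forall i, der (v i) (p i) &
  forall i a b, a <= b ->
    p i b - p i a = \int[mu]_(x in `[a, b]) (\sum_j U x i j * v j x - w i x)].

Lemma measurable_U i j : measurable_fun setT (fun x => U x i j).
Proof. exact: continuous_measurable_fun. Qed.

Lemma sqint_U v w : (forall i, sqint (v i)) -> (forall i, sqint (w i)) ->
  forall i, sqint (fun x => \sum_j U x i j * v j x - w i x).
Proof.
move=> vi wi i; apply: sqintB => //; apply: sqint_sum => j.
by apply: (@sqintM _ (v j) (fun x => U x i j) K) => //; exact: measurable_U.
Qed.

Lemma U_cancel (a b : 'I_d -> R) x :
  \sum_i Jd 0 i * ((\sum_j U x i j * a j) * b i) = \sum_i Jd 0 i * (a i * \sum_j U x i j * b j).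
Proof.
transitivity (\sum_i \sum_j Jd 0 i * U x i j * a j * b i).
  apply: eq_bigr => i _; rewrite mulr_suml mulr_sumr; apply: eq_bigr => j _.
  by rewrite !mulrA.
rewrite exchange_big/=; apply: eq_bigr => i _; rewrite !mulr_sumr; apply: eq_bigr => j _.
by rewrite symU; ring.
Qed.

Lemma rgraph_green f p h v q w a b : rgraph f p h -> rgraph v q w -> a <= b ->
  \sum_i Jd 0 i * (p i b * v i b - f i b * q i b) - \sum_i Jd 0 i * (p i a * v i a - f i a * q i a) =
  \int[mu]_(x in `[a, b]) (\sum_i Jd 0 i * (f i x * w i x - h i x * v i x)).
Proof.
move=> [fi hi fp pE] [vi wi vq qE] ab.
have gi := sqint_U fi hi; have ki := sqint_U vi wi.
pose I i x := (\sum_j U x i j * f j x - h i x) * v i x - f i x * (\sum_j U x i j * v j x - w i x).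
have Ii i : ig `[a, b] (I i).
  by apply: igB => //; apply: ig_setT_itv; [exact: sqint_mul (gi i) (vi i)|exact: sqint_mul (fi i) (ki i)].
transitivity (\int[mu]_(x in `[a, b]) (\sum_i Jd 0 i * I i x)); last first.
  apply: eq_Rintegral => x _; rewrite /I.
  rewrite (eq_bigr (fun i => (Jd 0 i * ((\sum_j U x i j * f j x) * v i x) -
    Jd 0 i * (f i x * \sum_j U x i j * v j x)) + Jd 0 i * (f i x * w i x - h i x * v i x))).
    by rewrite big_split/= sumrB U_cancel subrr add0r.
  by move=> i _; ring.
rewrite int_sum//; last by move=> i; exact: igZ.
rewrite -sumrB; apply: eq_bigr => i _; rewrite RintegralZl; [|by []|exact: Ii].
rewrite -mulrBr; congr (_ * _).
apply: green => //; [exact: sqint_itv|exact: sqint_itv| |].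
- by move=> s t _ st _; exact: pE.
- by move=> s t _ st _; exact: qE.
Qed.

Lemma norm_split_le (I A B pa pb e k eta : R) : `|I - (A + (pb - pa) + B)| <= e ->
  `|A| <= e -> `|B| <= e -> `|pa| <= k -> `|pb| <= k -> e <= eta -> `|I| <= 3 * eta + 2 * k.
Proof.
rewrite !ler_norml => /andP[? ?] /andP[? ?] /andP[? ?] /andP[? ?] /andP[? ?] ?.
by apply/andP; split; lra.
Qed.

(** Green's formula on a large interval, with endpoints chosen where f and v are small. There the
    boundary terms are small because the derivatives p and q are bounded on the whole line. *)
Lemma rgraph_sym f p h v q w : rgraph f p h -> rgraph v q w ->
  \int[mu]_x (\sum_i Jd 0 i * (h i x * v i x)) = \int[mu]_x (\sum_i Jd 0 i * (f i x * w i x)).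
Proof.
move=> Gf Gv; have G := rgraph_green Gf Gv; move: Gf Gv.
move=> [fi hi fp pE] [vi wi vq qE].
have hvi : ig setT (fun x => \sum_i Jd 0 i * (h i x * v i x)).
  by apply: ig_sum => // i; apply: igZ => //; exact: sqint_mul.
have fwi : ig setT (fun x => \sum_i Jd 0 i * (f i x * w i x)).
  by apply: ig_sum => // i; apply: igZ => //; exact: sqint_mul.
pose D x := \sum_i Jd 0 i * (f i x * w i x - h i x * v i x).
have DE : D = (fun x => \sum_i Jd 0 i * (f i x * w i x) - \sum_i Jd 0 i * (h i x * v i x)).
  by apply/funext => x; rewrite /D -sumrB; apply: eq_bigr => i _; rewrite mulrBr.
have Di : ig setT D by rewrite DE; exact: igB.
suff : \int[mu]_x D x = 0.
  by rewrite DE RintegralB// => /eqP; rewrite subr_eq0 => /eqP.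
have [Cp Cp0 pC] : exists2 C, 0 <= C & forall i x, `|p i x| <= C.
  have /choice[C HC] : forall i, exists C, 0 <= C /\ forall x, `|p i x| <= C.
    move=> i; have [C C0 HC] := derivative_bounded (fi i) (sqint_U fi hi i) (fp i) (pE i).
    by exists C.
  exists (\sum_i C i); first by apply: sumr_ge0 => i _; have [] := HC i.
  move=> i x; have [_ /(_ x)/le_trans] := HC i; apply.
  by rewrite (bigD1 i)//= lerDl sumr_ge0// => j _; have [] := HC j.
have [Cq Cq0 qC] : exists2 C, 0 <= C & forall i x, `|q i x| <= C.
  have /choice[C HC] : forall i, exists C, 0 <= C /\ forall x, `|q i x| <= C.
    move=> i; have [C C0 HC] := derivative_bounded (vi i) (sqint_U vi wi i) (vq i) (qE i).
    by exists C.
  exists (\sum_i C i); first by apply: sumr_ge0 => i _; have [] := HC i.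
  move=> i x; have [_ /(_ x)/le_trans] := HC i; apply.
  by rewrite (bigD1 i)//= lerDl sumr_ge0// => j _; have [] := HC j.
(* One integrable function dominates both f^2 + v^2, whose smallness controls the boundary terms,
   and |D|, whose tails have to vanish. *)
pose H x := \sum_i (f i x ^+ 2 + v i x ^+ 2) + `|D x|.
have Hi : ig setT H.
  apply: igD => //; last exact: ig_norm.
  by apply: ig_sum => // i; apply: igD => //; [have [] := fi i|have [] := vi i].
have H0 x : 0 <= H x by rewrite addr_ge0// sumr_ge0// => i _; rewrite addr_ge0// sqr_ge0.
have DH x : `|D x| <= H x by rewrite lerDr sumr_ge0// => i _; rewrite addr_ge0// sqr_ge0.
pose Phi x := \sum_i Jd 0 i * (p i x * v i x - f i x * q i x).
pose C := (\sum_i Jd 0 i) * (3 * (Cp + Cq)).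
have SJ0 : 0 <= \sum_i Jd 0 i by apply: sumr_ge0 => i _; exact: ltW.
have C0 : 0 <= C by rewrite mulr_ge0// mulr_ge0// addr_ge0.
(* On a unit interval where the integral of H is at most eta^2, some point has H <= 2 eta^2, so
   every f_i and v_i is at most 3 eta there; C collects the bounds of p and q and the weights. *)
have low a b eta : 0 < eta -> b = a + 1 -> \int[mu]_(x in `[a, b]) H x <= eta ^+ 2 ->
    exists2 x, a <= x <= b & `|Phi x| <= eta * C.
  move=> e0 ba HE; have [||||x xab Hx] := @ex_low_point _ H a b (eta ^+ 2).
  - by rewrite ba ltrDl.
  - exact: ig_setT_itv.
  - by rewrite exprn_gt0.
  - by rewrite (_ : b - a = 1) ?mulr1// ba; ring.
  exists x => //; have sm i : `|f i x| <= eta * 3 /\ `|v i x| <= eta * 3.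
    have : f i x ^+ 2 + v i x ^+ 2 <= eta ^+ 2 + eta ^+ 2.
      apply: le_trans Hx; rewrite /H (bigD1 i)//= -addrA lerDl addr_ge0// sumr_ge0// => j _.
      by rewrite addr_ge0// sqr_ge0.
    by move=> ?; split; rewrite ler_norml; apply/andP; split; nra.
  rewrite /Phi (le_trans (ler_norm_sum _ _ _))// /C mulrCA mulr_suml; apply: ler_sum => i _.
  have [f1 v1] := sm i.
  rewrite normrM gtr0_norm//; apply: ler_wpM2l; first exact: ltW.
  rewrite (le_trans (ler_normB _ _))//.
  rewrite !normrM mulrA mulrDr lerD//.
    by rewrite mulrC ler_pM.
  by rewrite ler_pM.
apply/eqP; rewrite -normr_le0; apply: (@le0_of_small _ _ (3 + 2 * C)); first by lra.
move=> eta e0 e1.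
have ee : eta ^+ 2 <= eta by nra.
have e20 : 0 < eta ^+ 2 by rewrite exprn_gt0.
(* Outside [-n, n] the integral of H is at most eta^2; the endpoints are then found in [n, n + 1]
   and [-n - 1, -n]. *)
have [n nH] : exists n : nat, \int[mu]_x H x - \int[mu]_(x in `[- n%:R, n%:R]) H x <= eta ^+ 2.
  have /cvgrPdist_le/(_ _ e20)[n _ /(_ n (leqnn _))/=] := int_cvg Hi.
  by move=> Hn; exists n; apply: le_trans (ler_norm _) Hn.
have out a b : a <= b -> (b <= - n%:R \/ n%:R <= a) -> \int[mu]_(x in `[a, b]) H x <= eta ^+ 2.
  move=> ab abn; apply: le_trans nH; rewrite lerBrDr.
  have n0 : - n%:R <= n%:R :> R by rewrite ge0_cp.
  have sub c e : \int[mu]_(x in `[c, e]) H x <= \int[mu]_x H x by exact: int_le_sub.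
  have pos c e : 0 <= \int[mu]_(x in `[c, e]) H x by apply: Rintegral_ge0.
  case: abn => [bn|na].
    apply: le_trans (sub a n%:R); rewrite (@int_cat _ _ a (- n%:R) n%:R)//; last 2 first.
      exact: le_trans bn.
      exact: ig_setT_itv.
    rewrite lerD2r (@int_cat _ _ a b (- n%:R))//; last exact: ig_setT_itv.
    by rewrite lerDl pos.
  apply: le_trans (sub (- n%:R) b); rewrite (@int_cat _ _ (- n%:R) n%:R b)//; last 2 first.
    exact: le_trans ab.
    exact: ig_setT_itv.
  rewrite addrC lerD2l (@int_cat _ _ n%:R a b)//; last exact: ig_setT_itv.
  by rewrite lerDr pos.
have [b /andP[nb bn] Pb] := low (n%:R) (n%:R + 1) eta e0 erefl
  (out _ _ (ltW (ltr_pwDr ltr01 (lexx _))) (or_intror (lexx _))).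
have [a /andP[na an] Pa] := low (- n%:R - 1) (- n%:R) eta e0 ltac:(ring)
  (out (- n%:R - 1) (- n%:R) ltac:(lra) (or_introl (lexx _))).
have [m [mn mD]] : exists m : nat, (n.+2 <= m)%N /\
    `|\int[mu]_x D x - \int[mu]_(x in `[- m%:R, m%:R]) D x| <= eta ^+ 2.
  have /cvgrPdist_le/(_ _ e20)[m _ hm] := int_cvg Di.
  by exists (maxn m n.+2); split; [rewrite leq_maxr|apply: hm => /=; rewrite leq_maxl].
have mn' : n%:R + 2 <= m%:R :> R by rewrite -natrD addn2 ler_nat.
have n0 : 0 <= n%:R :> R by [].
have Dsm c e : c <= e -> (e <= - n%:R \/ n%:R <= c) -> `|\int[mu]_(x in `[c, e]) D x| <= eta ^+ 2.
  move=> ce hce; have Dce : ig `[c, e] D by exact: ig_setT_itv.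
  apply: le_trans (out c e ce hce); apply: le_trans (int_norm_le Dce) _.
  apply: le_Rintegral => //; [exact: ig_norm|exact: ig_setT_itv].
have ma : - m%:R <= a by rewrite (le_trans _ na)// -opprD lerN2 (le_trans _ mn')// lerD2l ler1n.
have bm : b <= m%:R by rewrite (le_trans bn)// (le_trans _ mn')// lerD2l ler1n.
have ab : a <= b by rewrite (le_trans an)// (le_trans _ nb)// ge0_cp.
have D1 : `|\int[mu]_(x in `[- m%:R, a]) D x| <= eta ^+ 2 by apply: Dsm; [exact: ma|left].
have D2 : `|\int[mu]_(x in `[b, m%:R]) D x| <= eta ^+ 2 by apply: Dsm; [exact: bm|right].
have E : \int[mu]_(x in `[- m%:R, m%:R]) D x =
  \int[mu]_(x in `[- m%:R, a]) D x + (Phi b - Phi a) + \int[mu]_(x in `[b, m%:R]) D x.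
  rewrite (@int_cat _ _ (- m%:R) b m%:R); [|exact: le_trans ab|exact: bm|exact: ig_setT_itv].
  rewrite (@int_cat _ _ (- m%:R) a b); [|exact: ma|exact: ab|exact: ig_setT_itv].
  by rewrite [in RHS]/Phi G.
rewrite E in mD; have -> : eta * (3 + 2 * C) = 3 * eta + 2 * (eta * C) by ring.
exact: norm_split_le mD D1 D2 Pa Pb ee.
Qed.

(** The test function f is the twofold primitive of phi; the vanishing moments of order 0 and 1 of
    phi make f' and f vanish beyond m, so f lies in the domain. As G'' = U u - w, the adjoint
    relation says that phi is orthogonal to u - G. *)
Lemma rgraph_test u w (G P k : R -> R) (i0 : 'I_d) (m : R) (phi : R -> R) : 0 < m ->
  (forall f p h, rgraph f p h ->
    \int[mu]_x (\sum_i Jd 0 i * (h i x * u i x)) = \int[mu]_x (\sum_i Jd 0 i * (f i x * w i x))) ->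
  (forall i, sqint (u i)) -> (forall i, sqint (w i)) ->
  k = (fun x => \sum_j U x i0 j * u j x - w i0 x) ->
  der G P -> (forall a b, a <= b -> P b - P a = \int[mu]_(x in `[a, b]) k x) ->
  sqint phi -> (forall x, ~ (- m < x < m) -> phi x = 0) ->
  \int[mu]_(x in `[- m, m]) phi x = 0 -> \int[mu]_(x in `[- m, m]) (phi x * x) = 0 ->
  \int[mu]_(x in `[- m, m]) (phi x * (u i0 x - G x)) = 0.
Proof.
move=> m0 adj ui wi kE GP PE phii phi0 phi1 phix.
have mm : - m <= m by lra.
have ki : sqint k by rewrite kE; exact: sqint_U.
have [P1 cP1 P1E] := ex_integral_fun phii.
pose p x := P1 x - P1 (- m).
have pE a b : a <= b -> p b - p a = \int[mu]_(x in `[a, b]) phi x.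
  by move=> ab; rewrite -P1E// /p; ring.
have int0 a b : (forall x, a <= x -> x <= b -> ~ (- m < x < m)) ->
    \int[mu]_(x in `[a, b]) phi x = 0.
  move=> h; rewrite (@eq_Rintegral _ _ _ mu _ (fun=> 0)); first by rewrite Rintegral_cst// mul0r.
  move=> x; rewrite inE/= in_itv/= => /andP[ax xb]; apply: phi0; exact: h.
have pl x : x <= - m -> p x = 0.
  move=> xm; have := pE _ _ xm; rewrite int0.
    by rewrite /p subrr sub0r => /eqP; rewrite oppr_eq0 => /eqP.
  by move=> y _ ym /andP[my _]; lra.
have pm : p m = 0 by have := pE _ _ mm; rewrite phi1 /p subrr subr0.
have pr x : m <= x -> p x = 0.
  move=> xm; have := pE _ _ xm; rewrite int0 ?pm ?subr0//.
  by move=> y my _ /andP[_ ym]; lra.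
have cp : continuous p by move=> x; apply: cvgB; [exact: cP1|exact: cvg_cst].
pose f x := primitive p x - primitive p (- m).
have fp : der f p.
  move=> x; apply: hasd_eq (hasdB (der_primitive cp x) (hasd_cst _ _)) _.
  by rewrite subr0.
have cf := der_continuous fp.
have fl x : x <= - m -> f x = 0.
  move=> xm; have [c /andP[xc cm]] := mvt fp xm; rewrite pl// mul0r /f subrr sub0r.
  by move/eqP; rewrite oppr_eq0 => /eqP.
have fm : f m = 0.
  have := @green R f p phi id (fun=> 1) (fun=> 0) (- m) m mm fp (fun x => hasd_id x)
    (sqint_itv _ _ phii) (ig_cst _ _ _).
  move=> /(_ (fun s t _ st _ => pE s t st)) H.
  have : p m * m - f m * 1 - (p (- m) * - m - f (- m) * 1) =
      \int[mu]_(x in `[- m, m]) (phi x * x - f x * 0).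
    by apply: H => s t _ st _; rewrite int_cst// mul0r subrr.
  rewrite pm (pl (- m))// (fl (- m))// (@eq_Rintegral _ _ _ mu _ (fun x => phi x * x)); last first.
    by move=> x _; rewrite mulr0 subr0.
  by rewrite phix; lra.
have fr x : m <= x -> f x = 0.
  move=> xm; have [c /andP[xc cm]] := mvt fp xm; rewrite pr// mul0r fm subr0.
  by [].
have fsupp x : ~ (- m <= x <= m) -> f x = 0.
  move=> h; have [/ltW/fl//|mx] := ltP x (- m).
  by have [xm|/ltW/fr//] := leP x m; exfalso; apply: h; rewrite mx.
have fi : sqint f.
  split; first exact: continuous_measurable_fun.
  apply: (@ig_supp _ _ (- m) m) => [x /fsupp->|]; first by rewrite expr0n.
  by apply: ig_continuous => x; exact: cvgM (cf x) (cf x).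
have [Bf fB] : exists B, forall x, `|f x| <= B.
  have [C _ pC] := derivative_bounded fi phii fp pE.
  exists (C * (m - - m)) => x; have [xm|mx] := leP x (- m).
    by rewrite fl// normr0 mulr_ge0//; [exact: le_trans (pC 0)|lra].
  have C0 : 0 <= C by exact: le_trans (pC 0).
  have [xm|/ltW/fr->] := leP x m; last by rewrite normr0 mulr_ge0//; lra.
  have [c _] := mvt fp (ltW mx); rewrite (fl (- m))// subr0 => ->.
  rewrite normrM ler_pM// ger0_norm; lra.
(* f is placed in the component [i0]; its image under the operator is the column [i0] of U times f,
   minus phi in that component. *)
pose F i := if i == i0 then f else fun=> 0.
pose Pp i := if i == i0 then p else fun=> 0.
pose h i x := U x i i0 * f x - (if i == i0 then phi x else 0).
have Uf i : sqint (fun x => U x i i0 * f x).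
  by apply: (@sqintM _ f (fun x => U x i i0) K) => //; exact: measurable_U.
have GF : rgraph F Pp h.
  split.
  - by move=> i; rewrite /F; case: (i == i0) => //; exact: sqint0.
  - by move=> i; rewrite /h; apply: sqintB => //; case: (i == i0) => //; exact: sqint0.
  - by move=> i; rewrite /F /Pp; case: (i == i0) => // x; exact: hasd_cst.
  - move=> i a b ab; rewrite (@eq_Rintegral _ _ _ mu _ (fun x => if i == i0 then phi x else 0)).
      rewrite /Pp; case: (i == i0); first exact: pE.
      by rewrite Rintegral_cst// mul0r subrr.
    move=> x _; rewrite (bigD1 i0)//= big1 ?addr0; last first.
      by move=> j ji; rewrite /F (negbTE ji) mulr0.
    by rewrite /F eqxx /h; ring.
have := adj _ _ _ GF.
have -> : \int[mu]_x (\sum_i Jd 0 i * (F i x * w i x)) = \int[mu]_x (Jd 0 i0 * (f x * w i0 x)).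
  apply: eq_Rintegral => x _; rewrite (bigD1 i0)//= big1 ?addr0 /F ?eqxx//.
  by move=> j ji; rewrite (negbTE ji) mul0r mulr0.
have -> : \int[mu]_x (\sum_i Jd 0 i * (h i x * u i x)) =
    \int[mu]_x (Jd 0 i0 * (f x * (\sum_j U x i0 j * u j x) - phi x * u i0 x)).
  apply: eq_Rintegral => x _; rewrite (eq_bigr (fun i =>
    Jd 0 i0 * (f x * (U x i0 i * u i x)) - (if i == i0 then Jd 0 i0 * (phi x * u i0 x) else 0))).
    rewrite sumrB -big_mkcond/= big_pred1_eq mulrBr; congr (_ - _).
    by rewrite -!mulr_sumr.
  move=> i _; rewrite /h mulrBl mulrBr; congr (_ - _).
    by rewrite -mulrA mulrA symU; ring.
  by case: eqP => [->//|_]; rewrite mul0r mulr0.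
have Jn : Jd 0 i0 != 0 by rewrite gt_eqF.
have fki : ig setT (fun x => f x * k x) by exact: sqint_mul.
have pui : ig setT (fun x => phi x * u i0 x) by exact: sqint_mul.
have fwi : ig setT (fun x => f x * w i0 x) by exact: sqint_mul.
have fUi : ig setT (fun x => f x * (\sum_j U x i0 j * u j x)).
  rewrite (_ : (fun x => _) = (fun x => f x * k x + f x * w i0 x)); first exact: igD.
  by apply/funext => x; rewrite kE; ring.
rewrite RintegralZl//; last exact: igB.
rewrite RintegralZl// => /(mulfI Jn)/eqP; rewrite -subr_eq0 -RintegralB//; last exact: igB.
rewrite (@eq_Rintegral _ _ _ mu _ (fun x => f x * k x - phi x * u i0 x)); last first.
  by move=> x _; rewrite kE; ring.
rewrite (@int_supp _ _ (- m) m); last first.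
  move=> x h1; rewrite fsupp// phi0 ?mul0r ?subrr// => /andP[/ltW a1 /ltW a2].
  by apply: h1; rewrite a1.
move=> /eqP E1.
have := @green R f p phi G P k (- m) m mm fp GP (sqint_itv _ _ phii) (sqint_itv _ _ ki).
move=> /(_ (fun s t _ st _ => pE s t st) (fun s t _ st _ => PE s t st)).
rewrite pm (pl (- m))// (fl (- m))// fm !mul0r !subrr => E2.
have pGi : ig setT (fun x => phi x * G x).
  apply: (@ig_supp _ _ (- m) m) => [x h1|].
    rewrite phi0 ?mul0r// => /andP[/ltW a1 /ltW a2].
    by apply: h1; rewrite a1.
  have Gc := der_continuous GP.
  apply: (@ig_le _ _ _ (fun x => phi x ^+ 2 + G x ^+ 2)) => //.
  - by apply: measurable_funTS; apply: measurable_funM;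
      [case: phii|exact: continuous_measurable_fun].
  - apply: igD => //; first by apply: ig_setT_itv; case: phii.
    by apply: ig_continuous => x; exact: cvgM (Gc x) (Gc x).
  - by move=> x _; rewrite ler_norml; apply/andP; split; nra.
have := congr2 (fun a b => a + b) E1 (esym E2); rewrite /= addr0.
have itv g : ig setT g -> ig `[- m, m] g by exact: ig_setT_itv.
rewrite -RintegralD//; [|by apply: igB => //; exact: itv|by apply: igB => //; exact: itv].
rewrite (@eq_Rintegral _ _ _ mu _ (fun x => (-1) * (phi x * (u i0 x - G x)))); last first.
  by move=> x _; ring.
rewrite RintegralZl//; first by move/eqP; rewrite mulN1r oppr_eq0 => /eqP.
rewrite (_ : (fun x => _) = (fun x => phi x * u i0 x - phi x * G x)).
  by apply: igB => //; exact: itv.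
by apply/funext => x; ring.
Qed.

(** Orthogonal projection on the affine functions. On a symmetric interval 1 and x are orthogonal,
    with squared norms 2 m and 2 m^3 / 3, the denominators of the coefficients. *)
Lemma affine_orthogonal (E : R -> R) m : 0 < m -> ig `[- m, m] E -> ig `[- m, m] (fun x => E x * x) ->
  exists al bet, \int[mu]_(x in `[- m, m]) (E x - (al + bet * x)) = 0 /\
    \int[mu]_(x in `[- m, m]) ((E x - (al + bet * x)) * x) = 0.
Proof.
move=> m0 Ei Exi; have mm : - m <= m by lra.
have cid : continuous (fun x : R => x) by move=> x; exact: cvg_id.
have cx2 : continuous (fun x : R => x * x) by move=> x; apply: cvgM; exact: cvg_id.
have I1 : \int[mu]_(x in `[- m, m]) x = 0.
  rewrite (@int_der R (fun x => 2^-1 * (x * x)) id)//; first by field.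
  move=> x; apply: hasd_eq (hasdZ _ (hasdM (hasd_id x) (hasd_id x))) _.
  by rewrite /=; field.
have I2 : \int[mu]_(x in `[- m, m]) (x * x) = 2 / 3 * (m * m * m).
  rewrite (@int_der R (fun x => 3^-1 * (x * x * x)) (fun x => x * x))//; first by field.
  move=> x; apply: hasd_eq (hasdZ _ (hasdM (hasdM (hasd_id x) (hasd_id x)) (hasd_id x))) _.
  by rewrite /=; field.
have idi : ig `[- m, m] (fun x : R => x) by exact: ig_continuous.
have x2i : ig `[- m, m] (fun x : R => x * x) by exact: ig_continuous.
pose al := (\int[mu]_(x in `[- m, m]) E x) / (2 * m).
pose bet := (\int[mu]_(x in `[- m, m]) (E x * x)) / (2 / 3 * (m * m * m)).
have mn : m != 0 by rewrite gt_eqF.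
exists al, bet; split.
  rewrite RintegralB//; last by apply: igD => //; [exact: ig_cst|exact: igZ].
  rewrite RintegralD//; [|exact: ig_cst|exact: igZ].
  rewrite int_cst// RintegralZl// I1 /al; field.
  by rewrite mn.
rewrite (@eq_Rintegral _ _ _ mu _ (fun x => E x * x - (al * x + bet * (x * x)))); last first.
  by move=> x _; ring.
rewrite RintegralB//; last by apply: igD => //; exact: igZ.
rewrite RintegralD//; [|exact: igZ|exact: igZ].
rewrite !RintegralZl// I1 I2 /bet; field.
by rewrite mn.
Qed.

(** Du Bois-Reymond: for phi the restriction to ]-m, m[ of u - G minus its affine projection,
    [rgraph_test] gives that the integral of phi^2 is 0. *)
Lemma rgraph_local u w (G P k : R -> R) (i0 : 'I_d) (m : R) : 0 < m ->
  (forall f p h, rgraph f p h ->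
    \int[mu]_x (\sum_i Jd 0 i * (h i x * u i x)) = \int[mu]_x (\sum_i Jd 0 i * (f i x * w i x))) ->
  (forall i, sqint (u i)) -> (forall i, sqint (w i)) ->
  k = (fun x => \sum_j U x i0 j * u j x - w i0 x) ->
  der G P -> (forall a b, a <= b -> P b - P a = \int[mu]_(x in `[a, b]) k x) ->
  exists al bet, {ae mu, forall x, - m < x < m -> u i0 x = G x + (al + bet * x)}.
Proof.
move=> m0 adj ui wi kE GP PE; have mm : - m <= m by lra.
have [mu0 u2i] := ui i0; have Gc := der_continuous GP.
have u2m : ig `[- m, m] (fun x => u i0 x ^+ 2) by exact: ig_setT_itv.
have mG : measurable_fun setT G by exact: continuous_measurable_fun.
have uxi c : continuous c -> ig `[- m, m] (fun x => u i0 x * c x).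
  move=> cc; apply: (@ig_le _ _ _ (fun x => u i0 x ^+ 2 + c x ^+ 2)) => //.
  - by apply: measurable_funTS; apply: measurable_funM => //; exact: continuous_measurable_fun.
  - by apply: igD => //; apply: ig_continuous => x; exact: cvgM (cc x) (cc x).
  - by move=> x _; rewrite ler_norml; apply/andP; split; nra.
pose E x := u i0 x - G x.
have cid : continuous (fun x : R => x) by move=> x; exact: cvg_id.
have Ei : ig `[- m, m] E by apply: igB => //; [exact: sqint_itv|exact: ig_continuous].
have Exi : ig `[- m, m] (fun x => E x * x).
  rewrite (_ : (fun x => _) = (fun x => u i0 x * x - G x * x)).
    apply: igB => //; first exact: uxi.
    by apply: ig_continuous => x; apply: cvgM; [exact: Gc|exact: cvg_id].
  by apply/funext => x; rewrite /E mulrBl.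
have [al [bet [e1 e2]]] := affine_orthogonal m0 Ei Exi.
exists al, bet.
pose c x := G x + (al + bet * x).
have cc : continuous c.
  move=> x; apply: cvgD; first exact: Gc.
  by apply: cvgD; [exact: cvg_cst|apply: cvgM; [exact: cvg_cst|exact: cvg_id]].
pose psi x := u i0 x - c x.
have psiE x : psi x = E x - (al + bet * x) by rewrite /psi /c /E; ring.
pose phi := psi \_ (`]- m, m[ : set R).
have phiE x : - m < x < m -> phi x = psi x.
  by move=> xm; rewrite /phi patchE mem_set//= in_itv.
have phi0 x : ~ (- m < x < m) -> phi x = 0.
  by move=> xm; rewrite /phi patchE memNset//= in_itv.
have mpsi : measurable_fun setT psi.
  by apply: measurable_funB => //; exact: continuous_measurable_fun.
have mphi : measurable_fun setT phi.
  by apply: (measurable_restrictT _ _).1 => //; exact: measurable_funTS.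
have psi2i : ig `[- m, m] (fun x => psi x ^+ 2).
  apply: (@ig_le _ _ _ (fun x => 2 * u i0 x ^+ 2 + 2 * c x ^+ 2)) => //.
  - by apply: measurable_funTS; exact: measurable_funX.
  - apply: igD => //; first exact: igZ.
    by apply: igZ => //; apply: ig_continuous => x; exact: cvgM (cc x) (cc x).
  - move=> x _; rewrite ger0_norm ?sqr_ge0// /psi.
    by have := sqr_ge0 (u i0 x + c x); move: (u i0 x) (c x) => y z; nra.
have phi_case x : phi x = psi x \/ phi x = 0.
  by have [h|h] := pselect (- m < x < m); [left; exact: phiE|right; exact: phi0].
have phi2i : ig `[- m, m] (fun x => phi x ^+ 2).
  apply: (@ig_le _ _ _ (fun x => psi x ^+ 2)) => //.
  - by apply: measurable_funTS; exact: measurable_funX.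
  - by move=> x _; rewrite ger0_norm ?sqr_ge0//; have [->|->] := phi_case x;
      rewrite // expr0n sqr_ge0.
have phisq : sqint phi.
  split => //; apply: (@ig_supp _ _ (- m) m) => // x h; rewrite phi0 ?expr0n//.
  by move=> /andP[/ltW a1 /ltW a2]; apply: h; rewrite a1.
have psii : ig `[- m, m] psi by apply: igB => //; [exact: sqint_itv|exact: ig_continuous].
have phii : ig `[- m, m] phi by exact: sqint_itv.
have psix : ig `[- m, m] (fun x => psi x * x).
  rewrite (_ : (fun x => _) = (fun x => u i0 x * x - c x * x)).
    apply: igB => //; first exact: uxi.
    by apply: ig_continuous => x; apply: cvgM; [exact: cc|exact: cvg_id].
  by apply/funext => x; rewrite /psi mulrBl.
have phix : ig `[- m, m] (fun x => phi x * x).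
  apply: (@ig_le _ _ _ (fun x => phi x ^+ 2 + x * x)) => //.
  - by apply: measurable_funTS; apply: measurable_funM.
  - by apply: igD => //; apply: ig_continuous => x; apply: cvgM; exact: cvg_id.
  - by move=> x _; rewrite ler_norml; apply/andP; split; nra.
have z1 : \int[mu]_(x in `[- m, m]) phi x = 0.
  rewrite (int_interior mm phii psii)//; rewrite -[RHS]e1.
  by apply: eq_Rintegral => x _; rewrite psiE.
have z2 : \int[mu]_(x in `[- m, m]) (phi x * x) = 0.
  rewrite (int_interior mm phix psix)//; last by move=> x /phiE->.
  by rewrite -[RHS]e2; apply: eq_Rintegral => x _; rewrite psiE.
have := rgraph_test m0 adj ui wi kE GP PE phisq phi0 z1 z2.
rewrite (@eq_Rintegral _ _ _ mu _ (fun x => phi x ^+ 2 + (al * phi x + bet * (phi x * x)))); last first.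
  move=> x _; have [h|h] := pselect (- m < x < m).
    by rewrite phiE// /psi /c; ring.
  by rewrite phi0//; ring.
rewrite RintegralD//; last by apply: igD => //; exact: igZ.
rewrite RintegralD//; [|exact: igZ|exact: igZ].
rewrite !RintegralZl// z1 z2 !mulr0 !addr0 => z3.
have := int_eq0_ae phi2i (fun x => sqr_ge0 _) z3.
apply: aeS => x h xm; have /andP[/ltW a1 /ltW a2] := xm.
have /eqP : phi x ^+ 2 = 0 by apply: h; rewrite a1.
rewrite sqrf_eq0 => /eqP; rewrite phiE// /psi /c => /eqP; rewrite subr_eq0 => /eqP.
by [].
Qed.

(** The affine corrections found on the intervals ]-n-1, n+1[ coincide, so u equals almost
    everywhere a single function v with v'' = U u - w in the integrated sense; U u may then be
    replaced by U v under the integral. *)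
Theorem rgraph_adjoint u w : (forall i, sqint (u i)) -> (forall i, sqint (w i)) ->
  (forall f p h, rgraph f p h ->
    \int[mu]_x (\sum_i Jd 0 i * (h i x * u i x)) = \int[mu]_x (\sum_i Jd 0 i * (f i x * w i x))) ->
  exists v q, rgraph v q w /\ forall i, {ae mu, forall x, u i x = v i x}.
Proof.
move=> ui wi adj.
pose k i x := \sum_j U x i j * u j x - w i x.
have ki i : sqint (k i) by exact: sqint_U.
have /choice[P HP] : forall i, exists P, continuous P /\
    forall a b, a <= b -> P b - P a = \int[mu]_(x in `[a, b]) k i x.
  by move=> i; have [P cP PE] := ex_integral_fun (ki i); exists P.
pose G i := primitive (P i).
have GP i : der (G i) (P i) by apply: der_primitive; have [] := HP i.
have Gc i := der_continuous (GP i).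
have loc i (n : nat) : exists c : R * R,
    {ae mu, forall x, - n.+1%:R < x < n.+1%:R -> u i x = G i x + (c.1 + c.2 * x)}.
  have [_ PE] := HP i.
  have [al [bet H]] := @rgraph_local u w (G i) (P i) (k i) i n.+1%:R (ltr0Sn _ _) adj ui wi erefl (GP i) PE.
  by exists (al, bet).
have /choice[cf Hc] : forall i, exists c : R * R, {ae mu, forall x, u i x = G i x + (c.1 + c.2 * x)}.
  move=> i; have /choice[c Hc] := loc i; exists (c 0%N).
  (* An affine function is determined by its values at two points. The intervals [-1/2, -1/4] and
     [1/4, 1/2] each contain a point where both almost everywhere identities hold. *)
  have cE n : c n = c 0%N.
    have H := aeI (Hc n) (Hc 0%N).
    have n1 : 1 <= n.+1%:R :> R by rewrite ler1n.
    have [x /andP[x1 x2] [h1 h2]] := @ae_meets _ _ (- 2^-1) (- 4^-1) ltac:(lra) H.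
    have [y /andP[y1 y2] [h3 h4]] := @ae_meets _ _ (4^-1) (2^-1) ltac:(lra) H.
    have {}h1 : u i x = G i x + ((c n).1 + (c n).2 * x) by apply: h1; apply/andP; split; lra.
    have {}h2 : u i x = G i x + ((c 0%N).1 + (c 0%N).2 * x) by apply: h2; apply/andP; split; lra.
    have {}h3 : u i y = G i y + ((c n).1 + (c n).2 * y) by apply: h3; apply/andP; split; lra.
    have {}h4 : u i y = G i y + ((c 0%N).1 + (c 0%N).2 * y) by apply: h4; apply/andP; split; lra.
    have e2 : (c n).2 = (c 0%N).2.
      apply/eqP; rewrite -subr_eq0.
      have : ((c n).2 - (c 0%N).2) * (y - x) == 0 by apply/eqP; lra.
      rewrite mulf_eq0 => /orP[//|/eqP yx]; exfalso; lra.
    have e1 : (c n).1 = (c 0%N).1 by rewrite e2 in h1; lra.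
    by rewrite [LHS]surjective_pairing [RHS]surjective_pairing e1 e2.
  apply: (aeS _ (ae_foralln Hc)) => x h.
  have [n nx] : exists n : nat, `|x| < n.+1%:R by exists (Num.truncn `|x|); exact: truncnS_gt.
  by have := h n; rewrite cE; apply; rewrite -ltr_norml.
pose v i x := G i x + ((cf i).1 + (cf i).2 * x).
pose q i x := P i x + (cf i).2.
have vq i : der (v i) (q i).
  move=> x; apply: hasdD; first exact: GP.
  apply: hasd_eq (hasdD (hasd_cst _ _) (hasdZ _ (hasd_id x))) _.
  by rewrite add0r mulr1.
have mv i : measurable_fun setT (v i).
  by apply: continuous_measurable_fun; exact: der_continuous (vq i).
have vi i : sqint (v i) by apply: sqint_ae (mv i) (ui i) (Hc i).
exists v, q; split; last exact: Hc.
split => // i a b ab.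
have [_ PE] := HP i.
rewrite (_ : q i b - q i a = P i b - P i a); last by rewrite /q; ring.
rewrite PE//; apply: int_ae => //.
- by apply: measurable_funTS; have [] := ki i.
- by apply: measurable_funTS; have [] := sqint_U vi wi i.
have all : {ae mu, forall x, forall j, u j x = v j x}.
  have aea : forall s : seq 'I_d, {ae mu, forall x, forall j, j \in s -> u j x = v j x}.
    elim => [|j s IH]; first by apply: aeW => x j.
    apply: (aeS _ (aeI (Hc j) IH)) => x [h1 h2] j'; rewrite inE => /predU1P[->//|].
    exact: h2.
  by apply: (aeS _ (aea (enum 'I_d))) => x h j; apply: h; rewrite mem_enum.
by apply: (aeS _ all) => x h; rewrite /k; congr (_ - _); apply: eq_bigr => j _; rewrite h.
Qed.

End RealGraph.

(** * Self-adjointness for complex vector functions *)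

Section ComplexFunctions.
Variables (R : realType) (d : nat).
Local Notation C := R[i].
Local Notation mu := (@lebesgue_measure R).
Implicit Types f g h u w : R -> 'cV[C]_d.

Definition re f i x := complex.Re (f x i 0).
Definition im f i x := complex.Im (f x i 0).
Definition cvec (p q : 'I_d -> R -> R) x : 'cV[C]_d := \col_i (p i x +i* q i x)%C.

Lemma re_cvec p q : re (cvec p q) = p.
Proof. by apply/funext => i; apply/funext => x; rewrite /re mxE. Qed.

Lemma im_cvec p q : im (cvec p q) = q.
Proof. by apply/funext => i; apply/funext => x; rewrite /im mxE. Qed.

Lemma complexE (z : C) : z = (complex.Re z +i* complex.Im z)%C.
Proof. by case: z. Qed.

Lemma Re_sum (I : Type) (r : seq I) (P : pred I) (F : I -> C) :
  complex.Re (\sum_(i <- r | P i) F i) = \sum_(i <- r | P i) complex.Re (F i).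
Proof. by elim/big_rec2: _ => //= i x y _ <-; case: (F i); case: y. Qed.

Lemma Im_sum (I : Type) (r : seq I) (P : pred I) (F : I -> C) :
  complex.Im (\sum_(i <- r | P i) F i) = \sum_(i <- r | P i) complex.Im (F i).
Proof. by elim/big_rec2: _ => //= i x y _ <-; case: (F i); case: y. Qed.

Lemma ReB (z w : C) : complex.Re (z - w) = complex.Re z - complex.Re w.
Proof. by case: z; case: w. Qed.

Lemma ImB (z w : C) : complex.Im (z - w) = complex.Im z - complex.Im w.
Proof. by case: z; case: w. Qed.

Lemma Re_mulmx (A : 'M[R]_d) (v : 'cV[C]_d) i :
  complex.Re ((cmx A *m v) i 0) = \sum_j A i j * complex.Re (v j 0).
Proof.
rewrite mxE Re_sum; apply: eq_bigr => j _; rewrite mxE; case: (v j 0) => a b /=.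
by rewrite mul0r subr0.
Qed.

Lemma Im_mulmx (A : 'M[R]_d) (v : 'cV[C]_d) i :
  complex.Im ((cmx A *m v) i 0) = \sum_j A i j * complex.Im (v j 0).
Proof.
rewrite mxE Im_sum; apply: eq_bigr => j _; rewrite mxE; case: (v j 0) => a b /=.
by rewrite mul0r addr0.
Qed.

Lemma cderiveE f x i :
  cderive f x i 0 = (derive1 (Remx f) x i 0 +i* derive1 (Immx f) x i 0)%C.
Proof.
by rewrite !mxE; apply/eqP; rewrite eq_complex/= !(mul0r, mul1r, subr0, addr0, add0r, mulr0) !eqxx.
Qed.

Lemma der_cderive f : cderivable f ->
  forall i, der (re f i) (re (cderive f) i) /\ der (im f i) (im (cderive f) i).
Proof.
move=> fd i; split=> x; have [fr fi] := fd x; rewrite /re /im cderiveE/= derive1E.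
  have := (derivable_mxP _ _ _).1 fr i 0 => h.
  have := derive_mx fr => ->; rewrite mxE.
  have E : (fun x => Remx f x i 0) = re f i by apply/funext => y; rewrite mxE.
  by rewrite -[X in hasd X]/(re f i) -E; apply/derivableP.
have := (derivable_mxP _ _ _).1 fi i 0 => h.
have := derive_mx fi => ->; rewrite mxE.
have E : (fun x => Immx f x i 0) = im f i by apply/funext => y; rewrite mxE.
by rewrite -[X in hasd X]/(im f i) -E; apply/derivableP.
Qed.

Lemma cderivable_der f (p q : 'I_d -> R -> R) : (forall i, der (re f i) (p i)) ->
  (forall i, der (im f i) (q i)) -> cderivable f /\ cderive f = cvec p q.
Proof.
move=> fp fq; have fd : cderivable f.
  move=> x; split; apply/derivable_mxP => i j; rewrite (ord1 j).
    have -> : (fun x => Remx f x i 0) = re f i by apply/funext => y; rewrite mxE.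
    by have [] := fp i x.
  have -> : (fun x => Immx f x i 0) = im f i by apply/funext => y; rewrite mxE.
  by have [] := fq i x.
split => //; apply/funext => x; apply/colP => i; rewrite [LHS]complexE [RHS]mxE.
have [h1 h2] := der_cderive fd i; congr (_ +i* _)%C.
  by have [_ <-] := fp i x; have [_] := h1 x.
by have [_ <-] := fq i x; have [_] := h2 x.
Qed.

Lemma L2P f : L2 f <-> (forall i, sqint (re f i)) /\ (forall i, sqint (im f i)).
Proof.
split=> [h|[h1 h2] i].
  by split=> i; have [m1 m2 fi] := h i; (split; [by []|]);
    (apply: (@ig_le _ _ _ (fun x => complex.Re (f x i 0) ^+ 2 + complex.Im (f x i 0) ^+ 2)) => //;
     [exact: measurable_funX|by move=> x _; rewrite ger0_norm ?sqr_ge0// ?lerDl ?lerDr sqr_ge0]).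
by have [m1 i1] := h1 i; have [m2 i2] := h2 i; split => //; exact: igD.
Qed.

Variables (Jd : 'rV[R]_d) (U : R -> 'M[R]_d) (K : R).
Hypothesis Jpos : forall i, 0 < Jd 0 i.
Hypothesis cU : forall i j, continuous (fun x => U x i j).
Hypothesis UK : forall x i j, `|U x i j| <= K.
Hypothesis symU : forall x i j, Jd 0 i * U x i j = Jd 0 j * U x j i.

Lemma Re_integrand f h x i :
  complex.Re ((cmx (U x) *m f x - h x) i 0) = \sum_j U x i j * re f j x - re h i x.
Proof. by rewrite [in LHS]mxE [(- h x) _ _]mxE ReB Re_mulmx. Qed.

Lemma Im_integrand f h x i :
  complex.Im ((cmx (U x) *m f x - h x) i 0) = \sum_j U x i j * im f j x - im h i x.
Proof. by rewrite [in LHS]mxE [(- h x) _ _]mxE ImB Im_mulmx. Qed.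

Lemma schrodinger_graphP f h : schrodinger_graph U f h <->
  exists p q, rgraph U (re f) p (re h) /\ rgraph U (im f) q (im h).
Proof.
split=> [[/L2P[f1 f2] /L2P[h1 h2] fd fE]|[p [q [[f1 h1 fp pE] [f2 h2 fq qE]]]]].
  exists (re (cderive f)), (im (cderive f)); split; split => //.
  - by move=> i; have [] := der_cderive fd i.
  - move=> i a b ab; rewrite /re -ReB fE//=; apply: eq_Rintegral => x _.
    by rewrite Re_integrand.
  - by move=> i; have [] := der_cderive fd i.
  - move=> i a b ab; rewrite /im -ImB fE//=; apply: eq_Rintegral => x _.
    by rewrite Im_integrand.
have [fd fE] := cderivable_der fp fq; split => //; [exact/L2P|exact/L2P|].
move=> a b i ab; rewrite fE !mxE /cintegral [LHS]complexE/=; congr (_ +i* _)%C.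
  by rewrite pE//; apply: eq_Rintegral => x _; rewrite Re_integrand.
by rewrite qE//; apply: eq_Rintegral => x _; rewrite Im_integrand.
Qed.

Lemma Re_dotJ f g : complex.Re (dotJ Jd f g) =
  \int[mu]_x (\sum_i Jd 0 i * (re f i x * re g i x) + \sum_i Jd 0 i * (im f i x * im g i x)).
Proof.
rewrite /=; apply: eq_Rintegral => x _; rewrite Re_sum -big_split/=; apply: eq_bigr => i _.
by rewrite /re /im; case: (f x i 0) => a b; case: (g x i 0) => a' b' /=; ring.
Qed.

Lemma Im_dotJ f g : complex.Im (dotJ Jd f g) =
  \int[mu]_x (\sum_i Jd 0 i * (re f i x * im g i x) - \sum_i Jd 0 i * (im f i x * re g i x)).
Proof.
rewrite /=; apply: eq_Rintegral => x _; rewrite Im_sum -sumrB/=; apply: eq_bigr => i _.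
by rewrite /re /im; case: (f x i 0) => a b; case: (g x i 0) => a' b' /=; ring.
Qed.

Lemma ig_dot (a b : 'I_d -> R -> R) : (forall i, sqint (a i)) -> (forall i, sqint (b i)) ->
  ig setT (fun x => \sum_i Jd 0 i * (a i x * b i x)).
Proof. by move=> ai bi; apply: ig_sum => // i; apply: igZ => //; exact: sqint_mul. Qed.

Lemma ae_all (I : finType) (P : I -> R -> Prop) : (forall i, {ae mu, forall x, P i x}) ->
  {ae mu, forall x, forall i, P i x}.
Proof.
move=> h; have H : forall s : seq I, {ae mu, forall x, forall i, i \in s -> P i x}.
  elim=> [|j s IH]; first by apply: aeW => x j.
  apply: (aeS _ (aeI (h j) IH)) => x [h1 h2] i; rewrite inE => /predU1P[->//|].
  exact: h2.
by apply: (aeS _ (H (enum I))) => x h0 i; apply: h0; rewrite mem_enum.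
Qed.

(** Since J and U are real, real test functions suffice: the real and imaginary parts of the adjoint
    relation are the real adjoint relations for the real and imaginary parts of (u, w). *)
Theorem self_adjoint_symmetric : self_adjoint Jd U.
Proof.
move=> u w u2 w2; have [u2r u2i] := (L2P u).1 u2; have [w2r w2i] := (L2P w).1 w2; split.
  move=> adj.
  have adjr (f p h : 'I_d -> R -> R) : rgraph U f p h -> dotJ Jd (cvec h (fun=> fun=> 0)) u = dotJ Jd (cvec f (fun=> fun=> 0)) w.
    move=> G; apply: adj; apply/schrodinger_graphP; exists p, (fun=> fun=> 0).
    rewrite !re_cvec !im_cvec; split => //; split => //; try (by move=> ?; exact: sqint0).
      by move=> i x; exact: hasd_cst.
    move=> i a b _; rewrite subrr (@eq_Rintegral _ _ _ mu _ (fun=> 0)).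
      by rewrite Rintegral_cst// mul0r.
    by move=> x _; rewrite subr0 big1// => j _; rewrite mulr0.
  have z0 (a : 'I_d -> R -> R) x : \sum_i Jd 0 i * ((fun=> fun=> 0) i x * a i x) = 0 :> R.
    by rewrite big1// => i _; rewrite mul0r mulr0.
  have [vr [qr [Gr Er]]] : exists v q, rgraph U v q (re w) /\ forall i, {ae mu, forall x, re u i x = v i x}.
    apply: (@rgraph_adjoint _ _ Jd U K) => // f p h /adjr/(congr1 (@complex.Re R)).
    rewrite !Re_dotJ !re_cvec !im_cvec => E.
    transitivity (\int[mu]_x (\sum_i Jd 0 i * (h i x * re u i x) + \sum_i Jd 0 i * ((fun=> fun=> 0) i x * im u i x))).
      by apply: eq_Rintegral => x _; rewrite z0 addr0.
    by rewrite E; apply: eq_Rintegral => x _; rewrite z0 addr0.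
  have [vi [qi [Gi Ei]]] : exists v q, rgraph U v q (im w) /\ forall i, {ae mu, forall x, im u i x = v i x}.
    apply: (@rgraph_adjoint _ _ Jd U K) => // f p h /adjr/(congr1 (@complex.Im R)).
    rewrite !Im_dotJ !re_cvec !im_cvec => E.
    transitivity (\int[mu]_x (\sum_i Jd 0 i * (h i x * im u i x) - \sum_i Jd 0 i * ((fun=> fun=> 0) i x * re u i x))).
      by apply: eq_Rintegral => x _; rewrite z0 subr0.
    by rewrite E; apply: eq_Rintegral => x _; rewrite z0 subr0.
  exists (cvec vr vi).
    by apply/schrodinger_graphP; exists qr, qi; rewrite re_cvec im_cvec.
  apply: (aeS _ (aeI (ae_all Er) (ae_all Ei))) => x [h1 h2]; apply/colP => i.
  by rewrite mxE [LHS]complexE -h1 -h2.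
move=> [v Gv uv] f h Gf.
have [_ [_ [[v2r _ _ _] [v2i _ _ _]]]] := (schrodinger_graphP v w).1 Gv.
have [p [q [Gr Gi]]] := (schrodinger_graphP f h).1 Gf.
have [p' [q' [Gr' Gi']]] := (schrodinger_graphP v w).1 Gv.
have [f2r h2r _ _] := Gr; have [f2i h2i _ _] := Gi.
have sym := rgraph_sym Jpos cU UK symU.
rewrite [LHS]complexE [RHS]complexE !Re_dotJ !Im_dotJ; congr (_ +i* _)%C.
  transitivity (\int[mu]_x (\sum_i Jd 0 i * (re h i x * re v i x) + \sum_i Jd 0 i * (im h i x * im v i x))).
    apply: int_ae => //.
    - by apply: ig_measurable; apply: igD => //; exact: ig_dot.
    - by apply: ig_measurable; apply: igD => //; exact: ig_dot.
    - by apply: (aeS _ uv) => x; rewrite /re /im => ->.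
  rewrite !RintegralD//; try exact: ig_dot.
  by rewrite (sym _ _ _ _ _ _ Gr Gr') ?(sym _ _ _ _ _ _ Gi Gi').
transitivity (\int[mu]_x (\sum_i Jd 0 i * (re h i x * im v i x) - \sum_i Jd 0 i * (im h i x * re v i x))).
  apply: int_ae => //.
  - by apply: ig_measurable; apply: igB => //; exact: ig_dot.
  - by apply: ig_measurable; apply: igB => //; exact: ig_dot.
  - by apply: (aeS _ uv) => x; rewrite /re /im => ->.
rewrite !RintegralB//; try exact: ig_dot.
by rewrite (sym _ _ _ _ _ _ Gr Gi') ?(sym _ _ _ _ _ _ Gi Gr').
Qed.

End ComplexFunctions.

(** * The fundamental matrix of a pencil of linear systems *)

Section ComplexODE.
Variable R : realType.
Local Notation C := R[i].
Implicit Types (f g : R -> C) (z w : C).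

Definition cdr f f' := der (fun x => complex.Re (f x)) (fun x => complex.Re (f' x)) /\
  der (fun x => complex.Im (f x)) (fun x => complex.Im (f' x)).

Lemma cdr_eq f f' g' : cdr f f' -> f' =1 g' -> cdr f g'.
Proof. by move=> h /funext <-. Qed.

Lemma cdrD f f' g g' : cdr f f' -> cdr g g' -> cdr (fun x => f x + g x) (fun x => f' x + g' x).
Proof.
move=> [f1 f2] [g1 g2]; split=> x.
  apply: hasd_ext (hasd_eq (hasdD (f1 x) (g1 x)) _); last by rewrite ReD.
  by move=> y; rewrite ReD.
apply: hasd_ext (hasd_eq (hasdD (f2 x) (g2 x)) _); last by rewrite ImD.
by move=> y; rewrite ImD.
Qed.

Lemma cdrM f f' g g' : cdr f f' -> cdr g g' ->
  cdr (fun x => f x * g x) (fun x => f' x * g x + f x * g' x).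
Proof.
move=> [f1 f2] [g1 g2]; split=> x.
  apply: hasd_ext (hasd_eq (hasdB (hasdM (f1 x) (g1 x)) (hasdM (f2 x) (g2 x))) _).
    by move=> y; case: (f y) => a b; case: (g y).
  by case: (f x) (f' x) (g x) (g' x) => [? ?] [? ?] [? ?] [? ?] /=; ring.
apply: hasd_ext (hasd_eq (hasdD (hasdM (f1 x) (g2 x)) (hasdM (f2 x) (g1 x))) _).
  by move=> y; case: (f y) => a b; case: (g y).
by case: (f x) (f' x) (g x) (g' x) => [? ?] [? ?] [? ?] [? ?] /=; ring.
Qed.

Lemma cdr_cst z : cdr (fun=> z) (fun=> 0).
Proof. by split=> x; exact: hasd_cst. Qed.

Lemma cdrZ z f f' : cdr f f' -> cdr (fun x => z * f x) (fun x => z * f' x).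
Proof.
by move=> h; apply: cdr_eq (cdrM (cdr_cst z) h) _ => x; rewrite mul0r add0r.
Qed.

Lemma cdrB f f' g g' : cdr f f' -> cdr g g' -> cdr (fun x => f x - g x) (fun x => f' x - g' x).
Proof.
move=> h k; have -> : (fun x => f x - g x) = (fun x => f x + -1 * g x).
  by apply/funext => x; rewrite mulN1r.
by apply: cdr_eq (cdrD h (cdrZ (-1) k)) _ => x; rewrite mulN1r.
Qed.

Lemma cdr_real (f f' : R -> R) : der f f' -> cdr (fun x => (f x)%:C) (fun x => (f' x)%:C).
Proof. by move=> h; split => //= x; exact: hasd_cst. Qed.

Lemma cdr_sum (I : Type) (r : seq I) (F F' : I -> R -> C) : (forall i, cdr (F i) (F' i)) ->
  cdr (fun x => \sum_(i <- r) F i x) (fun x => \sum_(i <- r) F' i x).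
Proof.
move=> h; elim: r => [|i r IH].
  rewrite (_ : (fun x => _) = (fun=> 0)); last by apply/funext => x; rewrite big_nil.
  by apply: cdr_eq (cdr_cst 0) _ => x; rewrite big_nil.
rewrite (_ : (fun x => _) = (fun x => F i x + \sum_(j <- r) F j x)); last first.
  by apply/funext => x; rewrite big_cons.
by apply: cdr_eq (cdrD (h i) IH) _ => x; rewrite big_cons.
Qed.

Lemma cdr_pcont f f' : cdr f f' -> pcont f.
Proof. by move=> [h1 h2]; split; [exact: der_continuous h1|exact: der_continuous h2]. Qed.

Lemma cdr0_cst f : cdr f (fun=> 0) -> forall x, f x = f 0.
Proof.
move=> [h1 h2] x; apply: eq_complexP.
  exact: (der_unique h1 (fun y => hasd_cst (complex.Re (f 0)) y) erefl).
exact: (der_unique h2 (fun y => hasd_cst (complex.Im (f 0)) y) erefl).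
Qed.

Lemma sqr_sum_le (I : finType) (a : I -> R) : (forall i, 0 <= a i) ->
  (\sum_i a i) ^+ 2 <= #|I|%:R * \sum_i a i ^+ 2.
Proof.
move=> a0; rewrite expr2 big_distrlr/=.
apply: (@le_trans _ _ (\sum_i \sum_j (a i ^+ 2 + a j ^+ 2) / 2)).
  by apply: ler_sum => i _; apply: ler_sum => j _; have := sqr_ge0 (a i - a j); nra.
rewrite le_eqVlt; apply/orP; left; apply/eqP.
transitivity (\sum_i ((a i ^+ 2 *+ #|I| + \sum_j a j ^+ 2) / 2)).
  by apply: eq_bigr => i _; rewrite -mulr_suml big_split/= sumr_const.
rewrite -mulr_suml big_split/= sumr_const sumrMnl; set S := \sum_i _.
change ((S *+ #|I| + S *+ #|I|) / 2 = #|I|%:R * S).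
by rewrite -mulr_natl; field.
Qed.

(** Gronwall for the sum of squared moduli. The factor [#|I|] comes from Cauchy-Schwarz, the
    hypothesis being on sums of moduli, and the 2 from differentiating a square. *)
Lemma cgronwall (I : finType) (f f' : I -> R -> C) (K : R) : 0 <= K ->
  (forall i, cdr (f i) (f' i)) ->
  (forall i x, cn (f' i x) <= K * \sum_j cn (f j x)) ->
  forall x, \sum_i cn (f i x) ^+ 2 <= (\sum_i cn (f i 0) ^+ 2) * expR ((2 * K * #|I|%:R) * `|x|).
Proof.
move=> K0 ff' fK.
pose N' x := \sum_i 2 * (complex.Re (f i x) * complex.Re (f' i x) + complex.Im (f i x) * complex.Im (f' i x)).
apply: (@le_expR_of_derive _ _ N').
- move=> x; apply: hasd_sum => i _; have [h1 h2] := ff' i.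
  apply: (@hasd_ext _ (fun y => complex.Re (f i y) * complex.Re (f i y) + complex.Im (f i y) * complex.Im (f i y))).
    by move=> y; rewrite sqr_cn !expr2.
  apply: hasd_eq (hasdD (hasdM (h1 x) (h1 x)) (hasdM (h2 x) (h2 x))) _; ring.
- by move=> x; apply: sumr_ge0 => i _; exact: sqr_ge0.
- move=> x; rewrite /N' (le_trans (ler_norm_sum _ _ _))//.
  set S := \sum_j cn (f j x).
  apply: (@le_trans _ _ (2 * K * S ^+ 2)); last first.
    rewrite -(mulrA (2 * K)); apply: ler_wpM2l; first by rewrite mulr_ge0.
    by apply: sqr_sum_le => i; exact: cn_ge0.
  rewrite expr2 mulrA mulr_sumr; apply: ler_sum => i _.
  rewrite normrM [`|2|]ger0_norm//.
  have -> : 2 * K * S * cn (f i x) = 2 * (cn (f i x) * (K * S)) by ring.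
  rewrite ler_pM2l//; apply: (@le_trans _ _ (cn (f i x) * cn (f' i x))); last first.
    by rewrite ler_wpM2l ?cn_ge0// fK.
  have -> : complex.Re (f i x) * complex.Re (f' i x) + complex.Im (f i x) * complex.Im (f' i x) =
      complex.Re ((f i x)^* * f' i x).
    by case: (f i x) (f' i x) => [? ?] [? ?] /=; ring.
  by rewrite (le_trans (Re_le_cn _))// cnM cnJ.
Qed.

Lemma cn_sum_mul_le (I : finType) (b y : I -> C) K : (forall j, cn (b j) <= K) ->
  cn (\sum_j b j * y j) <= K * \sum_j cn (y j).
Proof.
move=> bK; rewrite (le_trans (cn_sum _ _ _))// mulr_sumr; apply: ler_sum => j _.
by rewrite cnM ler_wpM2r ?cn_ge0.
Qed.

Lemma cgronwall0 (I : finType) (f f' : I -> R -> C) (K : R) : 0 <= K ->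
  (forall i, cdr (f i) (f' i)) ->
  (forall i x, cn (f' i x) <= K * \sum_j cn (f j x)) ->
  (forall i, f i 0 = 0) -> forall i x, f i x = 0.
Proof.
move=> K0 ff' fK f0 i x; have := cgronwall K0 ff' fK x.
rewrite [X in _ <= X * _]big1 ?mul0r; last by move=> j _; rewrite f0 cn0 expr0n.
move=> h; apply/eqP; rewrite -cn_eq0 -sqrf_eq0 eq_le sqr_ge0 andbT.
apply: le_trans h; rewrite (bigD1 i)//= lerDl sumr_ge0// => j _; exact: sqr_ge0.
Qed.

(** Real and imaginary parts are indexed by the two copies of I in [I + I], which turns the system
    into a real one. *)
Lemma ex_clinear_ode (I : finType) (B : I -> I -> R -> C) (K : R) (y0 : I -> C) :
  (forall i j, pcont (B i j)) -> (forall i j x, cn (B i j x) <= K) ->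
  exists2 y : I -> R -> C, (forall i, y i 0 = y0 i) &
    forall i, cdr (y i) (fun x => \sum_j B i j x * y j x).
Proof.
move=> cB BK.
pose b (p q : I + I) (x : R) : R := match p, q with
  | inl i, inl j => complex.Re (B i j x) | inl i, inr j => - complex.Im (B i j x)
  | inr i, inl j => complex.Im (B i j x) | inr i, inr j => complex.Re (B i j x) end.
have cb p q : continuous (b p q).
  case: p q => i [] j; have [h1 h2] := cB i j; rewrite /b //.
  by move=> x; apply: cvgN; exact: h2.
have bK p q x : `|b p q x| <= K.
  by case: p q => i [] j; rewrite /b ?normrN; apply: le_trans (BK i j x);
    rewrite ?Re_le_cn ?Im_le_cn.
have [y yi yE] := ex_linear_ode (fun p : I + I => match p with
  inl i => complex.Re (y0 i) | inr i => complex.Im (y0 i) end) cb bK.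
exists (fun i x => y (inl i) x +i* y (inr i) x)%C.
  by move=> i; rewrite !yi; case: (y0 i).
move=> i; split=> x /=.
  apply: hasd_eq (yE (inl i) x) _; rewrite big_sumType/= Re_sum -big_split/=.
  by apply: eq_bigr => j _; case: (B i j x) => ? ? /=; ring.
apply: hasd_eq (yE (inr i) x) _; rewrite big_sumType/= Im_sum -big_split/=.
by apply: eq_bigr => j _; case: (B i j x) => ? ? /=; ring.
Qed.

Lemma cn_nat (b : bool) : cn (b%:R : C) <= 1.
Proof. by case: b; rewrite ?cn0//= -[1]/(1%:C) cnR normr1. Qed.

Section LinearFamily.
Variables (I : finType) (A B : I -> I -> R -> C) (K : R).
Hypothesis K0 : 0 <= K.
Hypothesis cA : forall i j, pcont (A i j).
Hypothesis cB : forall i j, pcont (B i j).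
Hypothesis AK : forall i j x, cn (A i j x) <= K.
Hypothesis BK : forall i j x, cn (B i j x) <= K.

Definition pencil mu i j x := mu * A i j x + B i j x.

Lemma pencil_cont mu i j : pcont (pencil mu i j).
Proof. by apply: pcontD => //; apply: pcontM => //; exact: pcont_cst. Qed.

Lemma pencil_le mu i j x (r : R) : cn mu <= r -> cn (pencil mu i j x) <= (r + 1) * K.
Proof.
move=> mr; rewrite (le_trans (cnD _ _))// cnM mulrDl mul1r lerD//.
by rewrite ler_pM ?cn_ge0.
Qed.

Definition solves mu (y : I -> R -> C) :=
  forall i, cdr (y i) (fun x => \sum_j pencil mu i j x * y j x).

Lemma solves_unique mu y1 y2 : solves mu y1 -> solves mu y2 ->
  (forall i, y1 i 0 = y2 i 0) -> forall i x, y1 i x = y2 i x.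
Proof.
move=> s1 s2 y12 i x; apply/eqP; rewrite -subr_eq0; apply/eqP.
have r0 : 0 <= (cn mu + 1) * K by rewrite mulr_ge0// addr_ge0// cn_ge0.
apply: (@cgronwall0 _ (fun i x => y1 i x - y2 i x) _ _ r0 (fun i => cdrB (s1 i) (s2 i))).
  move=> {}i {}x; rewrite -sumrB (eq_bigr (fun j => pencil mu i j x * (y1 j x - y2 j x))).
    by apply: cn_sum_mul_le => j; exact: pencil_le.
  by move=> j _; rewrite mulrBr.
by move=> j; rewrite y12 subrr.
Qed.

(** Holomorphy in mu is the delicate clause. The candidate derivative solves the variational
    equation, and Gronwall shows that the remainder of the first-order expansion is O(h^2). *)
Theorem ex_fundamental : exists X : R -> C -> I -> I -> C,
  [/\ forall mu i k, X 0 mu i k = (i == k)%:R,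
      forall mu k, solves mu (fun i x => X x mu i k) &
      forall x mu i k, holo (fun mu => X x mu i k) mu].
Proof.
have /choice[Y HY] : forall p : C * I, exists y : I -> R -> C,
    (forall i, y i 0 = (i == p.2)%:R) /\ solves p.1 y.
  move=> [mu k]; have [y y0 yE] := ex_clinear_ode (fun i => (i == k)%:R)
    (pencil_cont mu) (fun i j x => @pencil_le mu i j x (cn mu) (lexx _)).
  by exists y.
exists (fun x mu i k => Y (mu, k) i x); split.
- by move=> mu i k; have [-> _] := HY (mu, k).
- by move=> mu k; have [_] := HY (mu, k).
move=> x mu i k.
have [Y0 YE] := HY (mu, k).
pose L := (cn mu + 1 + 1) * K.
have L0 : 0 <= L by rewrite mulr_ge0// !addr_ge0// cn_ge0.
have pL h a b t : cn h <= 1 -> cn (pencil (mu + h) a b t) <= L.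
  by move=> h1; apply: pencil_le; rewrite (le_trans (cnD _ _))// lerD2l.
have pL0 a b t : cn (pencil mu a b t) <= L.
  by apply: pencil_le; rewrite lerDl.
have AL a b t : cn (A a b t) <= L.
  by rewrite (le_trans (AK _ _ _))// ler_peMl// lerDr addr_ge0 ?cn_ge0.
(* Block triangular system of the equation and its variational equation Z' = pencil Z + A Y; by
   uniqueness its first half is Y. *)
pose W (p q : I + I) t := match p, q with
  | inl a, inl b => pencil mu a b t | inl a, inr b => 0
  | inr a, inl b => A a b t | inr a, inr b => pencil mu a b t end.
have cW p q : pcont (W p q).
  by case: p q => a [] b //=; [exact: pencil_cont|exact: pcont_cst|exact: cA|exact: pencil_cont].
have WL p q t : cn (W p q t) <= L by case: p q => a [] b //=; rewrite cn0.
have [V V0 VE] := ex_clinear_ode (fun p : I + I => if p is inl a then (a == k)%:R else 0) cW WL.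
have V1 : solves mu (fun a => V (inl a)).
  move=> a; apply: cdr_eq (VE (inl a)) _ => t; rewrite big_sumType/= [X in _ + X]big1 ?addr0//.
  by move=> b _; rewrite mul0r.
have VY a t : V (inl a) t = Y (mu, k) a t.
  by apply: (solves_unique V1 YE) => b; rewrite V0 Y0.
pose Z a t := V (inr a) t.
have ZE a : cdr (Z a) (fun t => \sum_b A a b t * Y (mu, k) b t + \sum_b pencil mu a b t * Z b t).
  apply: cdr_eq (VE (inr a)) _ => t; rewrite big_sumType/=; congr (_ + _).
  by apply: eq_bigr => b _; rewrite VY.
pose c := 2 * (2 * L) * #|{: I + (I + I)}|%:R.
pose Q := expR (c * `|x|).
have est h : cn h <= 1 -> cn (Y (mu + h, k) i x - Y (mu, k) i x - h * Z i x) ^+ 2 <= (cn h ^+ 2) ^+ 2 * Q.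
  move=> h1; have [Yh0 YhE] := HY (mu + h, k).
  (* The remainder, h times the increment and h^2 times the perturbed solution form a closed linear
     system with coefficients bounded uniformly for |h| <= 1. Only the last has a nonzero initial
     value, of modulus |h|^2, so the remainder is of that order. *)
  pose F (p : I + (I + I)) t := match p with
    | inl a => Y (mu + h, k) a t - Y (mu, k) a t - h * Z a t
    | inr (inl a) => h * (Y (mu + h, k) a t - Y (mu, k) a t)
    | inr (inr a) => h ^+ 2 * Y (mu + h, k) a t end.
  pose F' (p : I + (I + I)) t := match p with
    | inl a => \sum_b pencil mu a b t * F (inl b) t + \sum_b A a b t * F (inr (inl b)) t
    | inr (inl a) => \sum_b pencil mu a b t * F (inr (inl b)) t + \sum_b A a b t * F (inr (inr b)) t
    | inr (inr a) => \sum_b pencil (mu + h) a b t * F (inr (inr b)) t end.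
  have FF' p : cdr (F p) (F' p).
    case: p => [a|[a|a]] /=.
    - apply: cdr_eq (cdrB (cdrB (YhE a) (YE a)) (cdrZ h (ZE a))) _ => t.
      rewrite /F' -!big_split/= mulr_sumr -!sumrB; apply: eq_bigr => b _.
      by rewrite /F /pencil; ring.
    - apply: cdr_eq (cdrZ h (cdrB (YhE a) (YE a))) _ => t.
      rewrite /F' -big_split/= -sumrB mulr_sumr; apply: eq_bigr => b _.
      by rewrite /F /pencil; ring.
    - apply: cdr_eq (cdrZ (h ^+ 2) (YhE a)) _ => t.
      by rewrite !mulr_sumr; apply: eq_bigr => b _; rewrite /F; ring.
  have SF t : \sum_p cn (F p t) = \sum_b cn (F (inl b) t) +
      (\sum_b cn (F (inr (inl b)) t) + \sum_b cn (F (inr (inr b)) t)).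
    by rewrite !big_sumType.
  have pos (G : I -> C) : 0 <= \sum_b cn (G b) by apply: sumr_ge0 => b _; exact: cn_ge0.
  have F'L p t : cn (F' p t) <= 2 * L * \sum_q cn (F q t).
    rewrite SF; have p1 := pos (fun b => F (inl b) t); have p2 := pos (fun b => F (inr (inl b)) t).
    have p3 := pos (fun b => F (inr (inr b)) t).
    case: p => [a|[a|a]] /=.
    - rewrite (le_trans (cnD _ _))//.
      have := cn_sum_mul_le (fun b => F (inl b) t) (fun b => pL0 a b t).
      have := cn_sum_mul_le (fun b => F (inr (inl b)) t) (fun b => AL a b t).
      by rewrite /F in p1 p2 p3 *; nra.
    - rewrite (le_trans (cnD _ _))//.
      have := cn_sum_mul_le (fun b => F (inr (inl b)) t) (fun b => pL0 a b t).
      have := cn_sum_mul_le (fun b => F (inr (inr b)) t) (fun b => AL a b t).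
      by rewrite /F in p1 p2 p3 *; nra.
    - have := cn_sum_mul_le (fun b => F (inr (inr b)) t) (fun b => pL h a b t h1).
      by rewrite /F in p1 p2 p3 *; nra.
  have L20 : 0 <= 2 * L by rewrite mulr_ge0.
  have := cgronwall L20 FF' F'L x.
  have -> : \sum_p cn (F p 0) ^+ 2 = (cn h ^+ 2) ^+ 2.
    rewrite !big_sumType/= big1 ?add0r; last first.
      by move=> a _; rewrite Yh0 Y0 /Z V0 mulr0 subrr subr0 cn0 expr0n.
    rewrite big1 ?add0r; last by move=> a _; rewrite Yh0 Y0 subrr mulr0 cn0 expr0n.
    rewrite (bigD1 k)//= big1 ?addr0; last first.
      by move=> a /negbTE ak; rewrite Yh0 /= ak mulr0 cn0 expr0n.
    by rewrite Yh0 /= eqxx mulr1 cnX.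
  rewrite -/c -/Q; apply: le_trans.
  rewrite (bigD1 (inl i))//= lerDl; apply: sumr_ge0 => p _; exact: sqr_ge0.
exists (Z i x) => e e0.
have Q0 : 0 <= Q by exact: expR_ge0.
exists (Num.min 1 (e / (1 + Q))); first by rewrite lt_min ltr01 divr_gt0// ltr_pwDl.
move=> h; rewrite lt_min => /andP[/ltW h1]; rewrite ltr_pdivlMr ?ltr_pwDl// => he.
have := est h h1; rewrite (mulrC h) => hh.
have h0 := cn_ge0 h.
have : cn (Y (mu + h, k) i x - Y (mu, k) i x - Z i x * h) <= cn h ^+ 2 * (1 + Q).
  rewrite -(@ler_pXn2r _ 2)// ?nnegrE ?cn_ge0 ?mulr_ge0 ?sqr_ge0 ?addr_ge0//.
  apply: le_trans hh _; rewrite [leRHS]exprMn; apply: ler_wpM2l; first exact: sqr_ge0.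
  by nra.
move/le_trans; apply.
rewrite (_ : cn h ^+ 2 * (1 + Q) = (cn h * (1 + Q)) * cn h); last by ring.
by apply: ler_wpM2r => //; exact: ltW.
Qed.

End LinearFamily.

Lemma cexpD z w : cexp (z + w) = cexp z * cexp w.
Proof.
rewrite /cexp ReD ImD expRD cosD sinD; apply: eq_complexP => /=; ring.
Qed.

Lemma cexp0 : cexp (0 : C) = 1.
Proof. by rewrite /cexp/= expR0 cos0 sin0; apply: eq_complexP => /=; ring. Qed.

Lemma cn_cexp z : cn (cexp z) = expR (complex.Re z).
Proof.
rewrite /cexp cnM cnR ger0_norm ?expR_ge0// /cn/= cos2Dsin2 sqrtr1 mulr1.
by [].
Qed.

Lemma cdr_cexp w : cdr (fun x => cexp (x%:C * w)) (fun x => w * cexp (x%:C * w)).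
Proof.
case: w => a b.
have E x : cexp (x%:C * (a +i* b)%C) = (expR (a * x) * cos (b * x + 0) +i* (expR (a * x) * sin (b * x + 0)))%C.
  rewrite /cexp Re_scale Im_scale/= !addr0 (mulrC x a) (mulrC x b).
  by apply: eq_complexP => /=; ring.
have ec x := @hasd_comp R cos (fun y => b * y + 0) x _ _ (is_derive_cos (b * x + 0)) (hasd_lin b 0 x).
have es x := @hasd_comp R sin (fun y => b * y + 0) x _ _ (is_derive_sin (b * x + 0)) (hasd_lin b 0 x).
split=> x.
  apply: (@hasd_ext _ (fun x => expR (a * x) * cos (b * x + 0))); first by move=> y; rewrite E.
  by apply: hasd_eq (hasdM (hasd_exp a x) (ec x)) _; rewrite E/=; ring.
apply: (@hasd_ext _ (fun x => expR (a * x) * sin (b * x + 0))); first by move=> y; rewrite E.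
by apply: hasd_eq (hasdM (hasd_exp a x) (es x)) _; rewrite E/=; ring.
Qed.

(** cexp mu is the value at x = 1 of the solution of the scalar equation y' = mu y with y(0) = 1, so
    holomorphy follows from [ex_fundamental]. *)
Lemma holo_cexp z : holo (@cexp R) z.
Proof.
have c1 : forall i j : unit, pcont (fun _ : R => 1 : C) by move=> _ _; exact: pcont_cst.
have c0 : forall i j : unit, pcont (fun _ : R => 0 : C) by move=> _ _; exact: pcont_cst.
have k1 : forall (i j : unit) (x : R), cn (1 : C) <= 1 by move=> _ _ _; exact: (cn_nat true).
have k0 : forall (i j : unit) (x : R), cn (0 : C) <= 1 by move=> _ _ _; rewrite cn0.
have [X [X0 XE XH]] := @ex_fundamental unit (fun _ _ _ => 1) (fun _ _ _ => 0) 1 ler01 c1 c0 k1 k0.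
have E mu : cexp mu = X 1 mu tt tt.
  have s : solves (fun _ _ _ => 1) (fun _ _ _ => 0) mu (fun (_ : unit) x => cexp (x%:C * mu)).
    move=> i; apply: cdr_eq (cdr_cexp mu) _ => x.
    by rewrite (bigD1 tt)//= big1 ?addr0 /pencil ?addr0 ?mulr1// => -[].
  have := solves_unique ler01 k1 k0 s (XE mu tt) _ tt 1; rewrite /= mul1r; apply.
  by move=> [] /=; rewrite mul0r cexp0 X0 eqxx.
by have := XH 1 z tt tt; rewrite (_ : (fun mu => _) = @cexp R)//; apply/funext => mu; rewrite E.
Qed.

End ComplexODE.

Lemma mxDE (V : nmodType) m n (A B : 'M[V]_(m, n)) i j : (A + B) i j = A i j + B i j.
Proof. by rewrite mxE. Qed.

Lemma mxBE (V : zmodType) m n (A B : 'M[V]_(m, n)) i j : (A - B) i j = A i j - B i j.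
Proof. by rewrite !mxE. Qed.

Lemma trmxBB (V : zmodType) m n (A B D E : 'M[V]_(m, n)) :
  (A - B - (D - E))^T = A^T - B^T - (D^T - E^T).
Proof. by apply/matrixP => i j; rewrite !mxE. Qed.

Lemma mxZE (K : pzRingType) m n (a : K) (A : 'M[K]_(m, n)) i j : (a *: A) i j = a * A i j.
Proof. by rewrite mxE. Qed.

(** * Entrywise derivatives, continuity and bounds of matrix functions *)

Section MatrixDerivative.
Variable R : realType.

Definition mder m n (A A' : R -> 'M[R]_(m, n)) :=
  forall i j, der (fun x => A x i j) (fun x => A' x i j).

Lemma mder_eq m n (A A' B' : R -> 'M[R]_(m, n)) : mder A A' -> A' =1 B' -> mder A B'.
Proof. by move=> h /funext <-. Qed.

Lemma mderD m n (A A' B B' : R -> 'M[R]_(m, n)) : mder A A' -> mder B B' ->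
  mder (fun x => A x + B x) (fun x => A' x + B' x).
Proof.
move=> hA hB i j x; apply: hasd_ext (hasd_eq (hasdD (hA i j x) (hB i j x)) _).
  by move=> y; rewrite mxE.
by rewrite mxE.
Qed.

Lemma mderN m n (A A' : R -> 'M[R]_(m, n)) : mder A A' -> mder (fun x => - A x) (fun x => - A' x).
Proof.
move=> hA i j x; apply: hasd_ext (hasd_eq (hasdN (hA i j x)) _).
  by move=> y; rewrite mxE.
by rewrite mxE.
Qed.

Lemma mderB m n (A A' B B' : R -> 'M[R]_(m, n)) : mder A A' -> mder B B' ->
  mder (fun x => A x - B x) (fun x => A' x - B' x).
Proof. by move=> hA hB; apply: mderD => //; exact: mderN. Qed.

Lemma mder_cst m n (A : 'M[R]_(m, n)) : mder (fun=> A) (fun=> 0).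
Proof. by move=> i j x; rewrite mxE; exact: hasd_cst. Qed.

Lemma mderM m n p (A A' : R -> 'M[R]_(m, n)) (B B' : R -> 'M[R]_(n, p)) : mder A A' -> mder B B' ->
  mder (fun x => A x *m B x) (fun x => A' x *m B x + A x *m B' x).
Proof.
move=> hA hB i j x.
apply: (@hasd_ext _ (fun y => \sum_k A y i k * B y k j)); first by move=> y; rewrite mxE.
apply: hasd_eq (hasd_sum _ (fun k _ => hasdM (hA i k x) (hB k j x))) _.
by rewrite !mxE -big_split/=; apply: eq_bigr => k _; rewrite addrC; ring.
Qed.

Lemma mderMr m n p (A A' : R -> 'M[R]_(m, n)) (B : 'M[R]_(n, p)) : mder A A' ->
  mder (fun x => A x *m B) (fun x => A' x *m B).
Proof. by move=> hA; apply: mder_eq (mderM hA (mder_cst B)) _ => x; rewrite mulmx0 addr0. Qed.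

Lemma mderT m n (A A' : R -> 'M[R]_(m, n)) : mder A A' ->
  mder (fun x => (A x)^T) (fun x => (A' x)^T).
Proof.
move=> hA i j x; apply: hasd_ext (hasd_eq (hA j i x) _); last by rewrite mxE.
by move=> y; rewrite mxE.
Qed.

Lemma mder_tr n (A A' : R -> 'M[R]_n) : mder A A' ->
  der (fun x => \tr (A x)) (fun x => \tr (A' x)).
Proof. by move=> hA x; apply: hasd_sum => i _; exact: hA. Qed.

Lemma mder_derive m n (A A' : R -> 'M[R]_(m, n)) : (forall x : R, is_derive x 1 A (A' x)) ->
  mder A A'.
Proof.
move=> h i j x; have [dA AE] := h x.
have := (derivable_mxP _ _ _).1 dA i j => hd.
by have := derive_mx dA; rewrite AE => ->; rewrite mxE; apply/derivableP.
Qed.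

Lemma derive1_mder m n (A A' : R -> 'M[R]_(m, n)) x : mder A A' -> derive1 A x = A' x.
Proof.
move=> h; have dA : derivable A x 1.
  by apply/derivable_mxP => i j; have [] := h i j x.
rewrite derive1E derive_mx//; apply/matrixP => i j; rewrite mxE.
by have [_] := h i j x.
Qed.

Lemma der0_cst (f : R -> R) : der f (fun=> 0) -> forall x, f x = f 0.
Proof. by move=> h x; exact: (der_unique h (fun y => hasd_cst (f 0) y) erefl). Qed.

Definition mcont m n (A : R -> 'M[R]_(m, n)) := forall i j, continuous (fun x => A x i j).

Lemma mcont_mder m n (A A' : R -> 'M[R]_(m, n)) : mder A A' -> mcont A.
Proof. by move=> h i j; exact: der_continuous (h i j). Qed.

Lemma mcontD m n (A B : R -> 'M[R]_(m, n)) : mcont A -> mcont B -> mcont (fun x => A x + B x).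
Proof.
move=> hA hB i j; rewrite (_ : (fun x => _) = (fun x => A x i j + B x i j)).
  by move=> x; apply: cvgD; [exact: hA|exact: hB].
by apply/funext => x; rewrite mxE.
Qed.

Lemma mcontN m n (A : R -> 'M[R]_(m, n)) : mcont A -> mcont (fun x => - A x).
Proof.
move=> hA i j; rewrite (_ : (fun x => _) = (fun x => - A x i j)).
  by move=> x; apply: cvgN; exact: hA.
by apply/funext => x; rewrite mxE.
Qed.

Lemma mcontM m n p (A : R -> 'M[R]_(m, n)) (B : R -> 'M[R]_(n, p)) : mcont A -> mcont B ->
  mcont (fun x => A x *m B x).
Proof.
move=> hA hB i j; rewrite (_ : (fun x => _) = (fun x => \sum_k A x i k * B x k j)).
  by apply: continuous_sumf => k _ x; apply: cvgM; [exact: hA|exact: hB].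
by apply/funext => x; rewrite mxE.
Qed.

Definition mbnd m n (A : R -> 'M[R]_(m, n)) := exists K : R, forall x i j, `|A x i j| <= K.

Lemma mbnd_cst m n (A : 'M[R]_(m, n)) : mbnd (fun=> A).
Proof.
exists (\sum_i \sum_j `|A i j|) => _ i j.
rewrite (bigD1 i)//= (bigD1 j)//= -addrA lerDl addr_ge0// sumr_ge0// => k _.
by apply: sumr_ge0.
Qed.

Lemma mbndD m n (A B : R -> 'M[R]_(m, n)) : mbnd A -> mbnd B -> mbnd (fun x => A x + B x).
Proof.
move=> [K hK] [L hL]; exists (K + L) => x i j.
by rewrite mxE (le_trans (ler_normD _ _))// lerD.
Qed.

Lemma mbndN m n (A : R -> 'M[R]_(m, n)) : mbnd A -> mbnd (fun x => - A x).
Proof. by move=> [K hK]; exists K => x i j; rewrite mxE normrN. Qed.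

Lemma mbndM m n p (A : R -> 'M[R]_(m, n)) (B : R -> 'M[R]_(n, p)) : mbnd A -> mbnd B ->
  mbnd (fun x => A x *m B x).
Proof.
move=> [K hK] [L hL]; exists (\sum_(k < n) K * L) => x i j.
rewrite mxE (le_trans (ler_norm_sum _ _ _))//; apply: ler_sum => k _.
by rewrite normrM ler_pM.
Qed.

End MatrixDerivative.

(** * The rigid body: symmetry of J U, first integrals, energy *)

Section RigidBody.
Variables (R : realType) (d : nat) (Jd : 'rV[R]_d).
Hypothesis Jpos : forall i : 'I_d, 0 < Jd 0 i.
Local Notation J := (diag_mx Jd).
Variables (M P Om : R -> 'M[R]_d).
Hypothesis Om_skew : forall x, (Om x)^T = - Om x.
Hypothesis P_sym : forall x, (P x)^T = P x.
Hypothesis M_def : forall x, M x = J *m Om x + Om x *m J.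
Hypothesis M_eq : forall x : R, is_derive x 1 M (commx (M x) (Om x) - commx (P x) J).
Hypothesis P_eq : forall x : R, is_derive x 1 P (commx (P x) (Om x)).
Variable U : R -> 'M[R]_d.
Hypothesis U_def : forall x, U x = Om x *m Om x - derive1 Om x + P x.

Definition P' x := commx (P x) (Om x).
Definition M' x := commx (M x) (Om x) - commx (P x) J.

Lemma mderP : mder P P'. Proof. exact: mder_derive. Qed.

Lemma mderM_ : mder M M'. Proof. exact: mder_derive. Qed.

Lemma J_sym : J^T = J. Proof. exact: tr_diag_mx. Qed.

Lemma M_skew x : (M x)^T = - M x.
Proof.
by rewrite M_def linearD/= !trmx_mul J_sym Om_skew mulNmx mulmxN opprD addrC.
Qed.

Lemma Jsum_neq0 i j : Jd 0 i + Jd 0 j != 0.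
Proof. by rewrite gt_eqF// addr_gt0. Qed.

Lemma anticommJ (A : 'M[R]_d) i j : (J *m A + A *m J) i j = (Jd 0 i + Jd 0 j) * A i j.
Proof. by rewrite mxE mul_diag_mx mul_mx_diag !mxE; ring. Qed.

Lemma Om_M x i j : Om x i j = M x i j * (Jd 0 i + Jd 0 j)^-1.
Proof. by rewrite M_def anticommJ mulrC mulKf// Jsum_neq0. Qed.

(** M = J Om + Om J is inverted entrywise, as J_i + J_j > 0. Differentiability of Om is thus deduced
    from that of M. *)
Definition Om' x : 'M[R]_d := \matrix_(i, j) (M' x i j * (Jd 0 i + Jd 0 j)^-1).

Lemma mderOm : mder Om Om'.
Proof.
move=> i j x; apply: (@hasd_ext _ (fun y => M y i j * (Jd 0 i + Jd 0 j)^-1)).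
  by move=> y; rewrite Om_M.
by apply: hasd_eq (hasdM (mderM_ i j x) (hasd_cst _ _)) _; rewrite [RHS]mxE; ring.
Qed.

Lemma derive_Om x : derive1 Om x = Om' x. Proof. exact: derive1_mder mderOm. Qed.

Lemma anticommJ_Om' x : J *m Om' x + Om' x *m J = M' x.
Proof. by apply/matrixP => i j; rewrite anticommJ mxE mulrCA divff ?mulr1// Jsum_neq0. Qed.

Lemma M'_skew x : (M' x)^T = - M' x.
Proof.
rewrite /M' /commx trmxBB !trmx_mul M_skew Om_skew P_sym J_sym !mulNmx !mulmxN !opprK.
move: (M x *m Om x) (Om x *m M x) (P x *m J) (J *m P x) => A1 A2 A3 A4.
by apply/matrixP => i j; rewrite !mxE; ring.
Qed.

Lemma Om'_skew x : (Om' x)^T = - Om' x.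
Proof.
have E i j : M' x j i = - M' x i j.
  by have /matrixP/(_ i j) := M'_skew x; rewrite [LHS]mxE [RHS]mxE.
apply/matrixP => i j; rewrite [LHS]mxE [RHS]mxE [Om' x j i]mxE [Om' x i j]mxE.
by rewrite E mulNr addrC.
Qed.

Lemma U_E x : U x = Om x *m Om x - Om' x + P x.
Proof. by rewrite U_def derive_Om. Qed.

Lemma U_trmx x : (U x)^T = Om x *m Om x + Om' x + P x.
Proof.
by rewrite U_E linearD/= linearB/= trmx_mul Om_skew Om'_skew P_sym mulNmx mulmxN !opprK.
Qed.

(** J U - U^T J = [J, Om^2] - (J Om' + Om' J) + [J, P], and the bracket is M' because [M, Om] =
    [J, Om^2]: this is the equation of motion of M. *)
Lemma JU_sym x i j : Jd 0 i * U x i j = Jd 0 j * U x j i.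
Proof.
have : J *m U x = (U x)^T *m J.
  have := anticommJ_Om' x; rewrite U_trmx U_E /M' /commx M_def.
  rewrite !(mulmxDl, mulmxDr, mulmxBl, mulmxBr, mulmxN, mulNmx) !mulmxA.
  move: (J *m Om x *m Om x) (Om x *m J *m Om x) (Om x *m Om x *m J) (P x *m J) (J *m P x)
    (J *m Om' x) (Om' x *m J) => A1 A2 A3 A4 A5 A6 A7 E.
  apply/matrixP => a b; have /matrixP/(_ a b) := E; rewrite !mxE => {}E.
  by lra.
by move/matrixP/(_ i j); rewrite mul_diag_mx mul_mx_diag !mxE mulrC => ->; rewrite mulrC.
Qed.

(** P' = [P, Om] is an isospectral flow. For a symmetric P the trace of P^2 is the sum of the
    squares of the entries, so P is bounded. *)
Lemma trPP x : \tr (P x *m P x) = \tr (P 0 *m P 0).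
Proof.
apply: (der0_cst (f := fun x => \tr (P x *m P x))) => {}x.
apply: hasd_eq (mder_tr (mderM mderP mderP) x) _.
rewrite mxtraceD (mxtrace_mulC (P x)) /P' /commx mulmxBl raddfB/= (mxtrace_mulC _ (P x)) !mulmxA.
have -> : \tr (Om x *m P x *m P x) = \tr (P x *m P x *m Om x).
  by rewrite -mulmxA mxtrace_mulC.
by rewrite subrr addr0.
Qed.

Lemma sum_sqr_le n (A : 'M[R]_n) i j : A i j ^+ 2 <= \sum_i \sum_j A i j ^+ 2.
Proof.
rewrite (bigD1 i)//= (bigD1 j)//= -addrA lerDl addr_ge0 ?sumr_ge0// => k _.
  exact: sqr_ge0.
by apply: sumr_ge0 => l _; exact: sqr_ge0.
Qed.

Lemma abs_le_sqr (a b : R) : a ^+ 2 <= b -> `|a| <= 1 + b.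
Proof. by move=> ab; rewrite ler_norml; apply/andP; split; nra. Qed.

Lemma mbndP : mbnd P.
Proof.
exists (1 + \tr (P 0 *m P 0)) => x i j; apply: abs_le_sqr; rewrite -(trPP x).
apply: le_trans (sum_sqr_le (P x) i j) _; rewrite /mxtrace; apply: ler_sum => a _.
rewrite mxE; apply: ler_sum => b _.
by have /matrixP/(_ a b) := P_sym x; rewrite mxE => ->; rewrite expr2.
Qed.

(** The coefficient of mu^2 in the trace of the square of the Lax matrix. Since M is skew, - tr M^2
    is the sum of the squares of its entries, so the bound on P yields one on M. *)
Lemma trMM x : \tr (M x *m M x) - 2 * \tr (P x *m (J *m J)) =
  \tr (M 0 *m M 0) - 2 * \tr (P 0 *m (J *m J)).
Proof.
apply: (der0_cst (f := fun x => \tr (M x *m M x) - 2 * \tr (P x *m (J *m J)))) => {}x.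
apply: hasd_eq (hasdB (mder_tr (mderM mderM_ mderM_) x) (hasdZ 2 (mder_tr (mderMr (J *m J) mderP) x))) _.
rewrite mxtraceD (mxtrace_mulC (M x)) /P' /M' /commx.
have -> : \tr ((M x *m Om x - Om x *m M x - (P x *m J - J *m P x)) *m M x) =
  - \tr ((P x *m J - J *m P x) *m M x).
  rewrite mulmxBl raddfB/= [X in X - _](_ : _ = 0) ?sub0r//.
  rewrite mulmxBl raddfB/= -(mulmxA (M x)) (mxtrace_mulC (M x)) subrr.
  by [].
rewrite M_def !(mulmxBl, mulmxDr) !mulmxA !(raddfB, raddfD)/=.
have e1 : \tr (J *m P x *m J *m Om x) = \tr (P x *m J *m Om x *m J).
  by rewrite -!mulmxA mxtrace_mulC !mulmxA.
have e2 : \tr (J *m P x *m Om x *m J) = \tr (P x *m Om x *m J *m J).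
  by rewrite -!mulmxA mxtrace_mulC !mulmxA.
have e3 : \tr (Om x *m P x *m J *m J) = \tr (P x *m J *m J *m Om x).
  by rewrite -!mulmxA mxtrace_mulC !mulmxA.
by rewrite e1 e2 e3; ring.
Qed.

Lemma mbndM_ : mbnd M.
Proof.
have [K KP] := mbndP; have [L LP] := mbndM mbndP (mbnd_cst (J *m J)).
exists (1 + (- (\tr (M 0 *m M 0) - 2 * \tr (P 0 *m (J *m J))) + 2 * \sum_(i < d) L)) => x i j.
apply: abs_le_sqr; rewrite -(trMM x).
apply: (@le_trans _ _ (- \tr (M x *m M x))).
  apply: le_trans (sum_sqr_le (M x) i j) _; rewrite /mxtrace -sumrN; apply: ler_sum => a _.
  rewrite mxE -sumrN; apply: ler_sum => b _.
  have /matrixP/(_ a b) := M_skew x; rewrite mxE [RHS]mxE => ->.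
  by rewrite mulrN opprK expr2.
have : \tr (P x *m (J *m J)) >= - \sum_(i < d) L.
  rewrite lerNl /mxtrace -sumrN; apply: ler_sum => a _.
  by have := LP x a a; rewrite ler_norml => /andP[h _]; rewrite lerNl.
by lra.
Qed.

Lemma mbnd_scale (A : R -> 'M[R]_d) (c : 'I_d -> 'I_d -> R) : mbnd A ->
  mbnd (fun x => \matrix_(i, j) (A x i j * c i j)).
Proof.
move=> [K hK]; have [L hL] := @mbnd_cst R _ _ (\matrix_(i, j) c i j).
exists (K * L) => x i j; rewrite mxE normrM ler_pM//.
by have := hL 0 i j; rewrite mxE.
Qed.

Lemma mbndOm : mbnd Om.
Proof.
have [K hK] := mbnd_scale (fun i j => (Jd 0 i + Jd 0 j)^-1) mbndM_.
by exists K => x i j; have := hK x i j; rewrite mxE -Om_M.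
Qed.

Lemma mbndM' : mbnd M'.
Proof.
have bO := mbndOm; have bM := mbndM_; have bP := mbndP; have bJ := mbnd_cst J.
by apply: mbndD; [apply: mbndD|apply: mbndN; apply: mbndD]; try apply: mbndN; apply: mbndM.
Qed.

Lemma mbndU : mbnd U.
Proof.
have bO := mbndOm; have bP := mbndP; have bM := mbndM'.
have [K hK] : mbnd (fun x => Om x *m Om x - Om' x + P x).
  apply: mbndD => //; apply: mbndD; first exact: mbndM.
  by apply: mbndN; exact: mbnd_scale.
by exists K => x i j; rewrite U_E.
Qed.

Lemma mcontM' : mcont M'.
Proof.
have cO := mcont_mder mderOm; have cM := mcont_mder mderM_; have cP := mcont_mder mderP.
have cJ := mcont_mder (mder_cst J).
by apply: mcontD; [apply: mcontD|apply: mcontN; apply: mcontD]; try apply: mcontN; apply: mcontM.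
Qed.

Lemma mcontU : mcont U.
Proof.
have cO := mcont_mder mderOm; have cP := mcont_mder mderP.
have c : mcont (fun x => Om x *m Om x - Om' x + P x).
  apply: mcontD => //; apply: mcontD; first exact: mcontM.
  apply: mcontN => i j; rewrite (_ : (fun x => _) = (fun x => M' x i j * (Jd 0 i + Jd 0 j)^-1)).
    by move=> x; apply: cvgM; [exact: mcontM'|exact: cvg_cst].
  by apply/funext => x; rewrite mxE.
move=> i j; rewrite (_ : (fun x => U x i j) = (fun x => (Om x *m Om x - Om' x + P x) i j)).
  exact: c.
by apply/funext => x; rewrite U_E.
Qed.

(** With phi = v' + Om v the equation becomes the system v' = phi - Om v, phi' = Om phi - (la - P)
    v. The skew matrix Om acts as a rotation, compensated by P' = [P, Om], and the remaining terms
    cancel by the symmetry of P. *)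
Lemma energy_const (la : R) (v v' v'' : R -> 'cV[R]_d) : mder v v' -> mder v' v'' ->
  (forall x, v'' x = U x *m v x - la *: v x) ->
  let phi x := v' x + Om x *m v x in
  let E x := (phi x)^T *m phi x + (v x)^T *m ((la%:M - P x) *m v x) in
  forall x, E x 0 0 = E 0 0 0.
Proof.
move=> vv' v'v'' v''E phi E.
pose phi' x := v'' x + (Om' x *m v x + Om x *m v' x).
have hphi : mder phi phi' by apply: mderD => //; exact: mderM mderOm vv'.
have phi'E x : phi' x = Om x *m phi x + (P x *m v x - la *: v x).
  rewrite /phi' v''E U_E /phi !(mulmxDr, mulmxDl, mulNmx) !mulmxA.
  by apply/matrixP => i j; rewrite !mxE; ring.
have hP : mder (fun x => la%:M - P x) (fun x => 0 - P' x).
  by apply: mderB; [exact: mder_cst|exact: mderP].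
have hE := mderD (mderM (mderT hphi) hphi) (mderM (mderT vv') (mderM hP vv')).
apply: (der0_cst (f := fun x => E x 0 0)) => x.
apply: hasd_eq (hE 0 0 x) _.
suff H : (phi' x)^T *m phi x + (phi x)^T *m phi' x + ((v' x)^T *m ((la%:M - P x) *m v x) +
    (v x)^T *m ((0 - P' x) *m v x + (la%:M - P x) *m v' x)) = 0 by rewrite H mxE.
rewrite phi'E (_ : v' x = phi x - Om x *m v x); last by rewrite /phi addrK.
move: (phi x) (v x) (Om_skew x) (P_sym x) => f u.
rewrite /P' /commx; move: (Om x) (P x) => O Q Os Qs.
rewrite linearD/= linearB/= linearZ/= !trmx_mul linearB/= !trmx_mul Os Qs.
rewrite !(mulmxDr, mulmxDl, mulmxBl, mulmxBr, mulNmx, mulmxN, sub0r, opprK).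
rewrite !(mul_scalar_mx, mul_mx_scalar, scalemxAl, mulmxA) -?scalemxAl -?scalemxAr.
rewrite mulmx0 mul0mx.
move: (f^T *m O *m f) (u^T *m Q *m f) (u^T *m f) (f^T *m Q *m u) (f^T *m u) (u^T *m O *m u)
  (u^T *m O *m Q *m u) (u^T *m Q *m O *m u) => B1 B2 B3 B4 B5 B6 B7 B8.
by apply/matrixP => i j; rewrite !mxE; ring.
Qed.

(** Each product v_i v_j is at most (v_i^2 + v_j^2) / 2, and every square then occurs n times. *)
Lemma form_ge n (Q : 'M[R]_n) (K la : R) (v : 'cV[R]_n) : (forall i j, `|Q i j| <= K) ->
  (la - n%:R * K) * \sum_i v i 0 ^+ 2 <= (v^T *m ((la%:M - Q) *m v)) 0 0.
Proof.
move=> QK.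
have -> : (v^T *m ((la%:M - Q) *m v)) 0 0 = la * \sum_i v i 0 ^+ 2 - \sum_i \sum_j v i 0 * Q i j * v j 0.
  rewrite mxE mulr_sumr -sumrB; apply: eq_bigr => i _.
  rewrite mulmxBl mul_scalar_mx mxBE mxZE.
  rewrite [(Q *m v) i 0]mxE [v^T 0 i]mxE mulrBr mulr_sumr; congr (_ - _); first by ring.
  by apply: eq_bigr => j _; rewrite mulrA.
rewrite mulrBl lerD2l lerN2.
apply: (@le_trans _ _ (\sum_i \sum_j K * ((v i 0 ^+ 2 + v j 0 ^+ 2) / 2))).
  apply: ler_sum => i _; apply: ler_sum => j _; apply: le_trans (ler_norm _) _.
  rewrite mulrAC normrM mulrC; apply: ler_pM => //.
  rewrite normrM -(real_normK (num_real (v i 0))) -(real_normK (num_real (v j 0))).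
  by have := sqr_ge0 (`|v i 0| - `|v j 0|); nra.
rewrite le_eqVlt; apply/orP; left; apply/eqP.
have -> : \sum_i \sum_j K * ((v i 0 ^+ 2 + v j 0 ^+ 2) / 2) =
    \sum_i K * ((v i 0 ^+ 2 *+ n + \sum_j v j 0 ^+ 2) / 2).
  apply: eq_bigr => i _; rewrite -mulr_sumr -mulr_suml big_split/= sumr_const card_ord.
  by [].
rewrite -mulr_sumr -mulr_suml big_split/= sumr_const sumrMnl card_ord -mulr_natl; by field.
Qed.

(** For la >= d K + 1 the form la - P is at least the identity, so the conserved energy dominates
    |v|^2. *)
Lemma real_solution_bounded (K la : R) (v v' v'' : R -> 'cV[R]_d) :
  (forall x i j, `|P x i j| <= K) -> d%:R * K + 1 <= la ->
  mder v v' -> mder v' v'' -> (forall x, v'' x = U x *m v x - la *: v x) ->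
  exists B, forall x i, `|v x i 0| <= B.
Proof.
move=> PK laK vv' v'v'' v''E.
move: (energy_const vv' v'v'' v''E) => /= EC.
exists (1 + ((v' 0 + Om 0 *m v 0)^T *m (v' 0 + Om 0 *m v 0) +
  (v 0)^T *m ((la%:M - P 0) *m v 0)) 0 0) => x i.
apply: abs_le_sqr; rewrite -(EC x) mxDE; have := form_ge la (v x) (PK x).
set S := \sum_i _ => h.
have S1 : v x i 0 ^+ 2 <= S by rewrite /S (bigD1 i)//= lerDl sumr_ge0// => k _; exact: sqr_ge0.
have S0 : 0 <= S by apply: le_trans S1; exact: sqr_ge0.
have : 0 <= ((v' x + Om x *m v x)^T *m (v' x + Om x *m v x)) 0 0.
  by rewrite mxE; apply: sumr_ge0 => k _; rewrite [_^T _ _]mxE -expr2 sqr_ge0.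
have : S <= (la - d%:R * K) * S by rewrite ler_peMl//; lra.
by lra.
Qed.

End RigidBody.

(** * Eigensolutions of the rigid body operator for large real la *)

Section Eigensolutions.
Variables (R : realType) (d : nat).
Local Notation C := R[i].

Lemma eigensolutionP (U : R -> 'M[R]_d) (la : C) (f : R -> 'cV[C]_d) :
  eigensolution U la f <-> exists f' f'' : R -> 'cV[C]_d,
    [/\ forall i, cdr (fun x => f x i 0) (fun x => f' x i 0),
        forall i, cdr (fun x => f' x i 0) (fun x => f'' x i 0) &
        forall x, f'' x = cmx (U x) *m f x - la *: f x].
Proof.
split=> [[f1 f2 fE]|[f' [f'' [h1 h2 fE]]]].
  exists (cderive f), (cderive (cderive f)); split.
  - by move=> i; have [] := der_cderive f1 i.
  - by move=> i; have [] := der_cderive f2 i.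
  - by move=> x; rewrite -fE /schrodinger opprD opprK addrCA subrr addr0.
have cvecE (g : R -> 'cV[C]_d) : cvec (re g) (im g) = g.
  by apply/funext => x; apply/colP => i; rewrite [LHS]mxE /re /im; case: (g x i 0).
have [c1 e1] := @cderivable_der _ _ f (re f') (im f') (fun i => (h1 i).1) (fun i => (h1 i).2).
have [c2 e2] := @cderivable_der _ _ f' (re f'') (im f'') (fun i => (h2 i).1) (fun i => (h2 i).2).
rewrite cvecE in e1; rewrite cvecE in e2.
split; [exact: c1|by rewrite e1; exact: c2|].
by move=> x; rewrite /schrodinger e1 e2 fE opprB subrK.
Qed.

Variables (Jd : 'rV[R]_d).
Hypothesis Jpos : forall i : 'I_d, 0 < Jd 0 i.
Local Notation J := (diag_mx Jd).
Variables (M P Om : R -> 'M[R]_d).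
Hypothesis Om_skew : forall x, (Om x)^T = - Om x.
Hypothesis P_sym : forall x, (P x)^T = P x.
Hypothesis M_def : forall x, M x = J *m Om x + Om x *m J.
Hypothesis M_eq : forall x : R, is_derive x 1 M (commx (M x) (Om x) - commx (P x) J).
Hypothesis P_eq : forall x : R, is_derive x 1 P (commx (P x) (Om x)).
Variable U : R -> 'M[R]_d.
Hypothesis U_def : forall x, U x = Om x *m Om x - derive1 Om x + P x.

Theorem rigid_body_self_adjoint : self_adjoint Jd U.
Proof.
have [K UK] := mbndU Jpos Om_skew P_sym M_def M_eq P_eq U_def.
apply: (self_adjoint_symmetric Jpos _ UK).
  exact: (mcontU Jpos M_def M_eq P_eq U_def).
exact: (JU_sym Jpos Om_skew P_sym M_def M_eq U_def).
Qed.

Theorem rigid_body_finite_gap : maximally_finite_gap U.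
Proof.
have [K PK] := mbndP P_sym P_eq.
exists (d%:R * K + 1) => la laK f /eigensolutionP[f' [f'' [h1 h2 fE]]].
(* g stands for the real and for the imaginary part: U and la are real, so both parts are real
   solutions. *)
have bnd (g : C -> R) (mg : forall (A : 'M[R]_d) (v : 'cV[C]_d) i,
      g ((cmx A *m v) i 0) = \sum_j A i j * g (v j 0))
    (gB : forall z w, g (z - w) = g z - g w) (gZ : forall z, g (la%:C * z) = la * g z)
    (gd : forall F F' : R -> C, cdr F F' -> der (fun x => g (F x)) (fun x => g (F' x))) :
    exists B, forall x i, `|g (f x i 0)| <= B.
  have mk (F F' : R -> 'cV[C]_d) : (forall i, cdr (fun x => F x i 0) (fun x => F' x i 0)) ->
      mder (fun x => map_mx g (F x)) (fun x => map_mx g (F' x)).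
    move=> h i j x; rewrite (ord1 j).
    apply: hasd_ext (hasd_eq (gd _ _ (h i) x) _); last by rewrite mxE.
    by move=> y; rewrite mxE.
  have [|B HB] := real_solution_bounded Jpos Om_skew P_sym M_def M_eq P_eq U_def PK (ltW laK)
    (mk _ _ h1) (mk _ _ h2).
    move=> x; apply/colP => i; rewrite [LHS]mxE fE mxBE gB mg mxZE gZ [RHS]mxBE mxZE.
    rewrite [(U x *m _) i 0]mxE; congr (_ - _); last by rewrite mxE.
    by apply: eq_bigr => j _; rewrite mxE.
  by exists B => x i; have := HB x i; rewrite mxE.
have [B1 H1] := bnd (@complex.Re R) (@Re_mulmx _ _) (@ReB _) (@Re_scale _ la) (fun _ _ h => h.1).
have [B2 H2] := bnd (@complex.Im R) (@Im_mulmx _ _) (@ImB _) (@Im_scale _ la) (fun _ _ h => h.2).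
exists (B1 + B2) => x i; rewrite normcn lecR (le_trans (cn_le_ReIm _))//.
by apply: lerD; [exact: H1|exact: H2].
Qed.

End Eigensolutions.

(** * Diagonalization of matrices skew for a definite form *)

Section Companion.
Variable K : numClosedFieldType.

(** The hypothesis excludes generalized eigenvectors. Applied to the cofactor of (X - x)^2 in the
    minimal polynomial, it would lower the degree of that polynomial. *)
Lemma diagonalized_semisimple n (A : 'M[K]_n.+1) :
  (forall mu (G : 'M[K]_n.+1), (A - mu%:M) *m ((A - mu%:M) *m G) = 0 -> (A - mu%:M) *m G = 0) ->
  exists V a, diagonalized A V a.
Proof.
move=> semi; have [rs rsE] := closed_field_poly_normal (mxminpoly A).
rewrite (monicP (mxminpoly_monic _)) scale1r in rsE.
have p0 : mxminpoly A != 0 by rewrite monic_neq0// mxminpoly_monic.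
have urs : uniq rs.
  apply: contraT => /uniqPn-/(_ 0)[i [j [ij jr ijE]]].
  have xrs : rs`_i \in rs by rewrite mem_nth// (ltn_trans ij).
  set x := rs`_i in ijE xrs.
  have cnt : (2 <= mup x (mxminpoly A))%N.
    rewrite rsE mu_prod_XsubC -(cat_take_drop j rs) count_cat.
    rewrite -addn1 leq_add// -has_count; apply/hasP; exists x => //=.
      by rewrite /x -(nth_take 0 ij) mem_nth// size_take jr.
    by rewrite ijE -[j in rs`_j]addn0 -nth_drop mem_nth// size_drop subn_gt0.
  rewrite mup_geq// in cnt.
  have /dvdpP[h hE] := cnt.
  have h0 : h != 0 by apply: contraNneq p0 => h0; rewrite hE h0 mul0r.
  have XA : horner_mx A ('X - x%:P) = A - x%:M by rewrite rmorphB/= horner_mx_X horner_mx_C.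
  have := mx_root_minpoly A; rewrite hE mulrC expr2 -mulrA !rmorphM/= XA => /semi.
  rewrite -XA -[_ *m _]/(_ * _) -rmorphM/= => /mxminpoly_min/dvdp_leq.
  rewrite mulf_neq0 ?polyXsubC_eq0// => /(_ isT); rewrite hE expr2 mulrA (mulrC ('X - x%:P)).
  by rewrite size_Mmonic ?mulf_neq0 ?polyXsubC_eq0 ?monicXsubC// size_XsubC addn2 /= ltnn.
have [_] := diagonalizableP A; case; first by exists rs => //; rewrite rsE.
move=> W uW /(similar_diagLR uW)[a aE]; exists W, a.
by split => //; rewrite aE conjVmx.
Qed.

Definition adj m n (A : 'M[K]_(m, n)) : 'M[K]_(n, m) := map_mx Num.conj A^T.

Lemma adjM m n p (A : 'M[K]_(m, n)) (B : 'M[K]_(n, p)) : adj (A *m B) = adj B *m adj A.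
Proof. by rewrite /adj trmx_mul map_mxM. Qed.

(** Let w1 = (A - mu) g with (A - mu) w1 = 0, and let <,> be the form H. Skewness gives conj(mu)
    <w1, w> = - <w1, A w>. With w = w1 either <w1, w1> = 0 or mu is imaginary; in the second case w
    = g gives <w1, (A - mu) g> = 0, again <w1, w1> = 0. *)
Lemma skew_diagonalized n (A H : 'M[K]_n.+1) : adj A *m H + H *m A = 0 ->
  (forall w : 'cV[K]_n.+1, adj w *m H *m w = 0 -> w = 0) -> exists V a, diagonalized A V a.
Proof.
move=> AH Hpos; apply: diagonalized_semisimple => mu G GE.
have col_mul j (B C : 'M[K]_n.+1) : col j (B *m C) = B *m col j C.
  by rewrite !matrix.colE mulmxA.
have AH' : adj A *m H = - (H *m A) by apply/eqP; rewrite -addr_eq0 AH.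
have colE j (B : 'M[K]_n.+1) : col j B = 0 -> forall i, B i j = 0.
  by move=> /colP h i; have := h i; rewrite !mxE.
apply/matrixP => i j; rewrite [RHS]mxE; apply: (colE j).
set w1 := col j _.
have w1E : w1 = A *m col j G - mu *: col j G.
  rewrite /w1 col_mul.
  rewrite mulmxBl.
  by rewrite mul_scalar_mx.
have Aw1 : A *m w1 = mu *: w1.
  apply/eqP; rewrite -subr_eq0 -mul_scalar_mx -mulmxBl /w1 -col_mul GE.
  by apply/eqP/colP => k; rewrite !mxE.
have form (w : 'cV[K]_n.+1) : mu^* *: (adj w1 *m H *m w) = - (adj w1 *m H *m (A *m w)).
  have <- : adj (A *m w1) *m H *m w = mu^* *: (adj w1 *m H *m w).
    rewrite Aw1; have -> : adj (mu *: w1) = mu^* *: adj w1.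
      by apply/matrixP => a b; rewrite !mxE rmorphM.
    by rewrite -!scalemxAl.
  by rewrite adjM -!mulmxA (mulmxA (adj A)) AH' mulNmx mulmxN !mulmxA.
have h1 := form w1; rewrite Aw1 -scalemxAr in h1.
have [E|E] := eqVneq (adj w1 *m H *m w1) 0; first exact: Hpos.
have mu_im : (mu^*)%R = - mu.
  apply/eqP; rewrite -addr_eq0; move/eqP: h1; rewrite -addr_eq0 -scalerDl scaler_eq0.
  by rewrite (negbTE E) orbF.
apply: Hpos; rewrite {2}w1E mulmxBr -scalemxAr.
have := form (col j G); rewrite mu_im scaleNr => /eqP; rewrite eqr_opp => /eqP <-.
by rewrite subrr.
Qed.

End Companion.

(** T is a product of unipotent block matrices, so of determinant 1, and multiplication by it makes
    the matrix block lower triangular. No block is inverted, so any commutative ring will do. *)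
Lemma det_companion (K : comNzRingType) n (a : K) (A B : 'M[K]_n) :
  \det (block_mx a%:M (- 1%:M) A B) = \det (A + a *: B).
Proof.
pose T := block_mx 0 1%:M (- 1%:M) a%:M : 'M[K]_(n + n).
have detT : \det T = 1.
  have -> : T = block_mx 1%:M 1%:M 0 1%:M *m block_mx 1%:M 0 (- 1%:M) 1%:M *m
      block_mx 1%:M (1 - a)%:M 0 1%:M.
    rewrite !mulmx_block !(mulmx1, mul1mx, mulmx0, mul0mx, addr0, add0r, subrr).
    have -> : - 1%:M *m (1 - a)%:M + 1%:M = (a%:M : 'M[K]_n).
      rewrite mulNmx mul1mx; apply/matrixP => i j; rewrite !mxE.
      by case: (i == j); rewrite ?mulr1n ?mulr0n; ring.
    by [].
  by rewrite !det_mulmx det_ublock det_lblock det_ublock !det1 !mulr1.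
rewrite -[LHS]mulr1 -[X in _ * X]detT -det_mulmx mulmx_block.
rewrite !(mulmx1, mul1mx, mulmx0, mul0mx, addr0, add0r, mulmxN, mulNmx, opprK).
rewrite subrr det_lblock det1 mul1r mul_mx_scalar.
by [].
Qed.

(** * The Lax pair and the spectral curve *)

Section LaxIdentities.
Variables (F : comNzRingType) (n : nat).
Implicit Types (J O Q Y : 'M[F]_n) (mu : F).

(** The first two terms are the derivative of the Lax matrix by the equations of motion. The
    identity says that Lax(x, mu) X again satisfies the linear system of X. *)
Lemma lax_identity J O Q mu (M := J *m O + O *m J) :
  (Q *m O - O *m Q) + mu *: ((M *m O - O *m M) - (Q *m J - J *m Q)) +
    (Q + mu *: M - mu ^+ 2 *: (J *m J)) *m (mu *: J - O) =
  (mu *: J - O) *m (Q + mu *: M - mu ^+ 2 *: (J *m J)).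
Proof.
rewrite /M !(mulmxDl, mulmxDr, mulNmx, mulmxN, opprD, opprK, scalerDr, scalerN,
  =^~ scalemxAl, =^~ scalemxAr, scalerA, mulmxA).
move: (J *m J *m O) (J *m O *m J) (O *m J *m J) (J *m O *m O) (O *m J *m O)
  (O *m O *m J) (Q *m O) (O *m Q) (Q *m J) (J *m Q) (J *m J *m J) =>
  B1 B2 B3 B4 B5 B6 B7 B8 B9 B10 B11.
by apply/matrixP => a b; rewrite !mxE; ring.
Qed.

Lemma lax_square J O O' Q mu (M := J *m O + O *m J) :
  (0 - O') + (mu *: J - O) *m (mu *: J - O) =
  (O *m O - O' + Q) - (Q + mu *: M - mu ^+ 2 *: (J *m J)).
Proof.
rewrite /M !(mulmxDl, mulmxDr, mulNmx, mulmxN, opprD, opprK, scalerDr, scalerN,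
  =^~ scalemxAl, =^~ scalemxAr, scalerA, mulmxA).
move: (J *m J) (J *m O) (O *m J) (O *m O) => B1 B2 B3 B4.
by apply/matrixP => a b; rewrite !mxE; ring.
Qed.

End LaxIdentities.

Lemma det_intertwine (F : comUnitRingType) n (A B Y : 'M[F]_n) (la : F) :
  \det Y \is a GRing.unit -> A *m Y = Y *m B -> \det (A - la%:M) = \det (B - la%:M).
Proof.
move=> uY AB; apply: (mulIr uY); rewrite -det_mulmx mulmxBl AB mul_scalar_mx -mul_mx_scalar.
by rewrite -mulmxBr det_mulmx mulrC.
Qed.

(** * Complexification and derivatives of complex matrix functions *)

Section ComplexMatrices.
Variable R : realType.
Local Notation C := R[i].

Lemma cmxM m n p (A : 'M[R]_(m, n)) (B : 'M[R]_(n, p)) : cmx (A *m B) = cmx A *m cmx B.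
Proof. exact: (map_mxM (real_complex R)). Qed.

Lemma cmxD m n (A B : 'M[R]_(m, n)) : cmx (A + B) = cmx A + cmx B.
Proof. exact: (map_mxD (real_complex R)). Qed.

Lemma cmxN m n (A : 'M[R]_(m, n)) : cmx (- A) = - cmx A.
Proof. exact: (map_mxN (real_complex R)). Qed.

Lemma cmxB m n (A B : 'M[R]_(m, n)) : cmx (A - B) = cmx A - cmx B.
Proof. exact: (map_mxB (real_complex R)). Qed.

Lemma cmx1 n : cmx (1%:M : 'M[R]_n) = 1%:M.
Proof. exact: (map_mx1 (real_complex R)). Qed.

Lemma cmx_scalar n (a : R) : cmx (a%:M : 'M[R]_n) = (a%:C)%:M.
Proof. exact: (map_scalar_mx (real_complex R)). Qed.

Lemma cmxT m n (A : 'M[R]_(m, n)) : cmx A^T = (cmx A)^T.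
Proof. by apply/matrixP => i j; rewrite !mxE. Qed.

Lemma conj_real (a : R) : (a%:C : C)^*%R = a%:C.
Proof. by apply: eq_complexP => /=; rewrite ?oppr0. Qed.

Lemma conj_cmx m n (A : 'M[R]_(m, n)) : map_mx Num.conj (cmx A) = cmx A.
Proof. by apply/matrixP => i j; rewrite !mxE conj_real. Qed.

Definition cmd m n (A A' : R -> 'M[C]_(m, n)) :=
  forall i j, cdr (fun x => A x i j) (fun x => A' x i j).

Lemma cmd_eq m n (A A' B' : R -> 'M[C]_(m, n)) : cmd A A' -> A' =1 B' -> cmd A B'.
Proof. by move=> h /funext <-. Qed.

Lemma cmd_cst m n (A : 'M[C]_(m, n)) : cmd (fun=> A) (fun=> 0).
Proof. by move=> i j; apply: cdr_eq (cdr_cst _) _ => x; rewrite mxE. Qed.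

Lemma cmdD m n (A A' B B' : R -> 'M[C]_(m, n)) : cmd A A' -> cmd B B' ->
  cmd (fun x => A x + B x) (fun x => A' x + B' x).
Proof.
move=> hA hB i j; rewrite (_ : (fun x => (A x + B x) i j) = (fun x => A x i j + B x i j)).
  by apply: cdr_eq (cdrD (hA i j) (hB i j)) _ => x; rewrite mxDE.
by apply/funext => x; rewrite mxDE.
Qed.

Lemma cmdZ m n (a : C) (A A' : R -> 'M[C]_(m, n)) : cmd A A' ->
  cmd (fun x => a *: A x) (fun x => a *: A' x).
Proof.
move=> hA i j; rewrite (_ : (fun x => (a *: A x) i j) = (fun x => a * A x i j)).
  by apply: cdr_eq (cdrZ a (hA i j)) _ => x; rewrite mxZE.
by apply/funext => x; rewrite mxZE.
Qed.

Lemma cmdB m n (A A' B B' : R -> 'M[C]_(m, n)) : cmd A A' -> cmd B B' ->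
  cmd (fun x => A x - B x) (fun x => A' x - B' x).
Proof.
move=> hA hB i j; rewrite (_ : (fun x => (A x - B x) i j) = (fun x => A x i j - B x i j)).
  by apply: cdr_eq (cdrB (hA i j) (hB i j)) _ => x; rewrite mxBE.
by apply/funext => x; rewrite mxBE.
Qed.

Lemma cmdM m n p (A A' : R -> 'M[C]_(m, n)) (B B' : R -> 'M[C]_(n, p)) : cmd A A' -> cmd B B' ->
  cmd (fun x => A x *m B x) (fun x => A' x *m B x + A x *m B' x).
Proof.
move=> hA hB i j; rewrite (_ : (fun x => (A x *m B x) i j) = (fun x => \sum_k A x i k * B x k j)).
  apply: cdr_eq (cdr_sum _ (fun k => cdrM (hA i k) (hB k j))) _ => x.
  by rewrite mxDE !mxE -big_split.
by apply/funext => x; rewrite mxE.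
Qed.

Lemma cmdT m n (A A' : R -> 'M[C]_(m, n)) : cmd A A' -> cmd (fun x => (A x)^T) (fun x => (A' x)^T).
Proof.
move=> hA i j; rewrite (_ : (fun x => (A x)^T i j) = (fun x => A x j i)).
  by apply: cdr_eq (hA j i) _ => x; rewrite mxE.
by apply/funext => x; rewrite mxE.
Qed.

Lemma cmd_cmx m n (A A' : R -> 'M[R]_(m, n)) : mder A A' ->
  cmd (fun x => cmx (A x)) (fun x => cmx (A' x)).
Proof.
move=> hA i j; rewrite (_ : (fun x => cmx (A x) i j) = (fun x => (A x i j)%:C)).
  by apply: cdr_eq (cdr_real (hA i j)) _ => x; rewrite mxE.
by apply/funext => x; rewrite mxE.
Qed.

Lemma Re_form n (S : 'M[R]_n) (v : 'cV[C]_n) :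
  complex.Re ((adj v *m cmx S *m v) 0 0) =
  ((map_mx (@complex.Re R) v)^T *m (S *m map_mx (@complex.Re R) v)) 0 0 +
  ((map_mx (@complex.Im R) v)^T *m (S *m map_mx (@complex.Im R) v)) 0 0.
Proof.
have E (z w : C) : complex.Re (Num.conj z * w) =
    complex.Re z * complex.Re w + complex.Im z * complex.Im w.
  by case: z w => [? ?] [? ?] /=; ring.
rewrite -mulmxA [X in complex.Re X]mxE Re_sum [X in _ = X + _]mxE [X in _ = _ + X]mxE -big_split.
apply: eq_bigr => i _; rewrite [adj v _ _]mxE [v^T _ _]mxE E Re_mulmx Im_mulmx.
rewrite ![(_^T) _ _]mxE ![(map_mx _ _) _ _]mxE ![(S *m _) _ _]mxE.
by congr (_ * _ + _ * _); apply: eq_bigr => j _; rewrite [in RHS]mxE.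
Qed.

End ComplexMatrices.

(** * The fundamental matrix of the Lax pair *)

Section FundamentalSolution.
Variables (R : realType) (d : nat) (Jd : 'rV[R]_d).
Hypothesis Jpos : forall i : 'I_d, 0 < Jd 0 i.
Local Notation C := R[i].
Local Notation J := (diag_mx Jd).
Variables (M P Om : R -> 'M[R]_d).
Hypothesis Om_skew : forall x, (Om x)^T = - Om x.
Hypothesis P_sym : forall x, (P x)^T = P x.
Hypothesis M_def : forall x, M x = J *m Om x + Om x *m J.
Hypothesis M_eq : forall x : R, is_derive x 1 M (commx (M x) (Om x) - commx (P x) J).
Hypothesis P_eq : forall x : R, is_derive x 1 P (commx (P x) (Om x)).
Variable U : R -> 'M[R]_d.
Hypothesis U_def : forall x, U x = Om x *m Om x - derive1 Om x + P x.

Definition lax x mu : 'M[C]_d := cmx (P x) + mu *: cmx (M x) - mu ^+ 2 *: cmx (J *m J).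

(** The fourth clause holds by uniqueness, both sides solving the same system with the same value at
    0. The last one holds because mu J is symmetric and Om skew, so the product has derivative 0; it
    provides the inverse of X. *)
Theorem ex_fundamental_mx : exists X : R -> C -> 'M[C]_d,
  [/\ forall mu, X 0 mu = 1%:M,
      forall mu, cmd (fun x => X x mu) (fun x => (mu *: cmx J - cmx (Om x)) *m X x mu),
      forall x mu i k, holo (fun mu => X x mu i k) mu,
      forall x mu, lax x mu *m X x mu = X x mu *m lax 0 mu &
      forall x mu, (X x (- mu))^T *m X x mu = 1%:M].
Proof.
have [K0 OK] := mbndOm Jpos Om_skew P_sym M_def M_eq P_eq.
have [K1 JK] := mbnd_cst J.
pose K := `|K0| + `|K1|.
have K_ge0 : 0 <= K by rewrite addr_ge0.
pose A (i j : 'I_d) (x : R) : C := cmx J i j.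
pose B (i j : 'I_d) (x : R) : C := - (Om x i j)%:C.
have cA i j : pcont (A i j) by exact: pcont_cst.
have cB i j : pcont (B i j).
  have := cdr_pcont (cdrZ (-1) (cdr_real (mderOm Jpos M_def M_eq i j))).
  by rewrite (_ : (fun x => -1 * _) = B i j)//; apply/funext => x; rewrite mulN1r.
have AK i j x : cn (A i j x) <= K.
  rewrite /A mxE cnR (le_trans (JK 0 i j))// (le_trans (ler_norm _))// lerDr.
  exact: normr_ge0.
have BK i j x : cn (B i j x) <= K.
  rewrite /B cnN cnR (le_trans (OK x i j))// (le_trans (ler_norm _))// lerDl.
  exact: normr_ge0.
have [X [X0 XE XH]] := ex_fundamental K_ge0 cA cB AK BK.
have pencilE mu i j x : pencil A B mu i j x = (mu *: cmx J - cmx (Om x)) i j.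
  by rewrite /pencil /A /B mxBE mxZE [cmx (Om x) i j]mxE.
pose Xm x mu : 'M[C]_d := \matrix_(i, k) X x mu i k.
have hX mu : cmd (fun x => Xm x mu) (fun x => (mu *: cmx J - cmx (Om x)) *m Xm x mu).
  move=> i k; rewrite (_ : (fun x => Xm x mu i k) = (fun x => X x mu i k)).
    apply: cdr_eq (XE mu k i) _ => x; rewrite mxE; apply: eq_bigr => j _.
    by rewrite pencilE [Xm x mu j k]mxE.
  by apply/funext => x; rewrite mxE.
have Xm0 mu : Xm 0 mu = 1%:M by apply/matrixP => i k; rewrite !mxE X0.
have cP := cmd_cmx (mderP P_eq); have cM := cmd_cmx (mderM_ M_eq).
exists Xm; split => //.
- move=> x mu i k; rewrite (_ : (fun mu => Xm x mu i k) = (fun mu => X x mu i k)).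
    exact: XH.
  by apply/funext => m; rewrite mxE.
- move=> x mu; apply/matrixP => i k.
  have sol (Y : R -> 'M[C]_d) : cmd Y (fun x => (mu *: cmx J - cmx (Om x)) *m Y x) ->
      solves A B mu (fun i x => Y x i k).
    move=> hY {}i; apply: cdr_eq (hY i k) _ => {}x; rewrite mxE; apply: eq_bigr => j _.
    by rewrite pencilE.
  have s1 : solves A B mu (fun i x => (lax x mu *m Xm x mu) i k).
    apply: (sol (fun x => lax x mu *m Xm x mu)).
    apply: cmd_eq (cmdM (cmdB (cmdD cP (cmdZ mu cM)) (cmd_cst (mu ^+ 2 *: cmx (J *m J)))) (hX mu)) _.
    move=> {}x; rewrite subr0 !mulmxA -mulmxDl; congr (_ *m _).
    by rewrite /lax /P' /M' /commx M_def !(cmxB, cmxD, cmxM) lax_identity.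
  have s2 : solves A B mu (fun i x => (Xm x mu *m lax 0 mu) i k).
    apply: (sol (fun x => Xm x mu *m lax 0 mu)).
    by apply: cmd_eq (cmdM (hX mu) (cmd_cst (lax 0 mu))) _ => {}x; rewrite mulmx0 addr0 mulmxA.
  apply: (solves_unique K_ge0 AK BK s1 s2) => {}i.
  by rewrite !Xm0 mulmx1 mul1mx.
- move=> x mu; have h : cmd (fun x => (Xm x (- mu))^T *m Xm x mu) (fun=> 0).
    apply: cmd_eq (cmdM (cmdT (hX (- mu))) (hX mu)) _ => {}x.
    rewrite trmx_mul -mulmxA -mulmxDr -mulmxDl linearB/= linearZ/= -!cmxT tr_diag_mx Om_skew cmxN.
    rewrite (_ : - mu *: cmx J - - cmx (Om x) + (mu *: cmx J - cmx (Om x)) = 0).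
      by rewrite mul0mx mulmx0.
    by apply/matrixP => a b; rewrite !mxE; ring.
  apply/matrixP => i k; have := cdr0_cst (f := fun x => ((Xm x (- mu))^T *m Xm x mu) i k) _ x.
  move=> ->; first by rewrite !Xm0 trmx1 mul1mx.
  by apply: cdr_eq (h i k) _ => y; rewrite mxE.
Qed.

Variable X : R -> C -> 'M[C]_d.
Hypothesis X0 : forall mu, X 0 mu = 1%:M.
Hypothesis X_der : forall mu, cmd (fun x => X x mu) (fun x => (mu *: cmx J - cmx (Om x)) *m X x mu).
Hypothesis X_lax : forall x mu, lax x mu *m X x mu = X x mu *m lax 0 mu.
Hypothesis X_inv : forall x mu, (X x (- mu))^T *m X x mu = 1%:M.

Lemma det_lax x mu la : \det (lax x mu - la%:M) = \det (lax 0 mu - la%:M).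
Proof.
apply: (@det_intertwine _ _ _ _ (X x mu)) => //.
have := congr1 determinant (X_inv x mu); rewrite det_mulmx det1 unitfE.
by move=> h; apply: contra_eq_neq h => ->; rewrite mulr0 eq_sym oner_eq0.
Qed.

Lemma laxE x la mu : mu ^+ 2 *: cmx (J *m J) - mu *: cmx (M x) - cmx (P x) + la%:M =
  - (lax x mu - la%:M).
Proof. by rewrite /lax; apply/matrixP => i j; rewrite !mxE; ring. Qed.

Lemma lax_eigensolution la mu (v : 'cV[C]_d) : lax 0 mu *m v = la *: v ->
  eigensolution U la (fun x => X x mu *m v) /\
  cmd (fun x => X x mu *m v) (fun x => (mu *: cmx J - cmx (Om x)) *m (X x mu *m v)).
Proof.
move=> vE; pose f x := X x mu *m v; pose D x := mu *: cmx J - cmx (Om x).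
have hf : cmd f (fun x => D x *m f x).
  by apply: cmd_eq (cmdM (X_der mu) (cmd_cst v)) _ => x; rewrite mulmx0 addr0 mulmxA.
have hO := cmd_cmx (mderOm Jpos M_def M_eq).
have hf' := cmdM (cmdB (cmd_cst (mu *: cmx J)) hO) hf.
split => //; apply/eigensolutionP; eexists; eexists; split.
- by move=> i; exact: (hf i 0).
- by move=> i; exact: (hf' i 0).
move=> x; have lf : lax x mu *m f x = la *: f x.
  by rewrite /f mulmxA X_lax -mulmxA vE scalemxAr.
rewrite -lf (U_E Jpos M_def M_eq U_def) /lax mulmxA -mulmxDl -mulmxBl; congr (_ *m _).
by rewrite /D (M_def x) !(cmxB, cmxD, cmxM) (lax_square _ _ _ (cmx (P x))).
Qed.

(** Gronwall for the first-order system of the pair (difference, derivative of the difference); it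
    lets solutions be compared by their Cauchy data at 0. *)
Lemma eigensolution_unique la (f g f' g' : R -> 'cV[C]_d) : eigensolution U la f -> eigensolution U la g ->
  cmd f f' -> cmd g g' -> f 0 = g 0 -> f' 0 = g' 0 -> forall x, f x = g x.
Proof.
have [K UK] := mbndU Jpos Om_skew P_sym M_def M_eq P_eq U_def.
have der2 h h' : eigensolution U la h -> cmd h h' ->
    cmd h' (fun x => cmx (U x) *m h x - la *: h x).
  move=> /eigensolutionP[h1 [h2 [c1 c2 E]]] hh' i j; rewrite (ord1 j).
  have e : (fun x => h' x i 0) = (fun x => h1 x i 0).
    have [[a1 a2] [b1 b2]] := (c1 i, hh' i 0); apply/funext => x; apply: eq_complexP.
      by have [_ <-] := a1 x; have [_ <-] := b1 x.
    by have [_ <-] := a2 x; have [_ <-] := b2 x.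
  by rewrite e; apply: cdr_eq (c2 i) _ => x; rewrite E.
move=> sf sg ff' gg' e0 e0' x; apply/colP => i; apply/eqP; rewrite -subr_eq0; apply/eqP.
pose Y (p : 'I_d + 'I_d) x := match p with
  | inl i => f x i 0 - g x i 0 | inr i => f' x i 0 - g' x i 0 end.
pose Y' (p : 'I_d + 'I_d) x := match p with
  | inl i => Y (inr i) x
  | inr i => \sum_j (cmx (U x) i j) * Y (inl j) x - la * Y (inl i) x end.
have YY' p : cdr (Y p) (Y' p).
  case: p => {}i; first exact: (cdrB (ff' i 0) (gg' i 0)).
  apply: cdr_eq (cdrB (der2 _ _ sf ff' i 0) (der2 _ _ sg gg' i 0)) _ => {}x.
  rewrite !mxBE !mxZE !mxE /Y' /Y.
  have -> : \sum_j cmx (U x) i j * (f x j 0 - g x j 0) =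
      \sum_j cmx (U x) i j * f x j 0 - \sum_j cmx (U x) i j * g x j 0.
    by rewrite -sumrB; apply: eq_bigr => j _; rewrite mulrBr.
  by ring.
pose L := 1 + `|K| + cn la.
have L0 : 0 <= L by rewrite !addr_ge0 ?cn_ge0.
have SE t : \sum_p cn (Y p t) = \sum_i cn (Y (inl i) t) + \sum_i cn (Y (inr i) t).
  by rewrite big_sumType.
have pos (G : 'I_d -> C) : 0 <= \sum_b cn (G b) by apply: sumr_ge0 => b _; exact: cn_ge0.
apply: (cgronwall0 L0 YY' _ _ (inl i)) => [p t|[j|j]]; last 2 first.
- by rewrite /Y e0 subrr.
- by rewrite /Y e0' subrr.
rewrite SE; case: p => a.
  have h1 : cn (Y (inr a) t) <= \sum_b cn (Y (inr b) t).
    by rewrite (bigD1 a)//= lerDl sumr_ge0// => b _; exact: cn_ge0.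
  apply: (le_trans h1); apply: (@le_trans _ _ (1 * (\sum_i0 cn (Y (inl i0) t) + \sum_i0 cn (Y (inr i0) t)))).
    by rewrite mul1r lerDr.
  apply: ler_wpM2r; first by rewrite addr_ge0.
  by rewrite /L -addrA lerDl addr_ge0 ?cn_ge0.
have h1 : cn (Y (inl a) t) <= \sum_b cn (Y (inl b) t).
  by rewrite (bigD1 a)//= lerDl sumr_ge0// => b _; exact: cn_ge0.
rewrite (le_trans (cnB _ _))// cnM.
have h2 : cn (\sum_j cmx (U t) a j * Y (inl j) t) <= `|K| * \sum_j cn (Y (inl j) t).
  by apply: cn_sum_mul_le => j; rewrite mxE cnR (le_trans (UK t a j))// ler_norm.
have h3 : cn la * cn (Y (inl a) t) <= cn la * \sum_b cn (Y (inl b) t).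
  by rewrite ler_wpM2l ?cn_ge0.
apply: (le_trans (lerD h2 h3)); rewrite -mulrDl.
apply: ler_pM; rewrite ?addr_ge0 ?cn_ge0 ?pos// /L.
  by rewrite -addrA lerDr.
by rewrite lerDl pos.
Qed.

End FundamentalSolution.

(** * Linearization of a quadratic matrix pencil *)

Section QuadraticPencil.
Variables (K : numClosedFieldType) (n : nat).
Local Notation d := n.+1.
Variables A B D Q : 'M[K]_d.
Hypothesis AQ : A *m Q = 1%:M.

Definition curve : {poly {poly K}} :=
  \det ('X^2 *: map_mx (fun c => c%:P%:P) A - 'X *: map_mx (fun c => c%:P%:P) B
        - map_mx (fun c => c%:P%:P) D + ('X%:P)%:M).

Lemma curveE la mu : curve.[mu%:P].[la] = \det (mu ^+ 2 *: A - mu *: B - D + la%:M).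
Proof.
rewrite -[LHS]/(horner_eval la (horner_eval mu%:P _)) -!det_map_mx; congr (\det _).
apply/matrixP => i j; rewrite !mxE /= /horner_eval.
by case: (i == j); rewrite ?mulr1n ?mulr0n !hornerE.
Qed.

Lemma QA : Q *m A = 1%:M.
Proof. exact: mulmx1C AQ. Qed.

Lemma detQ : \det Q != 0.
Proof.
have := congr1 determinant AQ; rewrite det_mulmx det1.
by move=> h; apply: contra_eq_neq h => ->; rewrite mulr0 eq_sym oner_eq0.
Qed.

(* Acts on the pairs (v, mu v): its eigenvalue equation is the quadratic
   eigenvalue problem (D + mu B - mu^2 A) v = la v. *)
Definition companion : 'M[{poly K}]_((n + n.+1).+1) :=
  block_mx (0 : 'M[{poly K}]_d) 1%:M (map_mx polyC Q *m (map_mx polyC (D) - 'X%:M)) (map_mx polyC (Q *m B)).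

(** The value of [companion] at la. The type with [d + d] is convertible to the one with
    [(n + n.+1).+1]: block operations are stated for the former, polynomials of a matrix for the
    latter. *)
Definition companion_at la : 'M[K]_(d + d) := block_mx 0 1%:M (Q *m (D - la%:M)) (Q *m B).

Lemma companionE la : evm la companion = companion_at la.
Proof.
have -> : evm la companion = @map_mx _ _ (horner_eval la) (d + d) (d + d)
    (block_mx 0 1%:M (map_mx polyC Q *m (map_mx polyC D - 'X%:M)) (map_mx polyC (Q *m B))) by [].
rewrite map_block_mx /companion_at; congr (@block_mx _ d d d d _ _ _ _).
- by rewrite map_mx0.
- by rewrite map_mx1.
- rewrite -[LHS]/(evm la _) evmM evmC; congr (_ *m _); rewrite /evm map_mxB -/(evm la _) evmC.
  congr (_ - _); apply/matrixP => i j; rewrite !mxE /= /horner_eval.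
  by case: (i == j); rewrite ?mulr1n ?mulr0n !hornerE.
- exact: evmC.
Qed.

(** Both sides are compared at every mu. There det (mu - companion) is evaluated by [det_companion],
    which produces Q times the pencil. *)
Lemma companion_char la : char_poly (evm la companion) = (\det Q)%:P * evp la curve.
Proof.
apply/eqP; rewrite -subr_eq0; apply/eqP.
have iT : infinitely (fun _ : K => True).
  (* A point of modulus larger than that of every element of S. *)
  move=> S; exists (1 + \sum_(z <- S) `|z|) => //.
  have pos (T : seq K) : 0 <= \sum_(z <- T) `|z| by apply: sumr_ge0.
  apply/negP => h; have : `|1 + \sum_(z <- S) `|z| | <= \sum_(z <- S) `|z|.
    have [T1 [T2 ST]] : exists T1 T2, S = T1 ++ (1 + \sum_(z <- S) `|z|) :: T2.
      by move: h; set y := 1 + _ => h; case/splitPr: h => T1 T2; exists T1, T2.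
    rewrite [in leRHS]ST big_cat big_cons/= addrCA lerDl.
    by apply: addr_ge0; exact: pos.
  rewrite ger0_norm ?addr_ge0 ?pos// gerDr.
  by rewrite (lt_geF ltr01).
apply: (infinitely_poly0 iT) => mu _; rewrite hornerD hornerN hornerM hornerC.
have -> : (evp la curve).[mu] = curve.[mu%:P].[la] by exact: evp_horner.
rewrite curveE -det_mulmx.
have -> : (char_poly (evm la companion)).[mu] = \det (mu%:M - evm la companion).
  rewrite /char_poly -[LHS]/(horner_eval mu _) -det_map_mx; congr (\det _).
  by apply/matrixP => i j; rewrite !mxE /= /horner_eval; case: (i == j); rewrite ?mulr1n ?mulr0n !hornerE.
apply/eqP; rewrite subr_eq0; apply/eqP.
have -> : mu%:M - evm la companion =
    (block_mx mu%:M (- 1%:M) (- (Q *m (D - la%:M))) (mu%:M - Q *m B) : 'M[K]_(d + d)).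
  transitivity ((mu%:M : 'M[K]_(d + d)) - companion_at la); first by rewrite companionE.
  rewrite /companion_at (scalar_mx_block d d) opp_block_mx add_block_mx.
  by rewrite oppr0 addr0 !add0r.
apply: etrans (@det_companion _ d mu _ _) _; congr (\det _).
have -> : mu%:M - Q *m B = mu *: (1%:M : 'M[K]_d) - Q *m B by rewrite scalemx1.
rewrite !(mulmxDr, mulmxN, opprD, opprK, scalerDr, scalerN, scalerA, =^~ scalemxAr, QA) expr2.
move: (Q *m D) (Q *m la%:M) (Q *m B) => A1 A2 A3.
by apply/matrixP => i j; rewrite !mxE; ring.
Qed.

Lemma companion_root la mu : root (char_poly (evm la companion)) mu = (curve.[mu%:P].[la] == 0).
Proof.
rewrite companion_char rootM rootC (negbTE detQ)/= /root; congr (_ == 0); exact: evp_horner.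
Qed.

Lemma curve_at_neq0 la : evp la curve != 0.
Proof.
apply: contraTneq (char_poly_monic (evm la companion)) => h.
by rewrite companion_char h mulr0 monicE lead_coef0 eq_sym oner_eq0.
Qed.

Lemma mup_curve la mu k : (k <= mup mu (char_poly (evm la companion)))%N ->
  (k <= mup mu (evp la curve))%N.
Proof.
rewrite !mup_geq ?curve_at_neq0 ?monic_neq0 ?char_poly_monic// companion_char mul_polyC.
by rewrite dvdpZr// detQ.
Qed.

Lemma companion_eigen la mu (v : 'cV[K]_(d + d)) : companion_at la *m v = mu *: v ->
  dsubmx v = mu *: usubmx v /\
  (D + mu *: B - mu ^+ 2 *: A) *m usubmx v = la *: usubmx v.
Proof.
rewrite -{1 2}[v]vsubmxK /companion_at mul_block_col scale_col_mx mul0mx add0r mul1mx.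
move=> /eq_col_mx[h1 h2]; split => //; move: (usubmx v) (dsubmx v) h1 h2 => u w -> h2.
have := congr1 (mulmx A) h2; rewrite mulmxDr !mulmxA AQ !mul1mx.
rewrite -!scalemxAr scalerA mulmxBl mul_scalar_mx => E.
rewrite mulmxBl mulmxDl -!scalemxAl expr2 -E.
by apply/matrixP => i j; rewrite !(mxBE, mxDE, mxZE); ring.
Qed.

End QuadraticPencil.

(** * Diagonalization at large real la and real structures of the curve *)

Section RealCurve.
Variables (R : realType) (n : nat).
Local Notation d := n.+1.
Variable Jd : 'rV[R]_d.
Hypothesis Jpos : forall i : 'I_d, 0 < Jd 0 i.
Local Notation C := R[i].
Let K : numClosedFieldType := R[i].
Local Notation J := (diag_mx Jd).
Variables (M0 P0 : 'M[R]_d).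
Hypothesis M0_skew : M0^T = - M0.
Hypothesis P0_sym : P0^T = P0.

Definition Jinv : 'M[R]_d := diag_mx (\row_i (Jd 0 i)^-1).

Lemma JJinv : J *m Jinv = 1%:M.
Proof.
rewrite /Jinv mulmx_diag -diag_const_mx; congr diag_mx; apply/rowP => i.
by rewrite !mxE divff// gt_eqF.
Qed.

Local Notation J2 := (cmx (J *m J)).
Local Notation Q := (cmx (Jinv *m Jinv)).

Lemma J2Q : J2 *m Q = 1%:M.
Proof. by rewrite -cmxM mulmxA -(mulmxA J J) JJinv mulmx1 JJinv cmx1. Qed.

Local Notation companion := (companion (cmx M0 : 'M[K]_d) (cmx P0 : 'M[K]_d) (Q : 'M[K]_d)).
Local Notation companion_at := (companion_at (cmx M0 : 'M[K]_d) (cmx P0 : 'M[K]_d) (Q : 'M[K]_d)).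
Local Notation curve := (curve (J2 : 'M[K]_d) (cmx M0 : 'M[K]_d) (cmx P0 : 'M[K]_d)).

(* The companion matrix is skew for the Hermitian form diag(la - P0, J^2). *)
Lemma companion_diagonalized (B la : R) : (forall i j, `|P0 i j| <= B) -> d%:R * B + 1 <= la ->
  exists V a, diagonalized (evm (la%:C : K) companion) V a.
Proof.
move=> PB laB; pose H : 'M[K]_((n + n.+1).+1) := block_mx (cmx (la%:M - P0)) 0 0 J2.
have S1T : (la%:M - P0)^T = la%:M - P0 by rewrite linearB/= tr_scalar_mx P0_sym.
have J2T : (J *m J)^T = J *m J by rewrite trmx_mul tr_diag_mx.
have adjc (S : 'M[R]_d) : adj (cmx S) = cmx S^T by rewrite /adj -cmxT conj_cmx.
have SE : cmx P0 - (la%:C)%:M = - cmx (la%:M - P0).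
  by rewrite cmxB cmx_scalar opprB.
have HA : H *m (companion_at la%:C : 'M[K]_((n + n.+1).+1)) =
    block_mx 0 (cmx (la%:M - P0)) (- cmx (la%:M - P0)) (cmx M0).
  rewrite /H /companion_at (@mulmx_block _ d d d d d d) !(mulmx0, mul0mx, mulmx1, addr0, add0r).
  by rewrite !mulmxA J2Q !mul1mx SE.
have adjH : adj H = H.
  rewrite /adj /H (@tr_block_mx _ d d d d) (@map_block_mx _ _ _ d d d d) !trmx0 !map_mx0.
  by rewrite -!cmxT !conj_cmx S1T J2T.
apply: (@skew_diagonalized K _ _ H).
  rewrite companionE.
  have -> : adj (companion_at la%:C : 'M[K]_((n + n.+1).+1)) *m H =
      adj (H *m (companion_at la%:C : 'M[K]_((n + n.+1).+1))).
    by rewrite adjM adjH.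
  rewrite HA /adj (@tr_block_mx _ d d d d) (@map_block_mx _ _ _ d d d d) trmx0 map_mx0.
  rewrite (@add_block_mx _ d d d d) linearN/= map_mxN -!cmxT !conj_cmx S1T M0_skew cmxN.
  by rewrite addr0 addNr subrr addNr block_mx0.
move=> w wH; have := congr1 (fun A : 'M[K]_1 => complex.Re (A 0 0)) wH.
pose v : 'cV[C]_d := usubmx (w : 'cV[K]_(d + d)); pose f : 'cV[C]_d := dsubmx (w : 'cV[K]_(d + d)).
have wE : w = col_mx v f by rewrite vsubmxK.
have -> : adj w *m H *m w = adj v *m cmx (la%:M - P0) *m v + adj f *m J2 *m f.
  rewrite wE /adj (@tr_col_mx _ d d) (@map_row_mx _ _ _ _ d d) /H.
  by rewrite (@mul_row_block _ _ d d d d) !(mulmx0, addr0, add0r) (@mul_row_col _ _ d d).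
rewrite mxDE ReD !Re_form; have -> : complex.Re ((0 : 'M[K]_1) 0 0) = 0 by rewrite mxE.
set a1 := map_mx _ v; set b1 := map_mx _ v; set a2 := map_mx _ f; set b2 := map_mx _ f.
have jj (a : 'cV[R]_d) : (a^T *m ((J *m J) *m a)) 0 0 = \sum_i (Jd 0 i * a i 0) ^+ 2.
  rewrite mxE; apply: eq_bigr => i _; rewrite -mulmxA !mul_diag_mx !mxE; ring.
rewrite !jj; have f1 := form_ge la a1 PB; have f2 := form_ge la b1 PB.
have pos (F : 'I_d -> R) : 0 <= \sum_i F i ^+ 2 by apply: sumr_ge0 => i _; exact: sqr_ge0.
have p1 := pos (fun i => a1 i 0); have p2 := pos (fun i => b1 i 0).
have p3 := pos (fun i => Jd 0 i * a2 i 0); have p4 := pos (fun i => Jd 0 i * b2 i 0).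
move=> tot.
have q1 : \sum_i a1 i 0 ^+ 2 <= (la - d%:R * B) * \sum_i a1 i 0 ^+ 2 by rewrite ler_peMl//; lra.
have q2 : \sum_i b1 i 0 ^+ 2 <= (la - d%:R * B) * \sum_i b1 i 0 ^+ 2 by rewrite ler_peMl//; lra.
have z1 : \sum_i a1 i 0 ^+ 2 = 0 by lra.
have z2 : \sum_i b1 i 0 ^+ 2 = 0 by lra.
have z3 : \sum_i (Jd 0 i * a2 i 0) ^+ 2 = 0 by lra.
have z4 : \sum_i (Jd 0 i * b2 i 0) ^+ 2 = 0 by lra.
have zero (F : 'I_d -> R) : \sum_i F i ^+ 2 = 0 -> forall i, F i = 0.
  move=> h i; apply/eqP; rewrite -sqrf_eq0; apply/eqP.
  by apply: (psumr_eq0P _ h) => // j _; exact: sqr_ge0.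
have v0 : v = 0.
  apply/colP => i; apply: eq_complexP; rewrite [(0 : 'cV[C]_d) _ _]mxE.
    by have := zero _ z1 i; rewrite mxE.
  by have := zero _ z2 i; rewrite mxE.
have f0 : f = 0.
  apply/colP => i; apply: eq_complexP; rewrite [(0 : 'cV[C]_d) _ _]mxE.
    by have /eqP := zero _ z3 i; rewrite mulf_eq0 gt_eqF//= mxE => /eqP.
  by have /eqP := zero _ z4 i; rewrite mulf_eq0 gt_eqF//= mxE => /eqP.
by rewrite wE v0 f0 col_mx0.
Qed.

(** Supplies the infinite set of parameters that [spectral_basis] starts from: real la beyond the
    threshold where la - P0 is positive definite. *)
Lemma companion_infinitely : exists D : K -> Prop, infinitely D /\
  forall l, D l -> exists V a, diagonalized (evm l companion) V a.
Proof.
have [B PB] := mbnd_cst P0.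
exists (fun l => exists2 la : R, d%:R * B + 1 <= la & l = la%:C); split; last first.
  by move=> _ [la h ->]; apply: companion_diagonalized h; exact: (PB 0).
move=> S; pose r := 1 + `|d%:R * B + 1| + \sum_(z <- S) cn z.
have pos (T : seq K) : 0 <= \sum_(z <- T) cn z by apply: sumr_ge0 => z _; exact: cn_ge0.
have r0 : 0 <= r by rewrite !addr_ge0.
exists (r%:C : K); last first.
  exists r => //; rewrite /r (le_trans (ler_norm _))// addrAC lerDr addr_ge0//.
have mem : forall (S : seq K) (t : R), (t%:C : K) \in S -> t <= \sum_(z <- S) cn z.
  elim=> [|z T IH] t; first by rewrite in_nil.
  rewrite inE big_cons => /predU1P[tz|tS].
    by rewrite -tz cnR (le_trans (ler_norm _))// lerDl.
  by rewrite (le_trans (IH _ tS))// lerDr cn_ge0.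
apply/negP => /mem.
rewrite /r gerDr; have := normr_ge0 (d%:R * B + 1); lra.
Qed.

Definition curve_std : {poly {poly C}} := ((-1) ^+ d)%:P%:P * curve.

Lemma curve_stdE la mu : curve_std.[mu%:P].[la] =
  \det (cmx P0 + mu *: cmx M0 - mu ^+ 2 *: J2 - la%:M).
Proof.
rewrite /curve_std hornerM hornerC hornerM hornerC curveE -detZ scaleN1r; congr (\det _).
by apply/matrixP => i j; rewrite !mxE; ring.
Qed.

Lemma conj_det m (A : 'M[K]_m) : (\det A)^*%R = \det (map_mx Num.conj A).
Proof. by rewrite det_map_mx. Qed.

(** Conjugation fixes the real coefficient matrices, which gives the usual real structure.
    Transposing as well changes the sign of the skew M0, equivalently of mu, which gives the
    structure with conj(mu) = - mu at real points. *)
Lemma curve_real_version : real_version curve curve_std (@conj_skew R).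
Proof.
have conjZ (a : K) (A : 'M[R]_d) : map_mx Num.conj (a *: cmx A) = (Num.conj a) *: cmx A.
  by rewrite map_mxZ conj_cmx.
have conjS (a : K) : map_mx Num.conj (a%:M : 'M[K]_d) = (Num.conj a)%:M by rewrite map_scalar_mx.
split.
- split=> [[a b]|[a b]]; rewrite /conj_skew /=; first by congr (_, _); rewrite ?rmorphN/= conjCK ?opprK.
  rewrite !curveE conj_det -[RHS]det_tr; congr (\det _).
  rewrite map_mxD !map_mxB !conjZ conj_cmx conjS rmorphXn/=.
  rewrite linearD/= !linearB/= !linearZ/= tr_scalar_mx -!cmxT trmx_mul tr_diag_mx M0_skew P0_sym.
  by rewrite cmxN sqrrN scaleNr scalerN.
- split=> [[a b]|[a b]]; rewrite /conj_std /=; first by congr (_, _); rewrite conjCK.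
  rewrite !curve_stdE conj_det; congr (\det _).
  by rewrite !map_mxB map_mxD !conjZ conj_cmx conjS rmorphXn.
- exists ((-1) ^+ d); first by rewrite expf_neq0// oppr_eq0 oner_eq0.
  rewrite /curve_std mulrA -!polyCM -exprD addnn -mul2n exprM sqrrN expr1n expr1n.
  by rewrite mul1r.
Qed.

End RealCurve.

(** * Germs of moderate growth, square roots and principal parts *)

Section Germs.
Variable R : realType.
Local Notation C := R[i].
Let K : numClosedFieldType := R[i].
Implicit Types (f g : C -> C).

Definition punctured (Q : C -> Prop) := near0c (fun z => z != 0 -> Q z).

Lemma puncturedI (P Q : C -> Prop) : punctured P -> punctured Q -> punctured (fun z => P z /\ Q z).
Proof.
move=> hP hQ; apply: near0c_sub (near0c_and hP hQ) => z [h1 h2] z0.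
by split; [exact: h1|exact: h2].
Qed.

Lemma puncturedS (P Q : C -> Prop) : (forall z, P z -> Q z) -> punctured P -> punctured Q.
Proof. by move=> PQ; apply: near0c_sub => z h /h/PQ. Qed.

Lemma punctured_near0c (P : C -> Prop) : near0c P -> punctured P.
Proof. by apply: near0c_sub. Qed.

Lemma punctured_open (P : C -> Prop) : punctured P ->
  punctured (fun z => exists2 e : R, 0 < e & forall h, cn h < e -> P (z + h)).
Proof.
move=> [e e0 he]; exists e => // z ze z0.
exists (Num.min (e - cn z) (cn z)); first by rewrite lt_min subr_gt0 ze cn_gt0.
move=> h; rewrite lt_min => /andP[h1 h2]; apply: he.
  by rewrite (le_lt_trans (cnD _ _))// addrC -ltrBrDr.
by apply: contraTneq h2 => /eqP; rewrite addrC addr_eq0 => /eqP ->; rewrite cnN ltxx.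
Qed.

Lemma holo_punctured f g : punctured (fun z => f z = g z) -> punctured (holo f) -> punctured (holo g).
Proof.
move=> fg hf; apply: puncturedS (puncturedI (punctured_open fg) hf) => z [h1 h2].
exact: holo_near h1 h2.
Qed.

Lemma holo0_bounded f : holo0 f -> exists2 B : R, 0 <= B & near0c (fun z => cn (f z) <= B).
Proof.
move=> [e e0 he]; have := he 0; rewrite cn0 => /(_ e0)/holo_cont/(_ 1 ltr01)[e' e'0 h].
exists (cn (f 0) + 1); first by rewrite addr_ge0 ?cn_ge0.
exists e' => // z /h; rewrite add0r => /ltW h1.
by rewrite -[f z](subrK (f 0)) addrC (le_trans (cnD _ _))// lerD2l.
Qed.

(** Meromorphy at 0 expressed by growth: [tame_meromorphic] and [meromorphic_tame] give the
    equivalence. Stability under sums and products needs no common denominators in this form. *)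
Definition tame f := punctured (holo f) /\
  exists N (B : R), 0 <= B /\ punctured (fun z => cn (f z) * cn z ^+ N <= B).

Lemma tame_meromorphic f : tame f -> meromorphic0 (K := K) f.
Proof. by move=> [hf [N [B [_ hB]]]]; exact: meromorphic0_bound hf hB. Qed.

Lemma tame_eq f g : punctured (fun z => f z = g z) -> tame f -> tame g.
Proof.
move=> fg [hf [N [B [B0 hB]]]]; split; first exact: holo_punctured fg hf.
exists N, B; split => //; apply: puncturedS (puncturedI fg hB) => z [<-].
by [].
Qed.

Lemma tame_holo0 f : holo0 f -> tame f.
Proof.
move=> hf; split; first exact: punctured_near0c.
have [B B0 hB] := holo0_bounded hf; exists 0%N, B; split => //.
by apply: puncturedS (punctured_near0c hB) => z; rewrite expr0 mulr1.
Qed.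

Lemma tame_cst c : tame (fun=> c).
Proof. by apply: tame_holo0; exact: holo0_cst. Qed.

Lemma tameM f g : tame f -> tame g -> tame (fun z => f z * g z).
Proof.
move=> [hf [N [B [B0 hB]]]] [hg [N' [B' [B'0 hB']]]]; split.
  by apply: puncturedS (puncturedI hf hg) => z [h1 h2]; exact: holoM.
exists (N + N')%N, (B * B'); split; first exact: mulr_ge0.
apply: puncturedS (puncturedI hB hB') => z [h1 h2].
by rewrite cnM exprD mulrACA ler_pM// mulr_ge0 ?exprn_ge0 ?cn_ge0.
Qed.

Lemma tameD f g : tame f -> tame g -> tame (fun z => f z + g z).
Proof.
move=> [hf [N [B [B0 hB]]]] [hg [N' [B' [B'0 hB']]]]; split.
  by apply: puncturedS (puncturedI hf hg) => z [h1 h2]; exact: holoD.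
exists (N + N')%N, (B + B'); split; first exact: addr_ge0.
have small : punctured (fun z => cn z <= 1) by exists 1 => // z /ltW.
apply: puncturedS (puncturedI small (puncturedI hB hB')) => z [z1 [h1 h2]].
have z0 := cn_ge0 z.
rewrite (@le_trans _ _ ((cn (f z) + cn (g z)) * cn z ^+ (N + N')))//.
  by rewrite ler_wpM2r ?exprn_ge0// cnD.
rewrite mulrDl exprD lerD//.
  by rewrite mulrA (le_trans _ h1)// ler_piMr ?mulr_ge0 ?exprn_ge0 ?cn_ge0// exprn_ile1.
by rewrite mulrCA (le_trans _ h2)// ler_piMl ?mulr_ge0 ?exprn_ge0 ?cn_ge0// exprn_ile1.
Qed.

Lemma tame_sum (I : Type) (r : seq I) (F : I -> C -> C) : (forall i, tame (F i)) ->
  tame (fun z => \sum_(i <- r) F i z).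
Proof.
move=> h; elim: r => [|i r IH].
  by rewrite (_ : (fun z => _) = (fun=> 0)); [exact: tame_cst|apply/funext => z; rewrite big_nil].
rewrite (_ : (fun z => _) = (fun z => F i z + \sum_(j <- r) F j z)); first exact: tameD.
by apply/funext => z; rewrite big_cons.
Qed.

Lemma tameX f k : tame f -> tame (fun z => f z ^+ k).
Proof.
move=> h; elim: k => [|k IH].
  by rewrite (_ : (fun z => _) = (fun=> 1)); [exact: tame_cst|apply/funext => z; rewrite expr0].
rewrite (_ : (fun z => _) = (fun z => f z * f z ^+ k)); first exact: tameM.
by apply/funext => z; rewrite exprS.
Qed.

Lemma tame_invX k : tame (fun z => (z ^+ k)^-1).
Proof.
split; first by exists 1 => // z _ z0; apply: holoV; [rewrite expf_neq0|apply: holoX; exact: holo_id].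
exists k, 1; split => //; exists 1 => // z _ z0.
by rewrite cnV cnX mulVf// expf_neq0// cn_eq0.
Qed.

Lemma meromorphic_tame f : meromorphic0 (K := K) f -> tame f.
Proof.
move=> [k /laurent0P[g hg fE]]; apply: tame_eq (tameM (tame_holo0 hg) (tame_invX k)).
by apply: near0c_sub fE => z h /h ->.
Qed.

Lemma near0c_point (P : C -> Prop) (b : R) : 0 < b -> near0c P ->
  exists z, [/\ P z, z != 0 & cn z <= b].
Proof.
move=> b0 [e e0 he]; pose t := Num.min (e / 2) b.
have t0 : 0 < t by rewrite lt_min b0 divr_gt0.
have ct : cn (t%:C : C) = t by rewrite cnR gtr0_norm.
exists t%:C; split.
- by apply: he; rewrite ct gt_min; apply/orP; left; lra.
- by rewrite -cn_gt0 ct.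
- by rewrite ct ge_min lexx orbT.
Qed.

Lemma holo0_lower f : holo0 f -> f 0 != 0 -> near0c (fun z => cn (f 0) / 2 <= cn (f z)).
Proof.
move=> [e e0 he] f0; have c0 : 0 < cn (f 0) / 2 by rewrite divr_gt0 ?cn_gt0.
have := he 0; rewrite cn0 => /(_ e0)/holo_cont/(_ _ c0)[e' e'0 h].
exists e' => // z /h; rewrite add0r => h1.
by have := cnBl (f 0) (f z); rewrite cnBC; lra.
Qed.

(** A pole of order j >= 1 would give |h(z)| <= (|B| + 1) |z| for a numerator h with h(0) nonzero,
    which fails at points close enough to 0. *)
Lemma tame_bounded f B : tame f -> punctured (fun z => cn (f z) <= B) ->
  exists2 g, holo0 g & punctured (fun z => f z = g z).
Proof.
move=> /tame_meromorphic[k /laurent0_normal[/laurent0P[g hg fE]|[j [h [/andP[j0 _] hh h0 fE]]]]] fB.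
  by exists g => //; apply: near0c_sub fE => z H /H ->; rewrite expr0 divr1.
exfalso; have B0 : 0 < `|B| + 1 by rewrite ltr_wpDl.
have c0 : 0 < cn (h 0) by rewrite cn_gt0.
have small : near0c (fun z : C => cn z <= 1) by exists 1 => // z /ltW.
have b0 : 0 < cn (h 0) / (4 * (`|B| + 1)) by rewrite divr_gt0// mulr_gt0.
have [z [[[h1 h2] [h3 h4]] z0 zb]] := near0c_point b0
  (near0c_and (near0c_and fB fE) (near0c_and (holo0_lower hh h0) small)).
have hE : h z = f z * z ^+ j by rewrite h2// divfK// expf_neq0.
have : cn (h z) <= (`|B| + 1) * cn z.
  rewrite hE cnM cnX ler_pM ?cn_ge0 ?exprn_ge0 ?cn_ge0//.
    by rewrite (le_trans (h1 z0))// (le_trans (ler_norm _))// lerDl.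
  by rewrite -[leRHS]expr1; apply: ler_wiXn2l => //; exact: cn_ge0.
have : (`|B| + 1) * cn z <= cn (h 0) / 4.
  rewrite (le_trans (ler_wpM2l (ltW B0) zb))//.
  have -> : (`|B| + 1) * (cn (h 0) / (4 * (`|B| + 1))) = cn (h 0) / 4; last exact: lexx.
  by field; rewrite gt_eqF.
by move: h3; lra.
Qed.

Lemma holo_prod (I : Type) (r : seq I) (F : I -> C -> C) z :
  (forall i, holo (F i) z) -> holo (fun w => \prod_(i <- r) F i w) z.
Proof.
move=> h; elim: r => [|i r IH].
  by rewrite (_ : (fun w => _) = (fun=> 1)); [exact: holo_cst|apply/funext => w; rewrite big_nil].
rewrite (_ : (fun w => _) = (fun w => F i w * \prod_(j <- r) F j w)); first exact: holoM.
by apply/funext => w; rewrite big_cons.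
Qed.

Lemma holo_det m (A : C -> 'M[C]_m) z : (forall i j, holo (fun w => A w i j) z) ->
  holo (fun w => \det (A w)) z.
Proof.
move=> h; apply: holo_sum => s _; apply: holoM; first exact: holo_cst.
by apply: holo_prod => i.
Qed.

(** Take a left eigenvector and compare the sums of the moduli of its coordinates. *)
Lemma eigen_bound m (B : 'M[C]_m) s b : (forall i j, cn (B i j) <= b) ->
  \det (B - s%:M) = 0 -> cn s <= m%:R * b.
Proof.
move=> Bb /eqP/det0P[w w0]; rewrite mulmxBr mul_mx_scalar => /eqP; rewrite subr_eq0 => /eqP E.
have [i wi] : exists i, w 0 i != 0.
  by apply/existsP; apply: contraNT w0; rewrite negb_exists => /forallP h; apply/eqP/rowP => i;
    rewrite mxE; apply/eqP; have := h i; rewrite negbK.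
pose S := \sum_j cn (w 0 j).
have S0 : 0 < S.
  by rewrite /S (bigD1 i)//= ltr_pwDl ?cn_gt0// sumr_ge0// => j _; exact: cn_ge0.
rewrite -(ler_pM2r S0) /S mulr_sumr.
apply: (@le_trans _ _ (\sum_(j < m) \sum_k cn (w 0 k) * b)).
  apply: ler_sum => j _; rewrite -cnM -mxZE -E mxE (le_trans (cn_sum _ _ _))//.
  by apply: ler_sum => k _; rewrite cnM ler_wpM2l ?cn_ge0.
by rewrite sumr_const card_ord -mulr_suml -mulrnAl -mulr_natl mulrAC.
Qed.

(** The root of nonnegative real part is a holomorphic branch near a value of positive real part:
    s(z+h) + s(z) has real part at least that of s(z), so the increment of sg can be divided by
    it. *)
Lemma holo_sqrt sg : holo0 sg -> 0 < complex.Re (sg 0) ->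
  exists s : C -> C, [/\ holo0 s, forall z, s z ^+ 2 = sg z & near0c (fun z => 0 < complex.Re (s z))].
Proof.
move=> hsg sg0; pose s z : C := let w := sqrtC (sg z : K) in if 0 <= complex.Re w then w else - w.
have s2 z : s z ^+ 2 = sg z by rewrite /s; case: ifP => _; rewrite ?sqrrN sqrtCK.
have s_ge0 z : 0 <= complex.Re (s z).
  rewrite /s; case: ifP => // /negbT; rewrite -ltNge.
  by case: (sqrtC (sg z : K)) => a b /=; rewrite oppr_ge0 => /ltW.
have sg_gt0 : near0c (fun z => 0 < complex.Re (sg z)).
  have [e e0 he] := hsg; have := he 0; rewrite cn0 => /(_ e0)/holo_cont/(_ _ sg0)[e' e'0 h].
  exists e' => // z /h; rewrite add0r => h1.
  have := Re_le_cn (sg z - sg 0); rewrite ReB ler_norml => /andP[h2 _].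
  by lra.
have s_gt0 : near0c (fun z => 0 < complex.Re (s z)).
  apply: near0c_sub sg_gt0 => z; rewrite -(s2 z) [in X in _ -> X]lt0r s_ge0 andbT.
  case: (s z) => a b; rewrite expr2 /= => h; apply: contraTneq h => ->.
  by rewrite -leNgt mul0r sub0r oppr_le0 -expr2 sqr_ge0.
exists s; split => //; apply: near0c_sub (near0c_and hsg s_gt0) => z [[l hl] r0].
set rho := complex.Re (s z) in r0; pose L := cn l + 1.
have L0 : 0 < L by rewrite ltr_wpDl ?cn_ge0.
have sz : s z != 0 by apply: contraTneq r0 => h; rewrite /rho h ltxx.
exists (l / (2 * s z)) => e e0.
have [d1 d10 lip] := cdiff_lip hl.
have e10 : 0 < e * rho / 2 by rewrite divr_gt0// mulr_gt0.
have [d2 d20 hd2] := hl _ e10.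
have d30 : 0 < e * rho ^+ 3 / L ^+ 2 by rewrite divr_gt0 ?mulr_gt0 ?exprn_gt0.
exists (Num.min d1 (Num.min d2 (e * rho ^+ 3 / L ^+ 2))); first by rewrite !lt_min d10 d20.
move=> h; rewrite !lt_min => /and3P[h1 h2 h3].
pose T := s (z + h) + s z.
have a_ge : rho <= cn (s z) by rewrite (le_trans _ (Re_le_cn _))// ler_norm.
have T_ge : rho <= cn T.
  rewrite (le_trans _ (Re_le_cn _))// (le_trans _ (ler_norm _))// /T ReD lerDr.
  exact: s_ge0.
have T0 : T != 0 by rewrite -cn_gt0; apply: lt_le_trans T_ge.
set D := sg (z + h) - sg z in hd2; have DsE : (s (z + h) - s z) * T = sg (z + h) - sg z.
  by rewrite -!s2 /T; ring.
have {}hd2 := hd2 h h2; have {}lip := lip h h1.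
set x := s (z + h) - s z - l / (2 * s z) * h.
(* Denominators are cleared in the remainder of the expansion with derivative l / (2 s). On the
   right the first term is o(h), by differentiability of sg, and the second O(h^2). *)
have xE : x * (2 * s z * T ^+ 2) = 2 * s z * T * (sg (z + h) - sg z - l * h) - l * h * (sg (z + h) - sg z).
  rewrite -DsE /x; have -> : l / (2 * s z) * h = l * h / (2 * s z) by ring.
  have -> : (s (z + h) - s z - l * h / (2 * s z)) * (2 * s z * T ^+ 2) =
     (s (z + h) - s z) * (2 * s z * T ^+ 2) - l * h * T ^+ 2.
    by field; rewrite sz.
  by rewrite /T; ring.
have c2 : cn (2 : C) = 2 by rewrite (_ : (2 : C) = (2 : R)%:C) ?cnR ?ger0_norm// rmorphD rmorph1.
have hh0 := cn_ge0 h.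
have xle : cn x * (2 * cn (s z) * cn T ^+ 2) <=
    2 * cn (s z) * cn T * (e * rho / 2 * cn h) + (L * cn h) * (L * cn h).
  rewrite -{1 2}c2 -cnX -!cnM xE (le_trans (cnB _ _))// lerD//.
    by rewrite cnM ler_wpM2l ?cn_ge0.
  rewrite cnM; apply: ler_pM; rewrite ?cn_ge0//.
  by rewrite cnM ler_wpM2r ?cn_ge0// lerDl.
have h3' : cn h * L ^+ 2 <= e * rho ^+ 3.
  by rewrite -ler_pdivlMr ?exprn_gt0// ltW.
have a0 : 0 < cn (s z) by rewrite cn_gt0.
have t0 : 0 < cn T by rewrite cn_gt0.
have pp : 0 < 2 * cn (s z) * cn T ^+ 2 by rewrite mulr_gt0 ?exprn_gt0// mulr_gt0.
rewrite -(ler_pM2r pp) (le_trans xle)//.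
have A1 : 2 * cn (s z) * cn T * (e * rho / 2 * cn h) <= cn (s z) * cn T ^+ 2 * (e * cn h).
  have -> : 2 * cn (s z) * cn T * (e * rho / 2 * cn h) = cn (s z) * cn T * rho * (e * cn h) by field.
  apply: ler_wpM2r; first by rewrite mulr_ge0// ltW.
  by rewrite expr2 mulrA ler_wpM2l// mulr_ge0 ?cn_ge0.
have A2 : (L * cn h) * (L * cn h) <= cn (s z) * cn T ^+ 2 * (e * cn h).
  have -> : (L * cn h) * (L * cn h) = cn h * L ^+ 2 * cn h by ring.
  rewrite (le_trans (ler_wpM2r hh0 h3'))//.
  have -> : e * rho ^+ 3 * cn h = (rho * rho ^+ 2) * (e * cn h) by ring.
  rewrite ler_wpM2r ?mulr_ge0 ?(ltW e0)//; apply: ler_pM; [exact: ltW|exact/exprn_ge0/ltW|exact: a_ge|].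
  by apply: lerXn2r; rewrite ?nnegrE ?cn_ge0// ltW.
by apply: (le_trans (lerD A1 A2)); rewrite le_eqVlt; apply/orP; left; apply/eqP; ring.
Qed.

(** The Taylor polynomial of degree below k becomes the principal part, a polynomial in 1/z. *)
Lemma holo0_polar (g : C -> C) k : holo0 g -> exists (q : {poly C}) r, holo0 r /\
  punctured (fun z => g z / z ^+ k = q.[z^-1] + r z).
Proof.
move=> hg; have [p [r [sp hr gE]]] := holo0_taylor k hg.
exists (\sum_(i < k) p`_i *: 'X^(k - i)), r; split => //.
apply: near0c_sub gE => z -> z0; have zk : z ^+ k != 0 by rewrite expf_neq0.
rewrite mulrDl (mulrC (z ^+ k)) mulfK//; congr (_ + _).
rewrite (horner_coef_wide _ sp) horner_sum mulr_suml; apply: eq_bigr => i _.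
rewrite hornerZ hornerXn -mulrA; congr (_ * _).
have -> : z ^+ k = z ^+ (k - i) * z ^+ i by rewrite -exprD subnK// ltnW.
by rewrite exprVn invfM mulrCA divff ?mulr1// expf_neq0.
Qed.

End Germs.

(** * Behaviour at infinity of the Baker-Akhiezer functions *)

Section TamePolynomials.
Variable R : realType.
Local Notation C := R[i].
Let K : numClosedFieldType := R[i].

Lemma tame_poly (p : {poly K}) (l : C -> C) : tame l -> tame (fun z => p.[l z]).
Proof.
move=> hl; rewrite (_ : (fun z => _) = (fun z => \sum_(i < size p) p`_i * l z ^+ i)).
  by apply: tame_sum => i; apply: tameM; [exact: tame_cst|exact: tameX].
by apply/funext => z; rewrite horner_coef.
Qed.

Lemma tame_ev2 (p : {poly {poly K}}) (l m : C -> C) : tame l -> tame m ->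
  tame (fun z => ev2 (l z) (m z) p).
Proof.
move=> hl hm; rewrite (_ : (fun z => _) = (fun z => \sum_(k < size p) (p`_k).[l z] * m z ^+ k)).
  by apply: tame_sum => k; apply: tameM; [exact: tame_poly|exact: tameX].
apply/funext => z; rewrite /ev2 [p.[_]]horner_coef horner_sum; apply: eq_bigr => k _.
by rewrite hornerM horner_exp hornerC.
Qed.

Lemma tame_cn_sum (I : Type) (r : seq I) (W : I -> C -> C) : (forall i, tame (W i)) ->
  exists N (B : R), 0 <= B /\ punctured (fun z => (\sum_(i <- r) cn (W i z)) * cn z ^+ N <= B).
Proof.
move=> hW; elim: r => [|i r [N [B [B0 hB]]]].
  by exists 0%N, 0; split => //; exists 1 => // z _ _; rewrite big_nil mul0r.
have [_ [N' [B' [B'0 hB']]]] := hW i.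
exists (N' + N)%N, (B' + B); split; first exact: addr_ge0.
have small : punctured (fun z : C => cn z <= 1) by exists 1 => // z /ltW.
apply: puncturedS (puncturedI small (puncturedI hB' hB)) => z [z1 [h1 h2]].
have z0 := cn_ge0 z; have S0 : 0 <= \sum_(j <- r) cn (W j z) by apply: sumr_ge0 => j _; exact: cn_ge0.
rewrite big_cons mulrDl exprD lerD//.
  by rewrite mulrA (le_trans _ h1)// ler_piMr ?mulr_ge0 ?exprn_ge0 ?cn_ge0// exprn_ile1.
by rewrite mulrCA (le_trans _ h2)// ler_piMl ?mulr_ge0 ?exprn_ge0 ?cn_ge0// exprn_ile1.
Qed.

Lemma holo0_eq0 (f : C -> C) : holo0 f -> punctured (fun z => f z = 0) -> f 0 = 0.
Proof.
move=> hf fz; apply/eqP; apply/negP => /negP f0.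
have [z [[h1 h2] z0 _]] := near0c_point ltr01 (near0c_and (holo0_lower hf f0) fz).
by move: h1; rewrite (h2 z0) cn0 leNgt divr_gt0// cn_gt0.
Qed.

Lemma points_over (F : {poly {poly K}}) (S : seq K) : (forall l, evp l F != 0) ->
  exists D : seq (K * K), forall l mu, l \in S -> F.[mu%:P].[l] = 0 -> (l, mu) \in D.
Proof.
move=> F0; elim: S => [|l S [D hD]]; first by exists [::].
have [rs rsE] := closed_field_poly_normal (evp l F).
exists ([seq (l, z) | z <- rs] ++ D) => l' mu; rewrite inE mem_cat => /orP[/eqP -> h|lS h].
  apply/orP; left; apply: map_f.
  have : root (evp l F) mu by rewrite /root evp_horner h.
  by rewrite rsE rootZ ?lead_coef_eq0// root_prod_XsubC.
by rewrite hD// orbT.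
Qed.

End TamePolynomials.

Lemma pencil_inv (F : fieldType) d (A B D : 'M[F]_d) (la mu : F) : mu != 0 ->
  A - mu^-1 *: B - mu^-1 ^+ 2 *: D - (- (la * mu^-1 ^+ 2))%:M =
  mu^-1 ^+ 2 *: (mu ^+ 2 *: A - mu *: B - D + la%:M).
Proof.
move=> mu0; apply/matrixP => i j; rewrite !mxE.
by case: (i == j); rewrite ?mulr1n ?mulr0n; field.
Qed.

Section BakerAkhiezer.
Variables (R : realType) (d : nat) (Jd : 'rV[R]_d).
Hypothesis Jpos : forall i : 'I_d, 0 < Jd 0 i.
Local Notation C := R[i].
Let K : numClosedFieldType := R[i].
Local Notation J := (diag_mx Jd).
Variables (M P Om : R -> 'M[R]_d).
Hypothesis Om_skew : forall x, (Om x)^T = - Om x.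
Hypothesis P_sym : forall x, (P x)^T = P x.
Hypothesis M_def : forall x, M x = J *m Om x + Om x *m J.
Hypothesis M_eq : forall x : R, is_derive x 1 M (commx (M x) (Om x) - commx (P x) J).
Hypothesis P_eq : forall x : R, is_derive x 1 P (commx (P x) (Om x)).
Variable U : R -> 'M[R]_d.
Hypothesis U_def : forall x, U x = Om x *m Om x - derive1 Om x + P x.
Variable X : R -> C -> 'M[C]_d.
Hypothesis X0 : forall mu, X 0 mu = 1%:M.
Hypothesis X_der : forall mu, cmd (fun x => X x mu) (fun x => (mu *: cmx J - cmx (Om x)) *m X x mu).
Hypothesis X_holo : forall x mu i k, holo (fun mu => X x mu i k) mu.
Local Notation lax := (lax Jd M P).
Hypothesis X_lax : forall x mu, lax x mu *m X x mu = X x mu *m lax 0 mu.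

Lemma cmx_J2 : cmx (J *m J) = diag_mx (\row_i (Jd 0 i ^+ 2)%:C).
Proof.
rewrite mulmx_diag; apply/matrixP => i j; rewrite !mxE.
by case: (i == j); rewrite ?mulr1n ?mulr0n// expr2.
Qed.

(* eta = exp(- x mu s) X v satisfies eta_i' = mu (J_i - s) eta_i - (Om eta)_i, and
   the eigenvector equation replaces mu (J_i - s) eta_i by
   ((P / mu + M) eta)_i / (J_i + s), which is bounded uniformly in mu. *)
Lemma lax_growth : exists c : R, forall la mu s (v : 'cV[C]_d), 1 <= cn mu -> 0 < complex.Re s ->
  lax 0 mu *m v = la *: v -> la = - (mu * s) ^+ 2 -> forall x i,
  cn (cexp (x%:C * - (mu * s)) * (X x mu *m v) i 0) <= (\sum_j cn (v j 0)) * expR (c * `|x|).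
Proof.
have [KP hKP] := mbndP P_sym P_eq.
have [KM hKM] := mbndM_ Om_skew P_sym M_def M_eq P_eq.
have [KO hKO] := mbndOm Jpos Om_skew P_sym M_def M_eq P_eq.
pose k : R := (\sum_i (`|KP| + `|KM|) / Jd 0 i) + `|KO|.
have k0 : 0 <= k.
  by rewrite addr_ge0// sumr_ge0// => i _; rewrite divr_ge0 ?addr_ge0// ltW.
exists (k * d%:R) => la mu s v mu1 s0 vE laE x i.
have mu0 : mu != 0 by rewrite -cn_gt0 (lt_le_trans _ mu1).
have Js_ge j : Jd 0 j <= cn ((Jd 0 j)%:C + s).
  by rewrite (le_trans _ (Re_le_cn _))// (le_trans _ (ler_norm _))// ReD /= lerDl ltW.
have Js0 j : (Jd 0 j)%:C + s != 0 by rewrite -cn_gt0 (lt_le_trans (Jpos j)).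
pose psi y := X y mu *m v; pose e y := cexp (y%:C * - (mu * s)).
pose B y a b := (mu^-1 * (P y a b)%:C + (M y a b)%:C) / ((Jd 0 a)%:C + s) - (Om y a b)%:C.
have psi_row y a : mu * ((Jd 0 a)%:C - s) * psi y a 0 =
    \sum_b (mu^-1 * (P y a b)%:C + (M y a b)%:C) / ((Jd 0 a)%:C + s) * psi y b 0.
  have E : lax y mu *m psi y = la *: psi y.
    by rewrite /psi mulmxA X_lax -mulmxA vE scalemxAr.
  have {}E := congr1 (fun A : 'cV[C]_d => A a 0) E.
  move: E; rewrite /lax mulmxBl mulmxDl -!scalemxAl cmx_J2 mul_diag_mx mxBE mxDE !mxZE.
  rewrite [X in _ - mu ^+ 2 * X = _]mxE [X in _ - mu ^+ 2 * (X * _) = _]mxE.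
  rewrite [X in X + _ - _ = _]mxE [X in _ + mu * X - _ = _]mxE => E.
  have -> : \sum_b (mu^-1 * (P y a b)%:C + (M y a b)%:C) / ((Jd 0 a)%:C + s) * psi y b 0 =
     (mu^-1 * (\sum_b cmx (P y) a b * psi y b 0) + \sum_b cmx (M y) a b * psi y b 0) / ((Jd 0 a)%:C + s).
    rewrite mulr_sumr -big_split/= mulr_suml; apply: eq_bigr => b _.
    by rewrite [cmx (P y) a b]mxE [cmx (M y) a b]mxE; ring.
  apply: (canRL (mulfK (Js0 a))); apply: (mulfI mu0).
  rewrite [RHS]mulrDr [mu * (mu^-1 * _)]mulrA divff// mul1r.
  move: E; rewrite laE rmorphXn/= => /(canRL (subrK _)) ->.
  by ring.
have eta_der a : cdr (fun y => e y * psi y a 0) (fun y => e y * \sum_b B y a b * psi y b 0).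
  have psi_der : cmd psi (fun y => (mu *: cmx J - cmx (Om y)) *m psi y).
    apply: cmd_eq (cmdM (X_der mu) (cmd_cst v)) _ => y.
    by rewrite mulmx0 addr0 mulmxA.
  apply: cdr_eq (cdrM (cdr_cexp _) (psi_der a 0)) _ => y; rewrite -/(e y).
  have -> : \sum_b B y a b * psi y b 0 = mu * ((Jd 0 a)%:C - s) * psi y a 0 -
      \sum_b (Om y a b)%:C * psi y b 0.
    by rewrite psi_row -sumrB; apply: eq_bigr => b _; rewrite mulrBl.
  have -> : ((mu *: cmx J - cmx (Om y)) *m psi y) a 0 =
      mu * (Jd 0 a)%:C * psi y a 0 - \sum_b (Om y a b)%:C * psi y b 0.
    rewrite mulmxBl -scalemxAl mxBE mxZE -mulrA; congr (mu * _ - _).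
      rewrite (_ : cmx J = diag_mx (cmx Jd)) ?mul_diag_mx ?mxE//.
      by rewrite /cmx map_diag_mx.
    by rewrite mxE; apply: eq_bigr => b _; rewrite mxE.
  by ring.
have B_le y a b : cn (B y a b) <= k.
  rewrite (le_trans (cnB _ _))// lerD//; last by rewrite cnR (le_trans (hKO y a b))// ler_norm.
  rewrite (@le_trans _ _ ((`|KP| + `|KM|) / Jd 0 a))//; last first.
    rewrite (bigD1 a)//= lerDl sumr_ge0// => c _.
    by rewrite divr_ge0 ?addr_ge0// ltW.
  rewrite cnM cnV ler_pM ?cn_ge0 ?invr_ge0 ?cn_ge0//.
    rewrite (le_trans (cnD _ _))// lerD//.
      rewrite cnM cnR cnV (@le_trans _ _ (1 * `|KP|))//; last by rewrite mul1r.
      by rewrite ler_pM ?invr_ge0 ?cn_ge0// ?invf_le1 ?(lt_le_trans ltr01)// (le_trans (hKP y a b))// ler_norm.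
    by rewrite cnR (le_trans (hKM y a b))// ler_norm.
  by rewrite lef_pV2 ?posrE ?(lt_le_trans (Jpos a))//.
have e0 a : e 0 * psi 0 a 0 = v a 0.
  by rewrite /e /psi X0 mul1mx (_ : (0%:C : C) * _ = 0) ?mul0r// cexp0 mul1r.
have E0 : \sum_a cn (e 0 * psi 0 a 0) ^+ 2 = \sum_a cn (v a 0) ^+ 2.
  by apply: eq_bigr => a _; rewrite e0.
have G : \sum_a cn (e x * psi x a 0) ^+ 2 <=
    (\sum_a cn (v a 0) ^+ 2) * expR (2 * k * #|'I_d|%:R * `|x|).
  rewrite -E0; apply: (cgronwall k0 eta_der _ x) => a y.
  rewrite mulr_sumr (eq_bigr (fun b => B y a b * (e y * psi y b 0))).
    by apply: cn_sum_mul_le => b.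
  by move=> b _; rewrite mulrCA.
have S0 : 0 <= \sum_j cn (v j 0) by apply: sumr_ge0 => j _; exact: cn_ge0.
rewrite -ler_sqr ?nnegrE ?cn_ge0 ?mulr_ge0 ?expR_ge0//.
apply: (@le_trans _ _ (\sum_a cn (e x * psi x a 0) ^+ 2)).
  by rewrite (bigD1 i)//= lerDl sumr_ge0// => j _; exact: sqr_ge0.
apply: (le_trans G); rewrite exprMn -expRM_natl card_ord ler_pM ?expR_ge0 ?sumr_ge0//.
- by move=> j _; exact: sqr_ge0.
- rewrite [leRHS]expr2 mulr_suml; apply: ler_sum => j _; rewrite expr2 ler_wpM2l ?cn_ge0//.
  by rewrite (bigD1 j)//= lerDl sumr_ge0// => b _; exact: cn_ge0.
- by rewrite ler_expR !mulrA.
Qed.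

Variable F : {poly {poly K}}.
Hypothesis F_det : forall la mu, F.[mu%:P].[la] = 0 ->
  \det (mu ^+ 2 *: cmx (J *m J) - mu *: cmx (M 0) - cmx (P 0) + la%:M) = 0.
Variable w : C -> C -> 'cV[C]_d.
Hypothesis w_lax : forall la mu, F.[mu%:P].[la] = 0 -> lax 0 mu *m w la mu = la *: w la mu.
Hypothesis w_tame : forall l m i, tame l -> tame m -> tame (fun z => w (l z) (m z) i 0).

Lemma tame_finite l m (g : C -> C) x i : tame l -> tame m -> holo0 g ->
  punctured (fun z => m z = g z) -> tame (fun z => (X x (m z) *m w (l z) (m z)) i 0).
Proof.
move=> hl hm hg mg.
rewrite (_ : (fun z => _) = (fun z => \sum_k X x (m z) i k * w (l z) (m z) k 0)).
  apply: tame_sum => k; apply: tameM; last exact: w_tame.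
  apply: (@tame_eq _ (fun z => X x (g z) i k)); first by apply: puncturedS mg => z ->.
  apply: tame_holo0; apply: near0c_sub hg => z hz.
  exact: (@holo_comp _ (fun mu => X x mu i k)).
by apply/funext => z; rewrite mxE.
Qed.

(* Divided by mu^2, the equation of the curve makes -la / mu^2 an eigenvalue of
   J^2 - M / mu - P / mu^2, hence bounded. *)
Lemma asymptotic_sqrt l m (g : C -> C) k : tame l -> holo0 g -> g 0 != 0 -> (0 < k)%N ->
  punctured (fun z => m z = g z / z ^+ k) -> punctured (fun z => F.[(m z)%:P].[l z] = 0) ->
  exists2 s : C -> C, holo0 s & punctured (fun z => 
    [/\ l z = - (m z * s z) ^+ 2, 1 <= cn (m z) & 0 < complex.Re (s z)]).
Proof.
move=> hl hg g0 k0 mg FE.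
(* The holomorphic continuation of 1/m to z = 0, where it vanishes since k > 0. *)
pose rr z := z ^+ k / g z.
have g_near : near0c (fun z => g z != 0).
  apply: near0c_sub (holo0_lower hg g0) => z h; rewrite -cn_gt0.
  by apply: lt_le_trans h; rewrite divr_gt0// cn_gt0.
have hrr : holo0 rr.
  apply: near0c_sub (near0c_and hg g_near) => z [h1 h2].
  by apply: holoM; [apply: holoX; exact: holo_id|exact: holoV].
have rr0 : rr 0 = 0 by rewrite /rr expr0n gtn_eqF// mul0r.
have rr1 : near0c (fun z => cn (rr z) <= 1).
  have [e ep he] := hrr; have := he 0; rewrite cn0 => /(_ ep)/holo_cont/(_ 1 ltr01)[e' e'0 h].
  by exists e' => // z /h; rewrite add0r rr0 subr0 => /ltW.
have rrE : punctured (fun z => m z != 0 /\ rr z = (m z)^-1).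
  apply: near0c_sub (near0c_and mg g_near) => z [h1 h2] z0; rewrite h1//.
  by rewrite mulf_neq0 ?invr_eq0 ?expf_neq0// /rr invf_div.
pose sg z := - (l z * rr z ^+ 2).
pose Bz z : 'M[C]_d := cmx (J *m J) - rr z *: cmx (M 0) - rr z ^+ 2 *: cmx (P 0).
have sg_tame : tame sg.
  apply: tame_eq (tameM (tame_cst (-1)) (tameM hl (tameX 2 (tame_holo0 hrr)))).
  by exists 1 => // z _ _; rewrite mulN1r.
have det0 : punctured (fun z => \det (Bz z - (sg z)%:M) = 0).
  apply: near0c_sub (near0c_and rrE FE) => z [h1 h2] z0.
  have [m0 rE] := h1 z0; rewrite /Bz /sg rE.
  apply: etrans (congr1 determinant (pencil_inv _ _ _ (l z) m0)) _.
  by rewrite detZ (F_det (h2 z0)) mulr0.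
have [KJ hKJ] := mbnd_cst (J *m J); have [KM hKM] := mbnd_cst (M 0).
have [KP hKP] := mbnd_cst (P 0).
move: hKJ hKM hKP => /(_ 0) hKJ /(_ 0) hKM /(_ 0) hKP.
have sg_le : punctured (fun z => cn (sg z) <= d%:R * (KJ + KM + KP)).
  apply: near0c_sub (near0c_and rr1 det0) => z [h1 h2] z0.
  apply: eigen_bound (h2 z0) => i j; rewrite mxBE mxBE !mxZE.
  rewrite (le_trans (cnB _ _))// lerD//; first rewrite (le_trans (cnB _ _))// lerD//.
  - by rewrite mxE cnR hKJ.
  - by rewrite cnM [cmx (_ 0) i j]mxE cnR -[leRHS]mul1r ler_pM ?cn_ge0.
  - rewrite cnM [cmx (_ 0) i j]mxE cnR -[leRHS]mul1r ler_pM ?cn_ge0// cnX.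
    by rewrite exprn_ile1 ?cn_ge0.
have [s1 hs1 s1E] := tame_bounded sg_tame sg_le.
(* This determinant is holomorphic at 0 and vanishes off 0, hence also at 0. There the pencil
   reduces to J^2, which identifies [s1 0]. *)
have hdet : holo0 (fun z => \det (Bz z - (s1 z)%:M)).
  apply: near0c_sub (near0c_and hrr hs1) => z [h1 h2]; apply: holo_det => i j.
  rewrite (_ : (fun w => _) = (fun w => cmx (J *m J) i j - rr w * cmx (M 0) i j -
      rr w ^+ 2 * cmx (P 0) i j - s1 w * (i == j)%:R)); last first.
    by apply/funext => y; rewrite !mxBE !mxZE mulr_natr; congr (_ - _); rewrite mxE.
  apply: holoB; last by apply: holoM => //; exact: holo_cst.
  apply: holoB; last by apply: holoM; [exact: holoX|exact: holo_cst].
  by apply: holoB; [exact: holo_cst|apply: holoM => //; exact: holo_cst].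
have [i s1i] : exists i, s1 0 = (Jd 0 i ^+ 2)%:C.
  have := holo0_eq0 hdet; rewrite /Bz rr0 expr0n/= !scale0r !subr0 => h.
  have {h} : \det (cmx (J *m J) - (s1 0)%:M) == 0.
    by apply/eqP/h; apply: near0c_sub (near0c_and det0 s1E) => z [h1 h2] z0; rewrite -h2// h1.
  rewrite cmx_J2 -diag_const_mx -[_ - _](raddfB (@diag_mx _ d)) det_diag => /prodf_eq0[i _].
  by rewrite !mxE subr_eq0 => /eqP <-; exists i.
have s1_gt0 : 0 < complex.Re (s1 0) by rewrite s1i exprn_gt0.
have [s [hs s2 s_gt0]] := holo_sqrt hs1 s1_gt0.
exists s => //; apply: near0c_sub (near0c_and (near0c_and rrE rr1) (near0c_and s1E s_gt0)).
move=> z [[h1 h2] [h3 h4]] z0; have [m0 rE] := h1 z0; split => //.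
  rewrite exprMn s2 -h3// /sg rE mulrN opprK mulrCA -exprMn divff// expr1n mulr1.
  by [].
by move: h2; rewrite rE cnV invf_le1// cn_gt0.
Qed.

Lemma punctured_holo_sum (I : Type) (r : seq I) (W : I -> C -> C) :
  (forall i, punctured (holo (W i))) -> punctured (holo (fun z => \sum_(i <- r) W i z)).
Proof.
move=> h; elim: r => [|i r IH].
  exists 1 => // z _ _; rewrite (_ : (fun z => _) = (fun=> 0)); first exact: holo_cst.
  by apply/funext => y; rewrite big_nil.
apply: puncturedS (puncturedI (h i) IH) => z [h1 h2].
rewrite (_ : (fun z => _) = (fun z => W i z + \sum_(j <- r) W j z)); first exact: holoD.
by apply/funext => y; rewrite big_cons.
Qed.

(** If m is holomorphic on the disc, X is composed with a holomorphic germ and q = 0. If m has a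
    pole, the exponential factor exp(x m s) is essentially singular and only its principal part has
    to be removed. *)
Theorem baker_akhiezer_lax (D : seq (C * C)) :
  (forall la mu, F.[mu%:P].[la] = 0 -> (la, mu) \notin D -> w la mu != 0) ->
  baker_akhiezer U F (fun la mu x => X x mu *m w la mu).
Proof.
move=> w0; split.
  exists D => la mu F0 lmD; split.
    by have [] := lax_eigensolution Jpos M_def M_eq U_def X_der X_lax (w_lax F0).
  by exists 0; rewrite X0 mul1mx; exact: w0.
move=> l m /meromorphic_tame hl mm /near0'P FE; have hm := meromorphic_tame mm.
have [hol|nhol] := pselect (holomorphic0 (K := K) m).
  exists 0 => // x i; have /laurent0P[g hg mg] := hol.
  apply: tame_meromorphic; apply: tame_eq (tame_finite x i hl hm hg _).
    by exists 1 => // z _ _; rewrite horner0 mulr0 oppr0 cexp0 mul1r.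
  by apply: near0c_sub mg => z h /h ->; rewrite expr0 divr1.
have [n /laurent0_normal[//|[k [g [/andP[k0 _] hg g0 mg]]]]] := mm.
have [s hs sE] := asymptotic_sqrt hl hg g0 k0 mg FE.
have hgs : holo0 (fun z => g z * s z).
  by apply: near0c_sub (near0c_and hg hs) => z [h1 h2]; exact: holoM.
(* q is the principal part of m s; the remainder r is holomorphic, so exp(x r) is bounded near 0. *)
have [q [r [hr qE]]] := holo0_polar k hgs.
exists q => [//|x i]; have [c hc] := lax_growth.
apply: tame_meromorphic; split.
  have hpsi : punctured (holo (fun z => (X x (m z) *m w (l z) (m z)) i 0)).
    rewrite (_ : (fun z => _) = (fun z => \sum_j X x (m z) i j * w (l z) (m z) j 0)).
      apply: punctured_holo_sum => j; have [hj _] := w_tame j hl hm; have [hm' _] := hm.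
      apply: puncturedS (puncturedI hm' hj) => z [h1 h2]; apply: holoM => //.
      exact: (@holo_comp _ (fun mu => X x mu i j)).
    by apply/funext => z; rewrite mxE.
  apply: near0c_sub hpsi => z h z0; apply: holoM; last exact: h.
  apply: (@holo_comp _ (@cexp R)); first exact: holo_cexp.
  apply: holoN; apply: holoM; first exact: holo_cst.
  by apply: holo_poly; apply: holoV => //; exact: holo_id.
have [N [B [B0 hB]]] := tame_cn_sum (index_enum 'I_d) (fun j => w_tame j hl hm).
have [Br Br0 hBr] := holo0_bounded hr.
(* The first factor bounds exp(x r), B bounds w up to the power N of z, and the last factor is the
   Gronwall bound of [lax_growth]. *)
exists N, (expR (`|x| * Br) * (B * expR (c * `|x|))); split.
  by rewrite mulr_ge0 ?expR_ge0// mulr_ge0// expR_ge0.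
apply: near0c_sub (near0c_and (near0c_and (near0c_and mg sE) (near0c_and qE hB)) (near0c_and hBr FE)).
move=> z [[[h1 h2] [h3 h4]] [h5 h6]] z0.
have [lE m1 s0] := h2 z0.
have -> : cexp (- (x%:C * q.[z^-1])) = cexp (x%:C * r z) * cexp (x%:C * - (m z * s z)).
  rewrite -cexpD -mulrDr -mulrN; congr (cexp (_ * _)).
  have -> : m z * s z = q.[z^-1] + r z by rewrite -h3// h1// mulrAC.
  by ring.
rewrite -mulrA cnM cnM -!mulrA ler_pM ?mulr_ge0 ?cn_ge0 ?exprn_ge0 ?cn_ge0//.
  rewrite cn_cexp ler_expR (le_trans (ler_norm _))// (le_trans (Re_le_cn _))// cnM cnR.
  by rewrite ler_wpM2l.
have := hc _ _ _ _ m1 s0 (w_lax (h6 z0)) lE x i.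
move=> h7; rewrite mulrA -cnM (le_trans (ler_wpM2r (exprn_ge0 N (cn_ge0 z)) h7))//.
by rewrite mulrAC ler_wpM2r ?expR_ge0// h4.
Qed.

End BakerAkhiezer.

(** * Linear combinations of eigensolutions with their derivatives *)

Section EigensolutionSums.
Variables (R : realType) (d : nat) (U : R -> 'M[R]_d) (la : R[i]).
Local Notation C := R[i].

(** The derivative is kept next to the solution, so that the Cauchy data of a combination can be
    read off. *)
Definition solution_pair f f' := eigensolution U la f /\ cmd f f'.

Lemma solution_pair0 : solution_pair (fun=> 0) (fun=> 0).
Proof.
have h : cmd (fun _ : R => 0 : 'cV[C]_d) (fun=> 0) by exact: cmd_cst.
split=> //; apply/eigensolutionP; exists (fun=> 0), (fun=> 0).
by split=> [i|i|x]; [exact: h|exact: h|rewrite mulmx0 scaler0 subr0].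
Qed.

Lemma solution_pairD f f' g g' : solution_pair f f' -> solution_pair g g' ->
  solution_pair (fun x => f x + g x) (fun x => f' x + g' x).
Proof.
move=> [/eigensolutionP[f1 [f2 [a1 a2 E]]] hf] [/eigensolutionP[g1 [g2 [b1 b2 E']]] hg].
have toc (h h' : R -> 'cV[C]_d) : (forall i, cdr (fun x => h x i 0) (fun x => h' x i 0)) -> cmd h h'.
  by move=> hh i j; rewrite (ord1 j).
split; last exact: cmdD.
apply/eigensolutionP; exists (fun x => f1 x + g1 x), (fun x => f2 x + g2 x); split.
- by move=> i; exact: (cmdD (toc _ _ a1) (toc _ _ b1) i 0).
- by move=> i; exact: (cmdD (toc _ _ a2) (toc _ _ b2) i 0).
- by move=> x; rewrite E E' mulmxDr scalerDr opprD addrACA.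
Qed.

Lemma solution_pairZ c f f' : solution_pair f f' ->
  solution_pair (fun x => c *: f x) (fun x => c *: f' x).
Proof.
move=> [/eigensolutionP[f1 [f2 [a1 a2 E]]] hf].
have toc (h h' : R -> 'cV[C]_d) : (forall i, cdr (fun x => h x i 0) (fun x => h' x i 0)) -> cmd h h'.
  by move=> hh i j; rewrite (ord1 j).
split; last exact: cmdZ.
apply/eigensolutionP; exists (fun x => c *: f1 x), (fun x => c *: f2 x); split.
- by move=> i; exact: (cmdZ c (toc _ _ a1) i 0).
- by move=> i; exact: (cmdZ c (toc _ _ a2) i 0).
- by move=> x; rewrite E -scalemxAr scalerBr !scalerA mulrC.
Qed.

Lemma solution_pair_sum (I : eqType) (r : seq I) f f' :
  {in r, forall i : I, solution_pair (f i) (f' i)} ->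
  solution_pair (fun x => \sum_(i <- r) f i x) (fun x => \sum_(i <- r) f' i x).
Proof.
elim: r => [|i r IH] h.
  rewrite (_ : (fun x => _) = (fun=> 0)); last by apply/funext => x; rewrite big_nil.
  rewrite (_ : (fun x => _) = (fun=> 0)); last by apply/funext => x; rewrite big_nil.
  exact: solution_pair0.
have hi := h i (mem_head _ _).
have {}IH := IH (fun j jr => h j (mem_behead (s := i :: r) jr)).
have E (g : I -> R -> 'cV[C]_d) : (fun x => \sum_(j <- i :: r) g j x) =
    (fun x => g i x + \sum_(j <- r) g j x) by apply/funext => x; rewrite big_cons.
rewrite !E; exact: solution_pairD.
Qed.

End EigensolutionSums.

Lemma det_opp (F : comNzRingType) n (A B : 'M[F]_n) : \det A = \det B -> \det (- A) = \det (- B).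
Proof. by rewrite -!scaleN1r !detZ => ->. Qed.

(** * The finite-gap property on the spectral curve *)

Section RigidBodyCurve.
Variables (R : realType) (n : nat).
Local Notation d := n.+1.
Variable Jd : 'rV[R]_d.
Hypothesis Jpos : forall i : 'I_d, 0 < Jd 0 i.
Local Notation C := R[i].
Let K : numClosedFieldType := R[i].
Local Notation J := (diag_mx Jd).
Variables (M P Om : R -> 'M[R]_d).
Hypothesis Om_skew : forall x, (Om x)^T = - Om x.
Hypothesis P_sym : forall x, (P x)^T = P x.
Hypothesis M_def : forall x, M x = J *m Om x + Om x *m J.
Hypothesis M_eq : forall x : R, is_derive x 1 M (commx (M x) (Om x) - commx (P x) J).
Hypothesis P_eq : forall x : R, is_derive x 1 P (commx (P x) (Om x)).
Variable U : R -> 'M[R]_d.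
Hypothesis U_def : forall x, U x = Om x *m Om x - derive1 Om x + P x.

Local Notation F := (curve (cmx (J *m J) : 'M[K]_d) (cmx (M 0) : 'M[K]_d) (cmx (P 0) : 'M[K]_d)).
Local Notation companion := (companion (cmx (M 0) : 'M[K]_d) (cmx (P 0) : 'M[K]_d)
  (cmx (Jinv Jd *m Jinv Jd) : 'M[K]_d)).

Theorem rigid_body_curve : finite_gap U F.
Proof.
have [X [X0 X_der X_holo X_lax _]] := ex_fundamental_mx Jpos Om_skew P_sym M_def M_eq P_eq.
have M0_skew : (M 0)^T = - M 0 by exact: M_skew Om_skew M_def 0.
have [D [iD dgD]] := companion_infinitely Jpos M0_skew (P_sym 0).
have [m [q [qE [S hS]]]] := spectral_basis iD dgD.
have AQ := J2Q Jpos.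
have rootE la mu : root (char_poly (evm la companion)) mu = (F.[mu%:P].[la] == 0).
  exact: companion_root AQ la mu.
pose v j la mu : 'cV[K]_(d + d) := ev2m la mu (q j).
pose w j la mu : 'cV[C]_d := usubmx (v j la mu).
have vE j la mu : F.[mu%:P].[la] = 0 ->
    dsubmx (v j la mu) = mu *: w j la mu /\ lax Jd M P 0 mu *m w j la mu = la *: w j la mu.
  move=> F0; have := qE j la mu; rewrite rootE F0 eqxx companionE => /(_ isT).
  exact: (companion_eigen AQ).
have F0 la : evp la F != 0 by exact: curve_at_neq0 AQ la.
(* The exceptional points of the curve are those over the exceptional la in S; there are finitely
   many, since F is a nonzero polynomial in mu at every la. *)
have [Dl hDl] := points_over S F0.
split.
  by apply: contra_neq (F0 0) => ->; rewrite /evp map_poly0.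
exists m, (fun j la mu x => X x mu *m w j la mu); split.
  move=> j; apply: (@baker_akhiezer_lax _ _ _ Jpos _ _ _ Om_skew P_sym M_def M_eq P_eq _ U_def X
    X0 X_der X_holo X_lax F _ _ _ _ Dl).
  - by move=> la mu; rewrite curveE.
  - by move=> la mu /(vE j)[].
  - move=> l k i hl hk; rewrite (_ : (fun z => _) = (fun z => ev2 (l z) (k z) (q j (lshift d i) 0))).
      exact: tame_ev2.
    by apply/funext => z; rewrite /w /v mxE mxE.
  (* The lower half of the companion eigenvector is mu times its upper half w, so w = 0 would make
     the whole eigenvector vanish. *)
  - move=> la mu Fz; apply: contraNneq => w0; apply: hDl => //; apply/negPn/negP => /hS[_ h _].
    have := h j mu; rewrite rootE Fz eqxx => /(_ isT)/negP; apply.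
    have [dE _] := vE j la mu Fz; apply/eqP.
    have := vsubmxK (v j la mu); rewrite dE -/(w j la mu) w0 scaler0 => E.
    by apply: etrans (esym E) _; exact: col_mx0.
exists S => la /hS[h1 _ h3]; split.
  by have [mu hmu] := h1; exists mu; apply: (mup_curve AQ).
move=> f hf; have /eigensolutionP[f' [f'' [c1 _ _]]] := hf.
have cf : cmd f f' by move=> i j; rewrite (ord1 j).
(* Cauchy data in companion coordinates. A solution psi = X w has psi'(0) = (mu J - Om(0)) w, so the
   second component mu w is J^-1 (psi'(0) + Om(0) psi(0)). *)
pose y : 'cV[K]_(d + d) := col_mx (f 0) (cmx (Jinv Jd) *m (f' 0 + cmx (Om 0) *m f 0)).
have [rs [c [hrs yE]]] := h3 y; exists rs, c.
have Frs mu : mu \in rs -> F.[mu%:P].[la] = 0 by move=> /hrs; rewrite rootE => /eqP.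
split; first by move=> mu /Frs.
have yu : f 0 = \sum_(mu <- rs) \sum_(j < m) c j mu *: w j la mu.
  apply/colP => i; have := congr1 (fun A : 'cV[K]_(d + d) => A (lshift d i) 0) yE.
  rewrite /y col_mxEu => ->; rewrite !summxE; apply: eq_bigr => mu _.
  by rewrite !summxE; apply: eq_bigr => j _; rewrite !mxZE; congr (_ * _); rewrite /w [RHS]mxE.
have yd : cmx (Jinv Jd) *m (f' 0 + cmx (Om 0) *m f 0) =
    \sum_(mu <- rs) \sum_(j < m) c j mu *: (mu *: w j la mu).
  transitivity (\sum_(mu <- rs) \sum_(j < m) c j mu *: dsubmx (v j la mu)).
    apply/colP => i; have := congr1 (fun A : 'cV[K]_(d + d) => A (rshift d i) 0) yE.
    rewrite /y col_mxEd => ->; rewrite !summxE; apply: eq_bigr => mu _.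
    by rewrite !summxE; apply: eq_bigr => j _; rewrite !mxZE; congr (_ * _); rewrite [RHS]mxE.
  apply: eq_big_seq => mu /Frs Fz; apply: eq_bigr => j _; congr (_ *: _).
  by have [] := vE j la mu Fz.
pose g' x := \sum_(mu <- rs) \sum_(j < m)
  c j mu *: ((mu *: cmx J - cmx (Om x)) *m (X x mu *m w j la mu)).
have [hg cg] : solution_pair U la (fun x => \sum_(mu <- rs) \sum_(j < m) c j mu *: (X x mu *m w j la mu)) g'.
  apply: (@solution_pair_sum _ _ _ _ _ rs (fun mu x => \sum_(j < m) c j mu *: (X x mu *m w j la mu))
    (fun mu x => \sum_(j < m) c j mu *: ((mu *: cmx J - cmx (Om x)) *m (X x mu *m w j la mu)))).
  move=> mu /Frs Fz.
  apply: (@solution_pair_sum _ _ _ _ _ (index_enum 'I_m) (fun j x => c j mu *: (X x mu *m w j la mu))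
    (fun j x => c j mu *: ((mu *: cmx J - cmx (Om x)) *m (X x mu *m w j la mu)))).
  move=> j _; apply: solution_pairZ; have [_ hw] := vE j la mu Fz.
  exact: (lax_eigensolution Jpos M_def M_eq U_def X_der X_lax hw).
apply: (eigensolution_unique Jpos Om_skew P_sym M_def M_eq P_eq U_def hf hg cf cg).
  rewrite yu; apply: eq_bigr => mu _; apply: eq_bigr => j _.
  by rewrite X0 mul1mx.
have -> : g' 0 = cmx J *m (\sum_(mu <- rs) \sum_(j < m) c j mu *: (mu *: w j la mu)) -
    cmx (Om 0) *m (\sum_(mu <- rs) \sum_(j < m) c j mu *: w j la mu).
  rewrite !mulmx_sumr -sumrB; apply: eq_bigr => mu _; rewrite !mulmx_sumr -sumrB.
  apply: eq_bigr => j _; rewrite X0 mul1mx mulmxBl scalerBr -!scalemxAr -scalemxAl.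
  by [].
by rewrite -yd -yu mulmxA -cmxM JJinv// cmx1 mul1mx addrK.
Qed.

Theorem rigid_body_curve_det x la mu :
  F.[mu%:P].[la] = \det (mu ^+ 2 *: cmx (J *m J) - mu *: cmx (M x) - cmx (P x) + la%:M).
Proof.
have [Y [_ _ _ Y_lax Y_inv]] := ex_fundamental_mx Jpos Om_skew P_sym M_def M_eq P_eq.
rewrite curveE.
apply: etrans (congr1 determinant (laxE Jd M P 0 la mu)) _.
apply: etrans _ (congr1 determinant (esym (laxE Jd M P x la mu))).
by apply: det_opp; exact: esym (det_lax Y_lax Y_inv x mu la).
Qed.

Theorem rigid_body_curve_std_det x la mu :
  (curve_std Jd (M 0) (P 0)).[mu%:P].[la] =
  \det (cmx (P x) + mu *: cmx (M x) - mu ^+ 2 *: cmx (J *m J) - la%:M).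
Proof.
have [Y [_ _ _ Y_lax Y_inv]] := ex_fundamental_mx Jpos Om_skew P_sym M_def M_eq P_eq.
by rewrite curve_stdE; exact: esym (det_lax Y_lax Y_inv x mu la).
Qed.

End RigidBodyCurve.

Close Scope complex_scope.
Close Scope classical_set_scope.

Theorem theorem4 (R : realType) (d : nat) (hd : (0 < d)%N)
  (Jd : 'rV[R]_d)
  (Jdec : forall i j : 'I_d, (i <= j)%N -> Jd 0 j <= Jd 0 i)
  (Jpos : forall i : 'I_d, 0 < Jd 0 i)
  (J : 'M[R]_d) (hJ : J = diag_mx Jd)
  (M P Om : R -> 'M[R]_d)
  (Om_skew : forall x, (Om x)^T = - Om x)
  (P_sym : forall x, (P x)^T = P x)
  (M_def : forall x, M x = J *m Om x + Om x *m J)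
  (M_eq : forall x : R,
     is_derive x 1 M (commx (M x) (Om x) - commx (P x) J))
  (P_eq : forall x : R, is_derive x 1 P (commx (P x) (Om x)))
  (U : R -> 'M[R]_d)
  (U_def : forall x, U x = Om x *m Om x - derive1 Om x + P x) :
  [/\ self_adjoint Jd U,
      maximally_finite_gap U
    & exists F G : {poly {poly R[i]}},
      [/\ forall (x : R) (la mu : R[i]),
            F.[mu, la] =
            \det (mu ^+ 2 *: cmx (J *m J) - mu *: cmx (M x) - cmx (P x)
                  + la%:M),
          forall (x : R) (la mu : R[i]),
            G.[mu, la] =
            \det (cmx (P x) + mu *: cmx (M x) - mu ^+ 2 *: cmx (J *m J)
                  - la%:M),
          finite_gap U F
        & real_version F G (@conj_skew R)]].
Proof.
move: Jd Jdec Jpos J hJ M P Om Om_skew P_sym M_def M_eq P_eq U U_def.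
(* A positive dimension is the form [n.+1] in which square matrices are a nontrivial ring and
   [horner_mx] is available. *)
case: d hd => [//|n] _ Jd _ Jpos J -> M P Om Om_skew P_sym M_def M_eq P_eq U U_def.
split.
- exact: (rigid_body_self_adjoint Jpos Om_skew P_sym M_def M_eq P_eq U_def).
- exact: (rigid_body_finite_gap Jpos Om_skew P_sym M_def M_eq P_eq U_def).
exists (curve (cmx (diag_mx Jd *m diag_mx Jd)) (cmx (M 0)) (cmx (P 0))), (curve_std Jd (M 0) (P 0)).
split.
- exact: (rigid_body_curve_det Jpos Om_skew P_sym M_def M_eq P_eq).
- exact: (rigid_body_curve_std_det Jpos Om_skew P_sym M_def M_eq P_eq).
- exact: (rigid_body_curve Jpos Om_skew P_sym M_def M_eq P_eq U_def).
- by apply: curve_real_version; [exact: M_skew Om_skew M_def 0|exact: P_sym].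
Qed.
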